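(* Pre-permutads are algebras over the $\mathtt{RTr}$-operad $\mathfrak{pp}$. The category of algebras over the Koszul dual $\mathfrak{pp}^!$ is isomorphic to the category of structures satisfying all axioms of classical (nonunital) Markl operads, except the associativity, which is replaced by $$(f\circ_jg)\circ_ih=\begin{cases}0&\text{for }1\le i<j\\ f\circ_j(g\circ_{i-j+1}h)&\text{for }j\le i<b+j\\ 0&\text{for }j+b\le i\le a+b-1\end{cases}$$ for $f,g,h$ of arities $a,b,c$ and $1\le j\le a$.
   Context: $\Bbbk$ is a field of characteristic $0$; everything takes values in graded $\Bbbk$-vector spaces, with Koszul signs. $\uparrow$ raises degree by one; graded duals are $(V^* )_n=(V_n)^*$. **The operadic category $\mathtt O=\mathtt{RTr}$.** An ordered graph $\Gamma$ has vertices $V=\{1,\dots,n\}$, $n\ge1$, a finite set $\mathrm{Fl}$ of half-edges, a map $g:\mathrm{Fl}\to V$, an involution $\sigma$ of $\mathrm{Fl}$, a linear order on each $g^{-1}(v)$ (local orders) and a linear order on the set of fixed points of $\sigma$, called legs (global order); half-edges are taken to be $\{1,\dots,m\}$, ordered first by vertex and then locally. Two-element orbits of $\sigma$ are internal edges and $e(\Gamma)$ is their number. Objects of $\mathtt{RTr}$ are ordered graphs which are trees (contractible), with at least one leg, such that at each vertex the half-edge pointing towards the smallest leg (the root) is the smallest one in the local order; internal edges are oriented towards the root. A morphism $\Gamma'\to\Gamma''$ is a pair $(\psi,\varphi)$: an injection $\psi:\mathrm{Fl}''\to\mathrm{Fl}'$ commuting with involutions and restricting to a bijection of legs preserving the global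 orders, and a surjection $\varphi:V'\to V''$ with $\varphi g'\psi=g''$, such that if $h\notin\mathrm{Im}\,\psi$ then $\varphi g'(h)=\varphi g'(\sigma'h)$, and all fibers are connected. The fiber over $v$ has vertices $\varphi^{-1}(v)$ (renumbered order-preservingly), half-edges $h\in\mathrm{Fl}'$ with $\varphi g'(h)=v$, involution $h\mapsto\sigma'(h)$ if $h\notin\mathrm{Im}\,\psi$ and $h\mapsto h$ if $h\in\mathrm{Im}\,\psi$, inherited local orders, and global order transported along $\psi$ from the local order at $v$. Put $|\Gamma|=V$, $|(\psi,\varphi)|=\varphi$; induced maps $f_v:(gf)^{-1}(v)\to g^{-1}(v)$ between fibers are restrictions. Local terminal objects (terminal in their connected component) are the one-vertex trees; the trivial (chosen local terminal) ones are those whose local and global orders agree. $\pi_0(\mathtt{RTr})=\mathbb N$ (number of non-root legs). **Markl operads over $\mathtt O$.** $\mathtt O_{\rm iso}$ is the groupoid of isomorphisms. $\phi:T\to S$ with $|\phi|$ order-preserving is elementary (at $i\in|S|$) if all its fibers are trivial except $F=\phi^{-1}(i)$, and $e(F)\ge1$; notation $F\triangleright_iT\xrightarrow{\phi}S$. A (strictly unital) operad $M$ over $\mathtt O$ is a presheaf of graded vector spaces on $\mathtt O_{\rm iso}$ with degree $0$ maps $\circ_\phi:M(S)\otimes M(F)\to M(T)$ for all elementary $F\triangleright T\xrightarrow{\phi}S$ and $\eta_U:\Bbbk\to M(U)$ for trivial $U$, such that: (a) if $F\triangleright_jT\xrightarrow{\phi}S$, $G\triangleright_iS\xrightarrow{\psi}P$,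 $|\psi|(j)=i$, $\xi=\psi\phi$, then $\circ_\xi(\mathrm{id}\otimes\circ_{\phi_i})=\circ_\phi(\circ_\psi\otimes\mathrm{id})$ on $M(P)\otimes M(G)\otimes M(F)$; (b) if $\psi'\phi'=\psi''\phi'':T\to S$ with $\phi',\psi',\phi'',\psi''$ elementary at $j,i,l,k$ and $|\psi''|(l)=i\ne k=|\psi'|(j)$ (then $\phi',\psi''$ have the same nontrivial fiber $F$, and $\phi'',\psi'$ the same nontrivial fiber $G$), then $\circ_{\phi'}(\circ_{\psi'}\otimes\mathrm{id})(\mathrm{id}\otimes\tau)=\circ_{\phi''}(\circ_{\psi''}\otimes\mathrm{id})$ on $M(S)\otimes M(F)\otimes M(G)$, $\tau$ the symmetry; (u) with $\eta_u:=!^*\eta_U$ for $u$ local terminal, $!:u\to U$, $U$ trivial: whenever $F\triangleright T\xrightarrow{!}u$, $M(T)=M(F)$ and $\circ_!(\eta_u\otimes\mathrm{id})=\mathrm{id}$; (c) if $\phi''\omega=\sigma\phi'$ with $\omega,\sigma$ isomorphisms, $F'\triangleright_iT'\xrightarrow{\phi'}S'$, $F''\triangleright_jT''\xrightarrow{\phi''}S''$, then $\omega^*\circ_{\phi''}=\circ_{\phi'}(\sigma^*\otimes\omega_j^* )$, where $\omega_j:F\to F''$, $F=(\phi''\omega)^{-1}(j)$, and $M(F)=M(F')$ by (u). It is $1$-connected if all $\eta_U$ are isomorphisms. **Quadratic operads, Koszul duals, $\mathfrak{pp}$.** A $1$-connected collection is a presheaf $E$ of graded vector spaces on $\mathtt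 O_{\rm iso}$ with $E(T)=0$ if $e(T)=0$; $E(T)=E(F)$ whenever $F$ is the fiber of $T\to u$, $u$ local terminal; and $E(\phi')=E(\phi'')$ if $\phi''$ is the map induced between the fibers over a local terminal $t$ by an isomorphism $\phi'$ over $t$. $\mathbb F(E)$ is the free $1$-connected operad on $E$ (left adjoint to $M\mapsto\{M(T)\text{ if }e(T)\ge1;\,0\text{ otherwise}\}$), with weight grading $\mathbb F(E)=\bigoplus_{k\ge0}\mathbb F^k(E)$ additive under $\circ_\phi$, $\mathbb F^0$ the unit part, $\mathbb F^1(E)=E$. Explicitly $\mathbb F^2(E)(X)\cong\bigoplus_cE(t_1^c)\otimes E(t_2^c)$, where $c$ runs over isomorphism classes of pairs ($\ell:X\to T$ an isomorphism, $\tau:T\to S$ elementary with $e(S)\ge1$), $(\ell',\tau')\sim(\ell'',\tau'')$ if there are isomorphisms $\sigma_1,\sigma_2$ with $\sigma_1\ell'=\ell''$, $\sigma_2\tau'=\tau''\sigma_1$; one representative is chosen in each class, $t_1$ is the nontrivial fiber of $\tau$, $t_2=S$, and $x\otimes y$ corresponds to $(-1)^{|x||y|}\ell^*\circ_\tau(y\otimes x)$. An ideal is a sub-presheaf $I$ with $\circ_\phi(a\otimes b)\in I$ if $a\in I$ or $b\in I$; $(R)$ is the smallest ideal containing $R$. For a quadratic operad $M=\mathbb F(E)/(R)$, $R\subset\mathbb F^2(E)$ a sub-presheaf, the Koszul dual is $M^!=\mathbb F(\uparrow E^* )/(R^\perp)$, with $R^\perp\subset\mathbb F^2(\uparrow E^*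 )$ the annihilator of $R$ under the pairing $\mathbb F^2(\uparrow E^* )(X)\otimes\mathbb F^2(E)(X)\to\Bbbk$ for which summands of distinct classes $c$ are orthogonal and which on the same class is the evaluation $\uparrow E^*(t_1)\otimes\uparrow E^*(t_2)\otimes E(t_1)\otimes E(t_2)\to\Bbbk$. Let $E(X)=\Bbbk$ if $e(X)=1$ and $0$ otherwise (constant presheaf). For $X$ with two internal edges, $\mathbb F^2(E)(X)$ is two-dimensional with basis $b_1,b_2$ ($=1\otimes1$ in the summands of the two classes, which correspond to the choice of the edge contracted first). Then $\mathfrak{pp}:=\mathbb F(E)/(R)$, where $R(X)$ is spanned by $b_1-b_2$ if the two edges of $X$ are composable (the three vertices of $X$ form a directed chain), and $R(X)=0$ otherwise (in particular, if the two edges have a common target). **Algebras.** Let $s_i(T)=\mathrm{id}_T^{-1}(i)$ and $\pi_0(T)$ be the connected component of $T$. An $M$-algebra is a family $(A_c)_{c\in\pi_0(\mathtt O)}$ with degree $0$ maps $\alpha_T:M(T)\otimes A_{\pi_0(s_1(T))}\otimes\cdots\otimes A_{\pi_0(s_n(T))}\to A_{\pi_0(T)}$, $n=|T|$, such that: (1) $\alpha_U(\eta_U\otimes-)=\mathrm{id}$ for trivial $U$; (2) for $F\triangleright_iT\xrightarrow{\phi}S$, $\alpha_T(\circ_\phi(m\otimes m')\otimes a_1\otimes\cdots)=\pm\alpha_S(m\otimes\cdots\otimes\alpha_F(m'\otimes\bigotimes_{|\phi|(k)=i}a_k)\otimes\cdots)$; (3) for an isomorphism $\omega:T\to S$, $\alpha_T(\omega^*m\otimes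 a_1\otimes\cdots\otimes a_n)=\pm\alpha_S(m\otimes b_1\otimes\cdots\otimes b_n)$ with $b_j=\alpha_{u_j}(\eta_{u_j}\otimes a_k)$, $u_j=\omega^{-1}(j)$, $k=|\omega|^{-1}(j)$ (Koszul signs). **Classical Markl operads and pre-permutads.** A classical (nonunital) Markl operad is a collection $\mathcal S=\{\mathcal S(n)\}_{n\ge0}$ of right $\Bbbk[\Sigma_n]$-modules with linear maps $\circ_i:\mathcal S(m)\otimes\mathcal S(n)\to\mathcal S(m+n-1)$, $1\le i\le m$, $n\ge 0$, such that (associativity) for $f\in\mathcal S(a)$, $g\in\mathcal S(b)$, $h\in\mathcal S(c)$, $1\le j\le a$: $(f\circ_jg)\circ_ih$ equals $(-1)^{|g||h|}(f\circ_ih)\circ_{j+c-1}g$ for $1\le i<j$; $f\circ_j(g\circ_{i-j+1}h)$ for $j\le i<b+j$; $(-1)^{|g||h|}(f\circ_{i-b+1}h)\circ_jg$ for $j+b\le i\le a+b-1$; and (equivariance) $(f\tau)\circ_i(g\sigma)=(f\circ_{\tau(i)}g)(\tau\circ_i\sigma)$, where $\tau\circ_i\sigma\in\Sigma_{m+n-1}$ is given by inserting $\sigma\in\Sigma_n$ at the $i$-th place of $\tau\in\Sigma_m$. A pre-permutad satisfies all these axioms except the first and the last case of the associativity. *)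

(* Defs.v *)
From HB Require Import structures.
From mathcomp Require Import all_boot all_fingroup all_algebra.
From mathcomp Require Import boolp.

Set Implicit Arguments.
Unset Strict Implicit.
Unset Printing Implicit Defensive.

Import GRing.Theory.

Local Open Scope nat_scope.

(* Vertices are 0, ..., nvert - 1 and half-edges 0, ..., nhalf - 1, numbered
   first by vertex and then by the local order, so that the local order at a
   vertex is the order of nat.  [src] is the map g, [flip] the involution, and
   [legs] lists the fixed points of [flip] in the global order. *)
Record otree := OTree {
  nvert : nat;
  src : seq nat;
  flip : seq nat;
  legs : seq nat
}.

Definition nhalf (t : otree) := size (src t).

Definition vertex (t : otree) (h : nat) := nth 0 (src t) h.

Definition mate (t : otree) (h : nat) := nth 0 (flip t) h.

Definition nedge (t : otree) :=
  (count (fun h => mate t h != h) (iota 0 (nhalf t)))./2.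

Definition pi0 (t : otree) := (size (legs t)).-1.

Definition adjacent (t : otree) : rel nat := fun v w =>
  has (fun h => (vertex t h == v) && (vertex t (mate t h) == w))
      (iota 0 (nhalf t)).

Definition connected (t : otree) : Prop :=
  0 < nvert t /\
  forall v w, v < nvert t -> w < nvert t ->
    exists2 p, path (adjacent t) v p & last v p = w.

Definition tree_root (t : otree) := head 0 (legs t).

(* [h] is the root itself, or an internal half-edge whose opposite end is
   joined to the root vertex by a path avoiding the vertex of [h]. *)
Definition rootward (t : otree) (h : nat) : Prop :=
  h = tree_root t \/
  mate t h <> h /\
  exists2 p, path (fun v w => adjacent t v w && (w != vertex t h))
                  (vertex t (mate t h)) p
           & last (vertex t (mate t h)) p = vertex t (tree_root t).

Record is_graph (t : otree) : Prop := IsGraph {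
  graph_nvert : 0 < nvert t;
  graph_src : all (fun v => v < nvert t) (src t);
  graph_sorted : sorted leq (src t);
  graph_size : size (flip t) = nhalf t;
  graph_flip : all (fun h => h < nhalf t) (flip t);
  graph_invol : forall h, h < nhalf t -> mate t (mate t h) = h;
  graph_legs : perm_eq (legs t) [seq h <- iota 0 (nhalf t) | mate t h == h]
}.

(* A connected graph is contractible iff its Euler characteristic is 1. *)
Record is_rtr (t : otree) : Prop := IsRTr {
  rtr_graph : is_graph t;
  rtr_connected : connected t;
  rtr_euler : nvert t = (nedge t).+1;
  rtr_leg : legs t <> [::];
  rtr_root : forall h h', h < nhalf t -> h' < nhalf t ->
    rootward t h -> vertex t h' = vertex t h -> h <= h'
}.

Record rtr := RTr { tree :> otree; rtrP : is_rtr tree }.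

(* [psi] maps half-edges of the target to half-edges of the source, [phi]
   maps vertices of the source to vertices of the target. *)
Record premor := PreMor { psi : seq nat; phi : seq nat }.

Definition onhalf (f : premor) (h : nat) := nth 0 (psi f) h.

Definition onvert (f : premor) (v : nat) := nth 0 (phi f) v.

Definition id_mor (T : otree) :=
  PreMor (iota 0 (nhalf T)) (iota 0 (nvert T)).

Definition comp_mor (g f : premor) :=
  PreMor [seq onhalf f h | h <- psi g] [seq onvert g v | v <- phi f].

Definition fiber_verts (T : otree) (f : premor) (v : nat) :=
  [seq w <- iota 0 (nvert T) | onvert f w == v].

Definition fiber_halves (T : otree) (f : premor) (v : nat) :=
  [seq h <- iota 0 (nhalf T) | onvert f (vertex T h) == v].

Definition fiber (T S : otree) (f : premor) (v : nat) : otree :=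
  let V := fiber_verts T f v in
  let H := fiber_halves T f v in
  OTree (size V)
        [seq index (vertex T h) V | h <- H]
        [seq index (if h \in psi f then h else mate T h) H | h <- H]
        [seq index (onhalf f h) H | h <- iota 0 (nhalf S) & vertex S h == v].

Definition induced (T S : otree) (f g : premor) (v : nat) : premor :=
  let gf := comp_mor g f in
  PreMor
    [seq index (onhalf f h) (fiber_halves T gf v) | h <- fiber_halves S g v]
    [seq index (onvert f w) (fiber_verts S g v) | w <- fiber_verts T gf v].

Record is_mor (T S : otree) (f : premor) : Prop := IsMor {
  mor_psi_size : size (psi f) = nhalf S;
  mor_psi_lt : all (fun h => h < nhalf T) (psi f);
  mor_psi_uniq : uniq (psi f);
  mor_mate : forall h, h < nhalf S -> onhalf f (mate S h) = mate T (onhalf f h);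
  mor_legs : [seq onhalf f l | l <- legs S] = legs T;
  mor_phi_size : size (phi f) = nvert T;
  mor_phi_lt : all (fun v => v < nvert S) (phi f);
  mor_phi_surj : forall v, v < nvert S -> v \in phi f;
  mor_vertex : forall h, h < nhalf S ->
    onvert f (vertex T (onhalf f h)) = vertex S h;
  mor_contract : forall h, h < nhalf T -> h \notin psi f ->
    onvert f (vertex T h) = onvert f (vertex T (mate T h));
  mor_fiber : forall v, v < nvert S -> connected (fiber T S f v)
}.

Record hom (T S : rtr) := Hom { mor :> premor; morP : is_mor T S mor }.

Record iso (T S : rtr) := Iso {
  fwd :> hom T S;
  bwd : hom S T;
  iso_bf : comp_mor bwd fwd = id_mor T;
  iso_fb : comp_mor fwd bwd = id_mor S
}.

Definition inv_iso T S (w : iso T S) : iso S T :=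
  Iso (iso_fb w) (iso_bf w).

Definition local_terminal (u : otree) : Prop := nvert u = 1.

Definition trivial_tree (U : otree) : Prop :=
  nvert U = 1 /\ legs U = iota 0 (nhalf U).

(* F |>_i T --f--> S *)
Record elementary (T S : rtr) (f : hom T S) (i : nat) (F : rtr) : Prop :=
  Elementary {
    elt_order : sorted leq (phi f);
    elt_lt : i < nvert S;
    elt_fiber : tree F = fiber T S f i;
    elt_edge : 1 <= nedge F;
    elt_trivial : forall j, j < nvert S -> j <> i -> trivial_tree (fiber T S f j)
  }.

(* Two trees with at least one edge have the same value under [unlabel] iff
   they differ only by the global order of their non-root legs. *)
Definition unlabel (t : otree) : otree :=
  if 0 < nedge t then OTree (nvert t) (src t) (flip t) (take 1 (legs t)) else t.

Lemma map_id_in (s : seq nat) (f : nat -> nat) :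
  {in s, forall x, f x = x} -> [seq f x | x <- s] = s.
Proof. by move=> h; rewrite (eq_in_map _ id s).1 ?map_id. Qed.

Lemma index_iota0 n x : x < n -> index x (iota 0 n) = x.
Proof.
by move=> h; rewrite -{1}[x]add0n -(nth_iota 0 0 h) index_uniq
  ?size_iota ?iota_uniq.
Qed.

Section TreeFacts.
Implicit Types T S F u : rtr.

Lemma vertex_lt T h : h < nhalf T -> vertex T h < nvert T.
Proof.
have [gT _ _ _ _] := rtrP T.
by move=> hh; apply: (allP (graph_src gT)); apply: mem_nth.
Qed.

Lemma mate_lt T h : h < nhalf T -> mate T h < nhalf T.
Proof.
have [gT _ _ _ _] := rtrP T.
move=> hh; apply: (allP (graph_flip gT)); apply: mem_nth.
by rewrite (graph_size gT).
Qed.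

Lemma onvert_lt T S (f : hom T S) v : v < nvert T -> onvert f v < nvert S.
Proof.
have fP := morP f.
move=> hv; apply: (allP (mor_phi_lt fP)); apply: mem_nth.
by rewrite (mor_phi_size fP).
Qed.

Lemma onhalf_lt T S (f : hom T S) h : h < nhalf S -> onhalf f h < nhalf T.
Proof.
have fP := morP f.
move=> hv; apply: (allP (mor_psi_lt fP)); apply: mem_nth.
by rewrite (mor_psi_size fP).
Qed.

Lemma mem_legs T h : (h \in legs T) = (h < nhalf T) && (mate T h == h).
Proof.
have [gT _ _ _ _] := rtrP T.
by rewrite (perm_mem (graph_legs gT)) mem_filter mem_iota add0n /= andbC.
Qed.

Lemma fiber1_verts T u (f : hom T u) :
  local_terminal u -> fiber_verts T f 0 = iota 0 (nvert T).
Proof.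
move=> u1; apply/all_filterP/allP => w; rewrite mem_iota => /andP[_ hw].
by have := onvert_lt f hw; rewrite u1 ltnS leqn0.
Qed.

Lemma fiber1_halves T u (f : hom T u) :
  local_terminal u -> fiber_halves T f 0 = iota 0 (nhalf T).
Proof.
move=> u1; apply/all_filterP/allP => h; rewrite mem_iota => /andP[_ hh].
by have := onvert_lt f (vertex_lt hh); rewrite u1 ltnS leqn0.
Qed.

Lemma terminal_vertex u h : local_terminal u -> h < nhalf u -> vertex u h = 0.
Proof.
by move=> u1 /vertex_lt; rewrite u1 ltnS leqn0 => /eqP.
Qed.

Lemma terminal_mate u h : local_terminal u -> h < nhalf u -> mate u h = h.
Proof.
have [gu _ eu _ _] := rtrP u.
move=> u1 hh; apply/eqP/negPn/negP => hm; move: eu; rewrite u1 => -[] /esym.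
rewrite /nedge; suff: 1 < count (fun h => mate u h != h) (iota 0 (nhalf u)).
  by case: count => [|[|n]].
rewrite -size_filter.
have -> : 2 = size [:: h; mate u h] by [].
apply: uniq_leq_size; first by rewrite /= inE andbT eq_sym.
move=> x; rewrite !inE mem_filter mem_iota /= add0n => /orP[] /eqP ->.
  by rewrite hm hh.
by rewrite (graph_invol gu) // eq_sym hm mate_lt.
Qed.

Lemma legs_lt T h : h \in legs T -> h < nhalf T.
Proof. by rewrite mem_legs => /andP[]. Qed.

Lemma root_leg T : tree_root T \in legs T.
Proof.
have [_ _ _ + _] := rtrP T; rewrite /tree_root.
by case: (legs T) => // a l _; rewrite inE eqxx.
Qed.

Lemma terminal_root u : local_terminal u -> tree_root u = 0.
Proof.
have [_ _ _ _ ru] := rtrP u; move=> u1.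
have hr := legs_lt (root_leg u).
have h0 : 0 < nhalf u by apply: leq_ltn_trans hr.
apply/eqP; rewrite -leqn0; apply: ru => //; first by left.
by rewrite !terminal_vertex.
Qed.

Lemma legs_cons T : legs T = tree_root T :: behead (legs T).
Proof. by have [_ _ _ + _] := rtrP T; rewrite /tree_root; case: (legs T). Qed.

Section OverTerminal.
Variables (T u F : rtr) (f : hom T u) (i : nat).
Hypotheses (u1 : local_terminal u) (ef : elementary f i F).

Lemma over_index : i = 0.
Proof. by apply/eqP; have := elt_lt ef; rewrite u1 ltnS leqn0. Qed.

Lemma over_tree : tree F = OTree (nvert T) (src T) (flip T)
  [seq onhalf f h | h <- iota 0 (nhalf u)].
Proof.
have [gT _ _ _ _] := rtrP T; have fP := morP f.
rewrite (elt_fiber ef) over_index /fiber fiber1_verts // fiber1_halves //.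
congr OTree; first by rewrite size_iota.
- rewrite -[RHS](mkseq_nth 0) /mkseq -/(nhalf T).
  apply/eq_in_map => h; rewrite mem_iota => /andP[_ hh].
  by rewrite index_iota0 ?vertex_lt.
- rewrite -[RHS](mkseq_nth 0) /mkseq (graph_size gT).
  apply/eq_in_map => h; rewrite mem_iota => /andP[_ hh].
  case: ifP => [hp|_]; last by rewrite index_iota0 ?mate_lt.
  rewrite index_iota0 //; case/(nthP 0): hp => h'; rewrite (mor_psi_size fP).
  by move=> h'u <-; rewrite -/(mate T _) -(mor_mate fP) // terminal_mate.
- rewrite (_ : [seq h <- _ | _] = iota 0 (nhalf u)); last first.
    apply/all_filterP/allP => h; rewrite mem_iota => /andP[_ hh].
    by rewrite terminal_vertex.
  apply/eq_in_map => h; rewrite mem_iota => /andP[_ hh].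
  by rewrite index_iota0 ?onhalf_lt.
Qed.

Lemma over_nedge : nedge F = nedge T.
Proof. by rewrite over_tree. Qed.

Lemma over_unlabel : unlabel F = unlabel T.
Proof.
have eT := elt_edge ef; rewrite /unlabel eT -over_nedge eT over_tree /=.
congr OTree; rewrite -(mor_legs (morP f)) -map_take -map_take; congr map.
rewrite legs_cons terminal_root //= take0.
have: 0 < nhalf u by apply: leq_ltn_trans (legs_lt (root_leg u)).
by case: nhalf => // n _ /=; rewrite take0.
Qed.

End OverTerminal.

Lemma nhalf_hom T S (f : hom T S) : nhalf S <= nhalf T.
Proof.
have fP := morP f; rewrite -(mor_psi_size fP) -(size_iota 0 (nhalf T)).
apply: uniq_leq_size; first exact: mor_psi_uniq fP.
by move=> h /(allP (mor_psi_lt fP)); rewrite mem_iota.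
Qed.

Lemma count_legs T :
  count (fun h => mate T h != h) (iota 0 (nhalf T)) = nhalf T - size (legs T).
Proof.
have [gT _ _ _ _] := rtrP T.
rewrite (perm_size (graph_legs gT)) size_filter.
rewrite -[X in X - _](size_iota 0) -(count_predC (fun h => mate T h == h)).
by rewrite addKn.
Qed.

Lemma iso_nedge T S (w : iso T S) : nedge T = nedge S.
Proof.
rewrite /nedge !count_legs -(mor_legs (morP w)) size_map.
by congr (_ - _)./2; apply/eqP; rewrite eqn_leq (nhalf_hom w) (nhalf_hom (bwd w)).
Qed.

Lemma id_morP T : is_mor T T (id_mor T).
Proof.
have [gT _ _ _ _] := rtrP T.
have oh h : h < nhalf T -> onhalf (id_mor T) h = h.
  by move=> hh; rewrite /onhalf nth_iota.
have ov v : v < nvert T -> onvert (id_mor T) v = v.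
  by move=> hh; rewrite /onvert nth_iota.
split; rewrite ?size_iota ?iota_uniq //.
- by apply/allP => h; rewrite mem_iota.
- by move=> h hh; rewrite !oh // mate_lt.
- by apply: map_id_in => l /legs_lt; exact: oh.
- by apply/allP => h; rewrite mem_iota.
- by move=> v; rewrite mem_iota.
- by move=> h hh; rewrite oh // ov // vertex_lt.
- by move=> h hh; rewrite mem_iota hh.
- move=> v hv; have sz : fiber_verts T (id_mor T) v = [:: v].
    rewrite /fiber_verts (@eq_in_filter _ _ (pred1 v)); last first.
      by move=> w; rewrite mem_iota => /andP[_ hw] /=; rewrite ov.
    by rewrite filter_pred1_uniq ?iota_uniq // mem_iota.
  split; rewrite /= sz //= => -[|a] [|b] // _ _; exists [::] => //.
Qed.

Definition id_hom T : hom T T := Hom (id_morP T).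

Lemma comp_mor_id T S (f : premor) : is_mor T S f -> comp_mor (id_mor S) f = f.
Proof.
move=> fP; case: f fP => ps ph fP; rewrite /comp_mor /=; congr PreMor.
  by rewrite -(mor_psi_size fP) -/(mkseq _ _) mkseq_nth.
apply: map_id_in => v hv; rewrite /onvert nth_iota //.
exact: (allP (mor_phi_lt fP) _ hv).
Qed.

Definition id_iso T : iso T T :=
  @Iso T T (id_hom T) (id_hom T) (comp_mor_id (id_morP T))
       (comp_mor_id (id_morP T)).

End TreeFacts.

Local Open Scope ring_scope.

Record premod (k : fieldType) := PreMod {
  pm_car :> Type;
  pm_zero : pm_car;
  pm_add : pm_car -> pm_car -> pm_car;
  pm_scale : k -> pm_car -> pm_car;
  pm_eq : pm_car -> pm_car -> Prop;
  pm_refl : forall x, pm_eq x x;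
  pm_sym : forall x y, pm_eq x y -> pm_eq y x;
  pm_trans : forall x y z, pm_eq x y -> pm_eq y z -> pm_eq x z;
  pm_addc : forall x x' y y',
    pm_eq x x' -> pm_eq y y' -> pm_eq (pm_add x y) (pm_add x' y');
  pm_scalec : forall a x x', pm_eq x x' -> pm_eq (pm_scale a x) (pm_scale a x');
  pm_addA : forall x y z,
    pm_eq (pm_add x (pm_add y z)) (pm_add (pm_add x y) z);
  pm_addC : forall x y, pm_eq (pm_add x y) (pm_add y x);
  pm_add0 : forall x, pm_eq (pm_add pm_zero x) x;
  pm_addN : forall x, pm_eq (pm_add (pm_scale (-1) x) x) pm_zero;
  pm_scaleA : forall a b x,
    pm_eq (pm_scale a (pm_scale b x)) (pm_scale (a * b) x);
  pm_scale1 : forall x, pm_eq (pm_scale 1 x) x;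
  pm_scaleDr : forall a x y,
    pm_eq (pm_scale a (pm_add x y)) (pm_add (pm_scale a x) (pm_scale a y));
  pm_scaleDl : forall x a b,
    pm_eq (pm_scale (a + b) x) (pm_add (pm_scale a x) (pm_scale b x))
}.

Section Quotient.
Variables (k : fieldType) (P : premod k).

Definition quo := {C : P -> Prop | exists x, C = pm_eq x}.

Definition cls (x : P) : quo := exist _ (pm_eq x) (ex_intro _ x erefl).

Definition qrep (c : quo) : P := sval (cid (proj2_sig c)).

Lemma qrepK c : cls (qrep c) = c.
Proof.
case: c => C hC; rewrite /qrep; case: cid => x /= e.
by apply: eq_exist.
Qed.

Lemma clsP x y : cls x = cls y <-> pm_eq x y.
Proof.
split=> [[] e|h]; first by rewrite e; exact: pm_refl.
apply: eq_exist; rewrite /=; apply: funext => z; apply: propext; split=> hz.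
  exact: pm_trans (pm_sym h) hz.
exact: pm_trans h hz.
Qed.

Lemma qrep_cls x : pm_eq (qrep (cls x)) x.
Proof. by apply/clsP; rewrite qrepK. Qed.

Lemma quoW (Q : quo -> Prop) : (forall x, Q (cls x)) -> forall c, Q c.
Proof. by move=> h c; rewrite -(qrepK c). Qed.

Definition qadd (x y : quo) := cls (pm_add (qrep x) (qrep y)).
Definition qscale (a : k) (x : quo) := cls (pm_scale a (qrep x)).

Lemma qaddE x y : qadd (cls x) (cls y) = cls (pm_add x y).
Proof. by apply/clsP; apply: pm_addc; apply: qrep_cls. Qed.

Lemma qscaleE a x : qscale a (cls x) = cls (pm_scale a x).
Proof. by apply/clsP; apply: pm_scalec; apply: qrep_cls. Qed.

Fact qaddA : associative qadd.
Proof.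
elim/quoW=> x; elim/quoW=> y; elim/quoW=> z; rewrite !qaddE.
by apply/clsP; exact: pm_addA.
Qed.

Fact qaddC : commutative qadd.
Proof.
elim/quoW=> x; elim/quoW=> y; rewrite !qaddE.
by apply/clsP; exact: pm_addC.
Qed.

Fact qadd0 : left_id (cls (pm_zero P)) qadd.
Proof. by elim/quoW=> x; rewrite qaddE; apply/clsP; exact: pm_add0. Qed.

Fact qaddN : left_inverse (cls (pm_zero P)) (qscale (-1)) qadd.
Proof. by elim/quoW=> x; rewrite qscaleE qaddE; apply/clsP; exact: pm_addN. Qed.

HB.instance Definition _ := gen_eqMixin quo.
HB.instance Definition _ := gen_choiceMixin quo.
HB.instance Definition _ := GRing.isZmodule.Build quo qaddA qaddC qadd0 qaddN.

Fact qscaleA a b x : qscale a (qscale b x) = qscale (a * b) x.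
Proof. by elim/quoW: x => x; rewrite !qscaleE; apply/clsP; exact: pm_scaleA. Qed.

Fact qscale1 : left_id 1 qscale.
Proof. by elim/quoW=> x; rewrite !qscaleE; apply/clsP; exact: pm_scale1. Qed.

Fact qscaleDr : right_distributive qscale +%R.
Proof.
move=> a; elim/quoW=> x; elim/quoW=> y; rewrite /GRing.add /=.
by rewrite !(qscaleE, qaddE); apply/clsP; exact: pm_scaleDr.
Qed.

Fact qscaleDl x : {morph qscale^~ x : a b / a + b}.
Proof.
move=> a b; elim/quoW: x => x; rewrite [in RHS]/GRing.add /=.
by rewrite !(qscaleE, qaddE); apply/clsP; exact: pm_scaleDl.
Qed.

HB.instance Definition _ := @GRing.Zmodule_isLmodule.Build k quo
  qscale qscaleA qscale1 qscaleDr qscaleDl.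

Lemma cls_lin a x y :
  cls (pm_add (pm_scale a x) y) = a *: cls x + cls y.
Proof. by rewrite /GRing.add /= /GRing.scale /= qscaleE qaddE. Qed.

End Quotient.

Definition graded (k : fieldType) := int -> lmodType k.

Definition koszul (k : fieldType) (z : int) : k := (-1) ^+ `|z|%N.

Definition cast (k : fieldType) (V W : graded k) (e : V = W) (d : int)
    (x : V d) : W d :=
  match e in _ = W' return W' d with erefl => x end.

Lemma cast_linear (k : fieldType) (V W : graded k) (e : V = W) d :
  linear (@cast k V W e d).
Proof. by case: W / e. Qed.

Lemma castK (k : fieldType) (V W : graded k) (e : V = W) d (x : V d) :
  cast (esym e) (cast e x) = x.
Proof. by case: W / e. Qed.

Lemma castKV (k : fieldType) (V W : graded k) (e : V = W) d (x : W d) :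
  cast e (cast (esym e) x) = x.
Proof. by case: W / e x. Qed.

Section Functional.
Variables (k : fieldType) (V : lmodType k).

Definition functional := {f : V -> k | forall a x y, f (a *: x + y) = a * f x + f y}.

Definition fapp (f : functional) : V -> k := sval f.

Lemma fapp_lin (f : functional) a x y :
  fapp f (a *: x + y) = a * fapp f x + fapp f y.
Proof. by case: f => f fl; exact: fl. Qed.

Lemma fapp0 (f : functional) : fapp f 0 = 0.
Proof. by have := fapp_lin f (-1) 0 0; rewrite scaler0 addr0 mulN1r addNr. Qed.

Lemma functional_ext (f g : functional) : fapp f =1 fapp g -> f = g.
Proof.
by case: f g => f fl [g gl] h; apply: eq_exist; apply: funext => x; exact: h.
Qed.

Fact fun_zero_lin (a : k) (x y : V) : 0 = a * 0 + 0 :> k.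
Proof. by rewrite mulr0 addr0. Qed.

Definition fun_zero : functional :=
  exist (fun f : V -> k => forall a x y, f (a *: x + y) = a * f x + f y)
        (fun=> 0) fun_zero_lin.

Fact fun_comb_lin (b : k) (f g : functional) a x y :
  b * fapp f (a *: x + y) + fapp g (a *: x + y) =
  a * (b * fapp f x + fapp g x) + (b * fapp f y + fapp g y).
Proof. by rewrite !fapp_lin !mulrDr !addrA (mulrCA a b) -!addrA; congr (_ + _); rewrite addrCA. Qed.

Definition fun_comb (b : k) (f g : functional) : functional :=
  exist (fun f : V -> k => forall a x y, f (a *: x + y) = a * f x + f y)
        (fun x => b * fapp f x + fapp g x) (fun_comb_lin b f g).

Definition fun_add (f g : functional) := fun_comb 1 f g.
Definition fun_scale (b : k) (f : functional) := fun_comb b f fun_zero.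

Fact fun_addA : associative fun_add.
Proof. by move=> f g h; apply: functional_ext => x /=; rewrite !mul1r addrA. Qed.
Fact fun_addC : commutative fun_add.
Proof. by move=> f g; apply: functional_ext => x /=; rewrite !mul1r addrC. Qed.
Fact fun_add0 : left_id fun_zero fun_add.
Proof. by move=> f; apply: functional_ext => x /=; rewrite mulr0 add0r. Qed.
Fact fun_addN : left_inverse fun_zero (fun_scale (-1)) fun_add.
Proof.
by move=> f; apply: functional_ext => x /=; rewrite mul1r addr0 mulN1r addNr.
Qed.

HB.instance Definition _ := gen_eqMixin functional.
HB.instance Definition _ := gen_choiceMixin functional.
HB.instance Definition _ :=
  GRing.isZmodule.Build functional fun_addA fun_addC fun_add0 fun_addN.

Fact fun_scaleA a b f : fun_scale a (fun_scale b f) = fun_scale (a * b) f.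
Proof. by apply: functional_ext => x /=; rewrite !addr0 mulrA. Qed.
Fact fun_scale1 : left_id 1 fun_scale.
Proof. by move=> f; apply: functional_ext => x /=; rewrite mul1r addr0. Qed.
Fact fun_scaleDr : right_distributive fun_scale +%R.
Proof.
by move=> a f g; apply: functional_ext => x /=; rewrite !addr0 !mul1r mulrDr.
Qed.
Fact fun_scaleDl f : {morph fun_scale^~ f : a b / a + b}.
Proof.
by move=> a b; apply: functional_ext => x /=; rewrite !addr0 !mul1r mulrDl.
Qed.

HB.instance Definition _ := @GRing.Zmodule_isLmodule.Build k functional
  fun_scale fun_scaleA fun_scale1 fun_scaleDr fun_scaleDl.

Lemma fappE a f g x : fapp (a *: f + g) x = a * fapp f x + fapp g x.
Proof. by rewrite /= mul1r addr0. Qed.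

End Functional.

Definition transpose (k : fieldType) (V W : lmodType k) (h : V -> W)
    (hl : linear h) (f : functional W) : functional V.
Proof.
exists (fun x => fapp f (h x)) => a x y.
by rewrite hl fapp_lin.
Defined.

(* Composites, fibers and induced maps are given through their underlying
   data, e.g. [mor h = comp_mor g f]; this determines [h] up to [morP]. *)
Record operad (k : fieldType) := Operad {
  op :> rtr -> graded k;
  pull : forall T S : rtr, iso T S -> forall d, op S d -> op T d;
  circ : forall (T S F : rtr) (f : hom T S) (i : nat), elementary f i F ->
    forall p q d : int, d = p + q -> op S p -> op F q -> op T d;
  eta : forall U : rtr, trivial_tree U -> op U 0;
  strict : forall (T u F : rtr) (f : hom T u) (i : nat),
    local_terminal u -> elementary f i F -> op F = op T;

  pull_linear : forall T S (w : iso T S) d, linear (@pull T S w d);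
  pull_id : forall T (w : iso T T), mor w = id_mor T ->
    forall d (x : op T d), pull w x = x;
  pull_comp : forall T S P (v : iso T S) (w : iso S P) (vw : iso T P),
    mor vw = comp_mor w v ->
    forall d (x : op P d), pull vw x = pull v (pull w x);

  circ_linearl : forall T S F (f : hom T S) i (ef : elementary f i F)
    (p q d : int) (e : d = p + q) (y : op F q), linear (fun x => circ ef e x y);
  circ_linearr : forall T S F (f : hom T S) i (ef : elementary f i F)
    (p q d : int) (e : d = p + q) (x : op S p), linear (circ ef e x);

  circ_assoc : forall (T S P F G H : rtr)
    (f : hom T S) (g : hom S P) (h : hom T P) (fi : hom H G) (j i j' : nat)
    (ef : elementary f j F) (eg : elementary g i G)
    (eh : elementary h i H) (efi : elementary fi j' F),
    onvert g j = i -> mor h = comp_mor g f -> mor fi = induced T S f g i ->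
    forall (p q r qr pq d : int) (e1 : d = p + qr) (e2 : qr = q + r)
      (e3 : d = pq + r) (e4 : pq = p + q)
      (x : op P p) (y : op G q) (z : op F r),
    circ eh e1 x (circ efi e2 y z) = circ ef e3 (circ eg e4 x y) z;

  circ_parallel : forall (T S S' S'' F G : rtr)
    (f' : hom T S') (g' : hom S' S) (f'' : hom T S'') (g'' : hom S'' S)
    (j i l m : nat)
    (ef' : elementary f' j F) (eg' : elementary g' i G)
    (ef'' : elementary f'' l G) (eg'' : elementary g'' m F),
    comp_mor g' f' = comp_mor g'' f'' ->
    onvert g'' l = i -> onvert g' j = m -> i <> m ->
    forall (p q r pq pr d : int) (e1 : d = pr + q) (e2 : pr = p + r)
      (e3 : d = pq + r) (e4 : pq = p + q)
      (x : op S p) (y : op F q) (z : op G r),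
    koszul k (q * r) *: circ ef' e1 (circ eg' e2 x z) y =
    circ ef'' e3 (circ eg'' e4 x y) z;

  circ_unit : forall (T u F U : rtr) (f : hom T u) (i : nat)
    (hu : local_terminal u) (ef : elementary f i F)
    (b : iso u U) (hU : trivial_tree U) (d : int) (e : d = 0 + d) (x : op F d),
    circ ef e (pull b (eta hU)) x = cast (strict hu ef) x;

  circ_iso : forall (T' S' F' T'' S'' F'' F u : rtr)
    (f' : hom T' S') (f'' : hom T'' S'') (g : hom F u) (i j l : nat)
    (ef' : elementary f' i F') (ef'' : elementary f'' j F'')
    (w : iso T' T'') (s : iso S' S'') (wj : iso F F'')
    (hu : local_terminal u) (eg : elementary g l F'),
    comp_mor f'' w = comp_mor s f' ->
    tree F = fiber T' S'' (comp_mor f'' w) j ->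
    mor wj = induced T' T'' w f'' j ->
    forall (p q d : int) (e : d = p + q) (x : op S'' p) (y : op F'' q),
    pull w (circ ef'' e x y) =
    circ ef' e (pull s x) (cast (esym (strict hu eg)) (pull wj y))
}.

Record collection (k : fieldType) := Collection {
  coll :> rtr -> graded k;
  cpull : forall T S : rtr, iso T S -> forall d, coll S d -> coll T d;
  cstrict : forall (T u F : rtr) (f : hom T u) (i : nat),
    local_terminal u -> elementary f i F -> coll F = coll T;
  cpull_linear : forall T S (w : iso T S) d, linear (@cpull T S w d);
  cpull_id : forall T (w : iso T T), mor w = id_mor T ->
    forall d (x : coll T d), cpull w x = x;
  cpull_comp : forall T S P (v : iso T S) (w : iso S P) (vw : iso T P),
    mor vw = comp_mor w v ->
    forall d (x : coll P d), cpull vw x = cpull v (cpull w x);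
  coll_zero : forall T : rtr, nedge T = 0%N -> forall d (x : coll T d), x = 0;
  cpull_strict : forall (T' T'' t F' F'' : rtr)
    (f' : hom T' t) (f'' : hom T'' t) (i j : nat)
    (ht : local_terminal t)
    (ef' : elementary f' i F') (ef'' : elementary f'' j F'')
    (w : iso T' T'') (wt : iso F' F''),
    comp_mor f'' w = mor f' -> mor wt = induced T' T'' w f'' j ->
    forall d (x : coll F'' d),
    cpull w (cast (cstrict ht ef'') x) = cast (cstrict ht ef') (cpull wt x)
}.

Section FreeOperad.
Variables (k : fieldType) (E : collection k).

(* Formal composites of generators.  The index of a term is an unlabelled
   tree, whence the equality M(T) = M(F) in [circ_unit]. *)
Inductive term : otree -> int -> Type :=
| Gen (T : rtr) d (x : E T d) : term (unlabel T) d
| Eta (U : rtr) (hU : trivial_tree U) : term (unlabel U) 0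
| Circ (T S F : rtr) (f : hom T S) (i : nat) (ef : elementary f i F)
    (p q d : int) (e : d = p + q)
    (x : term (unlabel S) p) (y : term (unlabel F) q) : term (unlabel T) d
| Pull (T S : rtr) (w : iso T S) d (x : term (unlabel S) d) :
    term (unlabel T) d
| Zero t d : term t d
| Add t d (x y : term t d) : term t d
| Scale t d (a : k) (x : term t d) : term t d.

Arguments Zero {t d}.

Definition castt t t' (e : t = t') d (x : term t d) : term t' d :=
  match e in _ = t0 return term t0 d with erefl => x end.

(* The congruence generated by the axioms of graded vector spaces and of
   operads, and by those of a morphism of collections from the generators;
   see [free_operad_universal]. *)
Inductive teq : forall t d, term t d -> term t d -> Prop :=
| teq_refl t d (x : term t d) : teq x x
| teq_sym t d (x y : term t d) : teq x y -> teq y x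
| teq_trans t d (x y z : term t d) : teq x y -> teq y z -> teq x z
| teq_addc t d (x x' y y' : term t d) :
    teq x x' -> teq y y' -> teq (Add x y) (Add x' y')
| teq_scalec t d a (x x' : term t d) : teq x x' -> teq (Scale a x) (Scale a x')
| teq_circc (T S F : rtr) (f : hom T S) i (ef : elementary f i F) (p q d : int)
    (e : d = p + q) x x' y y' :
    teq x x' -> teq y y' -> teq (Circ ef e x y) (Circ ef e x' y')
| teq_pullc (T S : rtr) (w : iso T S) d (x x' : term (unlabel S) d) :
    teq x x' -> teq (Pull w x) (Pull w x')
| teq_addA t d (x y z : term t d) : teq (Add x (Add y z)) (Add (Add x y) z)
| teq_addC t d (x y : term t d) : teq (Add x y) (Add y x)
| teq_add0 t d (x : term t d) : teq (Add Zero x) x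
| teq_addN t d (x : term t d) : teq (Add (Scale (-1) x) x) Zero
| teq_scaleA t d a b (x : term t d) :
    teq (Scale a (Scale b x)) (Scale (a * b) x)
| teq_scale1 t d (x : term t d) : teq (Scale 1 x) x
| teq_scaleDr t d a (x y : term t d) :
    teq (Scale a (Add x y)) (Add (Scale a x) (Scale a y))
| teq_scaleDl t d (x : term t d) a b :
    teq (Scale (a + b) x) (Add (Scale a x) (Scale b x))
| teq_gen_linear (T : rtr) d a (x y : E T d) :
    teq (Gen (a *: x + y)) (Add (Scale a (Gen x)) (Gen y))
| teq_gen_pull (T S : rtr) (w : iso T S) d (x : E S d) :
    teq (Gen (cpull w x)) (Pull w (Gen x))
| teq_gen_strict (T u F : rtr) (f : hom T u) i (hu : local_terminal u)
    (ef : elementary f i F) d (x : E F d) :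
    teq (Gen (cast (cstrict E hu ef) x)) (castt (over_unlabel hu ef) (Gen x))
| teq_pull_linear (T S : rtr) (w : iso T S) d a (x y : term (unlabel S) d) :
    teq (Pull w (Add (Scale a x) y)) (Add (Scale a (Pull w x)) (Pull w y))
| teq_pull_id (T : rtr) (w : iso T T) d (x : term (unlabel T) d) :
    mor w = id_mor T -> teq (Pull w x) x
| teq_pull_comp (T S P : rtr) (v : iso T S) (w : iso S P) (vw : iso T P) d
    (x : term (unlabel P) d) :
    mor vw = comp_mor w v -> teq (Pull vw x) (Pull v (Pull w x))
| teq_circ_linearl (T S F : rtr) (f : hom T S) i (ef : elementary f i F) (p q d : int)
    (e : d = p + q) a x x' y :
    teq (Circ ef e (Add (Scale a x) x') y)
        (Add (Scale a (Circ ef e x y)) (Circ ef e x' y))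
| teq_circ_linearr (T S F : rtr) (f : hom T S) i (ef : elementary f i F) (p q d : int)
    (e : d = p + q) x a y y' :
    teq (Circ ef e x (Add (Scale a y) y'))
        (Add (Scale a (Circ ef e x y)) (Circ ef e x y'))
| teq_circ_assoc (T S P F G H : rtr)
    (f : hom T S) (g : hom S P) (h : hom T P) (fi : hom H G) (j i j' : nat)
    (ef : elementary f j F) (eg : elementary g i G)
    (eh : elementary h i H) (efi : elementary fi j' F) :
    onvert g j = i -> mor h = comp_mor g f -> mor fi = induced T S f g i ->
    forall (p q r qr pq d : int) (e1 : d = p + qr) (e2 : qr = q + r)
      (e3 : d = pq + r) (e4 : pq = p + q) x y z,
    teq (Circ eh e1 x (Circ efi e2 y z)) (Circ ef e3 (Circ eg e4 x y) z)
| teq_circ_parallel (T S S' S'' F G : rtr)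
    (f' : hom T S') (g' : hom S' S) (f'' : hom T S'') (g'' : hom S'' S)
    (j i l m : nat)
    (ef' : elementary f' j F) (eg' : elementary g' i G)
    (ef'' : elementary f'' l G) (eg'' : elementary g'' m F) :
    comp_mor g' f' = comp_mor g'' f'' ->
    onvert g'' l = i -> onvert g' j = m -> i <> m ->
    forall (p q r pq pr d : int) (e1 : d = pr + q) (e2 : pr = p + r)
      (e3 : d = pq + r) (e4 : pq = p + q) x y z,
    teq (Scale (koszul k (q * r)) (Circ ef' e1 (Circ eg' e2 x z) y))
        (Circ ef'' e3 (Circ eg'' e4 x y) z)
| teq_circ_unit (T u F U : rtr) (f : hom T u) (i : nat)
    (hu : local_terminal u) (ef : elementary f i F)
    (b : iso u U) (hU : trivial_tree U) (d : int) (e : d = 0 + d) x :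
    teq (Circ ef e (Pull b (Eta hU)) x) (castt (over_unlabel hu ef) x)
| teq_circ_iso (T' S' F' T'' S'' F'' F u : rtr)
    (f' : hom T' S') (f'' : hom T'' S'') (g : hom F u) (i j l : nat)
    (ef' : elementary f' i F') (ef'' : elementary f'' j F'')
    (w : iso T' T'') (s : iso S' S'') (wj : iso F F'')
    (hu : local_terminal u) (eg : elementary g l F') :
    comp_mor f'' w = comp_mor s f' ->
    tree F = fiber T' S'' (comp_mor f'' w) j ->
    mor wj = induced T' T'' w f'' j ->
    forall (p q d : int) (e : d = p + q) x y,
    teq (Pull w (Circ ef'' e x y))
        (Circ ef' e (Pull s x) (castt (esym (over_unlabel hu eg)) (Pull wj y))).

Definition term_premod t d : premod k :=
  @PreMod k (term t d) Zero (@Add t d) (@Scale t d) (@teq t d)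
    (@teq_refl t d) (@teq_sym t d) (@teq_trans t d)
    (@teq_addc t d) (@teq_scalec t d)
    (@teq_addA t d) (@teq_addC t d) (@teq_add0 t d) (@teq_addN t d)
    (@teq_scaleA t d) (@teq_scale1 t d) (@teq_scaleDr t d) (@teq_scaleDl t d).

Definition fterm (t : otree) : graded k := fun d => quo (term_premod t d).

Definition fop (T : rtr) : graded k := fterm (unlabel T).

Definition fgen (T : rtr) d (x : E T d) : fop T d := cls (Gen x : term_premod _ _).

Definition fpull (T S : rtr) (w : iso T S) d (x : fop S d) : fop T d :=
  cls (Pull w (qrep x) : term_premod _ _).

Definition fcirc (T S F : rtr) (f : hom T S) i (ef : elementary f i F)
    (p q d : int) (e : d = p + q) (x : fop S p) (y : fop F q) : fop T d :=
  cls (Circ ef e (qrep x) (qrep y) : term_premod _ _).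

Definition feta (U : rtr) (hU : trivial_tree U) : fop U 0 :=
  cls (Eta hU : term_premod _ _).

Definition fstrict (T u F : rtr) (f : hom T u) i (hu : local_terminal u)
    (ef : elementary f i F) : fop F = fop T :=
  f_equal fterm (over_unlabel hu ef).

Lemma fpullE (T S : rtr) (w : iso T S) d (x : term_premod (unlabel S) d) :
  fpull w (cls x : fop S d) = cls (Pull w x : term_premod _ _).
Proof. by apply/clsP; apply: teq_pullc; exact: (qrep_cls x). Qed.

Lemma fcircE (T S F : rtr) (f : hom T S) i (ef : elementary f i F)
    (p q d : int) (e : d = p + q)
    (x : term_premod (unlabel S) p) (y : term_premod (unlabel F) q) :
  fcirc ef e (cls x : fop S p) (cls y : fop F q) =
  cls (Circ ef e x y : term_premod _ _).
Proof.
by apply/clsP; apply: teq_circc; [exact: (qrep_cls x) | exact: (qrep_cls y)].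
Qed.

Lemma cast_cls t t' (e : t = t') d (x : term_premod t d) :
  cast (f_equal fterm e) (cls x : fterm t d) = cls (castt e x : term_premod _ _).
Proof. by case: t' / e. Qed.

Lemma cast_esym_cls t t' (e : t = t') d (x : term_premod t' d) :
  cast (esym (f_equal fterm e)) (cls x : fterm t' d) =
  cls (castt (esym e) x : term_premod _ _).
Proof. by case: t' / e x. Qed.

Lemma fclsW t d (Q : fterm t d -> Prop) :
  (forall x : term_premod t d, Q (cls x)) -> forall x, Q x.
Proof. exact: quoW. Qed.

Lemma fcls_lin t d a (x y : term_premod t d) :
  a *: (cls x : fterm t d) + cls y = cls (Add (Scale a x) y : term_premod _ _).
Proof. by rewrite -cls_lin. Qed.

Lemma fcls_scale t d a (x : term_premod t d) :
  a *: (cls x : fterm t d) = cls (Scale a x : term_premod _ _).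
Proof. exact: qscaleE. Qed.

Definition free_operad : operad k.
Proof.
apply: (@Operad k fop fpull fcirc feta fstrict).
- move=> T S w d a; elim/fclsW=> x; elim/fclsW=> y.
  by rewrite fcls_lin !fpullE fcls_lin; apply/clsP; exact: teq_pull_linear.
- move=> T w h d; elim/fclsW=> x; rewrite fpullE.
  by apply/clsP; exact: teq_pull_id.
- move=> T S P v w vw h d; elim/fclsW=> x; rewrite !fpullE.
  by apply/clsP; exact: teq_pull_comp.
- move=> T S F f i ef p q d e; elim/fclsW=> y a; elim/fclsW=> x.
  elim/fclsW=> x'; rewrite fcls_lin !fcircE fcls_lin.
  by apply/clsP; exact: teq_circ_linearl.
- move=> T S F f i ef p q d e; elim/fclsW=> x a; elim/fclsW=> y.
  elim/fclsW=> y'; rewrite fcls_lin !fcircE fcls_lin.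
  by apply/clsP; exact: teq_circ_linearr.
- move=> T S P F G H f g h fi j i j' ef eg eh efi h1 h2 h3.
  move=> p q r qr pq d e1 e2 e3 e4; elim/fclsW=> x; elim/fclsW=> y.
  elim/fclsW=> z; rewrite !fcircE; apply/clsP.
  exact: teq_circ_assoc h1 h2 h3 _ _ _ _ _ _ _ _ _ _ _ _ _.
- move=> T S S' S'' F G f' g' f'' g'' j i l m ef' eg' ef'' eg'' h1 h2 h3 h4.
  move=> p q r pq pr d e1 e2 e3 e4; elim/fclsW=> x; elim/fclsW=> y.
  elim/fclsW=> z; rewrite !fcircE fcls_scale; apply/clsP.
  exact: teq_circ_parallel h1 h2 h3 h4 _ _ _ _ _ _ _ _ _ _ _ _ _.
- move=> T u F U f i hu ef b hU d e; elim/fclsW=> x.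
  rewrite fpullE fcircE [RHS]cast_cls; apply/clsP.
  exact: teq_circ_unit.
- move=> T' S' F' T'' S'' F'' F u f' f'' g i j l ef' ef'' w s wj hu eg h1 h2 h3.
  move=> p q d e; elim/fclsW=> x; elim/fclsW=> y.
  rewrite fcircE !fpullE [X in fcirc _ _ _ X]cast_esym_cls fcircE; apply/clsP.
  exact: teq_circ_iso h1 h2 h3 _ _ _ _ _ _.
Defined.

End FreeOperad.

Definition op_pred (k : fieldType) (M : operad k) :=
  forall (T : rtr) d, M T d -> Prop.

(* [ideal_strict] only says that I is a sub-presheaf of a presheaf with
   M(F) = M(T); by [circ_unit] it follows from the other clauses. *)
Record is_ideal (k : fieldType) (M : operad k) (I : op_pred M) : Prop :=
  IsIdeal {
  ideal_zero : forall T d, I T d 0;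
  ideal_linear : forall T d a (x y : M T d),
    I T d x -> I T d y -> I T d (a *: x + y);
  ideal_pull : forall T S (w : iso T S) d (x : M S d),
    I S d x -> I T d (pull w x);
  ideal_strict : forall (T u F : rtr) (f : hom T u) i
    (hu : local_terminal u) (ef : elementary f i F) d (x : M F d),
    I F d x <-> I T d (cast (strict M hu ef) x);
  ideal_circl : forall T S F (f : hom T S) i (ef : elementary f i F)
    (p q d : int) (e : d = p + q) (x : M S p) (y : M F q),
    I S p x -> I T d (circ ef e x y);
  ideal_circr : forall T S F (f : hom T S) i (ef : elementary f i F)
    (p q d : int) (e : d = p + q) (x : M S p) (y : M F q),
    I F q y -> I T d (circ ef e x y)
}.

Definition gen_ideal (k : fieldType) (M : operad k) (R : op_pred M) :
    op_pred M := fun T d x =>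
  forall I : op_pred M, is_ideal I -> (forall S n y, R S n y -> I S n y) ->
  I T d x.

Lemma gen_ideal_ideal (k : fieldType) (M : operad k) (R : op_pred M) :
  is_ideal (gen_ideal R).
Proof.
split.
- by move=> T d I hI _; apply: (ideal_zero hI).
- move=> T d a x y hx hy I hI hR.
  by apply: (ideal_linear hI); [exact: hx | exact: hy].
- by move=> T S w d x hx I hI hR; apply: (ideal_pull hI); exact: hx.
- move=> T u F f i hu ef d x; split=> hx I hI hR.
    by apply: (ideal_strict hI hu ef x).1; exact: hx.
  by apply: (ideal_strict hI hu ef x).2; exact: hx.
- move=> T S F f i ef p q d e x y hx I hI hR.
  by apply: (ideal_circl hI); exact: hx.
- move=> T S F f i ef p q d e x y hx I hI hR.
  by apply: (ideal_circr hI); exact: hx.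
Qed.

Record subspace (k : fieldType) (V : lmodType k) := Subspace {
  sub_pred :> V -> Prop;
  sub_zero : sub_pred 0;
  sub_linear : forall a x y, sub_pred x -> sub_pred y -> sub_pred (a *: x + y)
}.

Section QuotientSpace.
Variables (k : fieldType) (V : lmodType k) (I : subspace V).

Lemma sub_add x y : I x -> I y -> I (x + y).
Proof. by rewrite -{2}(scale1r x); exact: sub_linear. Qed.

Lemma sub_scale a x : I x -> I (a *: x).
Proof. by move=> hx; rewrite -(addr0 (_ *: _)); apply: sub_linear => //; exact: sub_zero. Qed.

Definition eqmod (x y : V) : Prop := I (x - y).

Fact eqmod_refl x : eqmod x x.
Proof. by rewrite /eqmod subrr; exact: sub_zero. Qed.
Fact eqmod_eq x y : x = y -> eqmod x y.
Proof. by move=> ->; exact: eqmod_refl. Qed.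
Fact eqmod_sym x y : eqmod x y -> eqmod y x.
Proof. by rewrite /eqmod => /(sub_scale (-1)); rewrite scaleN1r opprB. Qed.
Fact eqmod_trans x y z : eqmod x y -> eqmod y z -> eqmod x z.
Proof. by rewrite /eqmod => h /(sub_add h); rewrite addrA subrK. Qed.
Fact eqmod_add x x' y y' : eqmod x x' -> eqmod y y' -> eqmod (x + y) (x' + y').
Proof. by rewrite /eqmod => h /(sub_add h); rewrite opprD addrACA. Qed.
Fact eqmod_scale a x x' : eqmod x x' -> eqmod (a *: x) (a *: x').
Proof. by rewrite /eqmod -scalerBr; exact: sub_scale. Qed.

Definition eqmod_premod : premod k.
Proof.
apply: (@PreMod k V 0 +%R *:%R eqmod eqmod_refl eqmod_sym eqmod_trans
          eqmod_add eqmod_scale) => *; apply: eqmod_eq.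
- exact: addrA.
- exact: addrC.
- exact: add0r.
- by rewrite scaleN1r addNr.
- exact: scalerA.
- exact: scale1r.
- exact: scalerDr.
- exact: scalerDl.
Defined.

End QuotientSpace.

Definition quo_graded (k : fieldType) (V : graded k)
    (I : forall d, subspace (V d)) : graded k :=
  fun d => quo (eqmod_premod (I d)).

Section QuoGraded.
Variables (k : fieldType) (V W : graded k) (e : V = W).
Variables (I : forall d, subspace (V d)) (J : forall d, subspace (W d)).
Hypothesis IJ : forall d x, I d x <-> J d (cast e x).

Lemma quo_graded_eq : quo_graded I = quo_graded J.
Proof.
case: W / e J IJ => J' IJ'; congr quo_graded.
apply: functional_extensionality_dep => d; move: (IJ' d).
case: (I d) (J' d) => [I0 z0 l0] [J0 z1 l1] /= h.
have eI : I0 = J0 by apply: funext => x; apply: propext; exact: h.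
by case: J0 / eI z1 l1 {h} => z1 l1; congr Subspace; exact: Prop_irrelevance.
Qed.

Lemma cast_quo (E : quo_graded I = quo_graded J) d (x : V d) :
  cast E (cls (x : eqmod_premod (I d)) : quo_graded I d) =
  cls (cast e x : eqmod_premod (J d)).
Proof.
case: W / e J IJ E => J' IJ' E /=.
have eI : I = J'.
  apply: functional_extensionality_dep => d'; move: (IJ' d').
  case: (I d') (J' d') => [I0 z0 l0] [J0 z1 l1] /= h.
  have eI : I0 = J0 by apply: funext => y; apply: propext; exact: h.
  by case: J0 / eI z1 l1 {h} => z1 l1; congr Subspace; exact: Prop_irrelevance.
by case: J' / eI {IJ'} E => E; rewrite (Prop_irrelevance E erefl).
Qed.

End QuoGraded.

Section QuotientOperad.
Variables (k : fieldType) (M : operad k) (I : op_pred M) (hI : is_ideal I).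

Definition ideal_sub (T : rtr) (d : int) : subspace (M T d) :=
  @Subspace k (M T d) (@I T d) (@ideal_zero _ _ _ hI T d)
    (@ideal_linear _ _ _ hI T d).

Definition qop (T : rtr) : graded k := quo_graded (ideal_sub T).

Definition qcls (T : rtr) d (x : M T d) : qop T d :=
  cls (x : eqmod_premod (ideal_sub T d)).

Lemma qclsP (T : rtr) d (x y : M T d) : qcls x = qcls y <-> I (x - y).
Proof. exact: (@clsP k (eqmod_premod (ideal_sub T d)) x y). Qed.

Lemma qclsW (T : rtr) d (Q : qop T d -> Prop) :
  (forall x : M T d, Q (qcls x)) -> forall x, Q x.
Proof. exact: (@quoW k (eqmod_premod (ideal_sub T d)) Q). Qed.

Lemma qcls_lin (T : rtr) d a (x y : M T d) :
  a *: qcls x + qcls y = qcls (a *: x + y).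
Proof. by rewrite /qcls -cls_lin. Qed.

Lemma qcls_scale (T : rtr) d a (x : M T d) : a *: qcls x = qcls (a *: x).
Proof. exact: (@qscaleE k (eqmod_premod (ideal_sub T d)) a x). Qed.

Definition qpull (T S : rtr) (w : iso T S) d (x : qop S d) : qop T d :=
  qcls (pull w (qrep x : M S d)).

Definition qcirc (T S F : rtr) (f : hom T S) i (ef : elementary f i F)
    (p q d : int) (e : d = p + q) (x : qop S p) (y : qop F q) : qop T d :=
  qcls (circ ef e (qrep x : M S p) (qrep y : M F q)).

Definition qeta (U : rtr) (hU : trivial_tree U) : qop U 0 := qcls (eta M hU).

Definition qstrict (T u F : rtr) (f : hom T u) i (hu : local_terminal u)
    (ef : elementary f i F) : qop F = qop T :=
  @quo_graded_eq k (M F) (M T) (strict M hu ef) (ideal_sub F) (ideal_sub T)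
    (fun d x => ideal_strict hI hu ef x).

Lemma qcast (T u F : rtr) (f : hom T u) i (hu : local_terminal u)
    (ef : elementary f i F) d (x : M F d) :
  cast (qstrict hu ef) (qcls x) = qcls (cast (strict M hu ef) x).
Proof. by apply: cast_quo => d' y; exact: (ideal_strict hI). Qed.

Lemma qcast_esym (T u F : rtr) (f : hom T u) i (hu : local_terminal u)
    (ef : elementary f i F) d (x : M T d) :
  cast (esym (qstrict hu ef)) (qcls x) =
  qcls (cast (esym (strict M hu ef)) x).
Proof. by rewrite -{1}[x](castKV (strict M hu ef)) -qcast castK. Qed.

Lemma sub_of_linear (V W : lmodType k) (h : V -> W) (x y : V) :
  linear h -> h x - h y = h (x - y).
Proof.
move=> hl; have := hl (-1) y x.
by rewrite !scaleN1r => e; rewrite addrC -e addrC.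
Qed.

Lemma qpullE (T S : rtr) (w : iso T S) d (x : M S d) :
  qpull w (qcls x) = qcls (pull w x).
Proof.
apply/qclsP; rewrite sub_of_linear; last exact: pull_linear.
by apply: (ideal_pull hI); exact: (qrep_cls (x : eqmod_premod (ideal_sub S d))).
Qed.

Lemma qcircE (T S F : rtr) (f : hom T S) i (ef : elementary f i F)
    (p q d : int) (e : d = p + q) (x : M S p) (y : M F q) :
  qcirc ef e (qcls x) (qcls y) = qcls (circ ef e x y).
Proof.
rewrite /qcirc; set x' := qrep _; set y' := qrep _.
have hx : I ((x' : M S p) - x) by exact: (qrep_cls (x : eqmod_premod (ideal_sub S p))).
have hy : I ((y' : M F q) - y) by exact: (qrep_cls (y : eqmod_premod (ideal_sub F q))).
transitivity (qcls (circ ef e x (y' : M F q))); apply/qclsP.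
  rewrite (sub_of_linear (x' : M S p) x (circ_linearl ef e (y' : M F q))).
  exact: (ideal_circl hI).
rewrite (sub_of_linear (y' : M F q) y (circ_linearr ef e x)).
exact: (ideal_circr hI).
Qed.

Definition quotient_operad : operad k.
Proof.
apply: (@Operad k qop qpull qcirc qeta qstrict).
- move=> T S w d a; elim/qclsW=> x; elim/qclsW=> y.
  by rewrite qcls_lin !qpullE qcls_lin pull_linear.
- by move=> T w h d; elim/qclsW=> x; rewrite qpullE pull_id.
- move=> T S P v w vw h d; elim/qclsW=> x.
  by rewrite !qpullE (pull_comp h).
- move=> T S F f i ef p q d e; elim/qclsW=> y a; elim/qclsW=> x.
  elim/qclsW=> x'; rewrite qcls_lin !qcircE qcls_lin.
  by rewrite (circ_linearl ef e y).
- move=> T S F f i ef p q d e; elim/qclsW=> x a; elim/qclsW=> y.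
  elim/qclsW=> y'; rewrite qcls_lin !qcircE qcls_lin.
  by rewrite (circ_linearr ef e x).
- move=> T S P F G H f g h fi j i j' ef eg eh efi h1 h2 h3.
  move=> p q r qr pq d e1 e2 e3 e4; elim/qclsW=> x; elim/qclsW=> y.
  elim/qclsW=> z; rewrite !qcircE; congr qcls.
  exact: circ_assoc h1 h2 h3 _ _ _ _ _ _ _ _ _ _ _ _ _.
- move=> T S S' S'' F G f' g' f'' g'' j i l m ef' eg' ef'' eg'' h1 h2 h3 h4.
  move=> p q r pq pr d e1 e2 e3 e4; elim/qclsW=> x; elim/qclsW=> y.
  elim/qclsW=> z; rewrite !qcircE qcls_scale; congr qcls.
  exact: circ_parallel h1 h2 h3 h4 _ _ _ _ _ _ _ _ _ _ _ _ _.
- move=> T u F U f i hu ef b hU d e; elim/qclsW=> x.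
  by rewrite qpullE qcircE qcast circ_unit.
- move=> T' S' F' T'' S'' F'' F u f' f'' g i j l ef' ef'' w s wj hu eg h1 h2 h3.
  move=> p q d e; elim/qclsW=> x; elim/qclsW=> y.
  rewrite qcircE !qpullE qcast_esym qcircE; congr qcls.
  exact: circ_iso h1 h2 h3 _ _ _ _ _ _.
Defined.

End QuotientOperad.

Definition quotient_by (k : fieldType) (M : operad k) (R : op_pred M) :
  operad k := quotient_operad (gen_ideal_ideal R).

Lemma map_index_uniq (l : seq nat) :
  uniq l -> [seq index h l | h <- l] = iota 0 (size l).
Proof.
move=> ul; rewrite -{2}(mkseq_nth 0%N l) /mkseq -map_comp map_id_in // => h.
by rewrite mem_iota => /andP[_ hm] /=; rewrite index_uniq.
Qed.

Section Corolla.
Variables (m : nat) (m_gt0 : (0 < m)%N).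

Definition corolla (l : seq nat) : otree := OTree 1 (nseq m 0%N) (iota 0 m) l.

Lemma corolla_nhalf l : nhalf (corolla l) = m.
Proof. by rewrite /nhalf size_nseq. Qed.

Lemma corolla_mate l h : (h < m)%N -> mate (corolla l) h = h.
Proof. by move=> hm; rewrite /mate nth_iota. Qed.

Lemma corolla_vertex l h : vertex (corolla l) h = 0%N.
Proof. by rewrite /vertex nth_nseq if_same. Qed.

Lemma corolla_rtr l : perm_eq l (iota 0 m) -> head 0%N l = 0%N ->
  is_rtr (corolla l).
Proof.
move=> pl hl.
have e0 : nedge (corolla l) = 0%N.
  rewrite /nedge corolla_nhalf (@eq_in_count _ _ pred0) ?count_pred0 // => h.
  by rewrite mem_iota => /andP[_ hm]; rewrite corolla_mate ?eqxx.
split.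
- split=> //.
  + by apply/allP => x /nseqP[->].
  + by apply/(sortedP 0%N) => i _; rewrite !nth_nseq !if_same.
  + by rewrite corolla_nhalf size_iota.
  + by apply/allP => h; rewrite mem_iota corolla_nhalf.
  + by move=> h; rewrite corolla_nhalf => hm; rewrite !corolla_mate.
  + rewrite corolla_nhalf (@eq_in_filter _ _ predT) ?filter_predT // => h.
    by rewrite mem_iota => /andP[_ hm]; rewrite corolla_mate ?eqxx.
- by split=> // -[|v] [|w] // _ _; exists [::].
- by rewrite e0.
- by move=> /= e; move: (perm_size pl); rewrite e size_iota => /= e';
    move: m_gt0; rewrite -e'.
- move=> h h' hh hh' [->|[]]; first by rewrite /tree_root /= hl.
  by move: hh; rewrite corolla_nhalf => /corolla_mate ->.
Qed.

Lemma corolla_mor l l' s : perm_eq s (iota 0 m) ->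
  perm_eq l' (iota 0 m) -> [seq nth 0%N s h | h <- l'] = l ->
  is_mor (corolla l) (corolla l') (PreMor s [:: 0%N]).
Proof.
move=> ps pl' e.
have szs : size s = m by rewrite (perm_size ps) size_iota.
have slt h : (h < m)%N -> (nth 0%N s h < m)%N.
  move=> hm; have: nth 0%N s h \in s by rewrite mem_nth ?szs.
  by rewrite (perm_mem ps) mem_iota.
split; rewrite ?corolla_nhalf //=.
- by apply/allP => h; rewrite (perm_mem ps) mem_iota.
- by rewrite (perm_uniq ps) iota_uniq.
- by move=> h hm; rewrite !corolla_mate //; exact: slt.
- by move=> [|v].
- by move=> h _; rewrite !corolla_vertex.
- by move=> h _ _; rewrite !corolla_vertex.
- move=> [|v] // _; have fv : size (fiber_verts (corolla l) (PreMor s [:: 0%N]) 0)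
    = 1%N by [].
  by split; rewrite /= ?fv // => -[|v] [|w] // _ _; exists [::].
Qed.

Lemma corolla_iso l (u U : rtr) : perm_eq l (iota 0 m) ->
  tree u = corolla l -> tree U = corolla (iota 0 m) -> inhabited (iso u U).
Proof.
move=> pl eu eU.
have szl : size l = m by rewrite (perm_size pl) size_iota.
have ul : uniq l by rewrite (perm_uniq pl) iota_uniq.
have mf : is_mor u U (PreMor l [:: 0%N]).
  rewrite eu eU; apply: corolla_mor => //.
  by rewrite -szl -/(mkseq (nth 0%N l) (size l)) mkseq_nth.
pose s := [seq index h l | h <- iota 0 m].
have ns h : (h < m)%N -> nth 0%N s h = index h l.
  by move=> hm; rewrite (nth_map 0%N) ?size_iota // nth_iota.
have ps : perm_eq s (iota 0 m).
  apply: (perm_trans (y := [seq index h l | h <- l])).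
    by rewrite perm_sym; apply: perm_map.
  by rewrite map_index_uniq // szl.
have mb : is_mor U u (PreMor s [:: 0%N]).
  rewrite eu eU; apply: corolla_mor => //.
  rewrite -szl -map_index_uniq //; apply/eq_in_map => h; rewrite (perm_mem pl) mem_iota.
  by move=> /andP[_ hm]; rewrite ns.
split; apply: (@Iso u U (Hom mf) (Hom mb)); rewrite /comp_mor /id_mor /=.
- rewrite eu corolla_nhalf /=; congr PreMor; rewrite /s -map_comp.
  apply: map_id_in => h hm /=; rewrite /onhalf /= nth_index //.
  by rewrite (perm_mem pl).
- rewrite eU corolla_nhalf /=; congr PreMor.
  rewrite -[in LHS](mkseq_nth 0%N l) /mkseq szl -map_comp; apply: map_id_in => h.
  rewrite mem_iota => /andP[_ hm]; rewrite /= /onhalf /= ns; last first.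
    have: nth 0%N l h \in l by rewrite mem_nth ?szl.
    by rewrite (perm_mem pl) mem_iota.
  by rewrite index_uniq ?szl.
Qed.

Lemma corolla_trivial l (u : rtr) : perm_eq l (iota 0 m) ->
  tree u = corolla l ->
  exists (U : rtr) (_ : trivial_tree U), inhabited (iso u U).
Proof.
move=> pl eu; have hU : is_rtr (corolla (iota 0 m)).
  by apply: corolla_rtr => //; case: m m_gt0.
exists (RTr hU); have hU' : trivial_tree (RTr hU).
  by split; rewrite //= corolla_nhalf.
by exists hU'; exact: corolla_iso pl eu _.
Qed.

End Corolla.

Section Relabel.
Variables T T' : rtr.
Hypotheses (hT : (0 < nedge T)%N) (eTT : unlabel T = unlabel T').

Let nedge_eq : nedge T' = nedge T.
Proof.
move: eTT; rewrite /unlabel hT; case: ifP => [_ [_ e1 e2 _]|].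
  by rewrite /nedge /nhalf /mate e1 e2.
by move=> h e; move: h; rewrite -e /nedge /nhalf /mate /= -/(nhalf T) -/(nedge T) hT.
Qed.

Let fields_eq : [/\ nvert T' = nvert T, src T' = src T, flip T' = flip T &
  tree_root T' = tree_root T].
Proof.
move: eTT; rewrite /unlabel nedge_eq hT => -[-> -> -> e]; split=> //.
rewrite /tree_root; have := rtr_leg (rtrP T); have := rtr_leg (rtrP T').
by move: e; case: (legs T) (legs T') => [|a l] [|b l'] //= [->].
Qed.

Let nv_eq : nvert T' = nvert T. Proof. by case: fields_eq. Qed.
Let src_eq : src T' = src T. Proof. by case: fields_eq. Qed.
Let flip_eq : flip T' = flip T. Proof. by case: fields_eq. Qed.
Let root_eq : tree_root T' = tree_root T. Proof. by case: fields_eq. Qed.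
Let nh_eq : nhalf T' = nhalf T. Proof. by rewrite /nhalf src_eq. Qed.
Let mate_eq h : mate T' h = mate T h. Proof. by rewrite /mate flip_eq. Qed.
Let legs_eq : perm_eq (legs T') (legs T).
Proof.
have := graph_legs (rtr_graph (rtrP T)).
have := graph_legs (rtr_graph (rtrP T')).
rewrite nh_eq (eq_filter (a2 := fun h => mate T h == h)); last first.
  by move=> h; rewrite mate_eq.
by move=> h1; rewrite perm_sym => h2; exact: perm_trans h1 h2.
Qed.

Let m := size (legs T').

Let relabel_legs := [seq index l (legs T') | l <- legs T].

Definition relabel_tree : otree := corolla m relabel_legs.

Let uniq_legs (U : rtr) : uniq (legs U).
Proof.
by rewrite (perm_uniq (graph_legs (rtr_graph (rtrP U)))) filter_uniq ?iota_uniq.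
Qed.

Let nh_u : nhalf relabel_tree = m. Proof. by rewrite /nhalf size_nseq. Qed.
Let mate_u h : (h < m)%N -> mate relabel_tree h = h.
Proof. by move=> hm; rewrite /mate nth_iota. Qed.
Let vert_u h : vertex relabel_tree h = 0%N.
Proof. by rewrite /vertex nth_nseq if_same. Qed.
Let m_gt0 : (0 < m)%N.
Proof. by rewrite /m; have := rtr_leg (rtrP T'); case: (legs T'). Qed.
Let relabel_perm : perm_eq relabel_legs (iota 0 m).
Proof.
apply: (perm_trans (y := [seq index l (legs T') | l <- legs T'])).
  by apply: perm_map; rewrite perm_sym; exact: legs_eq.
by rewrite map_index_uniq.
Qed.

Lemma relabel_rtr : is_rtr relabel_tree.
Proof.
apply: corolla_rtr => //.
by rewrite /relabel_legs (legs_cons T) /= -root_eq (legs_cons T') /= eqxx.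
Qed.

Definition relabel_u : rtr := RTr relabel_rtr.

Definition relabel_mor : premor := PreMor (legs T') (nseq (nvert T) 0%N).

Let ov v : onvert relabel_mor v = 0%N.
Proof. by rewrite /onvert nth_nseq if_same. Qed.

Let fv : fiber_verts T relabel_mor 0 = iota 0 (nvert T).
Proof. by apply/all_filterP/allP => v _; rewrite ov. Qed.
Let fh : fiber_halves T relabel_mor 0 = iota 0 (nhalf T).
Proof. by apply/all_filterP/allP => v _; rewrite ov. Qed.

Lemma relabel_fiber : fiber T relabel_u relabel_mor 0 = T'.
Proof.
have gT := rtr_graph (rtrP T).
rewrite /fiber fv fh size_iota -nv_eq.
have -> : [seq index (vertex T h) (iota 0 (nvert T')) | h <- iota 0 (nhalf T)]
  = src T'.
  rewrite -[RHS](mkseq_nth 0%N) /mkseq -/(nhalf T') nh_eq.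
  apply/eq_in_map => h; rewrite mem_iota => /andP[_ hh].
  by rewrite nv_eq index_iota0 ?vertex_lt // /vertex src_eq.
have -> : [seq index (if h \in psi relabel_mor then h else mate T h)
             (iota 0 (nhalf T)) | h <- iota 0 (nhalf T)] = flip T'.
  rewrite -[RHS](mkseq_nth 0%N) /mkseq flip_eq (graph_size gT).
  apply/eq_in_map => h; rewrite mem_iota => /andP[_ hh].
  case: ifP => [|_]; last by rewrite index_iota0 ?mate_lt.
  rewrite (perm_mem legs_eq) mem_legs => /andP[_ /eqP e].
  by rewrite index_iota0 // -/(mate T h) e.
have -> : [seq index (onhalf relabel_mor h) (iota 0 (nhalf T))
             | h <- iota 0 (nhalf relabel_u) & vertex relabel_u h == 0%N]
  = legs T'.
  rewrite (@eq_filter _ _ predT) => [|h]; last by rewrite vert_u eqxx.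
  rewrite filter_predT nh_u -[RHS](mkseq_nth 0%N) /mkseq.
  apply/eq_in_map => h; rewrite mem_iota => /andP[_ hh].
  rewrite index_iota0 // -nh_eq; apply: legs_lt; exact: mem_nth.
by case: (tree T').
Qed.

Lemma relabel_morP : is_mor T relabel_u relabel_mor.
Proof.
split.
- by rewrite nh_u.
- by apply/allP => h /legs_lt; rewrite nh_eq.
- exact: uniq_legs.
- move=> h; rewrite nh_u => hm; rewrite mate_u //.
  have : nth 0%N (legs T') h \in legs T' by exact: mem_nth.
  by rewrite (perm_mem legs_eq) mem_legs => /andP[_ /eqP].
- rewrite /= -map_comp; apply: map_id_in => l hl /=.
  by rewrite /onhalf nth_index // (perm_mem legs_eq).
- by rewrite size_nseq.
- by apply/allP => x /nseqP[->].
- move=> [|v] // _; apply/nseqP; split=> //.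
  exact: graph_nvert (rtr_graph (rtrP T)).
- by move=> h _; rewrite vert_u ov.
- by move=> h _ _; rewrite !ov.
- by move=> [|v] // _; rewrite relabel_fiber; exact: rtr_connected (rtrP T').
Qed.

Definition relabel_hom : hom T relabel_u := Hom relabel_morP.

Lemma relabel_elementary : elementary relabel_hom 0 T'.
Proof.
split=> //.
- by apply/(sortedP 0%N) => i _; rewrite !nth_nseq !if_same.
- by rewrite relabel_fiber.
- by rewrite nedge_eq.
- by move=> [|j].
Qed.

Lemma relabel_trivial :
  exists (U : rtr) (_ : trivial_tree U), inhabited (iso relabel_u U).
Proof. exact: (@corolla_trivial m m_gt0 relabel_legs). Qed.

End Relabel.

Lemma rtr_eq (T T' : rtr) : tree T = tree T' -> T = T'.
Proof.
case: T T' => [t tP] [t' tP'] /= e; case: t' / e tP' => tP'.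
by rewrite (Prop_irrelevance tP tP').
Qed.

Lemma unlabel_inj0 (T T' : rtr) :
  (0 < nedge T)%N = false -> unlabel T = unlabel T' -> T = T'.
Proof.
move=> hT e; apply: rtr_eq; move: (e); rewrite /unlabel hT.
case: ifP => // h' e'; move: hT.
by rewrite e' /nedge /nhalf /mate /= -/(nhalf T') -/(nedge T') h'.
Qed.

Lemma strict_unlabel (k : fieldType) (N : operad k) (T T' : rtr) :
  unlabel T = unlabel T' -> N T' = N T.
Proof.
move=> e; case hT: (0 < nedge T)%N; last by rewrite (unlabel_inj0 hT e).
by apply: strict (relabel_elementary hT e).
Qed.

Record operad_map (k : fieldType) (M N : operad k) := OperadMap {
  opmap :> forall T d, M T d -> N T d;
  omap_linear : forall T d, linear (@opmap T d);
  omap_pull : forall T S (w : iso T S) d (x : M S d),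
    opmap (pull w x) = pull w (opmap x);
  omap_circ : forall (T S F : rtr) (f : hom T S) i (ef : elementary f i F)
    (p q d : int) (e : d = p + q) (x : M S p) (y : M F q),
    opmap (circ ef e x y) = circ ef e (opmap x) (opmap y);
  omap_eta : forall (U : rtr) (hU : trivial_tree U), opmap (eta M hU) = eta N hU
}.

(* Morphisms from a 1-connected collection to (the part with edges of) the
   collection underlying an operad. *)
Record collection_map (k : fieldType) (E : collection k) (N : operad k) :=
  CollectionMap {
  cmap :> forall T d, E T d -> N T d;
  cmap_linear : forall T d, linear (@cmap T d);
  cmap_pull : forall T S (w : iso T S) d (x : E S d),
    cmap (cpull w x) = pull w (cmap x);
  cmap_strict : forall (T u F : rtr) (f : hom T u) i (hu : local_terminal u)
    (ef : elementary f i F) d (x : E F d),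
    cmap (cast (cstrict E hu ef) x) = cast (strict N hu ef) (cmap x)
}.

Arguments opmap {k M N} _ {T d} _.
Arguments cmap {k E N} _ {T d} _.

Lemma cast_cast (k : fieldType) (U V W : graded k) (e : U = V) (e' : V = W)
    (e'' : U = W) d (x : U d) : cast e' (cast e x) = cast e'' x.
Proof.
by case: V / e e' => e'; case: W / e' e'' => e''; rewrite (Prop_irrelevance e'' erefl).
Qed.

Lemma cast_irr (k : fieldType) (V W : graded k) (e e' : V = W) d (x : V d) :
  cast e x = cast e' x.
Proof. by rewrite (Prop_irrelevance e e'). Qed.

Lemma cast0 (k : fieldType) (V W : graded k) (e : V = W) d :
  cast e (0 : V d) = 0.
Proof. by case: W / e. Qed.

Lemma castZ (k : fieldType) (V W : graded k) (e : V = W) d a (x : V d) :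
  cast e (a *: x) = a *: cast e x.
Proof. by case: W / e. Qed.

Lemma castD (k : fieldType) (V W : graded k) (e : V = W) d (x y : V d) :
  cast e (x + y) = cast e x + cast e y.
Proof. by case: W / e. Qed.

Lemma cast_id (k : fieldType) (V : graded k) (e : V = V) d (x : V d) :
  cast e x = x.
Proof. by rewrite (Prop_irrelevance e erefl). Qed.

Section OperadMap.
Variables (k : fieldType) (M N : operad k) (psi : operad_map M N).

Lemma opmapD (T : rtr) d (x y : M T d) :
  opmap psi (x + y) = opmap psi x + opmap psi y.
Proof. by rewrite -{1}(scale1r x) omap_linear scale1r. Qed.

Lemma opmap0 (T : rtr) d : opmap psi (0 : M T d) = 0.
Proof. by apply: (addrI (opmap psi (0 : M T d))); rewrite -opmapD !addr0. Qed.

Lemma opmapZ (T : rtr) d a (x : M T d) : opmap psi (a *: x) = a *: opmap psi x.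
Proof. by rewrite -[a *: x]addr0 omap_linear opmap0 addr0. Qed.

Lemma opmap_cast (T T' : rtr) (e : unlabel T = unlabel T') (eM : M T' = M T)
    d (x : M T' d) :
  opmap psi (cast eM x) = cast (strict_unlabel N e) (opmap psi x).
Proof.
case hT: (0 < nedge T)%N.
  have [U [hU [b]]] := relabel_trivial hT e.
  have hu : local_terminal (relabel_u hT e) by [].
  rewrite (cast_irr eM (strict M hu (relabel_elementary hT e))).
  rewrite (cast_irr _ (strict N hu (relabel_elementary hT e))).
  rewrite -(circ_unit hu (relabel_elementary hT e) b hU (esym (add0r d))).
  rewrite omap_circ omap_pull omap_eta.
  by rewrite circ_unit.
have eT : T = T' by exact: unlabel_inj0 hT e.
by case: T' / eT e eM x => e eM x; rewrite !cast_id.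
Qed.

End OperadMap.

Section Universal.
Variables (k : fieldType) (E : collection k) (N : operad k).
Variable phi : collection_map E N.

Let to (T T' : rtr) (e : unlabel T = unlabel T') d : N T' d -> N T d :=
  @cast k (N T') (N T) (strict_unlabel N e) d.

Fixpoint eval t d (x : term E t d) : forall T : rtr, unlabel T = t -> N T d :=
  match x in term _ t d return forall T : rtr, unlabel T = t -> N T d with
  | Gen T0 d x => fun T e => to e (cmap phi x)
  | Eta U hU => fun T e => to e (eta N hU)
  | Circ T0 S0 F0 f i ef p q d h x y => fun T e =>
      to e (circ ef h (eval x (T := S0) erefl) (eval y (T := F0) erefl))
  | Pull T0 S0 w d x => fun T e => to e (pull w (eval x (T := S0) erefl))
  | Zero t d => fun T e => 0
  | Add t d x y => fun T e => eval x e + eval y e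
  | Scale t d a x => fun T e => a *: eval x e
  end.

Lemma eval_to t d (x : term E t d) (T T' : rtr) (e : unlabel T = t)
    (e' : unlabel T' = t) (h : unlabel T = unlabel T') :
  eval x e = to h (eval x e').
Proof.
elim: x T T' e e' h => /=.
- by move=> *; rewrite /to; symmetry; apply: cast_cast.
- by move=> *; rewrite /to; symmetry; apply: cast_cast.
- by move=> *; rewrite /to; symmetry; apply: cast_cast.
- by move=> *; rewrite /to; symmetry; apply: cast_cast.
- by move=> t' d' T T' e e' h; rewrite /to cast0.
- move=> t' d' x IHx y IHy T T' e e' h.
  by rewrite (IHx _ _ e e' h) (IHy _ _ e e' h) /to castD.
- by move=> t' d' a x IHx T T' e e' h; rewrite (IHx _ _ e e' h) /to castZ.
Qed.

Lemma eval_castt t t' (e : t = t') d (x : term E t d) (T : rtr)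
    (h : unlabel T = t') (h' : unlabel T = t) : eval (castt e x) h = eval x h'.
Proof. by case: t' / e h => h; rewrite (Prop_irrelevance h h'). Qed.

Lemma to_id (T : rtr) (e : unlabel T = unlabel T) d (x : N T d) : to e x = x.
Proof. exact: cast_id. Qed.

Lemma eval_teq t d (x y : term E t d) : teq x y ->
  forall (T : rtr) (e : unlabel T = t), eval x e = eval y e.
Proof.
have lin0 (T T' : rtr) (h : unlabel T = unlabel T') n a (u v : N T' n) :
  to h (a *: u + v) = a *: to h u + to h v by exact: cast_linear.
elim=> {t d x y}.
- by [].
- by move=> t d x y _ IH T e; rewrite IH.
- by move=> t d x y z _ IH1 _ IH2 T e; rewrite IH1 IH2.
- by move=> t d x x' y y' _ IH1 _ IH2 T e /=; rewrite IH1 IH2.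
- by move=> t d a x x' _ IH T e /=; rewrite IH.
- by move=> T S F f i ef p q d h x x' y y' _ IH1 _ IH2 T' e /=; rewrite IH1 IH2.
- by move=> T S w d x x' _ IH T' e /=; rewrite IH.
- by move=> *; exact: addrA.
- by move=> *; exact: addrC.
- by move=> *; exact: add0r.
- by move=> t d x T e /=; rewrite scaleN1r addNr.
- by move=> *; exact: scalerA.
- by move=> *; exact: scale1r.
- by move=> *; exact: scalerDr.
- by move=> *; exact: scalerDl.
- by move=> T d a x y T' e /=; rewrite cmap_linear lin0.
- by move=> T S w d x T' e /=; rewrite cmap_pull to_id.
- move=> T u F f i hu ef d x T' e; rewrite /= cmap_strict.
  rewrite (eval_castt (over_unlabel hu ef) (Gen x) e (etrans e (esym (over_unlabel hu ef)))).
  by rewrite /= /to; apply: cast_cast.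
- by move=> T S w d a x y T' e /=; rewrite pull_linear lin0.
- move=> T w d x h T' e /=; rewrite pull_id //.
  by rewrite (eval_to x e erefl e).
- by move=> T S P v w vw d x h T' e /=; rewrite to_id (pull_comp h).
- move=> T S F f i ef p q d h a x x' y T' e /=.
  by rewrite (circ_linearl ef h _) lin0.
- move=> T S F f i ef p q d h x a y y' T' e /=.
  by rewrite (circ_linearr ef h _) lin0.
- move=> T S P F G H f g h fi j i j' ef eg eh efi h1 h2 h3.
  move=> p q r qr pq d e1 e2 e3 e4 x y z T' e /=; rewrite !to_id; congr to.
  exact: circ_assoc h1 h2 h3 _ _ _ _ _ _ _ _ _ _ _ _ _.
- move=> T S S' S'' F G f' g' f'' g'' j i l m ef' eg' ef'' eg'' h1 h2 h3 h4.
  move=> p q r pq pr d e1 e2 e3 e4 x y z T' e /=; rewrite !to_id.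
  rewrite -(circ_parallel ef' eg' ef'' eg'' h1 h2 h3 h4 e1 e2 e3 e4).
  by rewrite /to castZ.
- move=> T u F U f i hu ef b hU d h x T' e /=; rewrite !to_id circ_unit.
  rewrite (eval_castt (over_unlabel hu ef) x e (etrans e (esym (over_unlabel hu ef)))).
  rewrite (eval_to x _ erefl (etrans e (esym (over_unlabel hu ef)))) /to.
  exact: cast_cast.
- move=> T' S' F' T'' S'' F'' F u f' f'' g i j l ef' ef'' w s wj hu eg h1 h2 h3.
  move=> p q d h x y T0 e /=; rewrite !to_id; congr to.
  rewrite (circ_iso ef' ef'' hu eg h1 h2 h3); congr circ.
  rewrite (eval_castt (esym (over_unlabel hu eg)) (Pull wj y) erefl (over_unlabel hu eg)).
  by rewrite /= /to; apply: cast_irr.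
Qed.

Definition free_lift_at (T : rtr) d (x : free_operad E T d) : N T d :=
  eval (qrep x : term E (unlabel T) d) erefl.

Lemma free_lift_cls (T : rtr) d (x : term E (unlabel T) d) :
  free_lift_at (cls (x : term_premod E _ _) : fop E T d) = eval x erefl.
Proof. by apply: eval_teq; exact: (qrep_cls (x : term_premod E _ _)). Qed.

Definition free_lift : operad_map (free_operad E) N.
Proof.
apply: (@OperadMap k (free_operad E) N free_lift_at).
- move=> T d a; elim/(@fclsW k E)=> x; elim/(@fclsW k E)=> y.
  by rewrite (@fcls_lin k E) !free_lift_cls.
- move=> T S w d; elim/(@fclsW k E)=> x.
  by rewrite /= (@fpullE k E) !free_lift_cls /= to_id.
- move=> T S F f i ef p q d e; elim/(@fclsW k E)=> x; elim/(@fclsW k E)=> y.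
  by rewrite /= (@fcircE k E) !free_lift_cls /= to_id.
- by move=> U hU; rewrite /= /feta free_lift_cls /= to_id.
Defined.

Lemma free_lift_gen (T : rtr) d (x : E T d) :
  opmap free_lift (fgen x) = cmap phi x.
Proof. by rewrite /= /fgen free_lift_cls /= to_id. Qed.

Lemma free_lift_unique (psi : operad_map (free_operad E) N) :
  (forall (T : rtr) d (x : E T d), opmap psi (fgen x) = cmap phi x) ->
  forall (T : rtr) d (x : free_operad E T d), opmap psi x = opmap free_lift x.
Proof.
move=> hpsi.
suff main t d (x : term E t d) (T : rtr) (e : unlabel T = t) :
    opmap psi (cls (castt (esym e) x : term_premod E _ _) : fop E T d) = eval x e.
  move=> T d; elim/(@fclsW k E)=> x.
  by rewrite [RHS]free_lift_cls -(main _ _ x T erefl).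
have key (T0 : rtr) n (y : term E (unlabel T0) n) (T1 : rtr)
    (e1 : unlabel T1 = unlabel T0) :
  opmap psi (cls (castt (esym e1) y : term_premod E _ _) : fop E T1 n) =
  to e1 (opmap psi (cls (y : term_premod E _ _) : fop E T0 n)).
  pose eM : free_operad E T0 = free_operad E T1 := f_equal (fterm E) (esym e1).
  rewrite /to -(opmap_cast psi e1 eM); congr (opmap psi _).
  by symmetry; exact: (cast_cls (esym e1) y).
elim: x T e => {t d}.
- by move=> T0 d x T e; rewrite key [X in to _ X]hpsi.
- by move=> U hU T e; rewrite key /= -(omap_eta psi).
- move=> T S F f i ef p q d h x IHx y IHy T' e; rewrite key /=.
  rewrite -(IHx S erefl) -(IHy F erefl) -(omap_circ psi); congr (to _ (opmap _ _)).
  by rewrite /= (@fcircE k E).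
- move=> T S w d x IHx T' e; rewrite key /=.
  rewrite -(IHx S erefl) -(omap_pull psi); congr (to _ (opmap _ _)).
  by rewrite /= (@fpullE k E).
- move=> t d T e; case: t / e => /=.
  rewrite -[RHS](scale0r (opmap psi (0 : fop E T d))).
  rewrite -[X in opmap psi X]/(0 : fop E T d) -{1}(scale0r (0 : fop E T d)).
  by rewrite opmapZ.
- move=> t d x IHx y IHy T e; case: t / e x IHx y IHy => x IHx y IHy /=.
  rewrite -(IHx T erefl) -(IHy T erefl) -opmapD; congr opmap.
  by rewrite [RHS]qaddE.
- move=> t d a x IHx T e; case: t / e x IHx => x IHx /=.
  rewrite -(IHx T erefl) -opmapZ; congr opmap.
  by rewrite [RHS]qscaleE.
Qed.

Theorem free_operad_universal :
  exists2 psi : operad_map (free_operad E) N,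
    forall (T : rtr) d (x : E T d), opmap psi (fgen x) = cmap phi x &
    forall psi' : operad_map (free_operad E) N,
      (forall (T : rtr) d (x : E T d), opmap psi' (fgen x) = cmap phi x) ->
      forall (T : rtr) d (x : free_operad E T d), opmap psi' x = opmap psi x.
Proof.
exists free_lift; first exact: free_lift_gen.
exact: free_lift_unique.
Qed.

End Universal.

Section PullInverse.
Variables (k : fieldType) (E : collection k).

Lemma cpullK T S (w : iso T S) d (x : E T d) :
  cpull w (cpull (inv_iso w) x) = x.
Proof.
rewrite -(@cpull_comp k E T S T w (inv_iso w) (id_iso T)) ?cpull_id //=.
by rewrite iso_bf.
Qed.

Lemma cpullVK T S (w : iso T S) d (x : E S d) :
  cpull (inv_iso w) (cpull w x) = x.
Proof. by case: w => f g e e'; exact: (cpullK (Iso e' e)). Qed.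

End PullInverse.

Section SuspendedDual.
Variables (k : fieldType) (E : collection k).

Definition sdual_graded (V : graded k) : graded k :=
  fun d => functional (V (d - 1)).

Definition sdual_pull (T S : rtr) (w : iso T S) (d : int)
    (x : sdual_graded (E S) d) : sdual_graded (E T) d :=
  transpose (@cpull_linear k E S T (inv_iso w) (d - 1)) x.

Lemma cast_sdual (V W : graded k) (e : V = W) d
    (x : sdual_graded V d) (y : W (d - 1)) :
  fapp (cast (f_equal sdual_graded e) x) y = fapp x (cast (esym e) y).
Proof. by case: W / e y. Qed.

(* The suspension of the graded dual, ((E(T))^* )_n = (E(T)_n)^* , with the
   contragredient action of isomorphisms. *)
Definition sdual : collection k.
Proof.
apply: (@Collection k (fun T => sdual_graded (E T)) sdual_pull
  (fun T u F f i hu ef => f_equal sdual_graded (cstrict E hu ef))).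
- move=> T S w d a x y; apply: functional_ext => z.
  by rewrite [LHS]fappE [RHS]fappE.
- move=> T w h d x; apply: functional_ext => z /=; congr fapp.
  by rewrite -[RHS](cpullK w) (cpull_id h).
- move=> T S P v w vw h d x; apply: functional_ext => z /=; congr fapp.
  rewrite -{1}(cpullK v z) -(cpullK w (cpull (inv_iso v) z)).
  by rewrite -(cpull_comp h) cpullVK [in RHS]cpullK.
- move=> T h d x; apply: functional_ext => z.
  by rewrite (coll_zero h z) !fapp0.
- move=> T' T'' t F' F'' f' f'' i j ht ef' ef'' w wt h1 h2 d x.
  apply: functional_ext => y; rewrite [LHS]/= !cast_sdual [RHS]/=; congr fapp.
  set z := cpull (inv_iso wt) _.
  have <- : cpull w (cast (cstrict E ht ef'') z) = y.
    by rewrite (cpull_strict ht ef' ef'' h1 h2) cpullK castKV.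
  by rewrite cpullVK castK.
Defined.

End SuspendedDual.

(* A pair (l : X -> T an isomorphism, tau : T -> S elementary, e(S) >= 1);
   [dec_F] is the nontrivial fiber t_1 of tau and [dec_S] is t_2. *)
Record decomp (X : rtr) := Decomp {
  dec_T : rtr;
  dec_S : rtr;
  dec_F : rtr;
  dec_iso : iso X dec_T;
  dec_hom : hom dec_T dec_S;
  dec_idx : nat;
  dec_elt : elementary dec_hom dec_idx dec_F;
  dec_edge : (1 <= nedge dec_S)%N
}.

Definition decomp_equiv (X : rtr) (c c' : decomp X) : Prop :=
  exists (s1 : iso (dec_T c) (dec_T c')) (s2 : iso (dec_S c) (dec_S c')),
    comp_mor s1 (dec_iso c) = dec_iso c' /\
    comp_mor s2 (dec_hom c) = comp_mor (dec_hom c') s1.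

Definition representatives (D : forall X : rtr, decomp X -> Prop) : Prop :=
  forall (X : rtr) (c : decomp X),
    exists! c' : decomp X, D X c' /\ decomp_equiv c c'.

Section Quadratic.
Variable D : forall X : rtr, decomp X -> Prop.

(* A homogeneous element x (x) y of E(t_1^c) (x) E(t_2^c), of degree d. *)
Record tensor_at (k : fieldType) (E : collection k) (X : rtr) (d : int)
    (c : decomp X) := TensorAt {
  ten_p : int;
  ten_q : int;
  ten_deg : d = ten_q + ten_p;
  ten_x : E (dec_F c) ten_p;
  ten_y : E (dec_S c) ten_q
}.

Definition tensor (k : fieldType) (E : collection k) (X : rtr) (d : int) :=
  {c : {c : decomp X | D c} & tensor_at E d (sval c)}.

Definition realize1 (k : fieldType) (E : collection k) (X : rtr) (d : int)
    (t : tensor E X d) : free_operad E X d :=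
  let u := tagged t in
  koszul k (ten_p u * ten_q u) *:
  pull (dec_iso (sval (tag t)))
    (@circ k (free_operad E) _ _ _ _ _ (dec_elt (sval (tag t)))
       _ _ _ (ten_deg u) (fgen (ten_y u)) (fgen (ten_x u))).

(* The isomorphism from the direct sum of the E(t_1^c) (x) E(t_2^c) onto
   F^2(E)(X); an element of the sum is a finite list of tensors. *)
Definition realize (k : fieldType) (E : collection k) (X : rtr) (d : int)
    (s : seq (tensor E X d)) : free_operad E X d :=
  \sum_(t <- s) realize1 t.

(* Evaluation of an element of degree a + 1 of the suspended dual; it
   vanishes on elements of degree other than a. *)
Definition sdual_eval (k : fieldType) (E : collection k) (T : rtr) (p p' : int)
    (f : sdual E T p) (x : E T p') : k :=
  match p' =P p - 1 with
  | ReflectT e => fapp f (eq_rect p' (fun n => E T n) x (p - 1) e)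
  | ReflectF _ => 0
  end.

(* The Koszul sign comes from moving the second factor of u past the first
   factor of r. *)
Definition pair_at (k : fieldType) (E : collection k) (X : rtr) (d d' : int)
    (c : decomp X) (u : tensor_at (sdual E) d c) (r : tensor_at E d' c) : k :=
  koszul k (ten_q u * ten_p r) *
  (sdual_eval (ten_x u) (ten_x r) * sdual_eval (ten_y u) (ten_y r)).

Definition pairing (k : fieldType) (E : collection k) (X : rtr) (d d' : int)
    (u : tensor (sdual E) X d) (r : tensor E X d') : k :=
  match pselect (tag u = tag r) with
  | left e =>
      pair_at (eq_rect (tag u) (fun c => tensor_at (sdual E) d (sval c))
                       (tagged u) (tag r) e) (tagged r)
  | right _ => 0
  end.

Definition annihilator (k : fieldType) (E : collection k)
    (R : op_pred (free_operad E)) : op_pred (free_operad (sdual E)) :=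
  fun X d x => exists2 u : seq (tensor (sdual E) X d), x = realize u &
    forall d' (r : seq (tensor E X d')), R X d' (realize r) ->
      \sum_(a <- u) \sum_(b <- r) pairing a b = 0.

Definition quadratic_operad (k : fieldType) (E : collection k)
    (R : op_pred (free_operad E)) : operad k := quotient_by R.

Definition koszul_dual (k : fieldType) (E : collection k)
    (R : op_pred (free_operad E)) : operad k :=
  quotient_by (annihilator R).

End Quadratic.

Section SingleEdge.
Variable k : fieldType.

(* k if n = 1 and d = 0, else 0: row vectors of length 1 or 0. *)
Definition unit_graded (n : nat) : graded k :=
  fun d => 'rV[k]_((n == 1%N) && (d == 0)).

Definition unit_elt (n : nat) (d : int) : unit_graded n d := const_mx 1.

(* The identity of k when both source and target are k. *)
Definition unit_map (n m : nat) (d : int) (x : unit_graded n d) :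
    unit_graded m d := const_mx (\sum_j x 0 j).

Lemma unit_map_id n d (x : unit_graded n d) : unit_map n x = x.
Proof.
rewrite /unit_map; move: x; rewrite /unit_graded; case: (_ && _) => /= x.
  apply/rowP => j; rewrite mxE big_ord1; congr (x _ _).
  by apply: val_inj; case: j => -[].
by apply/rowP => -[].
Qed.

Lemma unit_map_comp n m l d (x : unit_graded n d) :
  n = m -> unit_map l (unit_map m x) = unit_map l x.
Proof. by move=> e; case: m / e; rewrite unit_map_id. Qed.

Lemma cast_unit n m (h : n = m) (e : unit_graded n = unit_graded m) d
    (x : unit_graded n d) : cast e x = unit_map m x.
Proof.
by case: m / h e => e; rewrite (Prop_irrelevance e erefl) unit_map_id.
Qed.

Definition single_edge : collection k.
Proof.
apply: (@Collection k (fun T => unit_graded (nedge T))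
  (fun T S w d x => unit_map (nedge T) x)
  (fun T u F f i hu ef => f_equal unit_graded (over_nedge hu ef))).
- move=> T S w d a x y; apply/rowP => j; rewrite !mxE mulr_sumr -big_split.
  by apply: eq_bigr => i _; rewrite !mxE.
- by move=> T w _ d x; exact: unit_map_id.
- move=> T S P v w vw _ d x; rewrite (iso_nedge v) (iso_nedge w).
  by rewrite !unit_map_id.
- move=> T h d x; apply/rowP => -[j jh]; exfalso.
  by move: jh; rewrite h.
- move=> T' T'' t F' F'' f' f'' i j ht ef' ef'' w wt _ _ d x.
  rewrite (cast_unit (over_nedge ht ef'')) (cast_unit (over_nedge ht ef')).
  rewrite (unit_map_comp _ _ (over_nedge ht ef'')).
  by rewrite (unit_map_comp _ _ (esym (iso_nedge wt))).
Defined.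

End SingleEdge.

Definition composable (X : otree) : Prop :=
  exists h1 h2, [/\ (h1 < nhalf X)%N, (h2 < nhalf X)%N,
    mate X h1 <> h1, mate X h2 <> h2 &
    [/\ rootward X h1, rootward X h2 & vertex X (mate X h1) = vertex X h2]].

Section PrePermutadOperad.
Variables (D : forall X : rtr, decomp X -> Prop) (k : fieldType).

Definition basis_tensor (X : rtr) (c : {c : decomp X | D c}) :
    tensor D (single_edge k) X 0 :=
  Tagged (fun c : {c : decomp X | D c} => tensor_at (single_edge k) 0 (sval c))
    (@TensorAt k (single_edge k) X 0 (sval c) 0 0 (esym (addr0 0))
      (unit_elt k (nedge (dec_F (sval c))) 0)
      (unit_elt k (nedge (dec_S (sval c))) 0)).

Definition basis_elt (X : rtr) (c : {c : decomp X | D c}) :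
  free_operad (single_edge k) X 0 := realize [:: basis_tensor c].

Inductive pp_rel : op_pred (free_operad (single_edge k)) :=
| PPZero (X : rtr) d : @pp_rel X d 0
| PPDiff (X : rtr) (c1 c2 : {c : decomp X | D c}) (a : k) :
    nedge X = 2%N -> composable X -> c1 <> c2 ->
    @pp_rel X 0 (a *: (basis_elt c1 - basis_elt c2)).

Definition pp : operad k := quadratic_operad pp_rel.

Definition pp_dual : operad k := koszul_dual D pp_rel.

End PrePermutadOperad.

Record category := Category {
  obj :> Type;
  arrow : obj -> obj -> Type;
  idm : forall x, arrow x x;
  compm : forall x y z, arrow y z -> arrow x y -> arrow x z;
  comp_idl : forall x y (f : arrow x y), compm (idm y) f = f;
  comp_idr : forall x y (f : arrow x y), compm f (idm x) = f;
  compmA : forall x y z t (h : arrow z t) (g : arrow y z) (f : arrow x y),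
    compm h (compm g f) = compm (compm h g) f
}.

Record functor (C D : category) := Functor {
  fobj :> C -> D;
  fmap : forall x y : C, arrow x y -> arrow (fobj x) (fobj y);
  fmap_id : forall x, fmap (idm x) = idm (fobj x);
  fmap_comp : forall x y z (g : arrow y z) (f : arrow x y),
    fmap (compm g f) = compm (fmap g) (fmap f)
}.

Definition is_isomorphism (C D : category) (F : functor C D) : Prop :=
  bijective F /\ forall x y : C, bijective (@fmap C D F x y).

Definition functor_comp (B C D : category) (G : functor C D) (F : functor B C) :
    functor B D.
Proof.
apply: (@Functor B D (fun x => G (F x)) (fun x y f => fmap G (fmap F f))).
- by move=> x; rewrite !fmap_id.
- by move=> x y z g f; rewrite !fmap_comp.
Defined.

Definition gcoll (k : fieldType) := nat -> graded k.

Definition gmap (k : fieldType) (A B : gcoll k) :=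
  {f : forall c d, A c d -> B c d | forall c d, linear (f c d)}.

Definition gapp (k : fieldType) (A B : gcoll k) (f : gmap A B) c d :
  A c d -> B c d := sval f c d.

Definition gid (k : fieldType) (A : gcoll k) : gmap A A.
Proof. by exists (fun c d x => x). Defined.

Definition gcomp (k : fieldType) (A B C : gcoll k) (g : gmap B C) (f : gmap A B) :
  gmap A C.
Proof.
exists (fun c d x => gapp g (gapp f x)) => c d a x y.
by rewrite /gapp (proj2_sig f) (proj2_sig g).
Defined.

Lemma gmap_ext (k : fieldType) (A B : gcoll k) (f g : gmap A B) :
  (forall c d x, @gapp k A B f c d x = gapp g x) -> f = g.
Proof.
case: f g => f fl [g gl] h; apply: eq_exist.
by do 3!apply: functional_extensionality_dep => ?; exact: h.
Qed.

Definition coll_category (k : fieldType) : category.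
Proof.
apply: (@Category (gcoll k) (@gmap k) (@gid k) (@gcomp k)).
- by move=> A B f; exact: gmap_ext.
- by move=> A B f; exact: gmap_ext.
- by move=> A B C D h g f; exact: gmap_ext.
Defined.

Section StructuredCollections.
Variables (k : fieldType) (str : gcoll k -> Type).
Variable preserves : forall A B : gcoll k, str A -> str B -> gmap A B -> Prop.
Hypothesis preserves_id : forall A (a : str A), preserves a a (gid A).
Hypothesis preserves_comp :
  forall A B C (a : str A) (b : str B) (c : str C) (g : gmap B C) (f : gmap A B),
  preserves b c g -> preserves a b f -> preserves a c (gcomp g f).

Let sobj := {A : gcoll k & str A}.

Let sarrow (A B : sobj) :=
  {f : gmap (tag A) (tag B) | preserves (tagged A) (tagged B) f}.

Definition str_category : category.
Proof.
apply: (@Category sobj sarrow (fun A => exist _ _ (preserves_id (tagged A)))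
  (fun A B C g f =>
     exist _ _ (preserves_comp (proj2_sig g) (proj2_sig f)))).
- by move=> A B [f hf]; apply: eq_exist; exact: gmap_ext.
- by move=> A B [f hf]; apply: eq_exist; exact: gmap_ext.
- by move=> A B C D [h hh] [g hg] [f hf]; apply: eq_exist; exact: gmap_ext.
Defined.

Definition forget : functor str_category (coll_category k) :=
  @Functor str_category (coll_category k) (fun A => tag A)
    (fun A B f => sval f) (fun A => erefl) (fun A B C g f => erefl).

End StructuredCollections.

(* Elements with their arity and degree, so as to compare elements whose
   arities and degrees are equal but not convertible. *)
Definition packed (k : fieldType) (A : gcoll k) :=
  {c : nat & {d : int & A c d}}.

Definition pack (k : fieldType) (A : gcoll k) c d (x : A c d) : packed A :=
  existT _ c (existT _ d x).

Definition arity (T : rtr) (v : nat) : nat := pi0 (fiber T T (id_mor T) v).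

Definition inputs (k : fieldType) (A : gcoll k) (T : rtr)
    (d : 'I_(nvert T) -> int) := forall v : 'I_(nvert T), A (arity T v) (d v).

Section Algebra.
Variables (k : fieldType) (M : operad k) (A : gcoll k).

Definition action := forall (T : rtr) (p n : int) (d : 'I_(nvert T) -> int),
  n = p + \sum_v d v -> M T p -> inputs A d -> A (pi0 T) n.

Definition acts_by (alpha : action) (u : rtr) (a b : packed A) : Prop :=
  exists (U : rtr) (hU : trivial_tree U) (s : iso u U)
    (d : 'I_(nvert u) -> int) (n : int) (e : n = 0 + \sum_v d v)
    (x : inputs A d),
    (forall v, pack (x v) = a) /\
    b = pack (alpha u 0 n d e (pull s (eta M hU)) x).

Record algebra := Algebra {
  alg_act : action;

  act_linearl : forall (T : rtr) (p n : int) (d : 'I_(nvert T) -> int)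
      (e : n = p + \sum_v d v) (a : inputs A d),
    linear (fun m : M T p => alg_act e m a);
  act_linearr : forall (T : rtr) (p n : int) (d : 'I_(nvert T) -> int)
      (e : n = p + \sum_v d v) (m : M T p)
      (a : inputs A d) (v : 'I_(nvert T)),
    linear (fun x : A (arity T v) (d v) =>
      alg_act e m (dfwith (a : forall w : 'I_(nvert T), A (arity T w) (d w)) x));

  act_unit : forall (U : rtr) (hU : trivial_tree U) (n : int)
      (d : 'I_(nvert U) -> int) (e : n = 0 + \sum_v d v) (a : inputs A d) (v : 'I_(nvert U)),
    pack (alg_act e (eta M hU) a) = pack (a v);

  (* b is a with the block of the vertices over i replaced by alpha_F(m', a'),
     and a' is that block; m' moves past the inputs before it. *)
  act_circ : forall (T S F : rtr) (f : hom T S) (i : nat)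
      (ef : elementary f i F) (p q r : int) (e : r = p + q)
      (m : M S p) (m' : M F q)
      (dT : 'I_(nvert T) -> int) (dS : 'I_(nvert S) -> int)
      (dF : 'I_(nvert F) -> int) (nT nS nF : int)
      (eT : nT = r + \sum_v dT v) (eS : nS = p + \sum_v dS v)
      (eF : nF = q + \sum_v dF v)
      (a : inputs A dT) (b : inputs A dS) (a' : inputs A dF),
    (forall (l : 'I_(nvert F)) (v : 'I_(nvert T)),
       nth 0%N (fiber_verts T f i) l = v -> pack (a' l) = pack (a v)) ->
    (forall (w : 'I_(nvert S)) (v : 'I_(nvert T)),
       w <> i :> nat -> onvert f v = w -> pack (b w) = pack (a v)) ->
    (forall w : 'I_(nvert S), w = i :> nat ->
       pack (b w) = pack (alg_act eF m' a')) ->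
    pack (alg_act eT (circ ef e m m') a) =
    pack (koszul k (q * \sum_(v < nvert T | (onvert f v < i)%N) dT v) *:
          alg_act eS m b);

  act_iso : forall (T S : rtr) (w : iso T S) (p : int) (m : M S p)
      (dT : 'I_(nvert T) -> int) (dS : 'I_(nvert S) -> int) (nT nS : int)
      (eT : nT = p + \sum_v dT v) (eS : nS = p + \sum_v dS v)
      (a : inputs A dT) (b : inputs A dS),
    (forall (j : 'I_(nvert S)) (v : 'I_(nvert T)), onvert w v = j ->
       exists2 u : rtr, tree u = fiber T S w j &
         acts_by alg_act u (pack (a v)) (pack (b j))) ->
    pack (alg_act eT (pull w m) a) =
    pack ((\prod_(v < nvert T)
             \prod_(v' < nvert T | (v < v')%N && (onvert w v' < onvert w v)%N)
                koszul k (dT v * dT v')) *: alg_act eS m b)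
}.

End Algebra.

Arguments alg_act {k M A} _ {T p n d} _ _ _.

Definition algebra_map (k : fieldType) (M : operad k) (A B : gcoll k)
    (alpha : algebra M A) (beta : algebra M B) (f : gmap A B) : Prop :=
  forall (T : rtr) (p n : int) (d : 'I_(nvert T) -> int)
      (e : n = p + \sum_v d v) (m : M T p) (a : inputs A d),
    gapp f (alg_act alpha e m a) =
    alg_act beta e m (fun v => gapp f (a v)).

Lemma algebra_map_id (k : fieldType) (M : operad k) (A : gcoll k)
  (alpha : algebra M A) : algebra_map alpha alpha (gid A).
Proof. by []. Qed.

Lemma algebra_map_comp (k : fieldType) (M : operad k) (A B C : gcoll k)
  (alpha : algebra M A) (beta : algebra M B) (gamma : algebra M C)
  (g : gmap B C) (f : gmap A B) :
  algebra_map beta gamma g -> algebra_map alpha beta f ->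
  algebra_map alpha gamma (gcomp g f).
Proof.
move=> hg hf T p n d e m a.
by rewrite -[LHS]/(gapp g (gapp f _)) hf hg.
Qed.

Definition algebra_category (k : fieldType) (M : operad k) : category :=
  str_category (@algebra_map_id k M) (@algebra_map_comp k M).

Definition algebra_forget (k : fieldType) (M : operad k) :
  functor (algebra_category M) (coll_category k) :=
  forget (@algebra_map_id k M) (@algebra_map_comp k M).

(* Inputs are numbered from 0.  The input k <> i of f becomes the input
   [slot i n k] of the composite of f and g at i, for g of arity n, and the
   input l of g becomes i + l. *)
Definition slot (i n k : nat) : nat := if (k < i)%N then k else (k + n).-1.

Definition is_insertion (m n : nat) (tau : 'S_m) (i : 'I_m) (sigma : 'S_n)
    (rho : 'S_(m + n).-1) : Prop :=
  (forall (l : 'I_n) (x : 'I_(m + n).-1), x = (i + l)%N :> nat ->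
     rho x = (tau i + sigma l)%N :> nat) /\
  (forall (l : 'I_m) (x : 'I_(m + n).-1), l <> i -> x = slot i n l :> nat ->
     rho x = slot (tau i) n (tau l) :> nat).

(* All the axioms of a nonunital Markl operad but the associativity.
   Permutations alg_act on the right for the product of functions, whereas
   (s * t) i = t (s i) for s t : 'S_n; whence the order in [ract_comp]. *)
Record partial_comp (k : fieldType) (A : gcoll k) := PartialComp {
  ract : forall n d, A n d -> 'S_n -> A n d;
  pcomp : forall (m n : nat) (i : 'I_m) (p q d : int), d = p + q ->
    A m p -> A n q -> A (m + n).-1 d;
  ract_linear : forall n d (s : 'S_n), linear (fun x : A n d => ract x s);
  ract_id : forall n d (x : A n d), ract x 1%g = x;
  ract_comp : forall n d (x : A n d) (s t : 'S_n),
    ract (ract x s) t = ract x (t * s)%g;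
  pcomp_linearl : forall m n (i : 'I_m) (p q d : int) (e : d = p + q)
    (y : A n q), linear (fun x : A m p => pcomp i e x y);
  pcomp_linearr : forall m n (i : 'I_m) (p q d : int) (e : d = p + q)
    (x : A m p), linear (fun y : A n q => pcomp i e x y);
  pcomp_equivariant : forall m n (i : 'I_m) (p q d : int) (e : d = p + q)
    (f : A m p) (g : A n q) (tau : 'S_m) (sigma : 'S_n) rho,
    is_insertion tau i sigma rho ->
    pcomp i e (ract f tau) (ract g sigma) = ract (pcomp (tau i) e f g) rho
}.

Definition sequential (k : fieldType) (A : gcoll k) (P : partial_comp A) : Prop :=
  forall (a b c : nat) (j : 'I_a) (i : 'I_(a + b).-1) (i' : 'I_b),
    i = (j + i')%N :> nat ->
  forall (p q r pq qr d : int) (e1 : pq = p + q) (e2 : d = pq + r)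
    (e3 : qr = q + r) (e4 : d = p + qr) (f : A a p) (g : A b q) (h : A c r),
  pack (pcomp P i e2 (pcomp P j e1 f g) h) =
  pack (pcomp P j e4 f (pcomp P i' e3 g h)).

Definition parallel_zero (k : fieldType) (A : gcoll k) (P : partial_comp A) :
    Prop :=
  forall (a b c : nat) (j : 'I_a) (i : 'I_(a + b).-1),
    (i < j)%N || (j + b <= i)%N ->
  forall (p q r pq d : int) (e1 : pq = p + q) (e2 : d = pq + r)
    (f : A a p) (g : A b q) (h : A c r),
  pcomp P i e2 (pcomp P j e1 f g) h = 0.

Definition pre_permutad (k : fieldType) (A : gcoll k) :=
  {P : partial_comp A | sequential P}.

Definition null_markl (k : fieldType) (A : gcoll k) :=
  {P : partial_comp A | sequential P /\ parallel_zero P}.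

Definition partial_comp_map (k : fieldType) (A B : gcoll k)
    (P : partial_comp A) (Q : partial_comp B) (f : gmap A B) : Prop :=
  (forall n d (x : A n d) (s : 'S_n), gapp f (ract P x s) = ract Q (gapp f x) s)
  /\
  (forall m n (i : 'I_m) (p q d : int) (e : d = p + q) (x : A m p) (y : A n q),
     gapp f (pcomp P i e x y) = pcomp Q i e (gapp f x) (gapp f y)).

Lemma partial_comp_map_id (k : fieldType) (A : gcoll k) (P : partial_comp A) :
  partial_comp_map P P (gid A).
Proof. by []. Qed.

Lemma partial_comp_map_comp (k : fieldType) (A B C : gcoll k)
  (P : partial_comp A) (Q : partial_comp B) (R : partial_comp C)
  (g : gmap B C) (f : gmap A B) :
  partial_comp_map Q R g -> partial_comp_map P Q f ->
  partial_comp_map P R (gcomp g f).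
Proof.
move=> [hg1 hg2] [hf1 hf2]; split.
  by move=> n d x s; rewrite -[LHS]/(gapp g (gapp f _)) hf1 hg1.
by move=> m n i p q d e x y; rewrite -[LHS]/(gapp g (gapp f _)) hf2 hg2.
Qed.

Section PrePermutadCategory.
Variable k : fieldType.

Definition pre_permutad_map (A B : gcoll k) (P : pre_permutad A)
  (Q : pre_permutad B) := partial_comp_map (sval P) (sval Q).

Definition pre_permutad_category : category :=
  @str_category k (@pre_permutad k) pre_permutad_map
    (fun A P => partial_comp_map_id (sval P))
    (fun A B C P Q R => @partial_comp_map_comp k A B C (sval P) (sval Q) (sval R)).

Definition pre_permutad_forget :
  functor pre_permutad_category (coll_category k) :=
  @forget k (@pre_permutad k) pre_permutad_map
    (fun A P => partial_comp_map_id (sval P))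
    (fun A B C P Q R => @partial_comp_map_comp k A B C (sval P) (sval Q) (sval R)).

Definition null_markl_map (A B : gcoll k) (P : null_markl A)
  (Q : null_markl B) := partial_comp_map (sval P) (sval Q).

Definition null_markl_category : category :=
  @str_category k (@null_markl k) null_markl_map
    (fun A P => partial_comp_map_id (sval P))
    (fun A B C P Q R => @partial_comp_map_comp k A B C (sval P) (sval Q) (sval R)).

End PrePermutadCategory.

(* Main.v *)
(* The action of the units turns an algebra over M into a collection A with right
   actions of the symmetric groups, and the rest of the structure into a morphism
   from M to an endomorphism operad of A.  A morphism out of the free operad with
   one generator, of degree 0 for pp and 1 for its dual, on each one-edge tree is
   an equivariant family of partial compositions of that degree.

   A tree with two edges has two classes of contractions, and it is isomorphic to
   a standard tree on which they evaluate to two nested composites.  For a chain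
   these are (f o g) o h and f o (g o h): R identifies them, and its annihilator
   makes their signed sum vanish.  For a fork R is zero, so that its annihilator
   is everything and both composites vanish.  That the two contractions are
   independent, which is needed to compute the annihilator, is seen on the
   algebra equal to k in all arities and degrees, with a composition that is
   zero except in well chosen degrees.  Finally a shift of degrees by one and the
   sign (-1)^|f| turn compositions of degree 1, associative up to -1, into
   associative compositions of degree 0. *)

From HB Require Import structures.
From mathcomp Require Import all_boot all_fingroup all_algebra zify.
From mathcomp Require Import boolp.
Require Import Defs.

Set Implicit Arguments.
Unset Strict Implicit.
Unset Printing Implicit Defensive.

Import GRing.Theory.

Local Open Scope nat_scope.

(** * Renumbering inputs *)

(** When [F] is the fiber of [T] over a one-vertex tree, [strict] asks for an equality of types
    between the values at [F] and at [T], although the two trees may order their legs differently.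
    An operation of the endomorphism operad can therefore not fix a numbering of the inputs of its
    result: it takes a numbering of the legs as an argument, equivariantly, and its type only
    retains the tree and its root. A second obstacle is that arities and degrees are often equal
    without being convertible. Inputs are therefore untyped lists of packed elements, and results
    are families over all arities and degrees, where linear combinations make sense without
    transports. The actions of the symmetric groups come from the units and not from the generators.
    Hence the endomorphism operad is built on a collection that already has them, and the structures
    to be compared are pairs of actions and a composition. The free operad is a quotient of formal
    terms, so the independence of its elements is established by evaluating them in endomorphism
    operads. *)

Section Relabelling.

(* [l] and [l'] are two numberings of the same labels, with the root first. *)
Definition relabels (l l' : seq nat) : bool :=
  [&& uniq l, perm_eq l l' & head 0 l == head 0 l'].

Lemma relabels_refl l : uniq l -> relabels l l.
Proof. by move=> u; rewrite /relabels u perm_refl eqxx. Qed.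

Lemma relabels_sym l l' : relabels l l' -> relabels l' l.
Proof.
by case/and3P=> u p /eqP h; rewrite /relabels -(perm_uniq p) u perm_sym p h eqxx.
Qed.

Lemma relabels_map (f : nat -> nat) l l' :
  0 < size l -> {in l &, injective f} -> relabels l l' ->
  relabels (map f l) (map f l').
Proof.
move=> s0 inj /and3P[u p /eqP h]; apply/and3P; split.
- by rewrite map_inj_in_uniq.
- exact: perm_map.
- by have := perm_size p; case: l l' h s0 {inj u p} => [|a l] [|b l'] //= ->.
Qed.

Lemma relabels_size l l' : relabels l l' -> size l = size l'.
Proof. by case/and3P=> _ /perm_size. Qed.

(** Position 0 of a numbering holds the root, so the input [i] is found at position [i.+1], and a
    numbering of [c] inputs has length [c.+1]. *)
Definition is_relabelling c (l l' : seq nat) (s : 'S_c) : Prop :=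
  c.+1 = size l /\ forall i : 'I_c, nth 0 l' i.+1 = nth 0 l (s i).+1.

(** The default 1 is taken when no such permutation exists, in particular when the arity does not
    match the length of the numberings. Renumbering then leaves the element alone, and it can be
    performed in all arities at once. *)
Definition relperm c (l l' : seq nat) : 'S_c :=
  if pselect (exists s : 'S_c, is_relabelling l l' s) is left e
  then sval (cid e) else 1%g.

Lemma relpermP c l l' : relabels l l' -> c.+1 = size l ->
  is_relabelling l l' (relperm c l l').
Proof.
case/and3P=> u p /eqP h sz; rewrite /relperm; case: pselect => [e|[]].
  by case: cid.
have sz' := perm_size p.
case: l l' u p h sz sz' => [|a l] [|b l'] //= /andP[_ u] p ab [sz] [sz'].
rewrite -ab perm_cons in p.
have mem (i : 'I_c) : nth 0 l' i \in l.
  by rewrite (perm_mem p) mem_nth // -sz' -sz.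
have lt (i : 'I_c) : index (nth 0 l' i) l < c.
  by have := mem i; rewrite -index_mem -sz.
have inj : injective (fun i => Ordinal (lt i)).
  move=> i j [] e; apply: ord_inj; apply/eqP.
  rewrite -(nth_uniq 0 (s := l')) -?sz' -?sz // -?(perm_uniq p) //; apply/eqP.
  by rewrite -(nth_index 0 (mem i)) e nth_index.
exists (perm inj); split=> [|i]; first by rewrite /= -sz.
by rewrite permE /= nth_index.
Qed.

Lemma relperm_uniq c l l' (s : 'S_c) :
  uniq l -> is_relabelling l l' s -> relperm c l l' = s.
Proof.
move=> u [sz hs]; rewrite /relperm; case: pselect => [e|[]]; last by exists s.
case: cid => /= t [_ ht]; apply/permP => i; apply: ord_inj; apply/eqP.
by rewrite -eqSS -(nth_uniq 0 (s := l)) -?sz ?ltnS // -ht hs.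
Qed.

Lemma relperm1 c l l' : c.+1 <> size l -> relperm c l l' = 1%g.
Proof. by move=> h; rewrite /relperm; case: pselect => // -[s []]. Qed.

Lemma relperm_id c l : uniq l -> relperm c l l = 1%g.
Proof.
move=> u; have [e|h] := c.+1 =P size l; last exact: relperm1.
by apply: relperm_uniq => //; split=> // i; rewrite perm1.
Qed.

(** Since [(s * t) i = t (s i)], the renumbering performed last is the left factor, in accordance
    with the convention for right actions in [sactM]. *)
Lemma relperm_comp c l l' l'' : relabels l l' -> relabels l' l'' ->
  (relperm c l' l'' * relperm c l l')%g = relperm c l l''.
Proof.
move=> h h'; have sz := relabels_size h.
have [e|ne] := c.+1 =P size l; last first.
  by rewrite !relperm1 -?sz // mulg1.
have e' : c.+1 = size l' by rewrite -sz.
have [_ h1] := relpermP h e; have [_ h2] := relpermP h' e'.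
symmetry; apply: relperm_uniq; first by case/and3P: h.
by split=> // i; rewrite permM h2 h1.
Qed.

(** The permutation only depends on positions, so both numberings may be moved along an injective
    renaming of half-edges. This is how renumberings in different trees are compared. *)
Lemma relperm_map c (f : nat -> nat) l l' :
  relabels l l' -> {in l &, injective f} ->
  relperm c (map f l) (map f l') = relperm c l l'.
Proof.
move=> h inj; have sz := relabels_size h.
have [e|ne] := c.+1 =P size l; last by rewrite !relperm1 ?size_map.
have [_ h1] := relpermP h e.
apply: relperm_uniq; first by rewrite map_inj_in_uniq //; case/and3P: h.
split=> [|i]; rewrite ?size_map //.
by rewrite !(nth_map 0) -?sz -?e ?ltnS ?ltn_ord // h1.
Qed.

End Relabelling.

(** * Elements of all arities and degrees *)

Local Open Scope ring_scope.

(** Packed elements cannot be added when their types differ. In the product over all arities and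
    degrees, linear identities can be stated without transports along equalities of arities or
    degrees. *)
Definition tot (k : fieldType) (A : gcoll k) := forall c d, A c d.

Section Total.
Variables (k : fieldType) (A : gcoll k).

Lemma totP (x y : tot A) : (forall c d, x c d = y c d) -> x = y.
Proof. by move=> h; do 2!apply: functional_extensionality_dep => ?; exact: h. Qed.

Definition tot_zero : tot A := fun c d => 0.
Definition tot_add (x y : tot A) : tot A := fun c d => x c d + y c d.
Definition tot_opp (x : tot A) : tot A := fun c d => - x c d.
Definition tot_scale a (x : tot A) : tot A := fun c d => a *: x c d.

Fact tot_addA : associative tot_add.
Proof. by move=> x y z; apply: totP => c d; exact: addrA. Qed.
Fact tot_addC : commutative tot_add.
Proof. by move=> x y; apply: totP => c d; exact: addrC. Qed.
Fact tot_add0 : left_id tot_zero tot_add.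
Proof. by move=> x; apply: totP => c d; exact: add0r. Qed.
Fact tot_addN : left_inverse tot_zero tot_opp tot_add.
Proof. by move=> x; apply: totP => c d; exact: addNr. Qed.

HB.instance Definition _ := gen_eqMixin (tot A).
HB.instance Definition _ := gen_choiceMixin (tot A).
HB.instance Definition _ :=
  GRing.isZmodule.Build (tot A) tot_addA tot_addC tot_add0 tot_addN.

Fact tot_scaleA a b x : tot_scale a (tot_scale b x) = tot_scale (a * b) x.
Proof. by apply: totP => c d; exact: scalerA. Qed.
Fact tot_scale1 : left_id 1 tot_scale.
Proof. by move=> x; apply: totP => c d; exact: scale1r. Qed.
Fact tot_scaleDr : right_distributive tot_scale +%R.
Proof. by move=> a x y; apply: totP => c d; exact: scalerDr. Qed.
Fact tot_scaleDl x : {morph tot_scale^~ x : a b / a + b}.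
Proof. by move=> a b; apply: totP => c d; exact: scalerDl. Qed.

HB.instance Definition _ := @GRing.Zmodule_isLmodule.Build k (tot A)
  tot_scale tot_scaleA tot_scale1 tot_scaleDr tot_scaleDl.

Lemma tot_linE a (x y : tot A) c d : (a *: x + y) c d = a *: x c d + y c d.
Proof. by []. Qed.
Lemma tot_scaleE a (x : tot A) c d : (a *: x) c d = a *: x c d.
Proof. by []. Qed.
Definition ar (p : packed A) : nat := tag p.
Definition dg (p : packed A) : int := tag (tagged p).
Definition el (p : packed A) : A (ar p) (dg p) := tagged (tagged p).

Lemma pack_el p : pack (el p) = p.
Proof. by case: p => c [d x]. Qed.

Definition castA c c' d d' (ec : c = c') (ed : d = d') (x : A c d) : A c' d' :=
  match ec in _ = c0, ed in _ = d0 return A c0 d0 with erefl, erefl => x end.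

Definition tin (p : packed A) : tot A := fun c d =>
  match ar p =P c, dg p =P d with
  | ReflectT ec, ReflectT ed => castA ec ed (el p)
  | _, _ => 0
  end.

Definition pk (c : nat) (d : int) (x : tot A) : packed A := pack (x c d).

Lemma tin_pack c d (x : A c d) : tin (pack x) c d = x.
Proof.
rewrite /tin /=; case: eqP => // ec; case: eqP => // ed.
by rewrite (Prop_irrelevance ec erefl) (Prop_irrelevance ed erefl).
Qed.

Lemma tin_out p c d : ~ (ar p = c /\ dg p = d) -> tin p c d = 0.
Proof. by rewrite /tin; case: eqP => // ?; case: eqP => // ? []. Qed.

Lemma pk_tin p : pk (ar p) (dg p) (tin p) = p.
Proof. by case: p => c [d x]; rewrite /pk /ar /dg /= tin_pack. Qed.

Lemma tin_linear c d : linear (fun x : A c d => tin (pack x)).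
Proof.
move=> a x y; apply: totP => c' d'; rewrite tot_linE.
have [[e e']|h] := pselect (c = c' /\ d = d').
  by case: c' / e; case: d' / e'; rewrite !tin_pack.
by rewrite !tin_out // scaler0 addr0.
Qed.

(** Arity and degree are compared separately because [tin] forgets them when the element is zero. *)
Lemma packed_eq (p q : packed A) :
  ar p = ar q -> dg p = dg q -> tin p = tin q -> p = q.
Proof. by move=> e1 e2 e3; rewrite -(pk_tin p) e1 e2 e3 pk_tin. Qed.

Lemma tin_pk c d (x : tot A) :
  (forall c' d', ~ (c = c' /\ d = d') -> x c' d' = 0) -> tin (pk c d x) = x.
Proof.
move=> h; apply: totP => c' d'.
have [[e e']|n] := pselect (c = c' /\ d = d').
  by case: c' / e; case: d' / e'; rewrite /pk tin_pack.
by rewrite h // tin_out.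
Qed.

End Total.

Arguments pk {k A} c d x.

Lemma lin0 (k : fieldType) (V W : lmodType k) (h : V -> W) : linear h -> h 0 = 0.
Proof.
move=> hl; have := hl (-1) 0 0; rewrite scaleN1r oppr0 addr0 => e.
by rewrite {1}e scaleN1r addNr.
Qed.

Lemma linZ (k : fieldType) (V W : lmodType k) (h : V -> W) a x :
  linear h -> h (a *: x) = a *: h x.
Proof. by move=> hl; have := hl a x 0; rewrite !addr0 (lin0 hl) addr0. Qed.

Lemma linD (k : fieldType) (V W : lmodType k) (h : V -> W) x y :
  linear h -> h (x + y) = h x + h y.
Proof. by move=> hl; have := hl 1 x y; rewrite !scale1r. Qed.

(** * Renumbering by right actions of the symmetric groups *)

Record symm (k : fieldType) (A : gcoll k) := Symm {
  sact : forall n d, A n d -> 'S_n -> A n d;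
  sact_linear : forall n d (s : 'S_n), linear (fun x : A n d => sact x s);
  sact1 : forall n d (x : A n d), sact x 1%g = x;
  sactM : forall n d (x : A n d) (s t : 'S_n), sact (sact x s) t = sact x (t * s)%g
}.

Section Rel.
Variables (k : fieldType) (A : gcoll k) (s : symm A).
Implicit Types (x : tot A) (p : packed A).

(* The element numbered by [l], renumbered by [l']. *)
Definition rel l l' x : tot A := fun c d => sact s (x c d) (relperm c l l').

Definition prel l l' p : packed A := pack (sact s (el p) (relperm (ar p) l l')).

Lemma rel_linear l l' : linear (rel l l').
Proof. by move=> a x y; apply: totP => c d; exact: sact_linear. Qed.

Lemma rel_id l x : uniq l -> rel l l x = x.
Proof. by move=> u; apply: totP => c d; rewrite /rel relperm_id // sact1. Qed.

Lemma rel_trans l l' l'' x : relabels l l' -> relabels l' l'' ->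
  rel l' l'' (rel l l' x) = rel l l'' x.
Proof.
by move=> h h'; apply: totP => c d; rewrite /rel sactM relperm_comp.
Qed.

Lemma rel_map (f : nat -> nat) l l' x : relabels l l' -> {in l &, injective f} ->
  rel (map f l) (map f l') x = rel l l' x.
Proof. by move=> h fi; apply: totP => c d; rewrite /rel relperm_map. Qed.

Lemma rel0 l l' x c d : x c d = 0 -> rel l l' x c d = 0.
Proof. by move=> h; rewrite /rel h; apply: (lin0 (sact_linear s _)). Qed.

Lemma rel_tin l l' p : tin (prel l l' p) = rel l l' (tin p).
Proof.
apply: totP => c d; have [[e e']|h] := pselect (ar p = c /\ dg p = d).
  case: c / e; case: d / e'; rewrite /prel (tin_pack (sact _ _ _)) /rel.
  by congr sact; case: p => c [d x]; exact: (esym (tin_pack x)).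
by rewrite !(tin_out, rel0) // tin_out.
Qed.

Lemma prel_ar l l' p : ar (prel l l' p) = ar p. Proof. by []. Qed.
Lemma prel_dg l l' p : dg (prel l l' p) = dg p. Proof. by []. Qed.

Lemma prel_id l p : uniq l -> prel l l p = p.
Proof. by move=> u; apply: packed_eq => //; rewrite rel_tin rel_id. Qed.

Lemma prel_trans l l' l'' p : relabels l l' -> relabels l' l'' ->
  prel l' l'' (prel l l' p) = prel l l'' p.
Proof. by move=> h h'; apply: packed_eq => //; rewrite !rel_tin rel_trans. Qed.

Lemma prel_map (f : nat -> nat) l l' p : relabels l l' -> {in l &, injective f} ->
  prel (map f l) (map f l') p = prel l l' p.
Proof. by move=> h fi; apply: packed_eq => //; rewrite !rel_tin rel_map. Qed.

Lemma prel_pack l l' c d (x : A c d) :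
  prel l l' (pack x) = pack (sact s x (relperm c l l')).
Proof. by []. Qed.

Lemma prel_pk l l' c d x : prel l l' (pk c d x) = pk c d (rel l l' x).
Proof. by []. Qed.

End Rel.

(** * Valences of vertices and numberings of legs *)

Local Open Scope ring_scope.

(** The part of a tree on which the type of an operation may depend. Unlike [unlabel], it forgets
    the non-root legs of trees without edges as well, so it factors through [unlabel]
    ([core_unlabel]). *)
Definition core (t : otree) := OTree (nvert t) (src t) (flip t) [:: tree_root t].

Arguments core : simpl never.

Definition halves (t : otree) v := [seq h <- iota 0 (nhalf t) | vertex t h == v].

(** The predecessor discounts the half-edge towards the root. *)
Definition valence (t : otree) v := (size (halves t v)).-1.

Definition valences (t : otree) := [seq valence t v | v <- iota 0 (nvert t)].

Definition labels (t : otree) (l : seq nat) : bool :=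
  [&& perm_eq l [seq h <- iota 0 (nhalf t) | mate t h == h] &
      head 0%N l == tree_root t].

Lemma labels_uniq t l : labels t l -> uniq l.
Proof. by case/andP=> p _; rewrite (perm_uniq p) filter_uniq ?iota_uniq. Qed.

Lemma labels_relabels t l l' : labels t l -> labels t l' -> relabels l l'.
Proof.
move=> h h'; rewrite /relabels (labels_uniq h).
case/andP: h => p /eqP ->; case/andP: h' => p' /eqP ->; rewrite eqxx andbT /=.
by apply: perm_trans p _; rewrite perm_sym.
Qed.

Lemma relabels_labels t l l' : labels t l -> relabels l l' -> labels t l'.
Proof.
case/andP=> p /eqP h /and3P[_ p' /eqP h']; rewrite /labels -h' h eqxx andbT.
by apply: perm_trans p; rewrite perm_sym.
Qed.

Lemma labels_legs (T : rtr) : labels T (legs T).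
Proof. by rewrite /labels (graph_legs (rtr_graph (rtrP T))) eqxx. Qed.

Lemma labels_size (T : rtr) l : labels T l -> size l = size (legs T).
Proof. by move=> h; apply: relabels_size (labels_relabels h (labels_legs T)). Qed.

Lemma size_legs (T : rtr) : size (legs T) = (pi0 T).+1.
Proof. by rewrite /pi0 legs_cons. Qed.

Lemma core_unlabel (T T' : rtr) : unlabel T = unlabel T' -> core T = core T'.
Proof.
rewrite /unlabel => e; have : core (unlabel T) = core (unlabel T') by rewrite /unlabel e.
have cu (S : rtr) : core (unlabel S) = core S.
  by rewrite /unlabel; case: ifP => //= _; rewrite /core /tree_root (legs_cons S).
by rewrite !cu.
Qed.

(** * The endomorphism operad *)

Section Endomorphisms.
Variables (k : fieldType) (A : gcoll k) (s : symm A).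
Implicit Types (w : seq (packed A)) (t : otree).

Definition degs w : int := \sum_(p <- w) dg p.

Definition fits t w : bool := [seq ar p | p <- w] == valences t.

Definition supported t (d : int) l w c (e : int) : bool :=
  [&& labels t l, fits t w, c.+1 == size l & e == d + degs w].

(** The arguments are a numbering of the legs, which numbers the inputs of the result, and the list
    of inputs in the order of the vertices. *)
Definition multi := seq nat -> seq (packed A) -> tot A.

(** Requiring the value 0 off the support makes an operation determined by its values on admissible
    arguments ([endo_ext]), although the function itself is defined on all lists. *)
Record is_endo t d (m : multi) : Prop := IsEndo {
  endo_supp : forall l w c e, supported t d l w c e = false -> m l w c e = 0;
  endo_slot : forall l w1 w2 c e,
    linear (fun x : A c e => m l (w1 ++ pack x :: w2));
  endo_rel : forall l l' w, labels t l -> labels t l' ->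
    m l' w = rel s l l' (m l w)
}.

Definition endo t d := {m : multi | is_endo t d m}.

Definition ev t d (m : endo t d) : multi := sval m.

Lemma evP t d (m : endo t d) : is_endo t d (ev m).
Proof. exact: proj2_sig. Qed.

Lemma ev_inj t d (x y : endo t d) : ev x = ev y -> x = y.
Proof. by case: x y => x xP [y yP] e; apply: eq_exist. Qed.

Lemma endo_ext t d (x y : endo t d) :
  (forall l w, labels t l -> fits t w -> ev x l w = ev y l w) -> x = y.
Proof.
move=> h; apply: ev_inj; do 2!apply: funext => ?; apply: totP => c e.
set l := (X in ev _ X); set w := (X in ev _ _ X).
case hs: (supported t d l w c e); last by rewrite !(endo_supp (evP _)).
by case/and4P: hs => hl hw _ _; rewrite h.
Qed.

Lemma ev_wrong t d (m : endo t d) l w c e :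
  ~ (c.+1 = size l /\ e = d + degs w) -> ev m l w c e = 0.
Proof.
move=> h; apply: (endo_supp (evP m)); apply/negP => /and4P[_ _ /eqP h1 /eqP h2].
exact: h.
Qed.

Fact endo_comb t d a (x y : endo t d) :
  is_endo t d (fun l w => a *: ev x l w + ev y l w).
Proof.
split.
- move=> l w c e h; rewrite tot_linE !(endo_supp (evP _) h).
  by rewrite scaler0 addr0.
- move=> l w1 w2 c e b u v /=; rewrite !(endo_slot (evP _)).
  by rewrite !scalerDr !scalerA mulrC addrACA.
- move=> l l' w h h'; rewrite (rel_linear s l l').
  by rewrite -!(endo_rel (evP _)).
Qed.

Fact endo_zeroP t d : is_endo t d (fun l w => 0).
Proof.
split=> //.
- by move=> l w1 w2 c e b u v; rewrite scaler0 addr0.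
- by move=> l l' w _ _; rewrite (lin0 (rel_linear s l l')).
Qed.

Definition endo_lin t d a (x y : endo t d) : endo t d := exist _ _ (endo_comb a x y).
Definition endo_zero t d : endo t d := exist _ _ (endo_zeroP t d).
Definition endo_add t d (x y : endo t d) := endo_lin 1 x y.
Definition endo_scale t d a (x : endo t d) := endo_lin a x (endo_zero t d).

Lemma ev_lin0 t d a (x y : endo t d) l w :
  ev (endo_lin a x y) l w = a *: ev x l w + ev y l w.
Proof. by []. Qed.

Lemma ev_ext t d (x y : endo t d) : (forall l w, ev x l w = ev y l w) -> x = y.
Proof. by move=> h; apply: ev_inj; do 2!apply: funext => ?. Qed.

Fact endo_addA t d : associative (@endo_add t d).
Proof. by move=> x y z; apply: ev_ext => l w; rewrite !ev_lin0 !scale1r addrA. Qed.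
Fact endo_addC t d : commutative (@endo_add t d).
Proof. by move=> x y; apply: ev_ext => l w; rewrite !ev_lin0 !scale1r addrC. Qed.
Fact endo_add0 t d : left_id (endo_zero t d) (@endo_add t d).
Proof. by move=> x; apply: ev_ext => l w; rewrite ev_lin0 scaler0 add0r. Qed.
Fact endo_addN t d : left_inverse (endo_zero t d) (@endo_scale t d (-1)) (@endo_add t d).
Proof.
move=> x; apply: ev_ext => l w.
by rewrite !ev_lin0 scale1r -[ev (endo_zero t d) l w]/0 addr0 scaleN1r addNr.
Qed.

HB.instance Definition _ t d := gen_eqMixin (endo t d).
HB.instance Definition _ t d := gen_choiceMixin (endo t d).
HB.instance Definition _ t d := GRing.isZmodule.Build (endo t d)
  (@endo_addA t d) (@endo_addC t d) (@endo_add0 t d) (@endo_addN t d).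

Lemma evD t d (x y : endo t d) l w : ev (x + y) l w = ev x l w + ev y l w.
Proof. by rewrite [LHS]ev_lin0 scale1r. Qed.

Fact endo_scaleA t d a b (x : endo t d) :
  endo_scale a (endo_scale b x) = endo_scale (a * b) x.
Proof. by apply: ev_ext => l w; rewrite !ev_lin0 !addr0 scalerA. Qed.
Fact endo_scale1 t d : left_id 1 (@endo_scale t d).
Proof. by move=> x; apply: ev_ext => l w; rewrite !ev_lin0 !addr0 scale1r. Qed.
Fact endo_scaleDr t d : right_distributive (@endo_scale t d) +%R.
Proof.
move=> a x y; apply: ev_ext => l w.
change (a *: ev (endo_add x y) l w + 0 =
  1 *: (a *: ev x l w + 0) + (a *: ev y l w + 0)).
by rewrite ev_lin0 !addr0 !scale1r scalerDr.
Qed.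
Fact endo_scaleDl t d x : {morph (@endo_scale t d)^~ x : a b / a + b}.
Proof.
move=> a b; apply: ev_ext => l w.
change ((a + b) *: ev x l w + 0 =
  1 *: (a *: ev x l w + 0) + (b *: ev x l w + 0)).
by rewrite !addr0 scale1r scalerDl.
Qed.

HB.instance Definition _ t d := @GRing.Zmodule_isLmodule.Build k (endo t d)
  (@endo_scale t d) (@endo_scaleA t d) (@endo_scale1 t d) (@endo_scaleDr t d)
  (@endo_scaleDl t d).

Lemma ev0 t d l w : ev (0 : endo t d) l w = 0.
Proof. by []. Qed.

Lemma evZ t d a (x : endo t d) l w : ev (a *: x) l w = a *: ev x l w.
Proof. by rewrite [LHS]ev_lin0 addr0. Qed.

Definition endT (T : otree) : graded k := fun d => endo (core T) d.

(** The tree enters the type [endo t d] only through a proposition, so a transport leaves the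
    underlying function alone. *)
Lemma ev_cast t t' (e : t = t') (E : (fun d => endo t d : lmodType k) = (fun d => endo t' d : lmodType k))
    d (x : endo t d) : ev (@cast k _ _ E d x : endo t' d) = ev x.
Proof. by case: t' / e E => E; rewrite (Prop_irrelevance E erefl). Qed.

Definition guard t d (f : multi) : multi := fun l w c e =>
  if supported t d l w c e then f l w c e else 0.

(** What has to be checked about a formula on admissible arguments only, so that [guard], which cuts
    it off elsewhere, yields an operation. *)
Record is_raw t d (f : multi) : Prop := IsRaw {
  raw_wrong : forall l w c e, labels t l -> fits t w ->
    ~ (c.+1 = size l /\ e = d + degs w) -> f l w c e = 0;
  raw_slot : forall l w1 w2 c e, labels t l ->
    [seq ar p | p <- w1] ++ c :: [seq ar p | p <- w2] = valences t ->
    linear (fun x : A c e => f l (w1 ++ pack x :: w2));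
  raw_rel : forall l l' w, labels t l -> labels t l' -> fits t w ->
    f l' w = rel s l l' (f l w)
}.

Lemma guardE t d f l w : is_raw t d f -> labels t l -> fits t w ->
  guard t d f l w = f l w.
Proof.
move=> hf hl hw; apply: totP => c e; rewrite /guard.
case hs: (supported _ _ _ _ _ _) => //; rewrite (raw_wrong hf) // => -[h1 h2].
by move: hs; rewrite /supported hl hw h1 h2 !eqxx.
Qed.

Lemma guardP t d f : is_raw t d f -> is_endo t d (guard t d f).
Proof.
move=> hf; split.
- by move=> l w c e; rewrite /guard => ->.
- move=> l w1 w2 c e a x y; apply: totP => c' e'; rewrite tot_linE /guard.
  have hs (z : A c e) : supported t d l (w1 ++ pack z :: w2) c' e' =
      supported t d l (w1 ++ pack (0 : A c e) :: w2) c' e'.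
    by rewrite /supported /fits /degs !map_cat !big_cat /= !big_cons.
  rewrite !hs; case h: (supported _ _ _ _ _ _); last by rewrite scaler0 addr0.
  case/and4P: h => hl /eqP hw _ _; rewrite map_cat /= in hw.
  by rewrite (raw_slot hf hl hw).
- move=> l l' w hl hl'; have sz := relabels_size (labels_relabels hl hl').
  apply: totP => c e; rewrite /rel /guard.
  have -> : supported t d l' w c e = supported t d l w c e.
    by rewrite /supported hl hl' sz.
  case h: (supported _ _ _ _ _ _); last by rewrite (lin0 (sact_linear s _)).
  by case/and4P: h => _ hw _ _; rewrite (raw_rel hf hl hl' hw).
Qed.

Definition mk_endo t d f (hf : is_raw t d f) : endo t d := exist _ _ (guardP hf).

Lemma ev_mk t d f (hf : is_raw t d f) l w : labels t l -> fits t w ->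
  ev (mk_endo hf) l w = f l w.
Proof. exact: guardE. Qed.

Lemma slotZ t d (m : endo t d) l w1 w2 a c e (x : A c e) :
  ev m l (w1 ++ pack (a *: x) :: w2) = a *: ev m l (w1 ++ pack x :: w2).
Proof. exact: (linZ a x (@endo_slot _ _ _ (evP m) l w1 w2 c e)). Qed.

Lemma degs_cat w1 w2 : degs (w1 ++ w2) = degs w1 + degs w2.
Proof. by rewrite /degs big_cat. Qed.

Lemma degs_cons p w : degs (p :: w) = dg p + degs w.
Proof. by rewrite /degs big_cons. Qed.

End Endomorphisms.

Arguments ev : simpl never.

Local Open Scope ring_scope.

(** * Koszul signs of permutations *)

Section Signs.
Variable k : fieldType.

Lemma koszulD a b : koszul k (a + b) = koszul k a * koszul k b.
Proof.
rewrite /koszul -signr_odd -[X in X * _]signr_odd -[X in _ * X]signr_odd.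
have -> : odd (absz (a + b)) = odd (absz a) (+) odd (absz b) by lia.
exact: signr_addb.
Qed.

Lemma koszul_sq a : koszul k a * koszul k a = 1.
Proof. by rewrite -expr2 sqrr_sign. Qed.

Lemma koszul0 : koszul k 0 = 1. Proof. by []. Qed.

Lemma koszul_sum (I : Type) (r : seq I) (P : pred I) (F : I -> int) :
  koszul k (\sum_(i <- r | P i) F i) = \prod_(i <- r | P i) koszul k (F i).
Proof. exact: (big_morph _ koszulD koszul0). Qed.

(** The Koszul sign of passing from the order given by [f] to the order given by [g] on elements of
    degrees [d]: one factor for each inversion. *)
Definition sgk (f g : nat -> nat) (V : seq nat) (d : nat -> int) : k :=
  \prod_(x <- V) \prod_(y <- V | (f x < f y)%N && (g y < g x)%N) koszul k (d x * d y).

(** An unordered pair of distinct elements occurs twice on the left and once, in the order of [f],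
    on the right. Identities between signs are thereby reduced to a single pair. *)
Lemma pairs_split (V : seq nat) (f : nat -> nat) (F : nat -> nat -> k) :
  {in V &, injective f} -> (forall x, F x x = 1) ->
  \prod_(x <- V) \prod_(y <- V) F x y =
  \prod_(x <- V) \prod_(y <- V | (f x < f y)%N) (F x y * F y x).
Proof.
move=> fi F1.
under [RHS]eq_bigr do rewrite big_split /=.
rewrite [RHS]big_split /= [X in _ * X](exchange_big_dep predT) //= -big_split /=.
rewrite !big_seq; apply: eq_bigr => x xV.
rewrite (bigID (fun y => (f x < f y)%N)) /=; congr (_ * _).
rewrite (bigID (fun y => y == x)) /= [X in X * _]big1_seq ?mul1r; last first.
  by move=> y /andP[/andP[_ /eqP ->] _].
rewrite big_seq_cond [RHS]big_seq_cond; apply: eq_bigl => y.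
case yV: (y \in V) => //=; rewrite -leqNgt ltn_neqAle andbC; congr (_ && _).
by apply/negP/negP => h /eqP e; apply: h; apply/eqP; [exact: fi | rewrite e].
Qed.

(** Pair by pair: the order of a pair is inverted from [f] to [h] iff exactly one of the two
    passages inverts it, and two inversions cancel because a Koszul sign squares to 1. *)
Lemma sgk_cocycle (f g h : nat -> nat) (V : seq nat) d :
  {in V &, injective f} -> {in V &, injective g} -> {in V &, injective h} ->
  sgk f g V d * sgk g h V d = sgk f h V d.
Proof.
move=> fi gi hi.
have E (a b : nat -> nat) : sgk a b V d = \prod_(x <- V) \prod_(y <- V)
    (if (a x < a y)%N && (b y < b x)%N then koszul k (d x * d y) else 1).
  by apply: eq_bigr => x _; rewrite big_mkcond.
rewrite !E -big_split /=; under [LHS]eq_bigr do rewrite -big_split /=.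
rewrite !(pairs_split fi) => [|x|x]; try by rewrite !ltnn /= ?mul1r.
rewrite !big_seq; apply: eq_bigr => x xV.
rewrite big_seq_cond [RHS]big_seq_cond; apply: eq_bigr => y /andP[yV fxy].
rewrite fxy (ltnNge (f y)) (ltnW fxy) /= (mulrC (d y)).
have ne : x != y by apply: contraTneq fxy => ->; rewrite ltnn.
have gne : g x != g y by apply: contra ne => /eqP e; apply/eqP; exact: gi.
have hne : h x != h y by apply: contra ne => /eqP e; apply/eqP; exact: hi.
have [g1|g1|/eqP] := ltngtP (g x) (g y); last by rewrite (negPf gne).
  have [h1|h1|/eqP] := ltngtP (h x) (h y); last by rewrite (negPf hne).
    by rewrite !mul1r.
  by rewrite ?mul1r ?mulr1.
have [h1|h1|/eqP] := ltngtP (h x) (h y); last by rewrite (negPf hne).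
  by rewrite ?mul1r ?mulr1 koszul_sq.
by rewrite ?mul1r ?mulr1.
Qed.

Lemma sgk_id f V d : sgk f f V d = 1.
Proof.
rewrite /sgk; apply: big1_seq => x _; apply: big1 => y.
by rewrite ltnNge => /andP[/negP h1 h2]; case: h1; exact: ltnW.
Qed.

Lemma sgk_perm f g V V' d : perm_eq V V' -> sgk f g V d = sgk f g V' d.
Proof.
move=> p; rewrite /sgk (perm_big _ p); apply: eq_bigr => x _; exact: perm_big.
Qed.

Lemma sgk_map f g (r : nat -> nat) V d :
  sgk f g (map r V) d = sgk (f \o r) (g \o r) V (d \o r).
Proof. by rewrite /sgk big_map; apply: eq_bigr => x _; rewrite big_map. Qed.

Lemma eq_in_sgk f f' g g' V d d' :
  {in V, f =1 f'} -> {in V, g =1 g'} -> {in V, d =1 d'} ->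
  sgk f g V d = sgk f' g' V d'.
Proof.
move=> hf hg hd; rewrite /sgk !big_seq; apply: eq_bigr => x xV.
rewrite big_seq_cond [RHS]big_seq_cond; apply: eq_big => [y|y /andP[yV _]].
  by case yV: (y \in V) => //=; rewrite !hf ?hg.
by rewrite !hd.
Qed.

End Signs.

(** * Half-edges and vertices under morphisms and isomorphisms *)

Section Homs.
Implicit Types T S P : rtr.

(** With [p = psi f] this transports a numbering of the legs of the source of [f] to its target;
    legs correspond bijectively, so nothing is lost. *)
Definition reind (p l : seq nat) := [seq index h p | h <- l].

Lemma reindK p l : {subset l <= p} -> [seq nth 0%N p h | h <- reind p l] = l.
Proof.
by move=> h; rewrite -map_comp; apply: map_id_in => x /h xp /=; rewrite nth_index.
Qed.

Lemma reind_map p l : uniq p -> {in l, forall h, (h < size p)%N} ->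
  reind p [seq nth 0%N p h | h <- l] = l.
Proof.
move=> u h; rewrite /reind -map_comp; apply: map_id_in => x /h xp /=.
by rewrite index_uniq.
Qed.

Section Hom.
Variables (T S : rtr) (f : hom T S).
Let fP := morP f.

Lemma hom_psi_size : size (psi f) = nhalf S. Proof. exact: mor_psi_size fP. Qed.
Lemma hom_phi_size : size (phi f) = nvert T. Proof. exact: mor_phi_size fP. Qed.

Lemma onhalf_inj h h' : (h < nhalf S)%N -> (h' < nhalf S)%N ->
  onhalf f h = onhalf f h' -> h = h'.
Proof.
move=> hh hh' /eqP; rewrite nth_uniq ?hom_psi_size ?(mor_psi_uniq fP) //.
by move/eqP.
Qed.

Lemma labels_lt l : labels S l -> {in l, forall h, (h < nhalf S)%N}.
Proof.
by case/andP=> p _ h; rewrite (perm_mem p) mem_filter mem_iota => /andP[_ /andP[]].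
Qed.

Lemma labels_sub l : labels T l -> {subset l <= psi f}.
Proof.
move=> hl h hin; have: h \in legs T.
  by case/and3P: (labels_relabels hl (labels_legs T)) => _ p _; rewrite -(perm_mem p).
rewrite -(mor_legs fP) => /mapP[l' l'in ->]; rewrite /onhalf mem_nth // hom_psi_size.
exact: legs_lt.
Qed.

Lemma reind_legs : reind (psi f) (legs T) = legs S.
Proof.
rewrite -(mor_legs fP) reind_map ?(mor_psi_uniq fP) // => h /legs_lt.
by rewrite hom_psi_size.
Qed.

Lemma labels_reind l : labels T l -> labels S (reind (psi f) l).
Proof.
move=> hl; have hr := labels_relabels (labels_legs T) hl.
apply: (relabels_labels (labels_legs S)); rewrite -reind_legs.
apply: relabels_map => //; first by rewrite size_legs.
move=> h h' /(labels_sub (labels_legs T)) i1 /(labels_sub (labels_legs T)) i2 e.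
by rewrite -(nth_index 0%N i1) e nth_index.
Qed.

Lemma labels_onhalf l : labels T l ->
  l = [seq onhalf f h | h <- reind (psi f) l].
Proof. by move=> hl; rewrite -[LHS](reindK (labels_sub hl)). Qed.

End Hom.

Lemma reind_comp T S P (f : hom T S) (g : hom S P) (h : premor) l :
  h = comp_mor g f -> labels T l ->
  reind (psi h) l = reind (psi g) (reind (psi f) l).
Proof.
move=> -> hl; have hl1 := labels_reind f hl; have hl2 := labels_reind g hl1.
have lt2 : {in reind (psi g) (reind (psi f) l), forall h, (h < nhalf P)%N}.
  exact: labels_lt hl2.
rewrite -[RHS](reind_map (p := psi (comp_mor g f))).
- congr reind; rewrite {1}(labels_onhalf f hl) {1}(labels_onhalf g hl1) -map_comp.
  apply/eq_in_map => x /lt2 hx /=.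
  by rewrite /onhalf /= (nth_map 0%N) // hom_psi_size.
- rewrite /= map_inj_in_uniq ?(mor_psi_uniq (morP g)) // => x y hx hy.
  by apply: onhalf_inj; apply: (allP (mor_psi_lt (morP g))).
- by move=> x /lt2; rewrite size_map hom_psi_size.
Qed.

Section IsoFacts.
Variables (T S : rtr) (w : iso T S).

Lemma iso_bwdK v : (v < nvert T)%N -> onvert (bwd w) (onvert w v) = v.
Proof.
move=> hv; have := f_equal (fun f => nth 0%N (phi f) v) (iso_bf w).
by rewrite /= (nth_map 0%N) ?hom_phi_size // nth_iota.
Qed.

Lemma iso_fwdK v : (v < nvert S)%N -> onvert w (onvert (bwd w) v) = v.
Proof.
move=> hv; have := f_equal (fun f => nth 0%N (phi f) v) (iso_fb w).
by rewrite /= (nth_map 0%N) ?hom_phi_size // nth_iota.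
Qed.

Lemma iso_onhalfK h : (h < nhalf T)%N -> onhalf w (onhalf (bwd w) h) = h.
Proof.
move=> hh; have := f_equal (fun f => nth 0%N (psi f) h) (iso_bf w).
by rewrite /= (nth_map 0%N) ?hom_psi_size // nth_iota.
Qed.

Lemma iso_bwd_onhalfK h : (h < nhalf S)%N -> onhalf (bwd w) (onhalf w h) = h.
Proof.
move=> hh; have := f_equal (fun f => nth 0%N (psi f) h) (iso_fb w).
by rewrite /= (nth_map 0%N) ?hom_psi_size // nth_iota.
Qed.

Lemma onvert_inj v v' : (v < nvert T)%N -> (v' < nvert T)%N ->
  onvert w v = onvert w v' -> v = v'.
Proof. by move=> hv hv' e; rewrite -(iso_bwdK hv) e iso_bwdK. Qed.

Lemma iso_nhalf : nhalf T = nhalf S.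
Proof. by apply/eqP; rewrite eqn_leq (nhalf_hom w) (nhalf_hom (bwd w)). Qed.

Lemma iso_phi_perm : perm_eq (phi w) (iota 0 (nvert S)).
Proof.
have u : uniq (phi w).
  apply/(uniqP 0%N) => i j; rewrite !inE hom_phi_size; exact: onvert_inj.
apply: uniq_perm; rewrite ?iota_uniq // => v; rewrite mem_iota add0n /=.
apply/idP/idP; last exact: (mor_phi_surj (morP w)).
exact: (allP (mor_phi_lt (morP w))).
Qed.

Lemma iso_nvert : nvert T = nvert S.
Proof. by have := perm_size iso_phi_perm; rewrite size_iota hom_phi_size. Qed.

Lemma iso_vertex h : (h < nhalf S)%N ->
  vertex T (onhalf w h) = onvert (bwd w) (vertex S h).
Proof.
move=> hh; rewrite -(mor_vertex (morP w) hh) iso_bwdK //.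
by apply: vertex_lt; exact: onhalf_lt.
Qed.

Lemma iso_mate h : (h < nhalf S)%N -> mate T (onhalf w h) = onhalf w (mate S h).
Proof. by move=> hh; rewrite (mor_mate (morP w)). Qed.

Lemma iso_adjacent u v : (u < nvert S)%N -> (v < nvert S)%N ->
  adjacent S u v -> adjacent T (onvert (bwd w) u) (onvert (bwd w) v).
Proof.
move=> hu hv /hasP[h]; rewrite mem_iota add0n => /andP[_ hh] /andP[/eqP <- /eqP <-].
apply/hasP; exists (onhalf w h); first by rewrite mem_iota add0n onhalf_lt.
by rewrite iso_mate // !iso_vertex ?mate_lt // !eqxx.
Qed.

Lemma iso_root : onhalf w (tree_root S) = tree_root T.
Proof.
have := f_equal (head 0%N) (mor_legs (morP w)).
by rewrite /tree_root [in RHS]legs_cons (legs_cons S) /=.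
Qed.

End IsoFacts.

Lemma mem_halves T v h : (h \in halves T v) = (h < nhalf T)%N && (vertex T h == v).
Proof. by rewrite mem_filter mem_iota add0n andbC. Qed.

Lemma halves_uniq t v : uniq (halves t v).
Proof. by rewrite filter_uniq ?iota_uniq. Qed.

Lemma adjacent_lt T u v : adjacent T u v -> (v < nvert T)%N.
Proof.
case/hasP=> h; rewrite mem_iota add0n => /andP[_ hh] /andP[_ /eqP <-].
by rewrite vertex_lt ?mate_lt.
Qed.

(** On a path without repetition from [v] to the root vertex, the first step leaves through a
    half-edge at [v] and the rest avoids [v]. An empty path means that the root itself is at [v]. *)
Lemma exists_rootward T v : (v < nvert T)%N ->
  exists h, [/\ (h < nhalf T)%N, vertex T h = v & rootward T h].
Proof.
move=> hv; have hr := legs_lt (root_leg T).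
have [_ /(_ v (vertex T (tree_root T)) hv (vertex_lt hr)) [p pp lp]] :=
  rtr_connected (rtrP T).
case/shortenP: pp lp => -[_ _ _ /= lp|u q].
  by exists (tree_root T); split=> //; left.
move=> /= /andP[uv pq] /andP[]; rewrite inE negb_or => /andP[vu vq] uq _ lq.
case/hasP: uv => h; rewrite mem_iota add0n => /andP[_ hh] /andP[/eqP e1 /eqP e2].
exists h; split=> //; right; split.
  by move=> e; move: vu; rewrite -e1 -e2 e eqxx.
exists q; rewrite e2 // e1.
elim: q u pq vq {uq lq e2 vu} => [|x q IH] u //= /andP[-> pq].
by rewrite inE negb_or eq_sym => /andP[-> vq]; exact: IH.
Qed.

Lemma iso_rootward T S (w : iso T S) h : (h < nhalf S)%N ->
  rootward S h -> rootward T (onhalf w h).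
Proof.
move=> hh [->|[hm [p pp lp]]]; first by left; exact: iso_root.
have hr := legs_lt (root_leg S).
right; rewrite iso_mate //; split.
  by move/onhalf_inj => e; apply: hm; apply: e => //; exact: mate_lt.
exists [seq onvert (bwd w) v | v <- p]; last first.
  rewrite iso_vertex ?mate_lt // last_map lp -(iso_root w) iso_vertex //.
rewrite !iso_vertex ?mate_lt //.
elim: p (vertex S (mate S h)) (vertex_lt (mate_lt hh)) pp {lp} => [|y p IH] x hx //=.
case/andP=> /andP[a1 a2] pp; have hy := adjacent_lt a1.
rewrite iso_adjacent // IH // andbT /=; apply: contra a2 => /eqP e; apply/eqP.
by rewrite -(iso_fwdK w hy) e iso_fwdK // vertex_lt.
Qed.

Lemma head_sorted (l : seq nat) x : sorted leq l -> x \in l ->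
  {in l, forall y, (x <= y)%N} -> head 0%N l = x.
Proof.
case: l => // a l /= so xin h; apply/eqP; rewrite eqn_leq h ?mem_head // andbT.
move: xin; rewrite inE => /orP[/eqP -> //|xl].
by have /allP := order_path_min leq_trans so; apply.
Qed.

Lemma halves_sorted t v : sorted leq (halves t v).
Proof. exact: (sorted_filter leq_trans _ (iota_sorted 0 _)). Qed.

Lemma head_halves T h : (h < nhalf T)%N -> rootward T h ->
  head 0%N (halves T (vertex T h)) = h.
Proof.
move=> hh hr; apply: head_sorted; first exact: halves_sorted.
  by rewrite mem_halves hh eqxx.
move=> h'; rewrite mem_halves => /andP[hh' /eqP e].
exact: (rtr_root (rtrP T)).
Qed.

Lemma head_halvesP T v : (v < nvert T)%N ->
  [/\ head 0%N (halves T v) \in halves T v,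
      (head 0%N (halves T v) < nhalf T)%N,
      vertex T (head 0%N (halves T v)) = v & rootward T (head 0%N (halves T v))].
Proof.
move=> hv; have [h [hh e hr]] := exists_rootward hv.
by rewrite -e head_halves // mem_halves hh e eqxx.
Qed.

Lemma halves_cons T v : (v < nvert T)%N ->
  halves T v = head 0%N (halves T v) :: behead (halves T v).
Proof. by case/head_halvesP; case: (halves T v). Qed.

Lemma size_halves T v : (v < nvert T)%N -> size (halves T v) = (valence T v).+1.
Proof. by move=> hv; rewrite /valence (halves_cons hv). Qed.

(** Isomorphisms preserve rootward half-edges and these come first in the local orders. Hence the
    two local orders at corresponding vertices are numberings of the same half-edges with the same
    root. *)
Lemma iso_halves T S (w : iso T S) v : (v < nvert T)%N ->
  relabels (halves T v) [seq onhalf w h | h <- halves S (onvert w v)].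
Proof.
move=> hv; have hv' := onvert_lt w hv; apply/and3P; split.
- exact: halves_uniq.
- apply: uniq_perm; first exact: halves_uniq.
    rewrite map_inj_in_uniq ?halves_uniq // => x y; rewrite !mem_halves.
    by move=> /andP[hx _] /andP[hy _]; exact: onhalf_inj.
  move=> h; rewrite mem_halves; apply/idP/mapP => [/andP[hh /eqP e]|[h']].
    exists (onhalf (bwd w) h); last by rewrite iso_onhalfK.
    rewrite mem_halves onhalf_lt //=.
    by rewrite -(mor_vertex (morP w)) ?onhalf_lt // iso_onhalfK // e.
  rewrite mem_halves => /andP[hh /eqP e] ->.
  by rewrite onhalf_lt // iso_vertex // e iso_bwdK /=.
- have [hin hlt hver hroot] := head_halvesP hv'.
  have := head_halves (onhalf_lt w hlt) (iso_rootward w hlt hroot).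
  rewrite iso_vertex // hver iso_bwdK // => ->.
  by rewrite (halves_cons hv') /= eqxx.
Qed.

Lemma iso_valence T S (w : iso T S) v : (v < nvert T)%N ->
  valence S (onvert w v) = valence T v.
Proof.
by move=> hv; rewrite /valence -(size_map (onhalf w)) -(relabels_size (iso_halves w hv)).
Qed.

End Homs.

Local Open Scope nat_scope.

(** * The shape of elementary morphisms *)

Section Elementary.
Variables (T S F : rtr) (f : hom T S) (i : nat).
Hypothesis ef : elementary f i F.

Lemma count_phi j : count_mem j (phi f) = size (fiber_verts T f j).
Proof.
rewrite /fiber_verts size_filter -[phi f](mkseq_nth 0) /mkseq count_map.
by rewrite hom_phi_size; apply: eq_count => v; rewrite /= -/(onvert f v).
Qed.

Lemma nvert_fiber : nvert F = size (fiber_verts T f i).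
Proof. by rewrite (elt_fiber ef). Qed.

(** A sorted list is determined by its multiplicities. The multiplicity of a vertex is the size of
    its fiber, which is 1 except over [i]. *)
Lemma elt_phi :
  phi f = iota 0 i ++ nseq (nvert F) i ++ iota i.+1 (nvert S - i.+1).
Proof.
have hi := elt_lt ef.
apply: (sorted_eq leq_trans anti_leq); first exact: elt_order ef.
  rewrite (sorted_pairwise leq_trans) !pairwise_cat -!(sorted_pairwise leq_trans).
  rewrite !iota_sorted !(andbT, andTb); apply/and3P; split.
  - have k1 (a b : nat) : 0 <= a < 0 + i -> i <= b -> a <= b by lia.
    apply/allrelP => x y; rewrite mem_iota mem_cat mem_nseq mem_iota => h.
    by case/orP=> [/andP[_ /eqP ->]|/andP[/ltnW h' _]]; exact: k1 h _.
  - apply/allrelP => x y; rewrite mem_nseq mem_iota => /andP[_ /eqP ->].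
    by case/andP=> /ltnW.
  - apply/(sortedP 0) => j; rewrite size_nseq => h.
    by rewrite !nth_nseq h (ltnW h).
apply/allP => x; rewrite mem_cat => /orP hx; apply/eqP.
have lx : x < nvert S.
  case: hx => [/(allP (mor_phi_lt (morP f))) //|].
  rewrite !mem_cat mem_nseq !mem_iota => /or3P[|/andP[_ /eqP ->] //|]; lia.
rewrite count_phi !count_cat count_nseq !count_uniq_mem ?iota_uniq // !mem_iota.
have [->|/eqP ne] := eqVneq x i.
  by rewrite -nvert_fiber /= eqxx mul1n add0n !ltnn addn0.
have [/= -> _] := elt_trivial ef lx ne.
by rewrite /= (negPf (introN eqP (nesym ne))) mul0n; lia.
Qed.

Lemma elt_nvert : nvert T = nvert S + nvert F - 1.
Proof.
have hi := elt_lt ef; have := f_equal size elt_phi.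
by rewrite hom_phi_size !size_cat size_nseq !size_iota; lia.
Qed.

Lemma elt_nvertF : 0 < nvert F.
Proof. exact: graph_nvert (rtr_graph (rtrP F)). Qed.

Lemma elt_onvert v : v < nvert T ->
  onvert f v = if v < i then v else if v < i + nvert F then i else (v - nvert F).+1.
Proof.
move=> hv; have hi := elt_lt ef; have nF := elt_nvertF; have nT := elt_nvert.
rewrite /onvert elt_phi nth_cat size_iota; case: ltnP => h1; first by rewrite nth_iota.
rewrite nth_cat size_nseq; case: ltnP => h2.
  by rewrite nth_nseq h2; case: ltnP => // h3; move: h2 h3; clear; lia.
rewrite nth_iota; last lia.
by case: ltnP => // h3; lia.
Qed.

Lemma elt_fiber_verts : fiber_verts T f i = iota i (nvert F).
Proof.
have hi := elt_lt ef; have nF := elt_nvertF; have nT := elt_nvert.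
apply: (@irr_sorted_eq _ ltn ltn_trans ltnn).
- exact: (sorted_filter ltn_trans _ (iota_ltn_sorted 0 _)).
- exact: iota_ltn_sorted.
suff key (v : nat) : (onvert f v == i) && (v < nvert T) = (i <= v < i + nvert F).
  by move=> v; rewrite mem_filter !mem_iota add0n; exact: key.
case hv: (v < nvert T); last by rewrite andbF; move/negbT: hv; lia.
rewrite elt_onvert // andbT; case: (ltnP v i) => h1; first lia.
by case: (ltnP v (i + nvert F)) => h2; lia.
Qed.

Lemma mem_fiber_halves j h :
  (h \in fiber_halves T f j) = (h < nhalf T) && (onvert f (vertex T h) == j).
Proof. by rewrite mem_filter mem_iota add0n andbC. Qed.

Lemma fiber_halves_uniq j : uniq (fiber_halves T f j).
Proof. by rewrite filter_uniq ?iota_uniq. Qed.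

(* The vertex of T over a vertex of S other than [i]. *)
Definition over j := if j < i then j else j + nvert F - 1.

Lemma onvert_over j : j < nvert S -> j <> i -> onvert f (over j) = j.
Proof.
move=> hj ne; have hi := elt_lt ef; have nF := elt_nvertF; have nT := elt_nvert.
have lo : (if j < i then j else j + nvert F - 1) < nvert T by case: (ltnP j i) => h; lia.
rewrite elt_onvert // /over; case: (ltnP j i) => h; first by rewrite h.
case: (ltnP (j + nvert F - 1) i) => h2; first lia.
by case: (ltnP (j + nvert F - 1) (i + nvert F)) => h3; lia.
Qed.

Lemma over_lt j : j < nvert S -> over j < nvert T.
Proof.
have hi := elt_lt ef; have nF := elt_nvertF; have nT := elt_nvert.
by rewrite /over; case: (ltnP j i) => h; lia.
Qed.

Lemma over_uniq j v : j <> i -> v < nvert T -> onvert f v = j -> v = over j.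
Proof.
move=> ne hv; have hi := elt_lt ef; have nF := elt_nvertF; have nT := elt_nvert.
rewrite elt_onvert // /over; case: (ltnP v i) => h1.
  by move=> <-; rewrite h1.
case: (ltnP v (i + nvert F)) => h2; first by move=> e; case: ne.
by move=> e; case: (ltnP j i) => h3; lia.
Qed.

Lemma over_halves j : j < nvert S -> j <> i ->
  fiber_halves T f j = halves T (over j).
Proof.
move=> hj ne; apply/eq_in_filter => h; rewrite mem_iota add0n => /andP[_ hh].
apply/eqP/eqP => [|->]; last exact: onvert_over.
by apply: over_uniq => //; exact: vertex_lt.
Qed.

(** The legs of the fiber over [j] come in the order of [S] and its half-edges in the order of [T];
    triviality says that the two orders agree. This is why a composition does not renumber the
    inputs outside the contracted block. *)
Lemma over_onhalf j : j < nvert S -> j <> i ->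
  [seq onhalf f h | h <- halves S j] = halves T (over j).
Proof.
move=> hj ne; have [_ e] := elt_trivial ef hj ne.
rewrite -over_halves //; rewrite /= /nhalf /= size_map in e.
set H := fiber_halves T f j in e *.
rewrite -[RHS](mkseq_nth 0) /mkseq -e -!map_comp; apply/eq_in_map => h.
rewrite mem_filter mem_iota add0n => /andP[/eqP hv /andP[_ hh]] /=.
rewrite nth_index // /H mem_fiber_halves onhalf_lt //=.
by rewrite (mor_vertex (morP f)) // hv.
Qed.

Lemma over_valence j : j < nvert S -> j <> i -> valence S j = valence T (over j).
Proof. by move=> hj ne; rewrite /valence -over_onhalf // size_map. Qed.

Lemma legs_fiber :
  legs F = [seq index (onhalf f h) (fiber_halves T f i) | h <- halves S i].
Proof. by rewrite (elt_fiber ef). Qed.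

Lemma pi0_fiber : pi0 F = valence S i.
Proof. by rewrite /pi0 legs_fiber size_map. Qed.

Lemma nhalf_fiber : nhalf F = size (fiber_halves T f i).
Proof. by rewrite (elt_fiber ef) /nhalf /= size_map. Qed.

Lemma vertex_fiber h : h < nhalf F ->
  i + vertex F h = vertex T (nth 0 (fiber_halves T f i) h).
Proof.
rewrite nhalf_fiber => hh; rewrite (elt_fiber ef) /vertex /= (nth_map 0) //.
rewrite elt_fiber_verts -/(vertex T _).
have := mem_nth 0 hh; rewrite mem_fiber_halves => /andP[h1 /eqP h2].
have: vertex T (nth 0 (fiber_halves T f i) h) \in fiber_verts T f i.
  by rewrite mem_filter mem_iota h2 eqxx vertex_lt.
rewrite elt_fiber_verts mem_iota => /andP[h3 h4].
set v := vertex T _ in h3 h4 *.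
have -> : v = nth 0 (iota i (nvert F)) (v - i) by rewrite nth_iota; lia.
by rewrite index_uniq ?size_iota ?iota_uniq //; [rewrite nth_iota; lia | lia].
Qed.

Lemma fiber_halvesE l : l < nvert F ->
  [seq nth 0 (fiber_halves T f i) h | h <- halves F l] = halves T (i + l).
Proof.
move=> hl; set H := fiber_halves T f i.
have -> : halves T (i + l) = [seq h <- H | vertex T h == i + l].
  rewrite -filter_predI; apply/eq_in_filter => h.
  rewrite mem_iota add0n => /andP[_ hh] /=.
  case: eqP => //= e; symmetry.
  have: vertex T h \in fiber_verts T f i by rewrite elt_fiber_verts e mem_iota; lia.
  by rewrite mem_filter => /andP[].
rewrite -{2}(mkseq_nth 0 H) /mkseq filter_map -nhalf_fiber; congr map.
apply/eq_in_filter => h; rewrite mem_iota add0n => /andP[_ hh] /=.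
by rewrite -vertex_fiber // eqn_add2l.
Qed.

Lemma valence_fiber l : l < nvert F -> valence F l = valence T (i + l).
Proof. by move=> hl; rewrite /valence -fiber_halvesE // size_map. Qed.

Lemma elt_valences :
  valences T = take i (valences S) ++ valences F ++ drop i.+1 (valences S).
Proof.
have hi := elt_lt ef; have nF := elt_nvertF; have nT := elt_nvert.
apply: (@eq_from_nth _ 0).
  by rewrite !size_cat size_drop size_take !size_map !size_iota hi; lia.
move=> v; rewrite size_map size_iota => hv.
rewrite (nth_map 0) ?size_iota // nth_iota // add0n.
rewrite !nth_cat size_take !size_map !size_iota hi; case: ltnP => h1.
  rewrite nth_take // (nth_map 0) ?size_iota ?nth_iota; try lia.
  by rewrite add0n over_valence /over ?h1; try lia.
case: ltnP => h2.
  rewrite (nth_map 0) ?size_iota ?nth_iota; try lia.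
  by rewrite valence_fiber; try lia; congr valence; lia.
rewrite nth_drop (nth_map 0) ?size_iota ?nth_iota; try lia.
rewrite over_valence /over; try lia.
by congr valence; case: ifP => h3; [lia | lia].
Qed.

End Elementary.

Local Open Scope ring_scope.

Section Fits.
Variables (k : fieldType) (A : gcoll k).
Implicit Types w : seq (packed A).

Lemma fits_size t w : fits t w -> size w = nvert t.
Proof. by move/eqP/(f_equal size); rewrite !size_map size_iota. Qed.

Lemma fits_nth t w v : fits t w -> (v < nvert t)%N -> 
  forall p0, ar (nth p0 w v) = valence t v.
Proof.
move=> fw hv p0; have sz := fits_size fw.
have := f_equal (fun l => nth 0%N l v) (eqP fw).
by rewrite !(nth_map 0%N) ?size_iota // (nth_map p0) ?sz // nth_iota.
Qed.

(** The inputs of the contracted vertices are contiguous because [phi f] is sorted. The element [p]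
    stands for the output of the fiber, which replaces them. *)
Lemma fits_split T S F (f : hom T S) i (ef : elementary f i F) w :
  fits T w -> exists w1 w2 w3, [/\ w = w1 ++ w2 ++ w3, size w1 = i, fits F w2 &
    forall p, ar p = pi0 F -> fits S (w1 ++ p :: w3)].
Proof.
move=> /eqP fw; have hi := elt_lt ef; have sw : size w = nvert T.
  by apply: fits_size; apply/eqP.
have nF := graph_nvert (rtr_graph (rtrP F)); have nT := elt_nvert ef.
have sv U : size (valences U) = nvert U by rewrite size_map size_iota.
exists (take i w), (take (nvert F) (drop i w)), (drop (nvert F) (drop i w)).
have e : w = take i w ++ take (nvert F) (drop i w) ++ drop (nvert F) (drop i w).
  by rewrite !cat_take_drop.
have s1 : size (take i w) = i by rewrite size_take sw; case: ltnP; lia.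
have s2 : size (take (nvert F) (drop i w)) = nvert F.
  by rewrite size_take size_drop sw; case: ltnP; lia.
split=> //.
  apply/eqP; move: fw; rewrite (elt_valences ef) {1}e !map_cat => /eqP.
  rewrite eqseq_cat ?size_map ?size_take ?sv ?sw ?hi; last by case: ltnP; lia.
  by rewrite eqseq_cat ?size_map ?s2 ?sv ?size_iota // => /and3P[_ /eqP].
move=> p hp; apply/eqP; move: fw; rewrite (elt_valences ef) {1}e !map_cat => /eqP.
rewrite eqseq_cat ?size_map ?size_take ?sv ?sw ?hi; last by case: ltnP; lia.
rewrite eqseq_cat ?size_map ?s2 ?sv ?size_iota // => /and3P[/eqP e1 _ /eqP e2].
rewrite -[RHS](cat_take_drop i) (drop_nth 0%N) ?sv //= e1 e2; congr (_ ++ _ :: _).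
by rewrite hp (pi0_fiber ef) (nth_map 0%N) ?size_iota // nth_iota.
Qed.

End Fits.

Local Open Scope ring_scope.

(** * Pull-backs, compositions and units of operations *)

Section Operations.
Variables (k : fieldType) (A : gcoll k) (s : symm A).
Implicit Types (a w : seq (packed A)) (T S : rtr).

Definition p0 : packed A := pack (0 : A 0%N 0).

Definition deg_at w v := dg (nth p0 w v).

Lemma degs_iota w : degs w = \sum_(v <- iota 0 (size w)) deg_at w v.
Proof.
rewrite /degs -[in LHS](mkseq_nth p0 w) /mkseq big_map.
by apply: eq_bigr.
Qed.

Lemma reind_rel T S (f : hom T S) l l' x : labels T l -> labels T l' ->
  rel s (reind (psi f) l) (reind (psi f) l') x = rel s l l' x.
Proof.
move=> hl hl'; rewrite {2}(labels_onhalf f hl) {2}(labels_onhalf f hl') rel_map //.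
  exact: labels_relabels (labels_reind f hl) (labels_reind f hl').
move=> h h' /(labels_lt (labels_reind f hl)) i1 /(labels_lt (labels_reind f hl)) i2.
exact: onhalf_inj.
Qed.

Section Pull.
Variables (T S : rtr) (w : iso T S).

(** An isomorphism need not preserve local orders: each input is permuted with its vertex and also
    renumbered, from the local order of [T] to the one coming from [S]. *)
Definition pin a : seq (packed A) :=
  [seq prel s (halves T (onvert (bwd w) j)) [seq onhalf w h | h <- halves S j]
        (nth p0 a (onvert (bwd w) j)) | j <- iota 0 (nvert S)].

Definition pull_sign a : k :=
  sgk k id (onvert w) (iota 0 (nvert T)) (deg_at a).

Definition pull_raw d (m : endT s S d) : multi A := fun l a =>
  pull_sign a *: ev m (reind (psi w) l) (pin a).

Lemma size_pin a : size (pin a) = nvert S.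
Proof. by rewrite size_map size_iota. Qed.

Lemma nth_pin a j : (j < nvert S)%N -> nth p0 (pin a) j =
  prel s (halves T (onvert (bwd w) j)) [seq onhalf w h | h <- halves S j]
    (nth p0 a (onvert (bwd w) j)).
Proof. by move=> hj; rewrite (nth_map 0%N) ?size_iota // nth_iota. Qed.

Lemma fits_pin a : fits T a -> fits S (pin a).
Proof.
move=> fa; apply/eqP; rewrite -map_comp; apply/eq_in_map => j.
rewrite mem_iota add0n => /andP[_ hj]; rewrite /comp prel_ar.
have hv := onvert_lt (bwd w) hj.
by rewrite (fits_nth fa) // -(iso_valence w) // iso_fwdK.
Qed.

Lemma deg_pin a v : (v < nvert T)%N -> deg_at (pin a) (onvert w v) = deg_at a v.
Proof.
by move=> hv; rewrite /deg_at nth_pin ?onvert_lt // prel_dg iso_bwdK.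
Qed.

Lemma iso_iota : perm_eq [seq onvert w v | v <- iota 0 (nvert T)] (iota 0 (nvert S)).
Proof.
apply: perm_trans (iso_phi_perm w).
by rewrite -[X in perm_eq _ X](mkseq_nth 0%N) /mkseq hom_phi_size.
Qed.

Lemma degs_pin a : fits T a -> degs (pin a) = degs a.
Proof.
move=> fa; rewrite !degs_iota size_pin (fits_size fa) -(perm_big _ iso_iota) big_map.
rewrite !big_seq; apply: eq_bigr => v; rewrite mem_iota => /andP[_ hv].
exact: deg_pin.
Qed.

Fact pull_is_raw d (m : endT s S d) : is_raw s (core T) d (pull_raw m).
Proof.
split.
- move=> l a c e hl fa h; rewrite /pull_raw tot_scaleE ev_wrong ?scaler0 //.
  by rewrite size_map degs_pin.
- move=> l w1 w2 c e hl hw b x y.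
  pose a (z : A c e) := w1 ++ pack z :: w2.
  have sz z : size (a z) = nvert T.
    by have := f_equal size hw; rewrite size_map size_iota /= size_cat /= !size_map size_cat.
  have dga z v : dg (nth p0 (a z) v) = dg (nth p0 (a 0) v).
    by rewrite /a !nth_cat; case: ifP => // _; case: (v - size w1)%N.
  have hv : (size w1 < nvert T)%N by rewrite -(sz 0) size_cat /= addnS leq_addr.
  set j := onvert w (size w1); have hj : (j < nvert S)%N by exact: onvert_lt.
  pose u z r := [seq prel s (halves T (onvert (bwd w) j')) [seq onhalf w h | h <- halves S j']
        (nth p0 (a z) (onvert (bwd w) j')) | j' <- r].
  (* Only the entry [j] of the permuted list depends on the varying input. *)
  have ea z r : all (fun j' => (j' < nvert S)%N && (j' != j)) r -> u z r = u 0 r.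
    move=> /allP hr; apply/eq_in_map => j' /hr /andP[hj' ne]; congr prel.
    rewrite /a !nth_cat; case: ifP => // h; case e1 : (_ - size w1)%N => [|n] //=.
    move: ne; rewrite /j (_ : size w1 = onvert (bwd w) j') ?iso_fwdK ?eqxx //.
    by move/negbT: h; rewrite -leqNgt => h; apply/eqP; rewrite eqn_leq h /leq e1.
  have ep z : pin (a z) = u 0 (iota 0 j) ++
      pack (sact s z (relperm c (halves T (size w1)) [seq onhalf w h | h <- halves S j])) ::
      u 0 (iota j.+1 (nvert S - j.+1)).
    have ei : iota 0 (nvert S) = iota 0 j ++ j :: iota j.+1 (nvert S - j.+1).
      by rewrite -[in LHS](subnKC hj) addSnnS iotaD.
    rewrite /pin ei map_cat /= -/(u z _) -/(u z _); congr (_ ++ _ :: _).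
    + by apply: ea; apply/allP => x'; rewrite mem_iota; lia.
    + by rewrite iso_bwdK // /a nth_cat ltnn subnn /=.
    + by apply: ea; apply/allP => x'; rewrite mem_iota; lia.
  have es z : pull_sign (a z) = pull_sign (a 0).
    by apply: eq_in_sgk => // v _; exact: dga.
  rewrite /pull_raw -!/(a _) !es !ep sact_linear (endo_slot (evP m)).
  by rewrite scalerDr !scalerA mulrC.
- move=> l l' a hl hl' fa; rewrite /pull_raw (linZ _ _ (rel_linear s l l')).
  congr (_ *: _); rewrite (endo_rel (evP m) _ (labels_reind w hl) (labels_reind w hl')).
  exact: reind_rel.
Qed.

Definition epull d (m : endT s S d) : endT s T d := mk_endo (pull_is_raw m).

Lemma ev_pull d (m : endT s S d) l a : labels T l -> fits T a ->
  ev (epull m) l a = pull_sign a *: ev m (reind (psi w) l) (pin a).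
Proof. by move=> hl fa; rewrite ev_mk. Qed.

End Pull.

Section Circ.
Variables (T S F : rtr) (f : hom T S) (i : nat) (ef : elementary f i F).
Variables (p q d : int) (e : d = p + q).

Definition cin n b a : seq (packed A) := take i a ++ b :: drop (i + n) a.

Lemma cin_cat w1 w2 w3 b : size w1 = i ->
  cin (size w2) b (w1 ++ w2 ++ w3) = w1 ++ b :: w3.
Proof.
move=> s1; rewrite /cin take_size_cat // drop_cat s1 ltnNge leq_addr /= addKn.
by rewrite drop_size_cat.
Qed.

Definition block n a : seq (packed A) := take n (drop i a).

Lemma block_cat w1 w2 w3 : size w1 = i -> block (size w2) (w1 ++ w2 ++ w3) = w2.
Proof. by move=> s1; rewrite /block drop_size_cat // take_size_cat. Qed.

(** The order of [legs F] is the local order of [S] at [i], so the result is numbered as an input at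
    that vertex should be. *)
Definition inner (y : endT s F q) w : packed A :=
  pk (pi0 F) (q + degs w) (ev y (legs F) w).

(** The sign is that of moving [y] past the inputs before the block on which it acts. *)
Definition circ_raw (x : endT s S p) (y : endT s F q) : multi A := fun l a =>
  koszul k (q * degs (take i a)) *:
  ev x (reind (psi f) l)
    (cin (nvert F) (inner y (block (nvert F) a)) a).

Lemma circ_rawE x y l w1 w2 w3 : size w1 = i -> size w2 = nvert F ->
  circ_raw x y l (w1 ++ w2 ++ w3) =
  koszul k (q * degs w1) *: ev x (reind (psi f) l) (w1 ++ inner y w2 :: w3).
Proof.
by move=> s1 s2; rewrite /circ_raw -s2 take_size_cat // cin_cat // block_cat.
Qed.

Lemma tin_inner y w : fits F w -> tin (inner y w) = ev y (legs F) w.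
Proof.
move=> fw; apply: tin_pk => c' d' h; apply: ev_wrong => -[e1 e2].
by apply: h; move: e1; rewrite size_legs => -[].
Qed.

Fact circ_is_raw x y : is_raw s (core T) d (circ_raw x y).
Proof.
have inj l : labels T l -> labels S (reind (psi f) l) by exact: labels_reind.
split.
- move=> l a c e' hl fa h; have [w1 [w2 [w3 [ea s1 f2 f3]]]] := fits_split ef fa.
  rewrite ea circ_rawE ?(fits_size f2) // tot_scaleE ev_wrong ?scaler0 //.
  rewrite size_map degs_cat degs_cons => -[h1 h2]; apply: h; split=> //.
  rewrite h2 e ea !degs_cat -[dg _]/(q + degs w2) -!addrA; congr (_ + _).
  exact: addrCA.
- move=> l w1 w2 c e' hl hw b x1 y1.
  have fz (z : A c e') : fits T (w1 ++ pack z :: w2) by rewrite /fits map_cat /= hw.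
  have [u1 [u2 [u3 [eu s1 f2 f3]]]] := fits_split ef (fz 0).
  have s2 := fits_size f2.
  have sz : (size w1 + (size w2).+1 = size u1 + (size u2 + size u3))%N.
    by have := f_equal size eu; rewrite !size_cat.
  (* The varying slot lies before, in or after the contracted block. In the second case linearity of
     [y] is used before that of [x]; the degree of the inner result does not depend on the varying
     input. *)
  have [lt|ge] := ltnP (size w1) (size u1).
    have e1 : u1 = w1 ++ pack (0 : A c e') :: drop (size w1).+1 u1.
      have e0 : take (size u1) (w1 ++ pack (0 : A c e') :: w2) = u1.
        by rewrite eu take_size_cat.
      rewrite -{1}e0 take_cat ltnNge (ltnW lt) /=.
      case en : (size u1 - size w1)%N => [|n]; first by move: en; lia.
      by rewrite /= -{1}e0 take_cat ltnNge (ltnW lt) /= en /= drop_cat ltnNge leqnSn /= subSnn /= drop0.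
    have e2 : w2 = drop (size w1).+1 u1 ++ u2 ++ u3.
      have := eu; rewrite {1}e1 -catA => /eqP; rewrite eqseq_cat // eqxx /=.
      by rewrite eqseq_cons => /andP[_ /eqP].
    set v := drop (size w1).+1 u1 in e1 e2.
    have E z : w1 ++ pack z :: w2 = (w1 ++ pack z :: v) ++ u2 ++ u3 by rewrite e2 -catA.
    have Es (z : A c e') : size (w1 ++ pack z :: v) = i.
      by rewrite -s1 e1 !size_cat.
    rewrite !E !circ_rawE //; rewrite !degs_cat !degs_cons /dg /=.
    by rewrite -!catA /= (endo_slot (evP x)) scalerDr !scalerA mulrC.
  have [lt|ge2] := ltnP (size w1) (size u1 + size u2).
    have e1 : w1 = u1 ++ drop (size u1) w1.
      have e0 : take (size u1) (w1 ++ pack (0 : A c e') :: w2) = u1.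
        by rewrite eu take_size_cat.
      move: e0; rewrite take_cat; case: ltnP => [_ e0|h].
        by rewrite -{1}e0 cat_take_drop.
      have h' : size u1 = size w1 by lia.
      by rewrite h' subnn take0 cats0 drop_size cats0.
    set v1 := drop (size u1) w1 in e1.
    have sv1 : (size v1 < size u2)%N by rewrite size_drop; lia.
    have e2 : v1 ++ pack (0 : A c e') :: w2 = u2 ++ u3.
      by move/eqP: eu; rewrite e1 -catA eqseq_cat // eqxx => /eqP.
    have e3 : u2 = v1 ++ pack (0 : A c e') :: drop (size v1).+1 u2.
      have e0 : take (size u2) (v1 ++ pack (0 : A c e') :: w2) = u2.
        by rewrite e2 take_size_cat.
      rewrite -{1}e0 take_cat ltnNge (ltnW sv1) /=.
      case en : (size u2 - size v1)%N => [|n]; first by move: en; lia.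
      by rewrite /= -{1}e0 take_cat ltnNge (ltnW sv1) /= en /= drop_cat ltnNge leqnSn /= subSnn /= drop0.
    set v2 := drop (size v1).+1 u2 in e3.
    have e4 : w2 = v2 ++ u3.
      by move/eqP: e2; rewrite {1}e3 -catA eqseq_cat // => /andP[_ /eqP/(f_equal behead)].
    have E z : w1 ++ pack z :: w2 = u1 ++ (v1 ++ pack z :: v2) ++ u3.
      by rewrite e4 {1}e1 -!catA.
    have Es (z : A c e') : size (v1 ++ pack z :: v2) = nvert F.
      by rewrite -s2 e3 !size_cat.
    rewrite !E !circ_rawE //.
    pose D := q + degs (v1 ++ pack (0 : A c e') :: v2).
    have Ei (z : A c e') : inner y (v1 ++ pack z :: v2) =
        pk (pi0 F) D (ev y (legs F) (v1 ++ pack z :: v2)).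
      by rewrite /inner /D !degs_cat !degs_cons.
    rewrite !Ei (endo_slot (evP y)) /pk tot_linE (endo_slot (evP x)).
    by rewrite scalerDr !scalerA mulrC.
  have e1 : w1 = u1 ++ u2 ++ drop (size u1 + size u2) w1.
    have e0 : take (size u1 + size u2) (w1 ++ pack (0 : A c e') :: w2) = u1 ++ u2.
      by rewrite eu catA take_size_cat // size_cat.
    move: e0; rewrite take_cat; case: ltnP => [_ e0|h].
      by rewrite catA -e0 cat_take_drop.
    have h' : (size u1 + size u2)%N = size w1 by lia.
    by rewrite h' subnn take0 cats0 drop_size cats0 => ->.
  set v := drop (size u1 + size u2) w1 in e1.
  have E z : w1 ++ pack z :: w2 = u1 ++ u2 ++ (v ++ pack z :: w2).
    by rewrite {1}e1 -!catA.
  rewrite !E !circ_rawE // -!cat_cons !catA.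
  by rewrite (endo_slot (evP x)) scalerDr !scalerA mulrC.
- move=> l l' a hl hl' fa; rewrite /circ_raw (linZ _ _ (rel_linear s l l')).
  congr (_ *: _); rewrite (endo_rel (evP x) _ (inj _ hl) (inj _ hl')).
  exact: reind_rel.
Qed.

Definition ecirc x y : endT s T d := mk_endo (circ_is_raw x y).

Lemma ev_circ x y l w1 w2 w3 : size w1 = i -> size w2 = nvert F ->
  labels T l -> fits T (w1 ++ w2 ++ w3) ->
  ev (ecirc x y) l (w1 ++ w2 ++ w3) =
  koszul k (q * degs w1) *: ev x (reind (psi f) l) (w1 ++ inner y w2 :: w3).
Proof. by move=> s1 s2 hl fa; rewrite ev_mk // circ_rawE. Qed.

End Circ.

Section Unit.
Variables (U : rtr) (hU : trivial_tree U).

(** The identity up to numbering: the input arrives in the local order of the only vertex and is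
    returned in the numbering [l]. *)
Definition eta_raw : multi A := fun l w => rel s (halves U 0) l (tin (head p0 w)).

Lemma trivial_halves : halves U 0 = legs U.
Proof.
have [u1 ->] := hU; apply/all_filterP/allP => h; rewrite mem_iota add0n => /andP[_ hh].
by apply/eqP; exact: terminal_vertex.
Qed.

Lemma labels_terminal l : labels U l -> relabels (halves U 0) l.
Proof. by rewrite trivial_halves; exact: labels_relabels (labels_legs U). Qed.

Lemma fits_terminal t w : local_terminal t -> fits t w ->
  exists2 p, w = [:: p] & ar p = valence t 0.
Proof.
move=> u1 fw; have := fits_size fw; rewrite u1.
case: w fw => [|p [|]] // /eqP; rewrite /valences u1 => -[e] _.
by exists p.
Qed.

Fact eta_is_raw : is_raw s (core U) 0 eta_raw.
Proof.
have [u1 _] := hU; split.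
- move=> l w c e hl /(fits_terminal u1)[p -> hp] h /=.
  apply: rel0; apply: tin_out => -[e1 e2]; apply: h; split.
    rewrite -(relabels_size (labels_terminal hl)) -e1 hp.
    by rewrite [in RHS]size_halves // u1.
  by rewrite degs_cons -e2 /degs big_nil addr0 add0r.
- move=> l w1 w2 c e hl hw; have := f_equal size hw.
  rewrite size_map size_iota u1 size_cat /= addnS => -[] /eqP.
  rewrite addn_eq0 !size_map => /andP[/nilP -> /nilP ->] b x y /=.
  by rewrite /eta_raw /= tin_linear rel_linear.
- move=> l l' w hl hl' _; rewrite /eta_raw rel_trans //; first exact: labels_terminal.
  exact: labels_relabels hl hl'.
Qed.

Definition eeta : endT s U 0 := mk_endo eta_is_raw.

Lemma ev_eta l p : labels U l -> ar p = valence U 0 ->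
  ev eeta l [:: p] = rel s (halves U 0) l (tin p).
Proof.
by move=> hl hp; rewrite ev_mk //; apply/eqP; rewrite /valences hU.1 /= hp.
Qed.

End Unit.

(** An equality of graded spaces is available because [endT] is a function of [core]. *)
Definition estrict (T u F : rtr) (f : hom T u) i (hu : local_terminal u)
  (ef : elementary f i F) : endT s F = endT s T :=
  f_equal (fun t => (fun d => endo s t d : lmodType k) : graded k)
    (core_unlabel (over_unlabel hu ef)).

Lemma ev_strict (T F : rtr) (e : core F = core T) (E : endT s F = endT s T) d (x : endT s F d) :
  ev (cast E x : endT s T d) = ev x.
Proof. exact: ev_cast e E d x. Qed.

End Operations.

Local Open Scope ring_scope.

Lemma cat_prefix (X : Type) (s1 s2 t1 t2 : seq X) :
  s1 ++ s2 = t1 ++ t2 -> (size s1 <= size t1)%N ->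
  exists2 r, t1 = s1 ++ r & s2 = r ++ t2.
Proof.
elim: s1 t1 => [|a s1 IH] [|b t1] //=; first by move=> -> _; exists [::].
  by move=> -> _; exists (b :: t1).
by case=> -> /IH h /h [r -> ->]; exists r.
Qed.

Lemma cat_inj_size (X : Type) (s1 s2 t1 t2 : seq X) :
  s1 ++ s2 = t1 ++ t2 -> size s1 = size t1 -> s1 = t1 /\ s2 = t2.
Proof.
by elim: s1 t1 => [|a s1 IH] [|b t1] //= [-> e] [/(IH _ e)[-> ->]].
Qed.

(** * Associativity, parallel and unit axioms for operations *)

Section Laws.
Variables (k : fieldType) (A : gcoll k) (s : symm A).
Implicit Types (a w : seq (packed A)) (T S F G H P : rtr).

Lemma evT_lin (T : rtr) d (a : k) (x y : endT s T d) l w :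
  ev (a *: x + y) l w = a *: ev x l w + ev y l w.
Proof. by rewrite -[LHS]/(ev (a *: (x : endo s (core T) d) + y) l w) evD evZ. Qed.

Lemma evT_scale (T : rtr) d (a : k) (x : endT s T d) l w :
  ev (a *: x) l w = a *: ev x l w.
Proof. exact: evZ. Qed.

Lemma evT_ext (T : rtr) d (x y : endT s T d) :
  (forall l w, labels T l -> fits T w -> ev x l w = ev y l w) -> x = y.
Proof. exact: (@endo_ext k A s (core T) d x y). Qed.

Lemma fits_contract T S F (f : hom T S) i (ef : elementary f i F) w1 w2 w3
    (p : packed A) : size w1 = i -> size w2 = nvert F -> ar p = pi0 F ->
  fits T (w1 ++ w2 ++ w3) -> fits S (w1 ++ p :: w3) /\ fits F w2.
Proof.
move=> s1 s2 hp /(fits_split ef)[u1 [u2 [u3 [e h1 h2 h3]]]].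
have [e1 e'] := cat_inj_size e (etrans s1 (esym h1)).
have [e2 e3] := cat_inj_size e' (etrans s2 (esym (fits_size h2))).
by rewrite e1 e2 e3; split=> //; exact: h3.
Qed.

Lemma epull_linear T S (w : iso T S) d : linear (@epull k A s T S w d).
Proof.
move=> a x y; apply: evT_ext => l v hl fv.
by rewrite evT_lin !ev_pull // evT_lin scalerDr !scalerA mulrC.
Qed.

Lemma epull_id T (w : iso T T) : mor w = id_mor T ->
  forall d (x : endT s T d), epull w x = x.
Proof.
move=> ew d x; apply: evT_ext => l a hl fa; rewrite ev_pull // ew /=.
have ov v : (v < nvert T)%N -> onvert w v = v.
  by move=> hv; rewrite ew /onvert nth_iota.
have ob v : (v < nvert T)%N -> onvert (bwd w) v = v.
  by move=> hv; rewrite -{1}(ov _ hv) iso_bwdK.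
have -> : reind (iota 0 (nhalf T)) l = l.
  by apply: map_id_in => h hh; rewrite index_iota0 // (labels_lt hl).
have -> : pin s w a = a.
  apply: (@eq_from_nth _ (p0 A)); rewrite size_pin ?(fits_size fa) // => v hv.
  rewrite nth_pin // ob // (_ : [seq onhalf w h | h <- halves T v] = halves T v).
    by rewrite prel_id // halves_uniq.
  apply: map_id_in => h; rewrite mem_halves => /andP[hh _].
  by rewrite ew /onhalf nth_iota.
rewrite /pull_sign (eq_in_sgk k (f' := id) (g' := id) (d' := deg_at a)) //.
  by rewrite sgk_id scale1r.
by move=> v; rewrite mem_iota => /andP[_ hv]; rewrite ov.
Qed.

Lemma bwd_comp T S P (v : iso T S) (w : iso S P) (vw : iso T P) :
  mor vw = comp_mor w v -> forall j, (j < nvert P)%N ->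
  onvert (bwd vw) j = onvert (bwd v) (onvert (bwd w) j).
Proof.
move=> e j hj; have h1 := onvert_lt (bwd w) hj; have h2 := onvert_lt (bwd v) h1.
apply: (onvert_inj (w := vw)) => //; first exact: onvert_lt.
rewrite iso_fwdK // e {1}/onvert /= (nth_map 0%N) ?hom_phi_size //.
by rewrite -/(onvert v _) iso_fwdK // iso_fwdK.
Qed.

Lemma onvert_comp T S (g f : premor) v : (v < size (phi f))%N ->
  onvert (comp_mor g f) v = onvert g (onvert f v).
Proof. by move=> hv; rewrite {1}/onvert /= (nth_map 0%N). Qed.

Lemma onhalf_comp (g f : premor) h : (h < size (psi g))%N ->
  onhalf (comp_mor g f) h = onhalf f (onhalf g h).
Proof. by move=> hv; rewrite {1}/onhalf /= (nth_map 0%N). Qed.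

Lemma epull_comp T S P (v : iso T S) (w : iso S P) (vw : iso T P) :
  mor vw = comp_mor w v ->
  forall d (x : endT s P d), epull vw x = epull v (epull w x).
Proof.
move=> e d x; apply: evT_ext => l a hl fa.
have hl1 := labels_reind v hl; have fa1 := fits_pin s v fa.
rewrite !ev_pull // scalerA -(reind_comp e hl); congr (_ *: ev x _ _).
- rewrite /pull_sign -(sgk_perm k _ _ _ (iso_iota v)) sgk_map.
  rewrite (eq_in_sgk k (f := id \o onvert v) (f' := onvert v) (g := onvert w \o onvert v)
     (g' := onvert vw) (d' := deg_at a)) //.
  + rewrite sgk_cocycle // => i j; rewrite !mem_iota !add0n => /andP[_ hi] /andP[_ hj].
      exact: onvert_inj.
    exact: onvert_inj.
  + move=> i; rewrite mem_iota add0n => /andP[_ hi] /=.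
    by rewrite e onvert_comp // hom_phi_size.
  + by move=> i; rewrite mem_iota add0n => /andP[_ hi] /=; rewrite deg_pin.
- apply: (@eq_from_nth _ (p0 A)); rewrite !size_pin // => j hj.
  have h1 := onvert_lt (bwd w) hj; have h2 := onvert_lt (bwd v) h1.
  rewrite !nth_pin // (bwd_comp e) //.
  set u := onvert (bwd w) j in h1 h2 *; set x0 := onvert (bwd v) u in h2 *.
  have r1 := iso_halves v h2; rewrite iso_fwdK // in r1.
  have r2 := iso_halves w h1; rewrite iso_fwdK // in r2.
  have inj : {in halves S u &, injective (onhalf v)}.
    move=> h h'; rewrite !mem_halves => /andP[i1 _] /andP[i2 _]; exact: onhalf_inj.
  rewrite -(prel_map _ _ r2 inj) -map_comp prel_trans //.
    congr prel; apply/eq_in_map => h; rewrite mem_halves => /andP[hh _] /=.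
    by rewrite e onhalf_comp // hom_psi_size.
  rewrite map_comp; apply: relabels_map => //.
  by rewrite size_halves.
Qed.

Lemma ecirc_linearl T S F (f : hom T S) i (ef : elementary f i F)
  (p q d : int) (e : d = p + q) (y : endT s F q) :
  linear (fun x => ecirc ef e x y : endT s T d).
Proof.
move=> a x x'; apply: evT_ext => l w hl fw; have [w1 [w2 [w3 [ew s1 f2 f3]]]] := fits_split ef fw.
rewrite evT_lin ew in fw *; rewrite !ev_circ ?(fits_size f2) //.
by rewrite evT_lin scalerDr !scalerA mulrC.
Qed.

Lemma ecirc_linearr T S F (f : hom T S) i (ef : elementary f i F)
  (p q d : int) (e : d = p + q) (x : endT s S p) :
  linear (fun y => ecirc ef e x y : endT s T d).
Proof.
move=> a y y'; apply: evT_ext => l w hl fw; have [w1 [w2 [w3 [ew s1 f2 f3]]]] := fits_split ef fw.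
rewrite evT_lin ew in fw *; rewrite !ev_circ ?(fits_size f2) //.
rewrite /inner evT_lin /pk tot_linE (endo_slot (evP x)).
by rewrite scalerDr !scalerA mulrC.
Qed.

Lemma edge_nvert F : (1 <= nedge F)%N -> (2 <= nvert F)%N.
Proof. by rewrite (rtr_euler (rtrP F)) ltnS. Qed.

Lemma induced_onvert T S P G H (f : hom T S) (g : hom S P) (h : hom T P)
  (fi : hom H G) i (eg : elementary g i G) (eh : elementary h i H) :
  mor h = comp_mor g f -> mor fi = induced T S f g i ->
  forall v, (v < nvert H)%N -> (i + onvert fi v = onvert f (i + v))%N.
Proof.
move=> e1 e2 v hv; have fh := elt_fiber_verts eh; rewrite e1 in fh.
rewrite e2 /onvert /= fh (nth_map 0%N) ?size_iota // nth_iota //.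
have vT : (i + v < nvert T)%N.
  by have := elt_nvert eh; have := elt_lt eh; lia.
have inS : onvert f (i + v) \in fiber_verts S g i.
  rewrite mem_filter mem_iota add0n onvert_lt // leq0n !andbT -onvert_comp ?hom_phi_size // -e1.
  have: (i + v)%N \in fiber_verts T h i by rewrite (elt_fiber_verts eh) mem_iota; lia.
  by rewrite mem_filter => /andP[].
move: inS; rewrite (elt_fiber_verts eg) mem_iota -/(onvert f _) => /andP[h1 h2].
set v' := onvert f (i + v) in h1 h2 *.
have -> : v' = nth 0%N (iota i (nvert G)) (v' - i) by rewrite nth_iota; lia.
by rewrite index_uniq ?size_iota ?iota_uniq //; [rewrite nth_iota; lia | lia].
Qed.

(** The block of [fi] has at least two vertices, so [f] sends both [i + j'] and [i + j'.+1] to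
    [i + j']. A vertex with two preimages under [f] can only be [j]. *)
Lemma nested_index T S P F G H (f : hom T S) (g : hom S P) (h : hom T P)
  (fi : hom H G) (j i j' : nat) (ef : elementary f j F) (eg : elementary g i G)
  (eh : elementary h i H) (efi : elementary fi j' F) :
  mor h = comp_mor g f -> mor fi = induced T S f g i -> j = (i + j')%N.
Proof.
move=> e1 e2; have io v (hv : (v < nvert H)%N) := induced_onvert eg eh e1 e2 hv.
have n2 := edge_nvert (elt_edge ef).
have a1 := elt_nvert ef; have a2 := elt_nvert efi; have a3 := elt_nvert eh.
have b1 := elt_lt ef; have b2 := elt_lt efi; have b3 := elt_lt eh.
have := io j' ltac:(lia); rewrite (elt_onvert efi); last lia.
rewrite (elt_onvert ef); last lia.
have := io j'.+1 ltac:(lia); rewrite (elt_onvert efi); last lia.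
rewrite (elt_onvert ef); last lia.
by do !case: ifP; lia.
Qed.

Lemma ecirc_assoc T S P F G H (f : hom T S) (g : hom S P) (h : hom T P)
  (fi : hom H G) (j i j' : nat)
  (ef : elementary f j F) (eg : elementary g i G)
  (eh : elementary h i H) (efi : elementary fi j' F) :
  mor h = comp_mor g f -> mor fi = induced T S f g i ->
  forall (p q r qr pq d : int) (e1 : d = p + qr) (e2 : qr = q + r)
    (e3 : d = pq + r) (e4 : pq = p + q)
    (x : endT s P p) (y : endT s G q) (z : endT s F r),
  ecirc eh e1 x (ecirc efi e2 y z) = ecirc ef e3 (ecirc eg e4 x y) z.
Proof.
move=> c1 c2 p q r qr pq d e1 e2 e3 e4 x y z.
have ej := nested_index ef eg eh efi c1 c2.
apply: evT_ext => l w hl fw.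
have [w1 [wH [w3 [ew s1 fH _]]]] := fits_split eh fw.
have [v1 [v2 [v3 [ev' t1 f2 fG]]]] := fits_split efi fH.
rewrite ew in fw *; rewrite ev_circ ?(fits_size fH) //.
have ew' : w1 ++ wH ++ w3 = (w1 ++ v1) ++ v2 ++ (v3 ++ w3).
  by rewrite ev' -!catA.
have fw' := fw; rewrite ew' in fw'.
have sj : size (w1 ++ v1) = j by rewrite size_cat s1 t1.
rewrite [in RHS]ew' ev_circ ?(fits_size f2) //.
have hp : ar (inner z v2) = pi0 F by [].
have [fS _] := fits_contract ef sj (fits_size f2) hp fw'.
have eS : (w1 ++ v1) ++ inner z v2 :: v3 ++ w3 =
  w1 ++ (v1 ++ inner z v2 :: v3) ++ w3 by rewrite -!catA.
rewrite eS in fS *; rewrite ev_circ //; first last.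
- exact: labels_reind.
- exact: fits_size (fG _ hp).
rewrite -(reind_comp c1 hl).
have eI : inner (ecirc efi e2 y z) wH =
    pk (pi0 G) (q + degs (v1 ++ inner z v2 :: v3))
      (koszul k (r * degs v1) *: ev y (legs G) (v1 ++ inner z v2 :: v3)).
  rewrite /inner (pi0_fiber eh) -(pi0_fiber eg); congr pk.
    rewrite e2 ev' !degs_cat degs_cons -[dg _]/(r + degs v2); lia.
  by rewrite {1}ev' ev_circ ?(fits_size f2) ?reind_legs ?labels_legs // -ev'.
rewrite eI /pk tot_scaleE slotZ !scalerA; congr (_ *: _).
(* On both sides [q] and [r] pass [w1], and [r] also passes [v1]. *)
by rewrite degs_cat -!koszulD; congr (koszul k _); rewrite e2; lia.
Qed.

Lemma ecirc_parallel_lt T S S' S'' F G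
  (f' : hom T S') (g' : hom S' S) (f'' : hom T S'') (g'' : hom S'' S)
  (j i l m : nat)
  (ef' : elementary f' j F) (eg' : elementary g' i G)
  (ef'' : elementary f'' l G) (eg'' : elementary g'' m F) :
  comp_mor g' f' = comp_mor g'' f'' ->
  onvert g'' l = i -> onvert g' j = m -> (i < m)%N ->
  forall (p q r pq pr d : int) (e1 : d = pr + q) (e2 : pr = p + r)
    (e3 : d = pq + r) (e4 : pq = p + q)
    (x : endT s S p) (y : endT s F q) (z : endT s G r),
  koszul k (q * r) *: ecirc ef' e1 (ecirc eg' e2 x z) y =
  ecirc ef'' e3 (ecirc eg'' e4 x y) z.
Proof.
move=> c1 c2 c3 lt p q r pq pr d e1 e2 e3 e4 x y z.
(* As [i < m], the block of [G] precedes that of [F]. So [l] is not displaced by contracting [F],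
   whereas in [S'] the vertex [j] still has the uncontracted block of [G] before it. *)
have el : l = i.
  have := c2; rewrite (elt_onvert eg'') ?(elt_lt ef'') //.
  by have := edge_nvert (elt_edge ef'); do !case: ifP; lia.
have ej : j = (m + nvert G - 1)%N.
  have := c3; rewrite (elt_onvert eg') ?(elt_lt ef') //.
  by have := edge_nvert (elt_edge ef''); do !case: ifP; lia.
have nG := edge_nvert (elt_edge ef'').
apply: evT_ext => b w hb fw; rewrite evT_scale.
have [u1 [u2 [u3 [ew s1 f2 fS']]]] := fits_split ef' fw.
have hp : ar (inner y u2) = pi0 F by [].
have [v1 [v2 [v3 [ev' t1 g2 gS]]]] := fits_split eg' (fS' _ hp).
have [w2 e5 e6] : exists2 w2, u1 = (v1 ++ v2) ++ w2 & v3 = w2 ++ inner y u2 :: u3.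
  apply: cat_prefix; first by rewrite -catA -ev'.
  by rewrite size_cat t1 (fits_size g2) s1 ej; lia.
have hq : ar (inner z v2) = pi0 G by [].
rewrite ew in fw *; rewrite ev_circ ?(fits_size f2) // ev'.
rewrite ev_circ ?(fits_size g2) //; first last.
- by rewrite -ev'; exact: fS'.
- exact: labels_reind.
have eT : u1 ++ u2 ++ u3 = v1 ++ v2 ++ (w2 ++ u2 ++ u3) by rewrite e5 -!catA.
have fT := fw; rewrite eT in fT.
rewrite [in RHS]eT ev_circ ?(fits_size g2) //; last by rewrite t1 el.
have [fS'' _] := fits_contract ef'' (etrans t1 (esym el)) (fits_size g2) hq fT.
have eS : v1 ++ inner z v2 :: w2 ++ u2 ++ u3 = (v1 ++ inner z v2 :: w2) ++ u2 ++ u3.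
  by rewrite -catA.
rewrite eS in fS'' *; rewrite ev_circ ?(fits_size f2) //; first last.
- exact: labels_reind.
- have := f_equal size e5; rewrite s1 ej !size_cat /= t1 (fits_size g2); lia.
rewrite -(reind_comp c1 hb) -(reind_comp erefl hb) e6 -catA !scalerA; congr (_ *: _).
rewrite e5 !degs_cat degs_cons -[dg _]/(r + degs v2) -!koszulD; congr (koszul k _).
by lia.
Qed.

Lemma ecirc_parallel T S S' S'' F G
  (f' : hom T S') (g' : hom S' S) (f'' : hom T S'') (g'' : hom S'' S)
  (j i l m : nat)
  (ef' : elementary f' j F) (eg' : elementary g' i G)
  (ef'' : elementary f'' l G) (eg'' : elementary g'' m F) :
  comp_mor g' f' = comp_mor g'' f'' ->
  onvert g'' l = i -> onvert g' j = m -> i <> m ->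
  forall (p q r pq pr d : int) (e1 : d = pr + q) (e2 : pr = p + r)
    (e3 : d = pq + r) (e4 : pq = p + q)
    (x : endT s S p) (y : endT s F q) (z : endT s G r),
  koszul k (q * r) *: ecirc ef' e1 (ecirc eg' e2 x z) y =
  ecirc ef'' e3 (ecirc eg'' e4 x y) z.
Proof.
move=> c1 c2 c3 ne p q r pq pr d e1 e2 e3 e4 x y z.
case: (ltngtP i m) => [lt|lt|//]; first exact: (ecirc_parallel_lt ef' eg' ef'' eg'').
rewrite -(ecirc_parallel_lt ef'' eg'' ef' eg' (esym c1) c3 c2 lt e3 e4 e1 e2).
by rewrite mulrC scalerA koszul_sq scale1r.
Qed.

Lemma terminal_relabels (u : rtr) l : local_terminal u -> labels u l ->
  relabels (halves u 0) l.
Proof.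
move=> u1 hl; have hi : halves u 0 = iota 0 (nhalf u).
  apply/all_filterP/allP => h; rewrite mem_iota add0n => /andP[_ hh].
  by apply/eqP; exact: terminal_vertex.
have [h1 _ _ _] := head_halvesP (T := u) (v := 0%N) ltac:(by rewrite u1).
apply: relabels_sym; rewrite /relabels (labels_uniq hl).
case/andP: hl => p /eqP ->; rewrite (terminal_root u1) /=; apply/andP; split.
  rewrite hi; apply: perm_trans p _; rewrite (_ : [seq _ <- _ | _] = iota 0 (nhalf u)) //.
  apply/all_filterP/allP => h; rewrite mem_iota add0n => /andP[_ hh].
  by rewrite terminal_mate.
by rewrite hi; move: h1; rewrite hi; case: nhalf.
Qed.

Lemma ev_pull_eta (u U : rtr) (b : iso u U) (hU : trivial_tree U) l p :
  local_terminal u -> labels u l -> ar p = valence u 0 ->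
  ev (epull b (eeta s hU)) l [:: p] = rel s (halves u 0) l (tin p).
Proof.
move=> hu hl hp.
have fp : fits u [:: p] by apply/eqP; rewrite /valences hu /= hp.
rewrite ev_pull //.
have -> : pull_sign b [:: p] = 1.
  rewrite /pull_sign hu /sgk big_cons big_nil big_mkcond big_cons big_nil ltnn /=.
  by rewrite !mulr1.
have b0 : onvert (bwd b) 0 = 0%N.
  by have : (onvert (bwd b) 0 < nvert u)%N by [rewrite onvert_lt // hU.1]; rewrite hu; case: onvert.
have b1 : onvert b 0 = 0%N.
  by have : (onvert b 0 < nvert U)%N by [rewrite onvert_lt // hu]; rewrite hU.1; case: onvert.
rewrite scale1r /pin hU.1 /= b0 ev_eta //; first last.
- by rewrite prel_ar hp -(iso_valence b) ?hu // b1.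
- exact: labels_reind.
have r1 : relabels (halves u 0) [seq onhalf b h | h <- halves U 0].
  by have := iso_halves b (v := 0%N); rewrite hu b1 => /(_ isT).
have injb : {in halves U 0 &, injective (onhalf b)}.
  by move=> h h'; rewrite !mem_halves => /andP[i1 _] /andP[i2 _]; exact: onhalf_inj.
have r2 : relabels (halves U 0) (reind (psi b) l).
  by apply: labels_terminal => //; exact: labels_reind.
rewrite rel_tin -(rel_map _ _ r2 injb) -(labels_onhalf b hl) rel_trans //.
rewrite (labels_onhalf b hl); apply: relabels_map => //.
by rewrite size_halves // hU.1.
Qed.

(** The unit renumbers the result of [x] from [legs F], the image of the local order of [u], to [l];
    by equivariance of [x] this is its value at [l]. *)
Lemma ecirc_unit (T u F U : rtr) (f : hom T u) (i : nat)
  (hu : local_terminal u) (ef : elementary f i F)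
  (b : iso u U) (hU : trivial_tree U) (d : int) (e : d = 0 + d) (x : endT s F d) :
  ecirc ef e (epull b (eeta s hU)) x = cast (estrict s hu ef) x.
Proof.
have cF : core F = core T := core_unlabel (over_unlabel hu ef).
apply: evT_ext => l w hl fw; rewrite (ev_strict cF).
have i0 := over_index hu ef; have sF : nvert F = nvert T by case: cF.
have -> : w = [::] ++ w ++ [::] by rewrite cats0.
have fw' : fits T ([::] ++ w ++ [::]) by rewrite cats0.
rewrite (ev_circ ef e _ x (w1 := [::]) (esym i0) (etrans (fits_size fw) (esym sF)) hl fw').
have hp : ar (inner x w) = pi0 F by [].
have [fu _] := fits_contract ef (w1 := [::]) (esym i0) (etrans (fits_size fw) (esym sF)) hp fw'.
have hl1 := labels_reind f hl.
rewrite {1}/degs big_nil mulr0 scale1r !cat0s cats0 ev_pull_eta //; last first.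
  by rewrite hp (pi0_fiber ef) i0.
have fF : fits F w by move: fw; rewrite /fits -[valences F]/(valences (core F)) cF.
have eF : legs F = [seq onhalf f h | h <- halves u 0].
  rewrite (over_tree hu ef) /=; congr map; symmetry.
  by apply/all_filterP/allP => h; rewrite mem_iota add0n => /andP[_ hh]; apply/eqP/terminal_vertex.
have hF : labels T (legs F) by rewrite -[labels T _]/(labels (core T) _) -cF; exact: labels_legs.
have r3 := terminal_relabels hu hl1.
have injf : {in halves u 0 &, injective (onhalf f)}.
  by move=> h h'; rewrite !mem_halves => /andP[i1 _] /andP[i2 _]; exact: onhalf_inj.
rewrite -(rel_map _ _ r3 injf) -eF -(labels_onhalf f hl) tin_inner //.
by rewrite -(endo_rel (evP x)) // /labels -[mate]/(fun t => mate t) -/(labels F _) -[labels F _]/(labels (core F) _) cF.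
Qed.

End Laws.

Local Open Scope ring_scope.

(** * Compatibility of composition with isomorphisms *)

Section BlockSign.
Variable k : fieldType.

Lemma eq_sgk_rel (f f' g g' : nat -> nat) (V : seq nat) (d d' : nat -> int) :
  {in V &, forall x y, (f x < f y)%N = (f' x < f' y)%N} ->
  {in V &, forall x y, (g x < g y)%N = (g' x < g' y)%N} ->
  {in V, d =1 d'} -> sgk k f g V d = sgk k f' g' V d'.
Proof.
move=> hf hg hd; rewrite /sgk !big_seq; apply: eq_bigr => x xV.
rewrite big_seq_cond [RHS]big_seq_cond; apply: eq_big => [y|y /andP[yV _]].
  by case yV: (y \in V) => //=; rewrite hf ?hg.
by rewrite !hd.
Qed.

(** In both orders each element of [U] lies wholly before or wholly after the block [B], as recorded
    by [al] and [be]. If it changes sides, it crosses the total degree of the block. *)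
Lemma sgk_block (f g : nat -> nat) (U B : seq nat) (d : nat -> int) (al be : pred nat) :
  {in U & B, forall x y, (f x < f y)%N = al x /\ (f y < f x)%N = ~~ al x} ->
  {in U & B, forall x y, (g x < g y)%N = be x /\ (g y < g x)%N = ~~ be x} ->
  sgk k f g (U ++ B) d = sgk k f g U d * sgk k f g B d *
    \prod_(x <- U | al x (+) be x) koszul k (d x * \sum_(y <- B) d y).
Proof.
move=> hf hg; rewrite /sgk big_cat /=.
under eq_bigr do rewrite big_cat /=.
under [X in _ * X]eq_bigr do rewrite big_cat /=.
rewrite !big_split /= -!mulrA; congr (_ * _); rewrite mulrC -mulrA mulrCA; congr (_ * _).
rewrite mulrC [X in _ * X](exchange_big_dep predT) //= -big_split /= [RHS]big_mkcond /=.
rewrite !big_seq; apply: eq_bigr => x xU.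
rewrite mulr_sumr koszul_sum.
have E (P : pred nat) (c : bool) (F : nat -> k) : {in B, P =1 fun=> c} ->
    \prod_(y <- B | P y) F y = if c then \prod_(y <- B) F y else 1.
  move=> hP; rewrite big_seq_cond; case: c hP => hP.
    rewrite [RHS]big_seq; apply: eq_bigl => y.
    by case yB: (y \in B) => //=; rewrite hP.
  by apply: big_pred0 => y; case yB: (y \in B) => //=; rewrite hP.
rewrite -?big_seq (E (fun y => (f x < f y)%N && (g y < g x)%N) (al x && ~~ be x)) => [|y yB]; last first.
  by have [-> _] := hf x y xU yB; have [_ ->] := hg x y xU yB.
rewrite (E (fun y => (f y < f x)%N && (g x < g y)%N) (~~ al x && be x)) => [|y yB]; last first.
  by have [_ ->] := hf x y xU yB; have [-> _] := hg x y xU yB.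
case: (al x); case: (be x) => /=; rewrite ?mulr1 ?mul1r //.
by apply: eq_bigr => y _; rewrite mulrC.
Qed.

End BlockSign.

Lemma nth_contract (X : Type) (x0 : X) u1 u2 u3 p m : m <> size u1 ->
  nth x0 (u1 ++ p :: u3) m =
  nth x0 (u1 ++ u2 ++ u3) (if (m < size u1)%N then m else m + size u2 - 1)%N.
Proof.
move=> ne; rewrite !nth_cat; case: (ltnP m (size u1)) => h; first by rewrite h.
have [h1 h2] : (size u1 <= m + size u2 - 1)%N /\ (size u2 <= m + size u2 - 1 - size u1)%N.
  by split; lia.
rewrite ltnNge h1 /= ltnNge h2 /=.
case em : (m - size u1)%N => [|n]; first lia.
by rewrite /=; congr nth; lia.
Qed.

Lemma over_mono (F : rtr) i m m' : m <> i -> m' <> i ->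
  (over F i m < over F i m')%N = (m < m')%N.
Proof.
have := graph_nvert (rtr_graph (rtrP F)); rewrite /over.
by case: (ltnP m i) => ?; case: (ltnP m' i) => ? ? ?; lia.
Qed.

Lemma over_block (F : rtr) i m v : m <> i -> (v < nvert F)%N ->
  (over F i m < i + v)%N = (m < i)%N /\ (i + v < over F i m)%N = ~~ (m < i)%N.
Proof. by rewrite /over; case: (ltnP m i) => ? ?; split; lia. Qed.

Lemma over_below (F : rtr) i m : m <> i -> (over F i m < i)%N = (m < i)%N.
Proof.
have := graph_nvert (rtr_graph (rtrP F)); rewrite /over.
by case: (ltnP m i) => ? ? ?; lia.
Qed.

Section IsoLaw.
Variables (k : fieldType) (A : gcoll k) (s : symm A).
Variables (T' S' F' T'' S'' F'' F u : rtr).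
Variables (f' : hom T' S') (f'' : hom T'' S'') (g : hom F u) (i j l : nat).
Variables (ef' : elementary f' i F') (ef'' : elementary f'' j F'').
Variables (w : iso T' T'') (t : iso S' S'') (wj : iso F F'').
Variables (hu : local_terminal u) (eg : elementary g l F').
Hypothesis square : comp_mor f'' w = comp_mor t f'.
Hypothesis treeF : tree F = fiber T' S'' (comp_mor f'' w) j.
Hypothesis morj : mor wj = induced T' T'' w f'' j.

Let cF : core F' = core F := core_unlabel (over_unlabel hu eg).
Let n := nvert F'.
Let nF : nvert F = n. Proof. by rewrite /n; case: cF. Qed.
Let nF'' : nvert F'' = n. Proof. by rewrite -(iso_nvert wj). Qed.

Let square_vert v : (v < nvert T')%N -> onvert f'' (onvert w v) = onvert t (onvert f' v).
Proof. by move=> hv; rewrite -!onvert_comp ?hom_phi_size // square. Qed.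

Let square_half h : (h < nhalf S'')%N -> onhalf w (onhalf f'' h) = onhalf f' (onhalf t h).
Proof. by move=> hh; rewrite -!onhalf_comp ?hom_psi_size // square. Qed.

Let fiber_square v : (v < nvert T')%N ->
  (onvert (comp_mor f'' w) v == j) = (onvert f' v == onvert (bwd t) j).
Proof.
move=> hv; rewrite square onvert_comp ?hom_phi_size //.
apply/eqP/eqP => [<-|->]; first by rewrite iso_bwdK // onvert_lt.
by rewrite iso_fwdK // (elt_lt ef'').
Qed.

(** The fiber of [f'] that corresponds to [j] has at least two vertices, while all fibers of [f']
    except the one over [i] have a single vertex. *)
Lemma square_index : onvert t i = j.
Proof.
have hj := elt_lt ef''; have n2 := edge_nvert (elt_edge ef').
suff -> : i = onvert (bwd t) j by rewrite iso_fwdK.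
apply: contrapT => ne.
have [e1 _] := elt_trivial ef' (onvert_lt (bwd t) hj) (nesym ne).
have := nF; rewrite treeF /= (_ : fiber_verts T' _ j = fiber_verts T' f' (onvert (bwd t) j)).
  by move: e1 => /= -> e; move: n2; rewrite -/n -e.
by apply/eq_in_filter => v; rewrite mem_iota => /andP[_ hv]; exact: fiber_square.
Qed.

Lemma square_index_bwd : onvert (bwd t) j = i.
Proof. by rewrite -square_index iso_bwdK // (elt_lt ef'). Qed.

Let V_eq : fiber_verts T' (comp_mor f'' w) j = iota i n.
Proof.
rewrite -(elt_fiber_verts ef') -square_index_bwd.
by apply/eq_in_filter => v; rewrite mem_iota => /andP[_ hv]; exact: fiber_square.
Qed.

Let H_eq : fiber_halves T' (comp_mor f'' w) j = fiber_halves T' f' i.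
Proof.
rewrite -square_index_bwd.
apply/eq_in_filter => h; rewrite mem_iota => /andP[_ hh].
by apply: fiber_square; exact: vertex_lt.
Qed.

Let H' := fiber_halves T' f' i.
Let H'' := fiber_halves T'' f'' j.

Lemma square_block v : (v < n)%N -> onvert w (i + v) = (j + onvert wj v)%N.
Proof.
move=> hv; rewrite morj {2}/onvert /= V_eq (nth_map 0%N) ?size_iota // nth_iota //.
have vT : (i + v < nvert T')%N by have := elt_nvert ef'; have := elt_lt ef'; rewrite -/n; lia.
have : onvert w (i + v) \in fiber_verts T'' f'' j.
  rewrite mem_filter mem_iota add0n onvert_lt // leq0n !andbT square_vert //.
  suff -> : onvert f' (i + v) = i by rewrite square_index.
  have : (i + v)%N \in fiber_verts T' f' i by rewrite (elt_fiber_verts ef') mem_iota -/n; lia.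
  by rewrite mem_filter => /andP[/eqP].
rewrite (elt_fiber_verts ef'') mem_iota => /andP[h1 h2].
set v' := onvert w (i + v) in h1 h2 *.
have -> : v' = nth 0%N (iota j (nvert F'')) (v' - j) by rewrite nth_iota; lia.
by rewrite index_uniq ?size_iota ?iota_uniq //; [rewrite nth_iota; lia | lia].
Qed.

Lemma square_onhalf h : (h < nhalf F'')%N ->
  nth 0%N H' (onhalf wj h) = onhalf w (nth 0%N H'' h).
Proof.
move=> hh; rewrite morj {1}/onhalf /= H_eq -/H' -/H''.
have sz := nhalf_fiber ef''; rewrite -/H'' in sz.
rewrite (nth_map 0%N) -?sz // nth_index //.
have := mem_nth 0%N (s := H'') (n := h); rewrite -sz => /(_ hh).
rewrite /H'' mem_fiber_halves => /andP[h1 /eqP h2].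
rewrite /H' mem_fiber_halves onhalf_lt //=.
have h3 := vertex_lt (onhalf_lt w h1).
rewrite -square_index_bwd -fiber_square // onvert_comp ?hom_phi_size //.
by rewrite (mor_vertex (morP w)) // h2.
Qed.

Lemma square_over m : (m < nvert S'')%N -> m <> j ->
  onvert (bwd t) m <> i /\ onvert (bwd w) (over F'' j m) = over F' i (onvert (bwd t) m).
Proof.
move=> hm ne; have hm' := onvert_lt (bwd t) hm.
have ne' : onvert (bwd t) m <> i.
  by move=> e; apply: ne; rewrite -square_index -e iso_fwdK.
split=> //; have ho := over_lt ef' hm'.
apply: (onvert_inj (w := w)) => //; first by apply: onvert_lt; exact: over_lt ef'' _ hm.
rewrite iso_fwdK; last exact: over_lt ef'' _ hm.
symmetry; apply: (over_uniq ef'' ne); first exact: onvert_lt.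
by rewrite square_vert // (onvert_over ef') // iso_fwdK.
Qed.

Section Values.
Variables (a : seq (packed A)).
Hypotheses (fa : fits T' a).
Variables (w1 w2 w3 z1 z2 z3 : seq (packed A)).
Hypotheses (ea : a = w1 ++ w2 ++ w3) (s1 : size w1 = i) (f2 : fits F' w2).
Hypotheses (ez : pin s w a = z1 ++ z2 ++ z3) (t1 : size z1 = j) (g2 : fits F'' z2).

Let s2 : size w2 = n. Proof. exact: fits_size f2. Qed.
Let t2 : size z2 = n. Proof. by rewrite (fits_size g2). Qed.
Let nn : (0 < n)%N. Proof. by have := edge_nvert (elt_edge ef'); rewrite -/n; lia. Qed.

Lemma square_inner_inputs : pin s wj w2 = z2.
Proof.
have jn : (j + n <= nvert T'')%N.
  by have := elt_nvert ef''; have := elt_lt ef''; rewrite nF''; lia.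
apply: (@eq_from_nth _ (p0 A)); rewrite size_pin ?t2 // => r hr; rewrite nF'' in hr.
have -> : nth (p0 A) z2 r = nth (p0 A) (pin s w a) (j + r).
  by rewrite ez nth_cat t1 ltnNge leq_addr /= addKn nth_cat t2 hr.
have hr'' : (r < nvert F'')%N by rewrite nF''.
have jr : (j + r < nvert T'')%N by lia.
rewrite !nth_pin //; set v := onvert (bwd wj) r.
have hv : (v < n)%N by rewrite -nF; exact: onvert_lt.
have ivT : (i + v < nvert T')%N by have := elt_nvert ef'; have := elt_lt ef'; rewrite -/n; lia.
have ev' : onvert (bwd w) (j + r) = (i + v)%N.
  apply: (onvert_inj (w := w)) => //; first exact: onvert_lt.
  by rewrite iso_fwdK // square_block // /v iso_fwdK.
have hh : halves F v = halves F' v by rewrite -[LHS]/(halves (core F) v) -cF.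
rewrite ev' (_ : nth _ a _ = nth (p0 A) w2 v); last first.
  by rewrite ea nth_cat s1 ltnNge leq_addr /= addKn nth_cat s2 hv.
have := iso_halves wj (v := v); rewrite nF => /(_ hv); rewrite /v iso_fwdK // -/v => rj.
rewrite -(prel_map _ (f := nth 0%N H') _ rj).
  rewrite hh (fiber_halvesE ef') // -(fiber_halvesE ef'') // -!map_comp; congr prel.
  apply/eq_in_map => h; rewrite mem_halves => /andP[hF _] /=.
  exact: square_onhalf.
move=> x y; rewrite hh !mem_halves => /andP[hx _] /andP[hy _] /eqP.
rewrite nth_uniq ?fiber_halves_uniq //; first by move/eqP.
all: by rewrite -(nhalf_fiber ef').
Qed.

(** Both sides pass from the local order at [i] to the one coming from [j], written in half-edges of
    the fiber on the left and in half-edges of [S'] on the right. *)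
Lemma square_inner_label (x : tot A) :
  rel s (reind (psi wj) (legs F')) (legs F'') x =
  rel s (halves S' i) [seq onhalf t h | h <- halves S'' j] x.
Proof.
have hF : labels F (legs F') by rewrite -[labels F _]/(labels (core F) _) -cF; exact: labels_legs.
have hr := labels_reind wj hF.
have r0 := labels_relabels hr (labels_legs F'').
have inj : {in reind (psi wj) (legs F') &, injective (onhalf wj)}.
  by move=> h h' /(labels_lt hr) i1 /(labels_lt hr) i2; exact: onhalf_inj.
rewrite -(rel_map _ _ r0 inj) -(labels_onhalf wj hF).
have ri := iso_halves t (elt_lt ef'); rewrite square_index in ri.
pose phi := fun x => index (onhalf f' x) H'.
have iphi : {in halves S' i &, injective phi}.
  move=> h h'; rewrite !mem_halves /phi => /andP[i1 /eqP v1] /andP[i2 /eqP v2] e.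
  apply: (onhalf_inj (f := f')) => //.
  have m1 : onhalf f' h \in H'.
    by rewrite mem_fiber_halves onhalf_lt //= (mor_vertex (morP f')) // v1.
  have m2 : onhalf f' h' \in H'.
    by rewrite mem_fiber_halves onhalf_lt //= (mor_vertex (morP f')) // v2.
  by rewrite -(nth_index 0%N m1) e nth_index.
rewrite -(rel_map _ _ ri iphi); congr rel; first by rewrite (legs_fiber ef').
rewrite (legs_fiber ef'') -!map_comp; apply/eq_in_map => h.
rewrite mem_halves => /andP[hh /eqP hv] /=; rewrite /phi -square_half //.
have m1 : onhalf f'' h \in H''.
  by rewrite mem_fiber_halves onhalf_lt //= (mor_vertex (morP f'')) // hv.
rewrite -/H'' -{2}(nth_index 0%N m1) -square_onhalf ?index_uniq ?fiber_halves_uniq //.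
  by rewrite -(nhalf_fiber ef') /= -[nhalf F']/(nhalf (core F')) cF; apply: onhalf_lt;
    rewrite (nhalf_fiber ef'') index_mem.
by rewrite (nhalf_fiber ef'') index_mem.
Qed.

Variables (q : int) (y : endT s F'' q).

Let D := q + degs w2.
Let b := w1 ++ pk (pi0 F') D (pull_sign wj w2 *: ev y (reind (psi wj) (legs F')) z2) :: w3.

Lemma square_outer_inputs :
  pin s t b = z1 ++ pk (pi0 F'') D (pull_sign wj w2 *: ev y (legs F'') z2) :: z3.
Proof.
have hF : labels F (legs F') by rewrite -[labels F _]/(labels (core F) _) -cF; exact: labels_legs.
have hr := labels_reind wj hF.
have zsz : size (z1 ++ z2 ++ z3) = nvert T'' by rewrite -ez size_pin.
apply: (@eq_from_nth _ (p0 A)); rewrite size_pin.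
  move: zsz; rewrite (elt_nvert ef'') !size_cat /= t1 t2 nF''.
  by have := elt_lt ef''; lia.
move=> m hm; rewrite nth_pin //.
have [->|/eqP ne] := eqVneq m j.
  rewrite square_index_bwd nth_cat t1 ltnn subnn /= /b nth_cat s1 ltnn subnn /=.
  rewrite prel_pk (_ : pi0 F' = pi0 F''); last first.
    rewrite (pi0_fiber ef') (pi0_fiber ef'') -square_index (iso_valence t) //.
    exact: elt_lt ef'.
  congr pk; rewrite -square_inner_label (linZ _ _ (rel_linear s _ _)); congr (_ *: _).
  by symmetry; apply: (endo_rel (evP y)); [exact: hr | exact: labels_legs].
have [ne' eo] := square_over hm ne.
rewrite (nth_contract _ z2) ?t1 // t2 -ez -nF'' -/(over F'' j m).
have ho := over_lt ef'' hm.
rewrite nth_pin // eo; set m' := onvert (bwd t) m in ne' eo *.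
have hm' : (m' < nvert S')%N := onvert_lt (bwd t) hm.
rewrite (nth_contract _ w2) ?s1 // s2 -ea -/(over F' i m').
have rt := iso_halves t hm'; rewrite iso_fwdK // in rt.
have inj : {in halves S' m' &, injective (onhalf f')}.
  by move=> h h'; rewrite !mem_halves => /andP[i1 _] /andP[i2 _]; exact: onhalf_inj.
rewrite -(prel_map _ _ rt inj) (over_onhalf ef') // -(over_onhalf ef'') // -!map_comp.
congr prel; apply/eq_in_map => h; rewrite mem_halves => /andP[hh _] /=.
by rewrite square_half.
Qed.

(** Vertices outside the block contribute equally to both sides, and vertices inside contribute
    [pull_sign wj w2]. A vertex that changes sides crosses the inputs of the block on the left; on
    the right it crosses these together with [y]. The two signs of bringing [y] to its block differ
    by exactly these crossings of [y]. *)
Lemma square_sign :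
  pull_sign w a * koszul k (q * degs z1) =
  koszul k (q * degs w1) * (pull_sign t b * pull_sign wj w2).
Proof.
have hi := elt_lt ef'; have hj := elt_lt ef''.
have nT' := elt_nvert ef'; rewrite -/n in nT'.
have nT'' := elt_nvert ef''; rewrite nF'' in nT''.
have nS := iso_nvert t; have nTT := iso_nvert w.
set r := (nvert S' - i.+1)%N.
(* [U'] lists the vertices of [S'] other than [i], and [U] the vertices of [T'] outside the
   block. *)
pose U' := iota 0 i ++ iota i.+1 r.
pose U := [seq over F' i m | m <- U'].
have mU' m : m \in U' -> (m < nvert S')%N /\ m <> i.
  by rewrite mem_cat !mem_iota /r; lia.
have pS : perm_eq (iota 0 (nvert S')) (U' ++ [:: i]).
  have -> : iota 0 (nvert S') = iota 0 i ++ i :: iota i.+1 r.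
    by rewrite -[in LHS](subnKC hi) addSnnS iotaD.
  by rewrite /U' -catA perm_cat2l -[i :: _]cat1s perm_catC.
have pT : perm_eq (iota 0 (nvert T')) (U ++ [seq (i + x)%N | x <- iota 0 n]).
  have -> : iota 0 (nvert T') = iota 0 i ++ iota i n ++ iota (i + n) r.
    by rewrite -iotaD -[X in iota X (n + r)]add0n -iotaD /r; congr iota; lia.
  have -> : U = iota 0 i ++ iota (i + n) r.
    rewrite /U map_cat; congr (_ ++ _).
      by apply: map_id_in => x; rewrite mem_iota /over => /andP[_]; rewrite add0n => ->.
    rewrite -[i.+1]addn1 -[(i + n)%N]addn0 !iotaDl -!map_comp.
    rewrite -[X in iota X]addn0 !iotaDl -!map_comp.
    by apply/eq_in_map => x _ /=; rewrite /over -/n; case: ltnP; lia.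
  have -> : [seq (i + x)%N | x <- iota 0 n] = iota i n.
    by rewrite -[in RHS](addn0 i) iotaDl.
  by rewrite -catA perm_cat2l perm_catC.
have onU m : m \in U' -> onvert w (over F' i m) = over F'' j (onvert t m) /\ onvert t m <> j.
  move=> /mU'[h1 h2]; have ne : onvert t m <> j.
    by rewrite -square_index => /onvert_inj e; apply: h2; exact: e.
  have [_ e] := square_over (onvert_lt t h1) ne; rewrite iso_bwdK // in e.
  by have lo := over_lt ef'' (onvert_lt t h1); rewrite -e iso_fwdK.
have dU m : m \in U' -> deg_at a (over F' i m) = deg_at b m.
  move=> /mU'[h1 h2]; rewrite /deg_at /b (nth_contract _ w2) ?s1 // s2.
  by rewrite ea /over.
(* Whether a vertex precedes the block before and after the isomorphism. *)
pose al m := (m < i)%N; pose be m := (onvert t m < j)%N.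
have E1 : pull_sign w a = sgk k id (onvert t) U' (deg_at b) * pull_sign wj w2 *
    \prod_(x <- U' | al x (+) be x) koszul k (deg_at b x * degs w2).
  rewrite /pull_sign (sgk_perm _ _ _ _ pT).
  rewrite (@sgk_block k id (onvert w) U _ _ (fun m => m < i)%N (fun m => onvert w m < j)%N).
  - congr (_ * _ * _).
    + rewrite sgk_map; apply: eq_sgk_rel => [x x' hx hx'|x x' hx hx'|x hx] /=.
      * by have [_ ?] := mU' _ hx; have [_ ?] := mU' _ hx'; rewrite over_mono.
      * by have [-> ?] := onU _ hx; have [-> ?] := onU _ hx'; rewrite over_mono.
      * exact: dU.
    + rewrite sgk_map nF; apply: eq_sgk_rel => [x x' hx hx'|x x' hx hx'|x hx] /=.
      * by rewrite ltn_add2l.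
      * move: hx hx'; rewrite !mem_iota !add0n => /andP[_ hx] /andP[_ hx'].
        by rewrite !square_block // ltn_add2l.
      * move: hx; rewrite mem_iota add0n => /andP[_ hx].
        by rewrite /deg_at ea nth_cat s1 ltnNge leq_addr /= addKn nth_cat s2 hx.
    + rewrite big_map big_map (degs_iota w2) s2 big_seq_cond [RHS]big_seq_cond.
      apply: eq_big => [x|x /andP[hx _]].
        case hx: (x \in U') => //=; have [-> ?] := onU _ hx; have [? ?] := mU' _ hx.
        by rewrite !over_below.
      rewrite dU //; congr (koszul k (_ * _)); rewrite !big_seq; apply: eq_bigr => v.
      rewrite mem_iota add0n => /andP[_ hv].
      by rewrite /deg_at ea nth_cat s1 ltnNge leq_addr /= addKn nth_cat s2 hv.
  - move=> _ _ /mapP[x hx ->] /mapP[v + ->]; rewrite mem_iota add0n => /andP[_ hv] /=.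
    by have [_ ?] := mU' _ hx; rewrite /n in hv; rewrite over_below //; exact: over_block.
  - move=> _ _ /mapP[x hx ->] /mapP[v + ->]; rewrite mem_iota add0n => /andP[_ hv] /=.
    have [-> ?] := onU _ hx; rewrite square_block // over_below //.
    by apply: over_block => //; apply: onvert_lt; rewrite nF.
have dgi : deg_at b i = q + degs w2.
  by rewrite /deg_at /b nth_cat s1 ltnn subnn.
have E2 : pull_sign t b = sgk k id (onvert t) U' (deg_at b) *
    \prod_(x <- U' | al x (+) be x) koszul k (deg_at b x * (q + degs w2)).
  rewrite /pull_sign (sgk_perm _ _ _ _ pS) (@sgk_block k id (onvert t) U' _ _ al be).
  - rewrite big_seq1 dgi; congr (_ * _); rewrite -[RHS]mulr1; congr (_ * _).
    by rewrite /sgk big_seq1 big_mkcond big_seq1 ltnn.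
  - move=> x y' hx; rewrite inE => /eqP ->; have [? ?] := mU' _ hx.
    by rewrite /al; split=> //; lia.
  - move=> x y' hx; rewrite inE => /eqP ->; have [_ ?] := onU _ hx.
    by rewrite square_index /be; split=> //; lia.
have sb : size b = nvert S'.
  have sa := fits_size fa; rewrite ea !size_cat s1 s2 in sa.
  by rewrite /b size_cat /= s1; lia.
have D1 : koszul k (q * degs w1) = \prod_(x <- U' | al x) koszul k (q * deg_at b x).
  rewrite -koszul_sum -mulr_sumr; congr (koszul k (q * _)).
  rewrite degs_iota s1 big_cat /= [X in _ = _ + X]big1_seq ?addr0; last first.
    by move=> x; rewrite mem_iota /al => /andP[? /andP[? _]]; lia.
  rewrite big_seq [RHS]big_seq_cond; apply: eq_big => x; rewrite mem_iota /al add0n /=.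
    by rewrite andbb.
  by move=> hx; rewrite /deg_at /b nth_cat s1 hx.
have D2 : koszul k (q * degs z1) = \prod_(x <- U' | be x) koszul k (q * deg_at b x).
  rewrite -koszul_sum -mulr_sumr; congr (koszul k (q * _)).
  pose c := pin s t b.
  have szc : size c = nvert S'' by rewrite size_pin.
  have ec := square_outer_inputs; rewrite -/b -/c in ec.
  transitivity (\sum_(x <- iota 0 (nvert S'') | (x < j)%N) deg_at c x).
    have -> : iota 0 (nvert S'') = iota 0 j ++ iota j (nvert S'' - j).
      by rewrite -{1}(subnKC (ltnW hj)) iotaD.
    rewrite big_cat /= [X in _ = _ + X]big1_seq ?addr0; last first.
      by move=> x; rewrite mem_iota => /andP[? /andP[? _]]; lia.
    rewrite degs_iota t1 big_seq [RHS]big_seq_cond; apply: eq_big => x; rewrite mem_iota add0n /=.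
      by rewrite andbb.
    by move=> hx; rewrite /deg_at ec nth_cat t1 hx.
  rewrite -(perm_big _ (iso_iota t)) big_map (perm_big _ pS) big_cat /=.
  rewrite [X in _ + X]big_mkcond big_seq1 square_index ltnn addr0.
  rewrite big_seq_cond [RHS]big_seq_cond; apply: eq_bigr => x /andP[/mU'[h1 _] _].
  by rewrite deg_pin.
rewrite E1 E2 D1 D2 -!mulrA; rewrite [RHS]mulrCA; congr (_ * _).
rewrite [RHS]mulrC -!mulrA [RHS]mulrC -!mulrA; congr (_ * _).
rewrite !(big_mkcond (fun x => al x (+) be x)) !(big_mkcond al) !(big_mkcond be).
rewrite -!big_split /=; apply: eq_bigr => x _.
case: (al x); case: (be x) => /=; rewrite ?mul1r ?mulr1 //.
  by rewrite mulrDr koszulD mulrA (mulrC q) koszul_sq mul1r.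
by rewrite mulrDr koszulD mulrC (mulrC q).
Qed.

End Values.

Lemma ecirc_iso (p q d : int) (e : d = p + q) (x : endT s S'' p) (y : endT s F'' q) :
  epull w (ecirc ef'' e x y) =
  ecirc ef' e (epull t x) (cast (esym (estrict s hu eg)) (epull wj y)).
Proof.
apply: evT_ext => lab a hl fa; rewrite ev_pull //.
have fz := fits_pin s w fa.
have [z1 [z2 [z3 [ez t1 g2 gS]]]] := fits_split ef'' fz.
have [w1 [w2 [w3 [ea s1 f2 fS]]]] := fits_split ef' fa.
rewrite ez in fz *; rewrite ev_circ ?(fits_size g2) //; last exact: labels_reind.
set Y := cast _ _; rewrite [in RHS]ea ev_circ ?(fits_size f2) //; last by rewrite -ea.
have hlab := labels_reind f' hl.
have hF : labels F (legs F') by rewrite -[labels F _]/(labels (core F) _) -cF; exact: labels_legs.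
have fF : fits F w2 by rewrite -[fits F _]/(fits (core F) _) -cF.
have ei := square_inner_inputs fa ea s1 f2 ez t1 g2.
have eY : inner Y w2 = pk (pi0 F') (q + degs w2)
    (pull_sign wj w2 *: ev y (reind (psi wj) (legs F')) z2).
  by rewrite /inner /Y (ev_strict (esym cF)) ev_pull // ei.
rewrite ev_pull //; last by apply: fS.
rewrite eY (square_outer_inputs fa ea s1 f2 ez t1 g2).
rewrite -(reind_comp square hl) (reind_comp erefl hl).
have dz : degs z2 = degs w2 by rewrite -ei degs_pin.
rewrite /inner dz /pk tot_scaleE slotZ !scalerA; congr (_ *: _).
by rewrite (square_sign fa ea s1 f2 ez t1 g2 y) mulrA.
Qed.

End IsoLaw.

Definition end_operad (k : fieldType) (A : gcoll k) (s : symm A) : operad k.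
Proof.
apply: (@Operad k (fun T => endT s T) (@epull k A s) (@ecirc k A s) (@eeta k A s)
  (@estrict k A s)).
- exact: epull_linear.
- exact: epull_id.
- exact: epull_comp.
- exact: ecirc_linearl.
- exact: ecirc_linearr.
- move=> T S P F G H f g h fi j i j' ef eg eh efi _; exact: ecirc_assoc.
- exact: ecirc_parallel.
- exact: ecirc_unit.
- exact: ecirc_iso.
Defined.

Local Open Scope ring_scope.

(** * Algebras as morphisms to an endomorphism operad *)

Section Inputs.
Variables (k : fieldType) (A : gcoll k).

Definition ins (T : rtr) (d : 'I_(nvert T) -> int) (a : inputs A d) :
  seq (packed A) := [seq pack (a v) | v <- enum 'I_(nvert T)].

Lemma arity_valence (T : rtr) v : arity T v = valence T v.
Proof.
rewrite /arity /pi0 /= size_map; congr (size _).-1.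
Qed.

Variables (T : rtr) (d : 'I_(nvert T) -> int) (a : inputs A d).

Lemma size_ins : size (ins a) = nvert T.
Proof. by rewrite size_map size_enum_ord. Qed.

Lemma nth_ins (v : 'I_(nvert T)) : nth (p0 A) (ins a) v = pack (a v).
Proof. by rewrite (nth_map v) ?size_enum_ord // nth_ord_enum. Qed.

Lemma fits_ins : fits T (ins a).
Proof.
apply/eqP; apply: (@eq_from_nth _ 0%N); rewrite size_map size_ins.
  by rewrite size_map size_iota.
move=> v hv; rewrite (nth_map (p0 A)) ?size_ins //.
rewrite -[v]/(val (Ordinal hv)) nth_ins (nth_map 0%N) ?size_iota // nth_iota //.
exact: arity_valence.
Qed.

Lemma degs_ins : degs (ins a) = \sum_v d v.
Proof. by rewrite /degs big_map big_enum. Qed.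

Lemma ins_eq w : size w = nvert T ->
  (forall v : 'I_(nvert T), nth (p0 A) w v = pack (a v)) -> ins a = w.
Proof.
move=> sz h; apply: (@eq_from_nth _ (p0 A)); rewrite size_ins // => v hv.
by rewrite -[v]/(val (Ordinal hv)) nth_ins h.
Qed.

Lemma ins_slot (v : 'I_(nvert T)) : exists w1 w2,
  forall x : A (arity T v) (d v),
    ins (dfwith (a : forall w : 'I_(nvert T), A (arity T w) (d w)) x : inputs A d) =
    w1 ++ pack x :: w2.
Proof.
have vin : v \in enum 'I_(nvert T) by rewrite mem_enum.
have un := enum_uniq 'I_(nvert T).
rewrite /ins; case/splitPr: vin un => e1 e2; rewrite cat_uniq /= negb_or.
case/and4P=> _ /andP[v1 _] v2 _.
exists [seq pack (a u) | u <- e1], [seq pack (a u) | u <- e2] => x.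
rewrite map_cat /= dfwith_in; congr (_ ++ _ :: _); apply/eq_in_map => u hu;
  rewrite dfwith_out //.
  by apply: contraNneq v1 => ->.
by apply: contraNneq v2 => ->.
Qed.

Lemma ins_terminal (v : 'I_(nvert T)) : local_terminal T -> ins a = [:: pack (a v)].
Proof.
move=> u1; apply: ins_eq => [|v']; first exact: esym u1.
have e0 (x : 'I_(nvert T)) : nat_of_ord x = 0%N.
  by have := ltn_ord x; move: (nat_of_ord x) => m; rewrite u1; case: m.
have -> : v' = v by apply: ord_inj; rewrite !e0.
by have := e0 v; move: (pack (a v)) => p; case: (nat_of_ord v).
Qed.

End Inputs.

Lemma degs_before (k : fieldType) (A : gcoll k) (T S F : rtr) (f : hom T S) i
  (ef : elementary f i F) (w1 w2 : seq (packed A)) : size w1 = i ->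
  \sum_(v < nvert T | (onvert f v < i)%N) deg_at (w1 ++ w2) v = degs w1.
Proof.
move=> s1; have hi := elt_lt ef; have nTv := elt_nvert ef.
have nFv : (0 < nvert F)%N := graph_nvert (rtr_graph (rtrP F)).
rewrite (degs_iota w1) s1.
rewrite -(big_mkord (fun v => (onvert f v < i)%N) (fun v => deg_at (w1 ++ w2) v)).
rewrite /index_iota subn0.
have -> : iota 0 (nvert T) = iota 0 i ++ iota i (nvert T - i).
  by rewrite -{2}[i]add0n -iotaD subnKC //; lia.
rewrite big_cat /= [X in _ + X]big1_seq ?addr0; last first.
  move=> v; rewrite mem_iota => /andP[h1 /andP[h2 h3]]; exfalso; move: h1.
  by rewrite (elt_onvert ef); [do !case: ifP => ?; lia | lia].
rewrite big_seq_cond [RHS]big_seq; apply: eq_big => v; rewrite mem_iota add0n /=.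
  case: ltnP => //= hv; rewrite (elt_onvert ef) ?hv //; lia.
by case/andP=> hv _; rewrite /deg_at nth_cat s1 hv.
Qed.

Section AlgebraOf.
Variables (k : fieldType) (A : gcoll k) (s : symm A) (M : operad k).
Variable Phi : operad_map M (end_operad s).

Definition end_of (T : rtr) d (m : M T d) : endo s (core T) d := opmap Phi m.

(** The inputs of the result are numbered by the global order of [T], and the component of the
    expected arity and degree is the only one that can be nonzero ([act_ofE]). *)
Definition act_of : action M A := fun T p n d _ m a =>
  ev (end_of m) (legs T) (ins a) (pi0 T) n.

Lemma act_ofE (T : rtr) (p n : int) (d : 'I_(nvert T) -> int)
    (e : n = p + \sum_v d v) (m : M T p) (a : inputs A d) :
  tin (pack (act_of e m a)) = ev (end_of m) (legs T) (ins a).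
Proof.
apply: tin_pk => c' d' h; apply: ev_wrong => -[h1 h2]; apply: h.
by move: h1; rewrite size_legs degs_ins in h2 * => -[->]; rewrite h2 e.
Qed.

Lemma act_of_inner (S F : rtr) (q n : int) (d : 'I_(nvert F) -> int)
    (e : n = q + \sum_v d v) (m : M F q) (a : inputs A d) :
  pack (act_of e m a) = inner (end_of m : endT s F q) (ins a).
Proof. by rewrite /inner degs_ins -e. Qed.

Lemma product_pull_sign (T S : rtr) (w : iso T S) (d : 'I_(nvert T) -> int) (a : inputs A d) :
  pull_sign w (ins a) = \prod_(v < nvert T)
     \prod_(v' < nvert T | (v < v')%N && (onvert w v' < onvert w v)%N)
        koszul k (d v * d v').
Proof.
have ei : iota 0 (nvert T) = index_iota 0 (nvert T) by rewrite /index_iota subn0.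
have dv (v : 'I_(nvert T)) : deg_at (ins a) v = d v by rewrite /deg_at nth_ins.
rewrite /pull_sign /sgk ei big_mkord; apply: eq_bigr => v _.
by rewrite big_mkord; apply: eq_bigr => v' _; rewrite !dv.
Qed.

(** The fiber of [w] over a vertex is a one-vertex tree with local order from [T] and legs in the
    order of [S]. Its unit therefore performs the renumbering that occurs in [pin]. *)
Lemma acts_by_prel (T S u : rtr) (w : iso T S) (v : nat) (p q : packed A) :
  (v < nvert T)%N -> ar p = valence T v ->
  tree u = fiber T S w (onvert w v) -> acts_by act_of u p q ->
  q = prel s (halves T v) [seq onhalf w h | h <- halves S (onvert w v)] p.
Proof.
move=> hv hp tu [U [hU [b [d [n [e [x [hx ->]]]]]]]].
have fv : fiber_verts T w (onvert w v) = [:: v].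
  rewrite /fiber_verts (@eq_in_filter _ _ (pred1 v)) => [|v']; last first.
    rewrite mem_iota add0n => /andP[_ hv'] /=; apply/eqP/eqP => [|-> //].
    exact: onvert_inj.
  by rewrite filter_pred1_uniq ?iota_uniq // mem_iota.
have fh : fiber_halves T w (onvert w v) = halves T v.
  apply/eq_in_filter => h; rewrite mem_iota add0n => /andP[_ hh].
  by apply/eqP/eqP => [|-> //]; apply: onvert_inj => //; exact: vertex_lt.
have u1 : local_terminal u by rewrite /local_terminal tu /= fv.
have v0 : 'I_(nvert u) by rewrite u1; exact: ord0.
have hu : halves u 0 = [seq index h (halves T v) | h <- halves T v].
  rewrite map_index_uniq ?halves_uniq //.
  have <- : nhalf u = size (halves T v) by rewrite tu /nhalf /= size_map fh.
  by apply/all_filterP/allP => h; rewrite mem_iota add0n => /andP[_ hh];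
    apply/eqP/terminal_vertex.
have lu : legs u = [seq index h (halves T v) | h <- [seq onhalf w h | h <- halves S (onvert w v)]].
  by rewrite tu /= fh -map_comp.
have vu : ar p = valence u 0.
  by rewrite /valence hu size_map.
rewrite /act_of (ins_terminal x v0 u1) hx.
have dn : n = dg p.
  rewrite e add0r -(degs_ins x) (ins_terminal x v0 u1) hx /degs big_seq1 //.
have -> : end_of (pull b (eta M hU)) = epull b (eeta s hU).
  by rewrite /end_of omap_pull omap_eta.
rewrite ev_pull_eta ?labels_legs //.
have -> : pi0 u = ar p.
  by rewrite /pi0 lu size_map -(relabels_size (iso_halves w hv)) hp.
have E l l' : pk (ar p) (dg p) (rel s l l' (tin p)) = prel s l l' p.
  by rewrite -prel_pk pk_tin.
rewrite dn -[LHS]/(pk (ar p) (dg p) _) E hu lu prel_map //.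
  exact: iso_halves.
move=> h h' i1 i2 e'; by rewrite -(nth_index 0%N i1) e' nth_index.
Qed.

Definition algebra_of : algebra M A.
Proof.
apply: (@Algebra k M A act_of).
- move=> T p n d e a c m m'; rewrite /act_of /end_of omap_linear.
  by rewrite evT_lin.
- move=> T p n d e m a v c x y; have [w1 [w2 hw]] := ins_slot a v.
  by rewrite /act_of !hw (endo_slot (evP _)).
- move=> U hU n d e a v; have [u1 _] := hU.
  have ar0 : ar (pack (a v)) = valence U 0.
    by have := fits_ins a; rewrite (ins_terminal a v u1) => /(fits_terminal u1)[p' [<-]].
  rewrite /act_of (ins_terminal a v u1) /end_of omap_eta.
  rewrite -[ev _]/(ev (eeta s hU)) ev_eta ?labels_legs //.
  rewrite -(trivial_halves hU) rel_id ?halves_uniq //.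
  have -> : pi0 U = ar (pack (a v)).
    by rewrite ar0 /pi0 -(trivial_halves hU).
  have -> : n = dg (pack (a v)).
    by rewrite e add0r -(degs_ins a) (ins_terminal a v u1) /degs big_seq1.
  exact: pk_tin.
- move=> T S F f i ef p q r e m m' dT dS dF nT nS nF eT eS eF a b a' ha' hb hbi.
  have [w1 [w2 [w3 [ew s1 f2 f3]]]] := fits_split ef (fits_ins a).
  have nFv : (0 < nvert F)%N := graph_nvert (rtr_graph (rtrP F)).
  have nTv := elt_nvert ef; have hi := elt_lt ef; have s2 := fits_size f2.
  have ea' : ins a' = w2.
    apply: ins_eq => // l.
    have hv : (i + l < nvert T)%N by move: (ltn_ord l); lia.
    rewrite (ha' l (Ordinal hv)) -?nth_ins; last first.
      by rewrite (elt_fiber_verts ef) nth_iota // ltn_ord.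
    by rewrite ew nth_cat s1 ltnNge leq_addr /= addKn nth_cat s2 ltn_ord.
  have eb : ins b = w1 ++ inner (end_of m' : endT s F q) w2 :: w3.
    have sT := size_ins a; rewrite ew !size_cat s1 s2 in sT.
    apply: ins_eq => [|v]; first by rewrite size_cat /= s1; lia.
    have [e1|/eqP ne] := eqVneq (val v) i.
      rewrite (hbi v e1) (act_of_inner S) ea' e1 nth_cat s1 ltnn subnn //.
    have hv := over_lt ef (ltn_ord v).
    rewrite (hb v (Ordinal hv) ne); last exact: (onvert_over ef (ltn_ord v) ne).
    by rewrite -nth_ins (nth_contract _ w2) ?s1 // s2 -ew.
  rewrite /act_of /end_of omap_circ -[ev _]/(ev (ecirc ef e (end_of m : endT s S p) (end_of m' : endT s F q))).
  have fa := fits_ins a; rewrite ew in fa *.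
  rewrite ev_circ ?labels_legs // reind_legs -eb.
  have -> : \sum_(v < nvert T | (onvert f v < i)%N) dT v = degs w1.
    rewrite (eq_bigr (fun v : 'I__ => deg_at (ins a) v)); last first.
      by move=> v _; rewrite /deg_at nth_ins.
    by rewrite ew; apply: (degs_before ef) => //; rewrite -ew.
  have <- : pi0 S = pi0 T.
    by rewrite /pi0 -(mor_legs (morP f)) size_map.
  suff -> : nT = nS by [].
  rewrite eS eT e -(degs_ins a) -(degs_ins b) eb ew !degs_cat degs_cons -[dg _]/(q + degs w2).
  by lia.
- move=> T S w p m dT dS nT nS eT eS a b h.
  rewrite -(product_pull_sign w a).
  have eb : ins b = pin s w (ins a).
    apply: ins_eq => [|j]; first by rewrite size_pin.
    rewrite nth_pin; last exact: ltn_ord.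
    have hv := onvert_lt (bwd w) (ltn_ord j); set v := Ordinal hv.
    rewrite -[onvert _ _]/(val v) nth_ins.
    have wv : onvert w v = j by rewrite /= iso_fwdK.
    have [u tu hu] := h j v wv; rewrite -wv in tu.
    rewrite (acts_by_prel _ _ tu hu) ?wv //.
    exact: arity_valence.
  rewrite /act_of /end_of omap_pull -[ev _]/(ev (epull w (end_of m : endT s S p))).
  rewrite ev_pull ?labels_legs ?fits_ins // reind_legs -eb.
  have <- : pi0 S = pi0 T by rewrite /pi0 -(mor_legs (morP w)) size_map.
  suff -> : nT = nS by [].
  by rewrite eS eT -(degs_ins a) -(degs_ins b) eb degs_pin // fits_ins.
Defined.

End AlgebraOf.

Local Open Scope ring_scope.

(** * Units at one-vertex trees *)

Section Terminal.
Implicit Types (u U : rtr).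

Lemma terminal_corolla u : local_terminal u -> tree u = corolla (nhalf u) (legs u).
Proof.
move=> u1; have gu := rtr_graph (rtrP u).
rewrite [LHS](_ : _ = OTree (nvert u) (src u) (flip u) (legs u)); last by case: (tree u).
rewrite u1; congr OTree.
  apply: (@eq_from_nth _ 0%N) => [|h hh]; first by rewrite size_nseq.
  by rewrite nth_nseq if_same -/(vertex u h) terminal_vertex.
apply: (@eq_from_nth _ 0%N) => [|h]; rewrite (graph_size gu) ?size_iota // => hh.
by rewrite nth_iota // -/(mate u h) terminal_mate.
Qed.

Lemma terminal_legs u : local_terminal u -> perm_eq (legs u) (iota 0 (nhalf u)).
Proof.
move=> u1; apply: perm_trans (graph_legs (rtr_graph (rtrP u))) _.
rewrite (_ : [seq _ <- _ | _] = iota 0 (nhalf u)) //; apply/all_filterP/allP => h.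
by rewrite mem_iota add0n => /andP[_ hh]; rewrite terminal_mate.
Qed.

Lemma terminal_iso u : local_terminal u ->
  exists (U : rtr) (_ : trivial_tree U), inhabited (iso u U).
Proof.
move=> u1; have h0 : (0 < nhalf u)%N by apply: leq_ltn_trans (legs_lt (root_leg u)).
exact: (corolla_trivial h0 (terminal_legs u1) (terminal_corolla u1)).
Qed.

Lemma trivial_eq U U' : trivial_tree U -> trivial_tree U' -> nhalf U = nhalf U' -> U = U'.
Proof.
move=> [h1 l1] [h2 l2] e; apply: rtr_eq.
by rewrite (terminal_corolla h1) (terminal_corolla h2) l1 l2 e.
Qed.

Lemma iso_trivial u U (b : iso u U) : trivial_tree U ->
  mor b = PreMor (legs u) [:: 0%N].
Proof.
move=> [U1 lU].
have e1 : psi b = legs u.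
  rewrite -(mor_legs (morP b)) lU -(hom_psi_size b).
  exact: (esym (mkseq_nth 0%N (psi b))).
have e2 : phi b = [:: 0%N].
  have := iso_phi_perm b; rewrite U1; case: (phi b) => [|x [|y ph]] p;
    have := perm_size p; rewrite // => _.
  by have := perm_mem p x; rewrite !inE eqxx => /esym/eqP ->.
by rewrite -e1 -e2; case: (mor b).
Qed.

(** The functoriality axiom mentions underlying maps only; applied to the composite with an
    identity, it shows that [pull] does not see the rest of the record. *)
Lemma premor_pull (k : fieldType) (M : operad k) T S (v w : iso T S) d (x : M S d) :
  mor v = mor w -> pull v x = pull w x.
Proof.
move=> e; rewrite (pull_comp (v := w) (w := id_iso S) (vw := v)) ?pull_id //.
by rewrite e; symmetry; exact: (comp_mor_id (morP w)).
Qed.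

(** A trivial tree is determined by its number of half-edges, and the isomorphism to it is
    unique. *)
Lemma eta_at_ex (k : fieldType) (M : operad k) u : local_terminal u ->
  exists m : M u 0, forall U (hU : trivial_tree U) (b : iso u U), m = pull b (eta M hU).
Proof.
move=> u1; have [U [hU [b]]] := terminal_iso u1.
exists (pull b (eta M hU)) => U' hU' b'.
have e : U = U' by apply: trivial_eq => //; rewrite -(iso_nhalf b) -(iso_nhalf b').
case: U' / e hU' b' => hU' b'; rewrite (Prop_irrelevance hU' hU).
by apply: premor_pull; rewrite !iso_trivial.
Qed.

Definition eta_at (k : fieldType) (M : operad k) u (hu : local_terminal u) : M u 0 :=
  sval (cid (eta_at_ex M hu)).

Lemma eta_atE (k : fieldType) (M : operad k) u U (hu : local_terminal u)
  (hU : trivial_tree U) (b : iso u U) : eta_at M hu = pull b (eta M hU).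
Proof. by rewrite /eta_at; case: cid => m h; exact: h. Qed.

Lemma eta_at_trivial (k : fieldType) (M : operad k) U (hu : local_terminal U)
  (hU : trivial_tree U) : eta_at M hu = eta M hU.
Proof. by rewrite (eta_atE M hu hU (id_iso U)) pull_id. Qed.

Lemma pull_eta_at (k : fieldType) (M : operad k) u u' (hu : local_terminal u)
  (hu' : local_terminal u') (w : iso u u') : pull w (eta_at M hu') = eta_at M hu.
Proof.
have [U [hU [b']]] := terminal_iso hu'; have [U1 [hU1 [b1]]] := terminal_iso hu.
have e : U = U1.
  by apply: trivial_eq => //; rewrite -(iso_nhalf b') -(iso_nhalf b1) (iso_nhalf w).
case: U1 / e hU1 b1 => _ b1.
rewrite (eta_atE M hu' hU b') (eta_atE M hu hU b1) -(pull_comp (vw := b1)) //.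
rewrite (iso_trivial b1 hU) (iso_trivial b' hU) /comp_mor /=; congr PreMor.
  by rewrite (mor_legs (morP w)).
have := iso_phi_perm w; rewrite hu' => p.
by case: (phi w) p => [|x [|y ph]] p; have := perm_size p; rewrite // => _;
  have := perm_mem p x; rewrite !inE eqxx => /esym/eqP ->.
Qed.

End Terminal.

(** * Actions of an algebra on untyped lists of inputs *)

Section UntypedAction.
Variables (k : fieldType) (A : gcoll k) (M : operad k) (al : algebra M A).

Lemma ins_surj (T : rtr) w : fits T w ->
  exists (d : 'I_(nvert T) -> int) (a : inputs A d), ins a = w.
Proof.
move=> fw; exists (fun v => dg (nth (p0 A) w v)).
have ex (v : 'I_(nvert T)) : exists x : A (arity T v) (dg (nth (p0 A) w v)),
    pack x = nth (p0 A) w v.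
  rewrite arity_valence -(fits_nth fw (ltn_ord v) (p0 A)).
  by exists (el (nth (p0 A) w v)); exact: pack_el.
exists (fun v => sval (cid (ex v))); apply: ins_eq => [|v]; first exact: fits_size.
by case: cid.
Qed.

Lemma pack_inj c d (x y : A c d) : pack x = pack y -> x = y.
Proof. by move=> e; rewrite -(tin_pack x) e tin_pack. Qed.

Lemma ins_inj (T : rtr) (p n n' : int) (d d' : 'I_(nvert T) -> int)
  (e : n = p + \sum_v d v) (e' : n' = p + \sum_v d' v) (m : M T p)
  (a : inputs A d) (a' : inputs A d') :
  ins a = ins a' -> pack (alg_act al e m a) = pack (alg_act al e' m a').
Proof.
move=> h; have h' v : pack (a v) = pack (a' v) by rewrite -!nth_ins h.
have ed : d = d' by apply: funext => v; have := f_equal (@dg k A) (h' v).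
case: d' / ed e' a' h h' => e' a' _ h'.
have ea : a = a' by apply: functional_extensionality_dep => v; exact: pack_inj.
case: a' / ea {h'}; have en : n = n' by rewrite e e'.
by case: n' / en e' => e'; rewrite (Prop_irrelevance e e').
Qed.

Lemma pack_castA c c' d d' (ec : c = c') (ed : d = d') (x : A c d) :
  pack (castA ec ed x) = pack x.
Proof. by case: c' / ec; case: d' / ed. Qed.

Lemma castA_linear c c' d d' (ec : c = c') (ed : d = d') :
  linear (@castA k A c c' d d' ec ed).
Proof. by case: c' / ec; case: d' / ed. Qed.

(** Without the types of the inputs, lists can be cut and joined exactly as in the endomorphism
    operad. The default [p0] is returned for lists that are not inputs of [T]. *)
Definition aUp (T : rtr) p (m : M T p) (w : seq (packed A)) : packed A :=
  if pselect (exists (d : 'I_(nvert T) -> int) (a : inputs A d), ins a = w) is left h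
  then pack (alg_act al erefl m (sval (cid (proj2_sig (cid h))))) else p0 A.

Lemma aUpE (T : rtr) (p n : int) (d : 'I_(nvert T) -> int)
  (e : n = p + \sum_v d v) (m : M T p) (a : inputs A d) :
  aUp m (ins a) = pack (alg_act al e m a).
Proof.
rewrite /aUp; case: pselect => [h|[]]; last by exists d, a.
by apply: ins_inj; case: (cid (proj2_sig (cid h))).
Qed.

Definition aT (T : rtr) p (m : M T p) w : tot A := tin (aUp m w).

Lemma aUp_ar (T : rtr) p (m : M T p) w : fits T w -> ar (aUp m w) = pi0 T.
Proof. by move=> /ins_surj[d [a <-]]; rewrite (aUpE erefl). Qed.

Lemma aUp_dg (T : rtr) p (m : M T p) w : fits T w -> dg (aUp m w) = p + degs w.
Proof. by move=> /ins_surj[d [a <-]]; rewrite (aUpE erefl) degs_ins. Qed.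

Lemma aUp_pk (T : rtr) p (m : M T p) w : fits T w ->
  aUp m w = pk (pi0 T) (p + degs w) (aT m w).
Proof. by move=> fw; rewrite -(aUp_ar m fw) -(aUp_dg m fw) pk_tin. Qed.

Lemma aT_linear (T : rtr) p w : fits T w -> linear (fun m : M T p => aT m w).
Proof.
move=> /ins_surj[d [a <-]] b m m'.
by rewrite /aT !(aUpE erefl) act_linearl tin_linear.
Qed.

Lemma aT_slot (T : rtr) p (m : M T p) w1 w2 c d :
  [seq ar p | p <- w1] ++ c :: [seq ar p | p <- w2] = valences T ->
  linear (fun x : A c d => aT m (w1 ++ pack x :: w2)).
Proof.
move=> hw b x y.
have fw (z : A c d) : fits T (w1 ++ pack z :: w2) by rewrite /fits map_cat /= hw.
have [dd [a ea]] := ins_surj (fw 0).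
have hv : (size w1 < nvert T)%N.
  by rewrite -(fits_size (fw 0)) size_cat /= addnS ltnS leq_addr.
pose v := Ordinal hv; have av : pack (a v) = pack (0 : A c d).
  by rewrite -nth_ins ea nth_cat ltnn subnn.
have ec : arity T v = c by have := f_equal (@ar k A) av.
have ed : dd v = d by have := f_equal (@dg k A) av.
have key (z : A c d) :
    ins (dfwith (a : forall w : 'I_(nvert T), A (arity T w) (dd w))
      (castA (esym ec) (esym ed) z) : inputs A dd) = w1 ++ pack z :: w2.
  apply: ins_eq => [|v']; first exact: fits_size.
  case: dfwithP => [|u vu].
    by rewrite nth_cat ltnn subnn pack_castA.
  rewrite -nth_ins ea !nth_cat; case: ifP => // h.
  case en : (u - size w1)%N => [|n] //; case/eqP: vu; apply: ord_inj => /=.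
  by move/negbT: h; rewrite -leqNgt => h; apply/eqP; rewrite eqn_leq h /leq en.
by rewrite -!key /aT !(aUpE erefl) castA_linear act_linearr tin_linear.
Qed.

Lemma aT_circ (T S F : rtr) (f : hom T S) i (ef : elementary f i F)
  (p q r : int) (e : r = p + q) (m : M S p) (m' : M F q) w1 w2 w3 :
  size w1 = i -> size w2 = nvert F -> fits T (w1 ++ w2 ++ w3) ->
  aT (circ ef e m m') (w1 ++ w2 ++ w3) =
  koszul k (q * degs w1) *: aT m (w1 ++ aUp m' w2 :: w3).
Proof.
move=> s1 s2 fT; have [a' [aa' ea']] := ins_surj (fits_contract ef s1 s2 (p := pk (pi0 F) 0 0) erefl fT).2.
have [dT [a ea]] := ins_surj fT.
have [fS fF] := fits_contract ef s1 s2 (aUp_ar m' (fits_contract ef s1 s2 (p := pk (pi0 F) 0 0) erefl fT).2) fT.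
have [dS [b eb]] := ins_surj fS.
have hi := elt_lt ef; have nT := elt_nvert ef; have sT := fits_size fT.
rewrite !size_cat s1 s2 in sT.
have nthT (v : 'I_(nvert T)) : pack (a v) = nth (p0 A) (w1 ++ w2 ++ w3) v by rewrite -nth_ins ea.
have nthS (v : 'I_(nvert S)) : pack (b v) = nth (p0 A) (w1 ++ aUp m' w2 :: w3) v by rewrite -nth_ins eb.
have nthF (v : 'I_(nvert F)) : pack (aa' v) = nth (p0 A) w2 v by rewrite -nth_ins ea'.
have := @act_circ k M A al T S F f i ef p q r e m m' dT dS a' _ _ _ erefl erefl erefl a b aa'.
have -> : \sum_(v < nvert T | (onvert f v < i)%N) dT v = degs w1.
  rewrite (eq_bigr (fun v : 'I__ => deg_at (ins a) v)); last first.
    by move=> v _; rewrite /deg_at nth_ins.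
  by rewrite ea; exact: (degs_before ef).
move=> h; rewrite /aT -[in LHS]ea -eb !(aUpE erefl) h.
- exact: (linZ _ _ (@tin_linear k A _ _)).
- move=> l v; rewrite (elt_fiber_verts ef) nth_iota // => ev'.
  by rewrite nthF nthT -ev' nth_cat s1 ltnNge leq_addr /= addKn nth_cat s2 ltn_ord.
- move=> w v ne ev'; rewrite nthS nthT (nth_contract _ w2) ?s1 // s2.
  by rewrite (over_uniq ef ne (ltn_ord v) ev').
- by move=> w ew; rewrite nthS ew nth_cat s1 ltnn subnn /= -ea' (aUpE erefl).
Qed.

End UntypedAction.

Local Open Scope ring_scope.

(** * The symmetric group actions of an algebra *)

Section IsoFiber.
Variables (T S : rtr) (w : iso T S) (v : nat).
Hypothesis hv : (v < nvert T)%N.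

Definition vertex_labels :=
  [seq index (onhalf w h) (halves T v) | h <- halves S (onvert w v)].

Lemma iso_fiber :
  fiber T S w (onvert w v) = corolla (size (halves T v)) vertex_labels.
Proof.
have fv : fiber_verts T w (onvert w v) = [:: v].
  rewrite /fiber_verts (@eq_in_filter _ _ (pred1 v)) => [|v']; last first.
    rewrite mem_iota add0n => /andP[_ hv'] /=; apply/eqP/eqP => [|-> //].
    exact: onvert_inj.
  by rewrite filter_pred1_uniq ?iota_uniq // mem_iota.
have fh : fiber_halves T w (onvert w v) = halves T v.
  apply/eq_in_filter => h; rewrite mem_iota add0n => /andP[_ hh].
  by apply/eqP/eqP => [|-> //]; apply: onvert_inj => //; exact: vertex_lt.
rewrite /fiber fv fh /corolla; congr OTree.
- have e (r : seq nat) : {in r, forall h, vertex T h = v} ->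
      [seq index (vertex T h) [:: v] | h <- r] = nseq (size r) 0%N.
    elim: r => //= h r IH hr; rewrite (hr h) ?mem_head //= eqxx IH // => x xr.
    by apply: hr; rewrite inE xr orbT.
  by apply: e => h; rewrite mem_halves => /andP[_ /eqP].
- rewrite -map_index_uniq ?halves_uniq //; apply/eq_in_map => h.
  rewrite mem_halves => /andP[hh _].
  suff -> : h \in psi w by [].
  by rewrite -(iso_onhalfK w hh) mem_nth // hom_psi_size onhalf_lt.
Qed.

Lemma vertex_labels_relabels :
  relabels (iota 0 (size (halves T v))) vertex_labels.
Proof.
rewrite -map_index_uniq ?halves_uniq // /vertex_labels (map_comp (fun h => index h (halves T v)) (onhalf w)).
apply: relabels_map; last exact: iso_halves.
  by rewrite size_halves.
by move=> h h' i1 i2 e'; rewrite -(nth_index 0%N i1) e' nth_index.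
Qed.

Lemma iso_fiber_rtr : is_rtr (fiber T S w (onvert w v)).
Proof.
rewrite iso_fiber; have /and3P[_ p /eqP e] := vertex_labels_relabels.
apply: corolla_rtr; first by rewrite size_halves.
  by rewrite perm_sym.
by rewrite -e size_halves.
Qed.

End IsoFiber.

Section PermCorolla.
Variable n : nat.
Implicit Types s t : 'S_n.

Definition perm_list s : seq nat := 0%N :: [seq (s i).+1 | i <- enum 'I_n].

Lemma size_perm_list s : size (perm_list s) = n.+1.
Proof. by rewrite /= size_map size_enum_ord. Qed.

Lemma nth_perm_list s (i : 'I_n) : nth 0%N (perm_list s) i.+1 = (s i).+1.
Proof. by rewrite /= (nth_map i) ?size_enum_ord // nth_ord_enum. Qed.

Lemma perm_list1 : perm_list 1 = iota 0 n.+1.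
Proof.
rewrite /perm_list /=; congr (_ :: _).
under eq_map do rewrite perm1.
by rewrite -[1%N]addn0 iotaDl -val_enum_ord -map_comp; apply: eq_map.
Qed.

Lemma perm_listM s t : [seq nth 0%N (perm_list s) h | h <- perm_list t] = perm_list (t * s).
Proof.
rewrite {2}/perm_list /= -map_comp; congr (_ :: _); apply: eq_map => i.
by rewrite permM [LHS](nth_perm_list s (t i)).
Qed.

Lemma perm_list_perm s : perm_eq (perm_list s) (iota 0 n.+1).
Proof.
rewrite -perm_list1 perm_cons (map_comp (fun j : 'I_n => j.+1) s).
rewrite (map_comp (fun j : 'I_n => j.+1) (1%g : 'S_n)).
under [X in perm_eq _ (map _ X)]eq_map do rewrite perm1.
apply: perm_map; rewrite map_id; apply: uniq_perm; rewrite ?enum_uniq //.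
  by rewrite map_inj_uniq ?enum_uniq //; exact: perm_inj.
move=> i; rewrite mem_enum; apply/mapP; exists (s^-1%g i); first by rewrite mem_enum.
by rewrite permKV.
Qed.

(** The one-vertex tree whose global order is the permutation [s] of its local order. Its unit
    defines the action of [s] on elements of arity [n]. *)
Definition cor s : rtr := RTr (corolla_rtr (ltn0Sn n) (perm_list_perm s) erefl).

Lemma cor_terminal s : local_terminal (cor s). Proof. by []. Qed.

Lemma cor_nhalf s : nhalf (cor s) = n.+1.
Proof. exact: corolla_nhalf. Qed.

Lemma cor_halves s : halves (cor s) 0 = iota 0 n.+1.
Proof.
rewrite /halves cor_nhalf; apply/all_filterP/allP => h _.
by rewrite (@corolla_vertex n.+1).
Qed.

Lemma cor_iso_mor s t : is_mor (cor (t * s)) (cor t) (PreMor (perm_list s) [:: 0%N]).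
Proof. by apply: corolla_mor; rewrite ?perm_list_perm // perm_listM. Qed.

Lemma cor_iso_comp s t :
  comp_mor (PreMor (perm_list s^-1) [:: 0%N]) (PreMor (perm_list s) [:: 0%N]) =
  id_mor (cor t).
Proof.
rewrite /id_mor cor_nhalf /comp_mor; congr PreMor.
by rewrite -[RHS]perm_list1 -(mulVg s) -perm_listM.
Qed.

Lemma cor_bwd_mor s t : is_mor (cor t) (cor (t * s)) (PreMor (perm_list s^-1) [:: 0%N]).
Proof. by have := cor_iso_mor s^-1 (t * s); rewrite mulgK. Qed.

Lemma cor_fwd_comp s t :
  comp_mor (PreMor (perm_list s) [:: 0%N]) (PreMor (perm_list s^-1) [:: 0%N]) =
  id_mor (cor t).
Proof. by have := cor_iso_comp s^-1 t; rewrite invgK. Qed.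

Definition cor_iso s t : iso (cor (t * s)) (cor t) :=
  @Iso _ _ (Hom (cor_iso_mor s t)) (Hom (cor_bwd_mor s t))
    (cor_iso_comp s (t * s)) (cor_fwd_comp s t).

Lemma cor_isoE s t : mor (cor_iso s t) = PreMor (perm_list s) [:: 0%N].
Proof. by []. Qed.

Lemma cor_relperm (u : rtr) : tree u = corolla n.+1 (legs u) ->
  relabels (iota 0 n.+1) (legs u) -> u = cor (relperm n (iota 0 n.+1) (legs u)).
Proof.
move=> eu r; apply: rtr_eq; rewrite eu /=; congr corolla.
have [_ hs] := relpermP (c := n) r (esym (size_iota 0 n.+1)).
have sz := relabels_size r; rewrite size_iota in sz.
apply: (@eq_from_nth _ 0%N); first by rewrite size_perm_list.
move=> [|i] hi; first by case/and3P: r => _ _ /eqP; rewrite -!nth0 /= => <-.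
rewrite -sz ltnS in hi; rewrite -[i]/(val (Ordinal hi)) nth_perm_list hs.
by rewrite nth_iota // ltnS.
Qed.

End PermCorolla.

Section SymmOf.
Variables (k : fieldType) (A : gcoll k) (M : operad k) (al : algebra M A).

Definition act1 (u : rtr) (hu : local_terminal u) (p : packed A) : packed A :=
  aUp al (eta_at M hu) [:: p].

Lemma fits1 (u : rtr) (p : packed A) : local_terminal u -> ar p = valence u 0 -> fits u [:: p].
Proof. by move=> hu hp; apply/eqP; rewrite /valences hu /= hp. Qed.

Lemma aT_pull (T S : rtr) (w : iso T S) p (m : M S p) a b :
  fits T a -> fits S b ->
  (forall v, (v < nvert T)%N -> exists (u : rtr) (hu : local_terminal u),
     tree u = fiber T S w (onvert w v) /\
     nth (p0 A) b (onvert w v) = act1 hu (nth (p0 A) a v)) ->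
  aT al (pull w m) a = pull_sign w a *: aT al m b.
Proof.
move=> /ins_surj[dT [x <-]] /ins_surj[dS [y <-]] h.
rewrite /aT !(aUpE _ erefl).
rewrite (@act_iso k M A al T S w p m dT dS _ _ erefl erefl x y).
  by rewrite -(product_pull_sign w x) (linZ _ _ (@tin_linear k A _ _)).
move=> j v wv; have [u [hu [tu eu]]] := h v (ltn_ord v).
exists u; first by rewrite -wv.
have [U [hU [b0]]] := terminal_iso hu.
rewrite wv !nth_ins in eu.
have fu : fits u [:: pack (x v)].
  have vu : halves u 0 = iota 0 (size (halves T v)).
    rewrite /halves tu (iso_fiber w (ltn_ord v)) (@corolla_nhalf (size (halves T v))).
    by apply/all_filterP/allP => h' _; rewrite corolla_vertex.
  apply: fits1 => //; rewrite -[LHS]/(arity T v) arity_valence /valence.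
  by rewrite vu size_iota.
have [d [z ez]] := ins_surj fu.
exists U, hU, b0, d, (0 + \sum_v d v), erefl, z; split.
  by move=> i; have := ins_terminal z i hu; rewrite ez => -[].
by rewrite eu /act1 -ez (aUpE _ erefl) (eta_atE M hu hU b0).
Qed.

Definition symact n d (x : A n d) (s : 'S_n) : A n d :=
  tin (act1 (cor_terminal s) (pack x)) n d.

Lemma fits_cor n d (x : A n d) (s : 'S_n) : fits (cor s) [:: pack x].
Proof. by apply: fits1 => //; rewrite /valence cor_halves size_iota. Qed.

Lemma pi0_cor n (s : 'S_n) : pi0 (cor s) = n.
Proof. by rewrite /pi0 [size _](size_perm_list s). Qed.

Lemma pack_symact n d (x : A n d) (s : 'S_n) :
  pack (symact x s) = act1 (cor_terminal s) (pack x).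
Proof.
have fx := fits_cor x s.
have e1 : ar (act1 (cor_terminal s) (pack x)) = n by rewrite /act1 aUp_ar // pi0_cor.
have e2 : dg (act1 (cor_terminal s) (pack x)) = d.
  by rewrite /act1 aUp_dg // /degs big_seq1 add0r.
by rewrite -[RHS](pk_tin) e1 e2.
Qed.

Lemma act1_irr (u u' : rtr) (hu : local_terminal u) (hu' : local_terminal u') p :
  u = u' -> act1 hu p = act1 hu' p.
Proof. by move=> e; case: u' / e hu' => hu'; rewrite (Prop_irrelevance hu hu'). Qed.

Lemma symact1 n d (x : A n d) : symact x 1%g = x.
Proof.
apply: pack_inj; rewrite pack_symact /act1.
have hU : trivial_tree (cor (1%g : 'S_n)).
  by split=> //; rewrite cor_nhalf -perm_list1.
rewrite (eta_at_trivial M _ hU); have [dd [z ez]] := ins_surj (fits_cor x 1%g).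
rewrite -ez (aUpE _ erefl) (act_unit al hU _ _ ord0).
by have := ins_terminal z ord0 erefl; rewrite ez => -[].
Qed.

(** This is [act_iso] for the isomorphism from [cor (t * s)] to [cor t], whose fiber is [cor s]. *)
Lemma symactM n d (x : A n d) (s t : 'S_n) :
  symact (symact x s) t = symact x (t * s)%g.
Proof.
apply: pack_inj; rewrite !pack_symact.
set p := pack x; set hts := cor_terminal (t * s)%g.
have fp : fits (cor (t * s)%g) [:: p] by exact: fits_cor.
have fq : fits (cor t) [:: act1 (cor_terminal s) p].
  by rewrite -pack_symact; exact: fits_cor.
have dq : dg (act1 (cor_terminal s) p) = dg p by rewrite -pack_symact.
apply: packed_eq.
- by rewrite /act1 !aUp_ar // !pi0_cor.
- by rewrite {1}/act1 [in RHS]/act1 !aUp_dg // /degs !big_seq1 dq.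
symmetry; rewrite -[LHS]/(aT al (eta_at M hts) [:: p]).
rewrite -(pull_eta_at M hts (cor_terminal t) (cor_iso s t)).
rewrite (aT_pull _ fp fq).
  suff -> : pull_sign (cor_iso s t) [:: p] = 1 by rewrite scale1r.
  by rewrite /pull_sign /sgk big_cons big_nil big_mkcond big_cons big_nil ltnn /= !mulr1.
move=> [|v] // _; exists (cor s), (cor_terminal s); split=> //=.
rewrite (iso_fiber (cor_iso s t) (v := 0%N)) // cor_halves size_iota.
have ov : onvert (cor_iso s t) 0 = 0%N by rewrite /onvert cor_isoE.
congr corolla; rewrite /vertex_labels ov !cor_halves /onhalf cor_isoE.
have sz := size_perm_list s; rewrite -{1}(mkseq_nth 0%N (perm_list s)) /mkseq sz.
apply/eq_in_map => h; rewrite mem_iota add0n => /andP[_ hh].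
rewrite index_iota0 //.
have : nth 0%N (perm_list s) h \in perm_list s by rewrite mem_nth ?sz.
by rewrite (perm_mem (perm_list_perm s)) mem_iota.
Qed.

Lemma symact_linear n d (s : 'S_n) : linear (fun x : A n d => symact x s).
Proof.
move=> a x y; rewrite /symact -tot_linE; congr (_ n d).
apply: (@aT_slot k A M al (cor s) 0 _ [::] [::]).
by rewrite /= /valences /= /valence cor_halves size_iota.
Qed.

Definition symm_of : symm A := Symm symact_linear symact1 symactM.

(** Every one-vertex tree is a [cor], the permutation being the one from its local to its global
    order. *)
Lemma act1_prel (u : rtr) (hu : local_terminal u) (p : packed A) :
  ar p = valence u 0 -> act1 hu p = prel symm_of (halves u 0) (legs u) p.
Proof.
move=> hp; have hh : halves u 0 = iota 0 (nhalf u).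
  apply/all_filterP/allP => h; rewrite mem_iota add0n => /andP[_ h1].
  by apply/eqP; exact: terminal_vertex.
have nh : nhalf u = (ar p).+1.
  rewrite hp -(size_iota 0 (nhalf u)) -hh size_halves // hu //.
have r := terminal_relabels hu (labels_legs u).
rewrite /prel [pack _]pack_symact -(pack_el p) /=.
rewrite hh nh in r *; apply: act1_irr; apply: cor_relperm => //.
by rewrite {1}(terminal_corolla hu) nh.
Qed.

End SymmOf.

(** * The operad map defined by an algebra *)

Section MapOf.
Variables (k : fieldType) (A : gcoll k) (M : operad k) (al : algebra M A).
Let s := symm_of al.

(** The algebra itself only gives the value at the numbering [legs T]; equivariance forces the
    others. *)
Definition map_raw (T : rtr) p (m : M T p) : multi A := fun l w =>
  rel s (legs T) l (aT al m w).

Fact map_is_raw (T : rtr) p (m : M T p) : is_raw s (core T) p (map_raw m).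
Proof.
split.
- move=> l w c e hl fw h; apply: rel0; apply: tin_out => -[h1 h2]; apply: h.
  rewrite -h1 -h2 aUp_ar // aUp_dg // (labels_size hl) size_legs.
  by [].
- move=> l w1 w2 c e hl hw a x y; rewrite /map_raw (aT_slot al m hw).
  exact: rel_linear.
- move=> l l' w hl hl' fw; rewrite /map_raw rel_trans //.
    exact: labels_relabels (labels_legs T) hl.
  exact: labels_relabels hl hl'.
Qed.

Definition map_at (T : rtr) p (m : M T p) : end_operad s T p := mk_endo (map_is_raw m).

Lemma ev_map_at (T : rtr) p (m : M T p) l w : labels T l -> fits T w ->
  ev (map_at m : endo s (core T) p) l w = rel s (legs T) l (aT al m w).
Proof. by move=> hl fw; rewrite ev_mk. Qed.

Definition map_of : operad_map M (end_operad s).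
Proof.
apply: (@OperadMap k M (end_operad s) map_at).
- move=> T d a x y; apply: (@evT_ext k A s) => l w hl fw.
  rewrite evT_lin !ev_map_at // aT_linear // rel_linear //.
- move=> T S w d x; apply: (@evT_ext k A s) => l a hl fa.
  rewrite -[pull w (map_at x)]/(epull w (map_at x : endT s S d)) ev_pull // !ev_map_at //; first last.
  + exact: fits_pin.
  + exact: labels_reind.
  rewrite (@aT_pull _ _ _ _ T S w d x a (pin s w a)) //; last first.
  + move=> v hv; pose u := RTr (iso_fiber_rtr w hv).
    have hu : local_terminal u by rewrite /local_terminal -[tree u]/(fiber T S w (onvert w v)) iso_fiber.
    exists u, hu; split=> //.
    have vu : halves u 0 = iota 0 (size (halves T v)).
      rewrite /halves -[tree u]/(fiber T S w (onvert w v)) (iso_fiber w hv) (@corolla_nhalf (size (halves T v))).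
      by apply/all_filterP/allP => h' _; rewrite corolla_vertex.
    rewrite act1_prel; last first.
      by rewrite (fits_nth fa) // /valence vu size_iota.
    rewrite nth_pin ?onvert_lt // iso_bwdK // vu.
    have inj : {in halves T v &, injective (fun h => index h (halves T v))}.
      by move=> h h' i1 i2 e'; rewrite -(nth_index 0%N i1) e' nth_index.
    rewrite -(prel_map _ _ (iso_halves w hv) inj) map_index_uniq ?halves_uniq //.
    by rewrite -map_comp -[tree u]/(fiber T S w (onvert w v)) (iso_fiber w hv).
  + exact: fits_pin.
  rewrite (linZ _ _ (rel_linear s _ _)); congr (_ *: _).
  by rewrite -(reind_legs w) reind_rel // labels_legs.
- move=> T S F f i ef p q d e x y; apply: (@evT_ext k A s) => l w hl fw.
  have [w1 [w2 [w3 [ew s1 f2 f3]]]] := fits_split ef fw.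
  rewrite -[circ ef e (map_at x) (map_at y)]/(ecirc ef e (map_at x : endT s S p) (map_at y : endT s F q)).
  rewrite ew in fw *; rewrite ev_circ ?(fits_size f2) // !ev_map_at //; first last.
  + exact: f3.
  + exact: labels_reind.
  rewrite (aT_circ _ _ _ _ _ s1 (fits_size f2)) // (linZ _ _ (rel_linear s _ _)).
  congr (_ *: _); rewrite -(reind_legs f) reind_rel ?labels_legs //; congr rel.
  congr (aT _ _ (_ ++ _ :: _)).
  by rewrite /inner ev_map_at ?labels_legs // rel_id ?(labels_uniq (labels_legs F)) // aUp_pk.
- move=> U hU; apply: (@evT_ext k A s) => l w hl fw.
  have [p ew hp] := fits_terminal hU.1 fw; rewrite ew in fw *.
  rewrite -[eta (end_operad s) hU]/(eeta s hU) ev_eta // ev_map_at // -(trivial_halves hU); congr rel.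
  have [d [z ez]] := ins_surj fw; rewrite -ez /aT (aUpE _ erefl).
  pose v0 : 'I_(nvert U) := cast_ord (esym hU.1) ord0.
  rewrite (act_unit al hU _ _ v0).
  by have := ins_terminal z v0 hU.1; rewrite ez => -[->].
Defined.

Lemma algebra_eq (be : algebra M A) :
  (forall (T : rtr) (p n : int) (d : 'I_(nvert T) -> int)
    (e : n = p + \sum_v d v) (m : M T p) (a : inputs A d),
    alg_act al e m a = alg_act be e m a) -> al = be.
Proof.
move=> h; have : @alg_act _ _ _ al = @alg_act _ _ _ be.
  change (@eq (forall (T : rtr) (p n : int) (d : 'I_(nvert T) -> int),
    n = p + \sum_v d v -> M T p -> inputs A d -> A (pi0 T) n)
    (@alg_act _ _ _ al) (@alg_act _ _ _ be)).
  by do 7!(apply: functional_extensionality_dep => ?); exact: h.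
case: (al) be {h} => a1 b1 c1 d1 e1 f1 [a2 b2 c2 d2 e2 f2] /= e.
case: a2 / e b2 c2 d2 e2 f2 => b2 c2 d2 e2 f2.
by congr Algebra; exact: Prop_irrelevance.
Qed.

Lemma algebra_of_map_of : algebra_of map_of = al.
Proof.
symmetry; apply: algebra_eq => T p n d e m a.
rewrite /= /act_of /end_of /= -[ev _]/(ev (map_at m : endo s (core T) p)).
rewrite ev_map_at ?labels_legs ?fits_ins // rel_id ?(labels_uniq (labels_legs T)) //.
rewrite /aT (aUpE _ e).
by rewrite tin_pack.
Qed.

End MapOf.

Local Open Scope ring_scope.

Lemma symm_eq (k : fieldType) (A : gcoll k) (s t : symm A) :
  (forall n d (x : A n d) u, sact s x u = sact t x u) -> s = t.
Proof.
move=> h; have : @sact _ _ s = @sact _ _ t.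
  by do 4!(apply: functional_extensionality_dep => ?); exact: h.
case: s t {h} => a1 b1 c1 d1 [a2 b2 c2 d2] /= e.
case: a2 / e b2 c2 d2 => b2 c2 d2.
by congr Symm; exact: Prop_irrelevance.
Qed.

Lemma aT_algebra_of (k : fieldType) (A : gcoll k) (M : operad k) (s : symm A)
  (Phi : operad_map M (end_operad s)) (T : rtr) p (m : M T p) w : fits T w ->
  aT (algebra_of Phi) m w = ev (end_of Phi m) (legs T) w.
Proof.
by move=> /ins_surj[d [a <-]]; rewrite /aT (aUpE _ erefl); exact: act_ofE.
Qed.

Lemma symm_of_algebra_of (k : fieldType) (A : gcoll k) (M : operad k) (s : symm A)
  (Phi : operad_map M (end_operad s)) : symm_of (algebra_of Phi) = s.
Proof.
apply: symm_eq => n d x u; rewrite /= /symact /act1.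
have fx := fits_cor x u.
rewrite -[tin _]/(aT (algebra_of Phi) (eta_at M (cor_terminal u)) [:: pack x]).
rewrite aT_algebra_of //.
have hu := cor_terminal u; have [U [hU [b]]] := terminal_iso hu.
rewrite (eta_atE M _ hU b).
have -> : end_of Phi (pull b (eta M hU)) = epull b (eeta s hU).
  by rewrite /end_of omap_pull omap_eta.
rewrite ev_pull_eta ?labels_legs //; last by rewrite /valence cor_halves size_iota.
rewrite /rel tin_pack cor_halves; congr sact.
apply: relperm_uniq; first exact: iota_uniq.
split; first by rewrite size_iota.
by move=> i; rewrite nth_iota ?ltnS // nth_perm_list.
Qed.

(** * Quotients and generators *)

Section Quotients.
Variables (k : fieldType) (M N : operad k).

Section Kernel.
Variable Phi : operad_map M N.

Definition kernel : op_pred M := fun T d x => opmap Phi x = 0.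

Lemma kernel_ideal : is_ideal kernel.
Proof.
split.
- by move=> T d; exact: opmap0.
- by move=> T d a x y hx hy; rewrite /kernel omap_linear hx hy scaler0 addr0.
- by move=> T S w d x hx; rewrite /kernel omap_pull hx (lin0 (@pull_linear _ _ _ _ w d)).
- move=> T u F f i hu ef d x.
  rewrite /kernel (opmap_cast Phi (esym (over_unlabel hu ef))).
  by split=> [->|h]; [exact: cast0 | rewrite -(castK (strict_unlabel N (esym (over_unlabel hu ef))) (opmap Phi x)) h cast0].
- move=> T S F f i ef p q d e x y hx.
  by rewrite /kernel omap_circ hx (lin0 (circ_linearl ef e _)).
- move=> T S F f i ef p q d e x y hy.
  by rewrite /kernel omap_circ hy (lin0 (circ_linearr ef e _)).
Qed.

End Kernel.

Variable R : op_pred M.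

Lemma gen_ideal_rel T d (x : M T d) : R x -> gen_ideal R x.
Proof. by move=> hx I _ h; exact: h. Qed.

Definition quo_proj : operad_map M (quotient_by R).
Proof.
apply: (@OperadMap k M (quotient_by R) (fun T d x => qcls (gen_ideal_ideal R) x)).
- by move=> T d a x y; rewrite -qcls_lin.
- by move=> T S w d x; rewrite /= qpullE.
- by move=> T S F f i ef p q d e x y; rewrite /= qcircE.
- by [].
Defined.

Lemma quo_proj_surj T d (c : quotient_by R T d) : exists x, c = opmap quo_proj x.
Proof. by elim/qclsW: c => x; exists x. Qed.

Lemma quo_proj_rel T d (x : M T d) : R x -> opmap quo_proj x = 0.
Proof.
move=> h; rewrite -(opmap0 quo_proj T d) /=; apply/qclsP; rewrite subr0.
exact: gen_ideal_rel.
Qed.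

Variable Phi : operad_map M N.
Hypothesis kills : forall T d (x : M T d), R x -> opmap Phi x = 0.

Definition quo_lift_at T d (c : quotient_by R T d) : N T d :=
  opmap Phi (qrep c : M T d).

(** The kernel of [Phi] is an ideal containing [R], hence contains the generated one, so the chosen
    representative does not matter. *)
Lemma quo_lift_cls T d (x : M T d) : quo_lift_at (opmap quo_proj x) = opmap Phi x.
Proof.
rewrite /quo_lift_at; set y := qrep _.
have h : gen_ideal R ((y : M T d) - x).
  exact: (qrep_cls (x : eqmod_premod (ideal_sub (gen_ideal_ideal R) T d))).
have := h _ (kernel_ideal Phi) kills; rewrite /kernel.
rewrite -(sub_of_linear _ _ (@omap_linear _ _ _ Phi T d)).
by move/eqP; rewrite subr_eq0 => /eqP.
Qed.

Definition quo_lift : operad_map (quotient_by R) N.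
Proof.
apply: (@OperadMap k (quotient_by R) N quo_lift_at).
- move=> T d a c c'; have [x ->] := quo_proj_surj c; have [x' ->] := quo_proj_surj c'.
  by rewrite -omap_linear !quo_lift_cls omap_linear.
- move=> T S w d c; have [x ->] := quo_proj_surj c.
  by rewrite -omap_pull !quo_lift_cls omap_pull.
- move=> T S F f i ef p q d e c c'.
  have [x ->] := quo_proj_surj c; have [x' ->] := quo_proj_surj c'.
  by rewrite -omap_circ !quo_lift_cls omap_circ.
- by move=> U hU; rewrite -(omap_eta quo_proj) quo_lift_cls omap_eta.
Defined.

End Quotients.

Definition opmap_comp (k : fieldType) (M N P : operad k) (g : operad_map N P)
  (f : operad_map M N) : operad_map M P.
Proof.
apply: (@OperadMap k M P (fun T d x => opmap g (opmap f x))).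
- by move=> T d a x y; rewrite !omap_linear.
- by move=> T S w d x; rewrite !omap_pull.
- by move=> T S F h i ef p q d e x y; rewrite !omap_circ.
- by move=> U hU; rewrite !omap_eta.
Defined.

(* Collections equal to k in a single degree on the trees with one edge. *)
Record edge_gens (k : fieldType) (E : collection k) (dl : int) := EdgeGens {
  egen : forall T : rtr, E T dl;
  ecoord : forall T : rtr, E T dl -> k;
  ecoord_linear : forall T : rtr, linear (@ecoord T : _ -> k^o);
  ecoord1 : forall T : rtr, nedge T = 1%N -> ecoord (egen T) = 1;
  espan : forall (T : rtr) (x : E T dl), x = ecoord x *: egen T;
  ezero : forall (T : rtr) d (x : E T d), ~ (nedge T = 1%N /\ d = dl) -> x = 0;
  egen_pull : forall (T S : rtr) (w : iso T S), cpull w (egen S) = egen T;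
  egen_strict : forall (T u F : rtr) (f : hom T u) i (hu : local_terminal u)
    (ef : elementary f i F), cast (cstrict E hu ef) (egen F) = egen T
}.

Section EdgeMap.
Variables (k : fieldType) (E : collection k) (dl : int) (G : edge_gens E dl).
Variables (N : operad k) (v : forall T : rtr, N T dl).
Hypothesis v_pull : forall (T S : rtr) (w : iso T S), nedge T = 1%N -> pull w (v S) = v T.
Hypothesis v_strict : forall (T u F : rtr) (f : hom T u) i (hu : local_terminal u)
    (ef : elementary f i F), nedge T = 1%N -> cast (strict N hu ef) (v F) = v T.

Definition edge_cmap_at (T : rtr) d (x : E T d) : N T d :=
  match dl =P d with
  | ReflectT e => (match e in _ = d' return E T d' -> N T d' with
      erefl => fun x => (if nedge T == 1%N then ecoord G x else 0) *: v T end) x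
  | ReflectF _ => 0
  end.

Lemma edge_cmapE (T : rtr) (x : E T dl) : nedge T = 1%N ->
  edge_cmap_at x = ecoord G x *: v T.
Proof.
move=> h; rewrite /edge_cmap_at; case: eqP => // e.
by rewrite (Prop_irrelevance e erefl) h.
Qed.

Lemma edge_cmap0 (T : rtr) d (x : E T d) : ~ (nedge T = 1%N /\ d = dl) ->
  edge_cmap_at x = 0.
Proof.
rewrite /edge_cmap_at; case: eqP => // e h; case: d / e x h => x h.
by case: eqP => [e|]; [case: h | rewrite scale0r].
Qed.

Lemma ecoordE (T : rtr) a : nedge T = 1%N -> ecoord G (a *: egen G T) = a.
Proof.
by move=> h; rewrite (linZ a (egen G T) (@ecoord_linear _ _ _ G T)) ecoord1 // /GRing.scale /= mulr1.
Qed.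

Definition edge_cmap : collection_map E N.
Proof.
apply: (@CollectionMap k E N edge_cmap_at).
- move=> T d a x y; have [[h e]|h] := pselect (nedge T = 1%N /\ d = dl).
    subst d; rewrite !edge_cmapE //.
    by rewrite (ecoord_linear G a x y) scalerDl scalerA.
  by rewrite !edge_cmap0 // scaler0 addr0.
- move=> T S w d x; have [[h e]|h] := pselect (nedge S = 1%N /\ d = dl).
    have hT : nedge T = 1%N by rewrite (iso_nedge w).
    subst d; rewrite !edge_cmapE // (linZ _ _ (@pull_linear _ _ _ _ w dl)).
    rewrite v_pull //; congr (_ *: _).
    by rewrite {1}(espan G x) (linZ _ _ (@cpull_linear _ _ _ _ w dl)) egen_pull ecoordE.
  by rewrite !edge_cmap0 ?(iso_nedge w) // (lin0 (@pull_linear _ _ _ _ w d)).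
- move=> T u F f i hu ef d x; have nF := over_nedge hu ef.
  have [[h e]|h] := pselect (nedge T = 1%N /\ d = dl); last first.
    by rewrite !edge_cmap0 ?nF // cast0.
  subst d; rewrite !edge_cmapE ?nF // castZ v_strict //; congr (_ *: _).
  by rewrite {1}(espan G x) castZ egen_strict ecoordE.
Defined.

Lemma edge_cmap_gen (T : rtr) : nedge T = 1%N -> cmap edge_cmap (egen G T) = v T.
Proof. by move=> h; rewrite /= edge_cmapE // ecoord1 // scale1r. Qed.

End EdgeMap.

Lemma edge_cmap_ext (k : fieldType) (E : collection k) (dl : int) (G : edge_gens E dl)
  (N : operad k) (f g : forall (T : rtr) d, E T d -> N T d) :
  (forall (T : rtr) d, linear (@f T d)) -> (forall (T : rtr) d, linear (@g T d)) ->
  (forall T : rtr, nedge T = 1%N -> f T dl (egen G T) = g T dl (egen G T)) ->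
  forall (T : rtr) d (x : E T d), f T d x = g T d x.
Proof.
move=> fl gl h T d x; have [[hT e]|h'] := pselect (nedge T = 1%N /\ d = dl).
  subst d; rewrite (espan G x).
  by rewrite (linZ _ _ (fl T dl)) (linZ _ _ (gl T dl)) h.
by rewrite (ezero G x h') (lin0 (fl T d)) (lin0 (gl T d)).
Qed.

Section Instances.
Variable k : fieldType.

Lemma unit_map_const n m : n = m -> unit_map m (unit_elt k n 0) = unit_elt k m 0.
Proof. by move=> e; case: m / e; rewrite unit_map_id. Qed.

Definition unit_coord n (x : unit_graded k n 0) : k := \sum_j x 0 j.

Lemma unit_coord_linear n : linear (@unit_coord n : _ -> k^o).
Proof.
move=> a x y.
change (\sum_j (a *: x + y) 0 j = a * (\sum_j x 0 j) + \sum_j y 0 j).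
rewrite mulr_sumr -big_split /=.
by apply: eq_bigr => j _; rewrite !mxE.
Qed.

Lemma unit_coord1 n : n = 1%N -> unit_coord (unit_elt k n 0) = 1.
Proof. by move=> ->; rewrite /unit_coord big_ord1 mxE. Qed.

Lemma unit_span n (x : unit_graded k n 0) : x = unit_coord x *: unit_elt k n 0.
Proof.
apply/rowP => j; rewrite !mxE mulr1 /unit_coord; move: x j.
rewrite /unit_graded; case: (_ && _) => /= x j; last by case: j.
by rewrite big_ord1; congr (x _ _); apply: ord_inj; case: j => -[].
Qed.

Lemma unit_zero n d (x : unit_graded k n d) : ~ (n = 1%N /\ d = 0) -> x = 0.
Proof.
move=> h; apply/rowP; rewrite /unit_graded in x *.
have e : (n == 1%N) && (d == 0) = false.
  by apply/negP => /andP[/eqP ? /eqP ?]; exact: h.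
by move=> j; have := ltn_ord j; rewrite [X in (_ < X)%N -> _]/= {2}e.
Qed.

Definition single_edge_gens : edge_gens (single_edge k) 0.
Proof.
apply: (@EdgeGens k (single_edge k) 0 (fun T => unit_elt k (nedge T) 0)
  (fun T => @unit_coord (nedge T))).
- by move=> T; exact: unit_coord_linear.
- by move=> T; exact: unit_coord1.
- by move=> T x; exact: unit_span.
- by move=> T d x; exact: unit_zero.
- by move=> T S w; apply: unit_map_const; rewrite (iso_nedge w).
- move=> T u F f i hu ef; rewrite (cast_unit (over_nedge hu ef)).
  exact: unit_map_const (over_nedge hu ef).
Defined.

End Instances.

Local Open Scope ring_scope.

Section DualEdge.
Variable k : fieldType.

Definition coord_functional n : functional (unit_graded k n 0) :=
  exist (fun f : unit_graded k n 0 -> k => forall a x y, f (a *: x + y) = a * f x + f y)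
    (@unit_coord k n) (@unit_coord_linear k n).

Lemma coord_unit_map n m (x : unit_graded k n 0) : n = m ->
  unit_coord (unit_map m x) = unit_coord x.
Proof. by move=> e; case: m / e; rewrite unit_map_id. Qed.

Definition dual_edge_gens : edge_gens (sdual (single_edge k)) 1.
Proof.
apply: (@EdgeGens k (sdual (single_edge k)) 1
  (fun T => coord_functional (nedge T))
  (fun T f => fapp f (unit_elt k (nedge T) 0))).
- by move=> T a f g; exact: fappE.
- by move=> T hT; exact: unit_coord1.
- move=> T f; apply: functional_ext => x; rewrite /= addr0 mulrC.
  have := fapp_lin f (unit_coord x) (unit_elt k (nedge T) 0) 0.
  by rewrite addr0 -(unit_span x) fapp0 addr0.
- move=> T d f h; apply: functional_ext => x.
  rewrite (_ : x = 0) ?fapp0 //; apply: unit_zero => -[h1 h2]; apply: h; split=> //.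
  by rewrite -(subrK 1 d) h2.
- move=> T S w; apply: functional_ext => x.
  by rewrite [LHS]coord_unit_map // (iso_nedge w).
- move=> T u F f i hu ef; apply: functional_ext => x.
  rewrite [LHS]cast_sdual (cast_unit (esym (over_nedge hu ef))).
  exact: coord_unit_map (esym (over_nedge hu ef)).
Defined.

End DualEdge.

(** * Partial compositions and trees with one edge *)

Section Splice.
Implicit Types L : seq nat.

(* The inputs of the graft of a second element, numbered by [L'], at the input
   [h] of an element numbered by [L]. *)
Definition splice L h L' := take (index h L) L ++ behead L' ++ drop (index h L).+1 L.

Lemma cat_splice L h : h \in L ->
  L = take (index h L) L ++ h :: drop (index h L).+1 L.
Proof.
move=> hL; rewrite -{1}(cat_take_drop (index h L) L); congr (_ ++ _).
by rewrite (drop_nth 0%N) ?index_mem // nth_index.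
Qed.

Lemma splice_perm L h L' : h \in L ->
  perm_eq (h :: splice L h L') (L ++ behead L').
Proof.
move=> hL; rewrite [X in X ++ _](cat_splice hL) /splice -catA /=.
rewrite -cat1s perm_catCA perm_cat2l /= perm_cons perm_catC.
by [].
Qed.

Lemma size_splice L h L' : h \in L -> (0 < size L')%N ->
  size (splice L h L') = (size L + size L' - 2)%N.
Proof.
move=> hL h'; have := perm_size (splice_perm L' hL); rewrite size_cat size_behead /=.
lia.
Qed.

Lemma splice_uniq L h L' : h \in L -> uniq (L ++ behead L') -> uniq (splice L h L').
Proof.
by move=> hL u; have := perm_uniq (splice_perm L' hL); rewrite u => /andP[].
Qed.

Lemma index_behead L h : uniq L -> h \in behead L -> (0 < index h L < size L)%N.
Proof.
case: L => // a L /= /andP[aL _] hL; case: eqP => [e|_]; first by rewrite e hL in aL.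
by rewrite !ltnS leq0n index_mem.
Qed.

Lemma splice_relabels L L1 h L' L1' : relabels L L1 -> relabels L' L1' ->
  h \in behead L -> uniq (L ++ behead L') ->
  relabels (splice L h L') (splice L1 h L1').
Proof.
move=> r r' hb u.
have uL : uniq L by case/and3P: r.
have hL : h \in L by case: (L) hb => // a M; rewrite inE => ->; rewrite orbT.
have [/and3P[_ p /eqP e] /and3P[_ p' /eqP e']] := (r, r').
have hL1 : h \in L1 by rewrite -(perm_mem p).
have uL1 : uniq L1 by rewrite -(perm_uniq p).
have pb : perm_eq (behead L') (behead L1').
  have := perm_size p'; case: (L') (L1') p' e' => [|a M] [|b M'] //= p' ab _.
  by rewrite ab perm_cons in p'.
rewrite /relabels splice_uniq //=; apply/andP; split.
  rewrite -(perm_cons h); apply: perm_trans (splice_perm L' hL) _.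
  rewrite perm_sym; apply: perm_trans (splice_perm L1' hL1) _.
  by rewrite perm_sym; exact: perm_cat.
have hb1 : h \in behead L1.
  have := perm_size p; case: (L) (L1) p e hb => [|a M] [|b M'] //= p ab hb _.
  by rewrite ab perm_cons in p; rewrite -(perm_mem p).
have := index_behead uL hb; have := index_behead uL1 hb1; rewrite /splice.
by case: (L) (L1) e => [|a M] [|b M'] //= ->; do 2!case: eqP => // _.
Qed.

Lemma nth_splice_in L h L' l : h \in L -> (l < (size L').-1)%N ->
  nth 0%N (splice L h L') (index h L + l) = nth 0%N L' l.+1.
Proof.
move=> hL hl; rewrite /splice nth_cat size_take index_mem hL ltnNge leq_addr /= addKn.
by rewrite nth_cat size_behead hl nth_behead.
Qed.

Lemma nth_splice_out L h L' l : h \in L -> (0 < size L')%N -> l <> index h L ->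
  nth 0%N (splice L h L') (if (l < index h L)%N then l else l + size L' - 2)%N =
  nth 0%N L l.
Proof.
move=> hL h' ne; rewrite /splice nth_cat size_take index_mem hL.
case: (ltnP l (index h L)) => hl; first by rewrite hl nth_take.
have h1 : (index h L <= l + size L' - 2)%N by lia.
rewrite ltnNge h1 /= nth_cat size_behead.
have h2 : ((size L').-1 <= l + size L' - 2 - index h L)%N by lia.
by rewrite ltnNge h2 /= nth_drop; congr nth; lia.
Qed.

Lemma splice_map (f : nat -> nat) L h L' : {in h :: L &, injective f} -> 
  [seq f x | x <- splice L h L'] = splice [seq f x | x <- L] (f h) [seq f x | x <- L'].
Proof.
move=> inj; have e : index (f h) [seq f x | x <- L] = index h L.
  elim: L inj => //= a L IH inj.
  have -> : (f a == f h) = (a == h).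
    by apply/eqP/eqP => [/inj|-> //]; apply; rewrite !inE eqxx ?orbT.
  rewrite IH // => x y hx hy; apply: inj; rewrite !inE in hx hy *.
    by case/orP: hx => ->; rewrite ?orbT.
  by case/orP: hy => ->; rewrite ?orbT.
by rewrite /splice !map_cat !map_take map_drop e; congr (_ ++ _ ++ _); case: L'.
Qed.

Lemma relabels_mem_behead L L1 h : relabels L L1 -> h \in behead L -> h \in behead L1.
Proof.
case/and3P=> _ p /eqP e; have := perm_size p.
case: (L) (L1) p e => [|a M] [|b M'] //= p ab _.
by rewrite ab perm_cons in p; rewrite (perm_mem p).
Qed.

End Splice.

(** The structure that the values of one generator of degree [dl] on one-edge trees amount to.
    Associativity is left out, since it comes from relations on two-edge trees. *)
Record gcmp (k : fieldType) (A : gcoll k) (s : symm A) (dl : int) := Gcmp {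
  gc : forall (m n : nat) (i : 'I_m) (p q d : int), d = dl + (p + q) ->
    A m p -> A n q -> A (m + n).-1 d;
  gc_linearl : forall m n (i : 'I_m) (p q d : int) (e : d = dl + (p + q))
    (y : A n q), linear (fun x : A m p => gc i e x y);
  gc_linearr : forall m n (i : 'I_m) (p q d : int) (e : d = dl + (p + q))
    (x : A m p), linear (fun y : A n q => gc i e x y);
  gc_equiv : forall m n (i : 'I_m) (p q d : int) (e : d = dl + (p + q))
    (f : A m p) (g : A n q) (tau : 'S_m) (sigma : 'S_n) rho,
    is_insertion tau i sigma rho ->
    gc i e (sact s f tau) (sact s g sigma) = sact s (gc (tau i) e f g) rho
}.

Lemma slot_lt a b c d : (a < c)%N -> (b < c)%N -> a <> b ->
  (slot b d a < (c + d).-1)%N.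
Proof. by rewrite /slot; case: ifP; lia. Qed.

Lemma slot_succ a i n : (0 < i)%N -> a.+1 <> i ->
  (slot i.-1 n a).+1 = (if (a.+1 < i)%N then a.+1 else a.+1 + n.+1 - 2)%N.
Proof. by rewrite /slot; case: ifP; case: ifP; lia. Qed.

Lemma insert_lt a b c d : (a < c)%N -> (b < d)%N -> (a + b < (c + d).-1)%N.
Proof. by lia. Qed.

Section Composition.
Variables (k : fieldType) (A : gcoll k) (s : symm A) (dl : int) (P : gcmp s dl).
Implicit Types x y : packed A.

(** For an index out of range the default has the arity and degree of a composite, so that [pcp_ar]
    and [pcp_dg] hold without conditions. *)
Definition pcp (i : nat) x y : packed A :=
  match insub i : option 'I_(ar x) with
  | Some j => pack (gc P j erefl (el x) (el y))
  | None => pack (0 : A (ar x + ar y).-1 (dl + (dg x + dg y)))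
  end.

Lemma pcp_ar i x y : ar (pcp i x y) = (ar x + ar y).-1.
Proof. by rewrite /pcp; case: insub. Qed.

Lemma pcp_dg i x y : dg (pcp i x y) = dl + (dg x + dg y).
Proof. by rewrite /pcp; case: insub. Qed.

Lemma pcpE m n (i : 'I_m) (p q d : int) (e : d = dl + (p + q)) (x : A m p) (y : A n q) :
  pcp i (pack x) (pack y) = pack (gc P i e x y).
Proof. by subst d; rewrite /pcp valK. Qed.

Lemma pcp_linearl i c d y : linear (fun x : A c d => tin (pcp i (pack x) y)).
Proof.
case: y => n [q y] a x x'; rewrite -[existT _ n _]/(pack y).
have [hi|hi] := ltnP i c.
  by rewrite -[i]/(val (Ordinal hi)) !(pcpE _ erefl) gc_linearl tin_linear.
have z (u : A c d) : tin (pcp i (pack u) (pack y)) = 0.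
  by rewrite /pcp insubN -?leqNgt //; exact: (lin0 (@tin_linear k A _ _)).
by rewrite !z scaler0 addr0.
Qed.

Lemma pcp_linearr i c d x : linear (fun y : A c d => tin (pcp i x (pack y))).
Proof.
case: x => n [q x] a y y'; rewrite -[existT _ n _]/(pack x).
have [hi|hi] := ltnP i n.
  by rewrite -[i]/(val (Ordinal hi)) !(pcpE _ erefl) gc_linearr tin_linear.
have z (u : A c d) : tin (pcp i (pack x) (pack u)) = 0.
  by rewrite /pcp insubN -?leqNgt //; exact: (lin0 (@tin_linear k A _ _)).
by rewrite !z scaler0 addr0.
Qed.

(** The input used for grafting is designated by a half-edge [h] instead of a number, so that it can
    be followed through renumberings. The predecessors of the indices discount the root at position
    0. *)
Lemma pcp_equiv L L1 L' L1' h x y : relabels L L1 -> relabels L' L1' ->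
  h \in behead L -> uniq (L ++ behead L') -> size L = (ar x).+1 ->
  size L' = (ar y).+1 ->
  pcp (index h L1).-1 (prel s L L1 x) (prel s L' L1' y) =
  prel s (splice L h L') (splice L1 h L1') (pcp (index h L).-1 x y).
Proof.
move=> r r' hb u sL sL'; case: x y sL sL' => m [p x] [n [q y]].
rewrite -[existT _ m _]/(pack x) -[existT _ n _]/(pack y) /ar /= => sL sL'.
have uL : uniq L by case/and3P: r.
have hb1 := relabels_mem_behead r hb.
have uL1 : uniq L1 by case/and3P: r => _ pr _; rewrite -(perm_uniq pr).
have hL : h \in L by case: (L) hb => // a M; rewrite inE => ->; rewrite orbT.
have hL1 : h \in L1 by case: (L1) hb1 => // a M; rewrite inE => ->; rewrite orbT.
have sL1 : size L1 = m.+1 by rewrite -(relabels_size r).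
have sL1' : size L1' = n.+1 by rewrite -(relabels_size r').
have i0 := index_behead uL hb; have i1 := index_behead uL1 hb1.
have lt0 : ((index h L).-1 < m)%N by lia.
have lt1 : ((index h L1).-1 < m)%N by lia.
have [_ ht] := relpermP r (esym sL); have [_ hs] := relpermP r' (esym sL').
set tau := relperm m L L1 in ht *; set sigma := relperm n L' L1' in hs *.
(* The permutation takes the position of [h] in [L1] to its position in [L]. *)
have et : tau (Ordinal lt1) = Ordinal lt0.
  apply: ord_inj; have := ht (Ordinal lt1).
  rewrite /= prednK ?(andP i1).1 // nth_index // => e.
  apply/eqP; rewrite -eqSS prednK ?(andP i0).1 // -(nth_uniq 0%N _ _ uL) ?sL ?ltnS //.
    by rewrite -e nth_index.
  by move: i0; rewrite sL ltnS => /andP[].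
rewrite !prel_pack -[X in pcp X _ _]/(val (Ordinal lt1)) (pcpE _ erefl).
rewrite -[X in pcp X _ _]/(val (Ordinal lt0)) (pcpE _ erefl) prel_pack -et.
have rs := splice_relabels r r' hb u.
have ss : (m + n).-1.+1 = size (splice L h L').
  by rewrite size_splice ?sL ?sL' //; lia.
have [_ hr] := relpermP rs ss.
congr pack; apply: gc_equiv; rewrite -/tau -/sigma; clearbody tau sigma.
have us : uniq (splice L h L') by exact: splice_uniq.
have eq_rho (x0 : 'I_(m + n).-1) (j : nat) : (j < (m + n).-1)%N ->
    nth 0%N (splice L1 h L1') x0.+1 = nth 0%N (splice L h L') j.+1 ->
    relperm (m + n).-1 (splice L h L') (splice L1 h L1') x0 = j :> nat.
  move=> hj; rewrite hr => /eqP; rewrite nth_uniq -?ss ?ltnS //.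
  by rewrite eqSS => /eqP.
have e0 : tau (Ordinal lt1) = (index h L).-1 :> nat by rewrite et.
split=> [l x0 ex|l x0 ne ex].
  have hl := ltn_ord l; have hsl := ltn_ord (sigma l).
  apply: eq_rho; first by rewrite e0; exact: insert_lt.
  have -> : x0.+1 = (index h L1 + l)%N by rewrite ex -addSn /= prednK ?(andP i1).1.
  have -> : (tau (Ordinal lt1) + sigma l).+1 = (index h L + sigma l)%N.
    by rewrite e0 -addSn prednK ?(andP i0).1.
  by rewrite !nth_splice_in ?sL' ?sL1' // hs.
have hl := ltn_ord l; have hsl := ltn_ord (tau l).
have ne1 : l.+1 <> index h L1 by move=> e; apply: ne; apply: ord_inj; rewrite /= -e.
have ne2 : (tau l).+1 <> index h L.
  by move=> e; apply: ne; apply: (@perm_inj _ tau); rewrite et; apply: ord_inj; rewrite /= -e.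
apply: eq_rho.
  by rewrite e0; apply: slot_lt => // e; apply: ne2; rewrite e prednK ?(andP i0).1.
rewrite e0 ex /= !slot_succ ?(andP i0).1 ?(andP i1).1 //.
have := nth_splice_out (L' := L1') hL1 _ ne1; have := nth_splice_out (L' := L') hL _ ne2.
by rewrite sL' sL1' -ht => /(_ isT) -> /(_ isT) ->.
Qed.

End Composition.

Local Open Scope ring_scope.

(** * Trees with one edge and the operation on them *)

Definition rootv (t : otree) := vertex t (tree_root t).

(* The half-edge at the root vertex of the edge of a tree with one edge. *)
Definition bot (t : otree) : nat :=
  head 0%N [seq h <- halves t (rootv t) | mate t h != h].

Definition topv (t : otree) := vertex t (mate t (bot t)).

Definition edge_labels (t : otree) := splice (halves t (rootv t)) (bot t) (halves t (topv t)).

Definition bot_index (t : otree) := (index (bot t) (halves t (rootv t))).-1.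

Section EdgeTree.
Variable T : rtr.
Hypothesis hT : nedge T = 1%N.
Let gT := rtr_graph (rtrP T).

Lemma edge_nvert2 : nvert T = 2%N.
Proof. by rewrite (rtr_euler (rtrP T)) hT. Qed.

(** Otherwise there would be four distinct internal half-edges, that is, two edges. *)
Lemma edge_internal h x : (h < nhalf T)%N -> (x < nhalf T)%N ->
  mate T h <> h -> mate T x <> x -> x = h \/ x = mate T h.
Proof.
move=> hh hx mh mx; apply: contrapT => ne.
have u : uniq [:: h; mate T h; x; mate T x].
  have mhx : mate T h <> mate T x.
    by move=> e; apply: ne; left; rewrite -(graph_invol gT hx) -e graph_invol.
  have hmx : h <> mate T x.
    by move=> e; apply: ne; right; rewrite e graph_invol.
  rewrite /= !inE !negb_or !andbT; apply/and3P; split; first (apply/and3P; split);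
    try (apply/andP; split); apply/eqP => // e.
  - by apply: mh.
  - by apply: ne; left.
  - by apply: ne; right.
  - by apply: mx.
have := hT; rewrite /nedge -size_filter.
set r := filter _ _; suff : (3 < size r)%N by case: (size r) => [|[|[|[|]]]].
apply: (uniq_leq_size u) => y; rewrite !inE mem_filter mem_iota add0n /=.
case/or4P=> /eqP ->; apply/andP; split=> //; rewrite ?mate_lt //; apply/eqP => //.
  by rewrite graph_invol // => /esym.
by rewrite graph_invol // => /esym.
Qed.

Lemma rootv_lt : (rootv T < 2)%N.
Proof. by rewrite -edge_nvert2 vertex_lt // legs_lt // root_leg. Qed.

Let mate_root : mate T (tree_root T) = tree_root T.
Proof. by have := root_leg T; rewrite mem_legs => /andP[_ /eqP]. Qed.

(** The rootward half-edge at the vertex other than the root vertex is internal. Its opposite end is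
    at the root vertex, since a loop would leave no way out, and by [edge_internal] there are no
    other internal half-edges. *)
Lemma edge_facts : [/\ bot T \in halves T (rootv T), mate T (bot T) <> bot T,
  topv T = (1 - rootv T)%N & head 0%N (halves T (topv T)) = mate T (bot T)].
Proof.
have r2 := rootv_lt; set r := rootv T in r2 *; set v := (1 - r)%N.
have vr : v <> r by rewrite /v; lia.
have v2 : (v < nvert T)%N by rewrite edge_nvert2 /v; lia.
have other u : (u < nvert T)%N -> u <> v -> u = r.
  by rewrite edge_nvert2 /v; lia.
have [h [hh hv hr]] := exists_rootward v2.
have [mh [p pp lp]] : mate T h <> h /\ exists2 p,
    path (fun a b => adjacent T a b && (b != vertex T h)) (vertex T (mate T h)) p &
    last (vertex T (mate T h)) p = r.
  by case: hr => // e; case: vr; rewrite -hv e.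
have mr : vertex T (mate T h) = r.
  apply: other; first by rewrite vertex_lt ?mate_lt.
  move=> e; rewrite e in pp lp; case: p pp lp => [_ /= e'|y p /=]; first by case: vr.
  case/andP=> /andP[/hasP[x]]; rewrite mem_iota add0n => /andP[_ hx].
  case/andP=> /eqP xv /eqP xy; rewrite hv => yv _ _.
  have mx : mate T x <> x by move=> e'; move: yv; rewrite -xy e' xv eqxx.
  by case: (edge_internal hh hx mh mx) => ex; move: yv; rewrite -xy ex ?graph_invol // ?hv ?e eqxx.
have eb : [seq x <- halves T r | mate T x != x] = [:: mate T h].
  have mm : (mate T h \in [seq x <- halves T r | mate T x != x]).
    rewrite mem_filter mem_halves mate_lt // mr eqxx !andbT graph_invol //.
    by apply/eqP => /esym.
  have un : uniq [seq x <- halves T r | mate T x != x] by rewrite filter_uniq ?halves_uniq.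
  apply: perm_small_eq => //; apply: uniq_perm => // x.
  rewrite inE; apply/idP/eqP => [|->//].
  rewrite mem_filter mem_halves => /and3P[/eqP mx hx /eqP vx].
  case: (edge_internal hh hx mh mx) => // ex.
  by case: vr; rewrite -hv -vx ex.
have bE : bot T = mate T h by rewrite /bot -/r eb.
have tE : topv T = v by rewrite /topv bE graph_invol.
split=> //.
- by rewrite bE mem_halves mate_lt // mr eqxx.
- by rewrite bE graph_invol // => /esym.
- by rewrite tE -hv head_halves // bE graph_invol.
Qed.

Lemma bot_lt : (bot T < nhalf T)%N.
Proof. by case: edge_facts; rewrite mem_halves => /andP[]. Qed.

Lemma topv_lt : (topv T < nvert T)%N.
Proof. by rewrite vertex_lt // mate_lt // bot_lt. Qed.

Lemma rootv_halves : halves T (rootv T) = tree_root T :: behead (halves T (rootv T)).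
Proof.
have hr : (rootv T < nvert T)%N by rewrite edge_nvert2 rootv_lt.
rewrite {1}(halves_cons hr) head_halves //; first exact: legs_lt (root_leg T).
by left.
Qed.

Lemma bot_behead : bot T \in behead (halves T (rootv T)).
Proof.
have [h1 h2 _ _] := edge_facts; move: h1; rewrite rootv_halves inE => /orP[/eqP e|//].
by case: h2; rewrite e mate_root.
Qed.

Lemma edge_halves_uniq : uniq (halves T (rootv T) ++ behead (halves T (topv T))).
Proof.
rewrite cat_uniq halves_uniq /=; have u := halves_uniq T (topv T).
have ne : topv T <> rootv T by have [_ _ -> _] := edge_facts; have := rootv_lt; lia.
apply/andP; split; last by move: u; case: (halves T (topv T)) => //= a l /andP[].
apply/hasPn => x xb; have : x \in halves T (topv T).
  by case: (halves _ _) xb => //= a l xl; rewrite inE xl orbT.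
rewrite !mem_halves => /andP[_ /eqP e]; rewrite negb_and; apply/orP; right.
by apply/eqP => e'; apply: ne; rewrite -e -e'.
Qed.

Lemma size_edge_labels :
  size (edge_labels T) = (valence T (rootv T) + valence T (topv T))%N.
Proof.
have [h1 _ _ _] := edge_facts.
have hr : (rootv T < nvert T)%N by rewrite edge_nvert2 rootv_lt.
rewrite size_splice ?size_halves // ?topv_lt //; lia.
Qed.

(** [splice] leaves out exactly the two internal half-edges: [bot T], which is replaced, and its
    mate, which comes first at the top vertex and is dropped by [behead]. *)
Lemma labels_edge : labels T (edge_labels T).
Proof.
have [h1 h2 h3 h4] := edge_facts; have u := edge_halves_uniq.
have ht := halves_cons topv_lt; rewrite h4 in ht.
have p := splice_perm (halves T (topv T)) h1; have pu := perm_uniq p; rewrite u in pu; rewrite -/(edge_labels T) in p pu.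
have hm := mate_lt bot_lt.
rewrite /labels; apply/andP; split; last first.
  have ne : tree_root T <> bot T by move=> e; apply: h2; rewrite -e mate_root.
  rewrite /edge_labels /splice rootv_halves /=.
  by rewrite (negPf (introN eqP ne)) /= eqxx.
apply: uniq_perm; rewrite ?filter_uniq ?iota_uniq //; first by case/andP: pu.
move=> x; rewrite mem_filter mem_iota add0n /=.
have := perm_mem p x; rewrite inE (mem_cat x (halves T (rootv T))).
have [->|/eqP xb] := eqVneq x (bot T).
  by move=> _; case/andP: pu => /negPf -> _; case: eqP.
rewrite /= => ->.
have [->|/eqP xm] := eqVneq x (mate T (bot T)).
  rewrite graph_invol ?bot_lt // (_ : (bot T == _) = false); last by apply/eqP => /esym.
  have nb : mate T (bot T) \notin behead (halves T (topv T)).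
    by have : uniq (halves T (topv T)) by [exact: halves_uniq]; rewrite ht /= => /andP[].
  rewrite (negPf nb) mem_halves hm -/(topv T) /= h3 orbF.
  by apply/eqP; have := rootv_lt; lia.
rewrite (_ : (x \in behead _) = (x \in halves T (topv T))); last first.
  by rewrite [in RHS]ht inE; case: eqP.
rewrite !mem_halves -andb_orr andbC; case hx: (x < nhalf T)%N; rewrite ?andbF // !andbT /=.
have -> : mate T x == x.
  by apply/eqP; apply: contrapT => mx; case: (edge_internal bot_lt hx h2 mx).
have := vertex_lt hx; rewrite edge_nvert2 h3; have := rootv_lt.
by case: eqP => //= ? ? ?; apply/eqP; lia.
Qed.

End EdgeTree.

Lemma pull_sign2 (k : fieldType) (A : gcoll k) (T S : rtr) (w : iso T S) (a : seq (packed A)) :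
  nvert T = 2%N -> pull_sign w a =
  if (onvert w 1 < onvert w 0)%N then koszul k (deg_at a 0 * deg_at a 1) else 1.
Proof.
by move=> nT; rewrite /pull_sign nT /sgk /= !big_cons !big_nil /= !mulr1; case: ifP => // _; rewrite ?mulr1.
Qed.

Section EdgeOperation.
Variables (k : fieldType) (A : gcoll k) (s : symm A) (dl : int) (P : gcmp s dl).

(** In a composition the element at the root vertex comes first. If that vertex has number 1, the
    two inputs have to be exchanged. *)
Definition edge_sign (t : otree) (w : seq (packed A)) : k :=
  if rootv t == 0%N then 1 else koszul k (deg_at w 0 * deg_at w 1).

Definition edge_raw (t : otree) : multi A := fun l w =>
  edge_sign t w *: rel s (edge_labels t) l
    (tin (pcp P (bot_index t) (nth (p0 A) w (rootv t)) (nth (p0 A) w (1 - rootv t)))).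

Section Tree.
Variable T : rtr.
Hypothesis hT : nedge T = 1%N.

Let r2 := rootv_lt hT.

Fact edge_is_raw : is_raw s (core T) dl (edge_raw T).
Proof.
have nv := edge_nvert2 hT; have [_ _ ht _] := edge_facts hT.
split.
- move=> l w c e hl fw h; rewrite /edge_raw tot_scaleE rel0 ?scaler0 //.
  have sz := fits_size fw; rewrite [nvert _]nv in sz.
  apply: tin_out; rewrite pcp_ar pcp_dg => -[e1 e2]; apply: h.
  rewrite (relabels_size (labels_relabels hl (labels_edge hT))) size_edge_labels //.
  have v0 : (rootv T < nvert T)%N by rewrite nv.
  have v1 : (1 - rootv T < nvert T)%N by rewrite nv; lia.
  have fw' : fits T w := fw.
  rewrite -e1 -e2 !(fits_nth fw') //; split.
    rewrite ht prednK //.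
    have := bot_behead hT.
    by rewrite /valence; case: (halves T (rootv T)) => [|a [|b l']].
  congr (_ + _); move: sz; case: (w) => [|x [|y [|]]] // _.
  rewrite !degs_cons /degs big_nil addr0; move: r2; case: (rootv T) => [|[|]] //= _.
  exact: addrC.
- move=> l w1 w2 c e hl hw a x y.
  have hs : (size w1 + (size w2).+1)%N = 2%N.
    have := f_equal size hw; rewrite size_map size_iota [nvert _]nv size_cat /= !size_map.
    by [].
  have lin (q : packed A) (r : bool) : linear (fun z : A c e =>
      tin (pcp P (bot_index T) (if r then pack z else q) (if r then q else pack z))).
    by case: r; [exact: pcp_linearl | exact: pcp_linearr].
  have fin (C : k) (q : packed A) (r : bool) (F : A c e -> tot A) :
      (forall z, F z = C *: rel s (edge_labels T) l
        (tin (pcp P (bot_index T) (if r then pack z else q) (if r then q else pack z)))) ->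
      F (a *: x + y) = a *: F x + F y.
    by move=> h; rewrite !h lin rel_linear scalerDr !scalerA mulrC.
  have go := r2.
  case: w1 w2 hs {hw} => [|p1 [|p2 w1]] [|q1 [|q2 w2]] hs;
    try (by move: hs; rewrite /= ?addnS ?addSn);
    case er: (rootv T) go => [|[|]] // _.
  + apply: (fin 1 q1 true (fun z => edge_raw T l [:: pack z; q1])).
    by move=> z; rewrite /edge_raw /edge_sign er.
  + apply: (fin (koszul k (e * dg q1)) q1 false (fun z => edge_raw T l [:: pack z; q1])).
    by move=> z; rewrite /edge_raw /edge_sign er.
  + apply: (fin 1 p1 false (fun z => edge_raw T l [:: p1; pack z])).
    by move=> z; rewrite /edge_raw /edge_sign er.
  + apply: (fin (koszul k (dg p1 * e)) p1 true (fun z => edge_raw T l [:: p1; pack z])).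
    by move=> z; rewrite /edge_raw /edge_sign er.
- move=> l l' w hl hl' fw; rewrite /edge_raw (linZ _ _ (rel_linear s l l')) rel_trans //.
    exact: labels_relabels (labels_edge hT) hl.
  exact: labels_relabels hl hl'.
Qed.

End Tree.

Definition edge_end (T : rtr) : endT s T dl :=
  if pselect (nedge T = 1%N) is left h then mk_endo (edge_is_raw h) else 0.

Lemma ev_edge (T : rtr) l w : nedge T = 1%N -> labels T l -> fits T w ->
  ev (edge_end T) l w = edge_raw T l w.
Proof. by move=> hT hl fw; rewrite /edge_end; case: pselect => // h; rewrite ev_mk. Qed.

Lemma edge_end_strict (T u F : rtr) (f : hom T u) i (hu : local_terminal u)
  (ef : elementary f i F) : nedge T = 1%N ->
  cast (strict (end_operad s) hu ef) (edge_end F : end_operad s F dl) = edge_end T.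
Proof.
move=> hT; have cF : core F = core T := core_unlabel (over_unlabel hu ef).
have hF : nedge F = 1%N by rewrite (over_nedge hu ef).
apply: (@evT_ext k A s) => l w hl fw; rewrite (ev_strict cF) !ev_edge //.
- by rewrite -[edge_raw F]/(edge_raw (core F)) cF.
- by rewrite -[labels F l]/(labels (core F) l) cF.
- by rewrite -[fits F w]/(fits (core F) w) cF.
Qed.

(** An isomorphism matches root vertices and lower half-edges, so both sides compose the same two
    inputs at the same place. They differ by renumberings of the operands, which [pcp_equiv] turns
    into one of the result. *)
Lemma edge_end_pull (T S : rtr) (w : iso T S) : nedge T = 1%N ->
  epull w (edge_end S) = edge_end T.
Proof.
move=> hT; have hS : nedge S = 1%N by rewrite -(iso_nedge w).
have nT := edge_nvert2 hT; have nS := edge_nvert2 hS.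
have [bS1 bS2 bS3 _] := edge_facts hS; have [bT1 bT2 bT3 _] := edge_facts hT.
have rT := rootv_lt hT; have rS := rootv_lt hS.
have rS' : (rootv S < nvert S)%N by rewrite nS.
have hroot : (tree_root S < nhalf S)%N by exact: legs_lt (root_leg S).
have vr : onvert (bwd w) (rootv S) = rootv T by rewrite -iso_vertex // iso_root.
have hbS := bot_lt hS; have hbT := bot_lt hT.
have eb : onhalf w (bot S) = bot T.
  have lt := onhalf_lt w hbS.
  have m1 : mate T (onhalf w (bot S)) <> onhalf w (bot S).
    by rewrite iso_mate // => /onhalf_inj e; apply: bS2; apply: e => //; exact: mate_lt.
  case: (edge_internal hT hbT lt bT2 m1) => // e.
  have := f_equal (vertex T) e; rewrite iso_vertex // -/(topv T) bT3.
  by move: bS1; rewrite mem_halves => /andP[_ /eqP ->]; rewrite vr; lia.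
have vt : onvert (bwd w) (topv S) = topv T.
  by rewrite -iso_vertex ?mate_lt // -iso_mate // eb.
apply: (@evT_ext k A s) => l a hl fa; have hl1 := labels_reind w hl.
rewrite ev_pull // !ev_edge //; last exact: fits_pin.
rewrite /edge_raw -bS3 -bT3 !nth_pin ?topv_lt // vr vt.
have vrT : onvert w (rootv T) = rootv S by rewrite -vr iso_fwdK.
have vtT : onvert w (topv T) = topv S by rewrite -vt iso_fwdK ?topv_lt.
have rv : (rootv T < nvert T)%N by rewrite nT.
have q1 := iso_halves w rv; rewrite vrT in q1.
have q2 := iso_halves w (topv_lt hT); rewrite vtT in q2.
set L1 := [seq onhalf w h | h <- halves S (rootv S)] in q1 *.
set L1' := [seq onhalf w h | h <- halves S (topv S)] in q2 *.
have inj : {in bot S :: halves S (rootv S) &, injective (onhalf w)}.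
  have lt x : x \in bot S :: halves S (rootv S) -> (x < nhalf S)%N.
    by rewrite inE mem_halves => /orP[/eqP -> //|/andP[]].
  by move=> x y /lt hx /lt hy; exact: onhalf_inj.
have ei : bot_index S = (index (bot T) L1).-1.
  rewrite /bot_index /L1 -eb; congr _.-1.
  elim: (halves S (rootv S)) inj => //= x r IH inj.
  have -> : (onhalf w x == onhalf w (bot S)) = (x == bot S).
    by apply/eqP/eqP => [/inj|-> //]; apply; rewrite !inE eqxx ?orbT.
  rewrite IH // => y z hy hz; apply: inj; rewrite !inE in hy hz *.
    by case/orP: hy => ->; rewrite ?orbT.
  by case/orP: hz => ->; rewrite ?orbT.
have el : [seq onhalf w h | h <- edge_labels S] = splice L1 (bot T) L1'.
  by rewrite /edge_labels splice_map // eb.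
have rl := labels_relabels (labels_edge hS) hl1.
have injl : {in edge_labels S &, injective (onhalf w)}.
  by move=> x y /(labels_lt (labels_edge hS)) hx /(labels_lt (labels_edge hS)) hy; exact: onhalf_inj.
rewrite -(rel_map _ _ rl injl) -(labels_onhalf w hl) el ei.
rewrite (pcp_equiv P q1 q2) ?(bot_behead hT) ?(edge_halves_uniq hT) //; first last.
- by rewrite size_halves ?topv_lt // (fits_nth fa) // topv_lt.
- by rewrite size_halves // (fits_nth fa).
rewrite rel_tin rel_trans; first last.
- by rewrite -el (labels_onhalf w hl); apply: relabels_map => //; rewrite (labels_size (labels_edge hS)) size_legs.
- exact: splice_relabels (bot_behead hT) (edge_halves_uniq hT).
rewrite scalerA; congr (_ *: _).
(* The isomorphism exchanges the two vertices exactly when the root vertices have different numbers;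
   its sign then makes up for the difference of the two signs [edge_sign]. *)
rewrite (pull_sign2 w a nT) /edge_sign; have dr := deg_pin s w a rv; have dt := deg_pin s w a (topv_lt hT).
rewrite vrT in dr; rewrite vtT bS3 bT3 in dt.
have := vrT; have := vtT; rewrite bT3 bS3.
move: dr dt; have := rT; have := rS; case: (rootv T) => [|[|]] //; case: (rootv S) => [|[|]] //= _ _.
- by move=> _ _ -> ->; rewrite mulr1.
- by move=> -> -> -> ->; rewrite /= mulrC [deg_at a 1 * _]mulrC koszul_sq.
- by move=> _ _ -> ->; rewrite mulr1.
- by move=> -> -> -> ->; rewrite mul1r.
Qed.

End EdgeOperation.

Local Open Scope nat_scope.

(** * Constructing isomorphisms and trees from explicit data *)

Section IsoBuild.
Variables (T S : rtr) (ps ph : seq nat).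
Hypotheses (pps : perm_eq ps (iota 0 (nhalf T))) (nh : nhalf S = nhalf T).
Hypotheses (pph : perm_eq ph (iota 0 (nvert S))) (nv : nvert S = nvert T).
Hypothesis hmate : forall h, h < nhalf S -> nth 0 ps (mate S h) = mate T (nth 0 ps h).
Hypothesis hlegs : [seq nth 0 ps h | h <- legs S] = legs T.
Hypothesis hvert : forall h, h < nhalf S -> nth 0 ph (vertex T (nth 0 ps h)) = vertex S h.

Let ips := [seq index h ps | h <- iota 0 (nhalf T)].
Let iph := [seq index v ph | v <- iota 0 (nvert T)].
Let sps : size ps = nhalf T. Proof. by rewrite (perm_size pps) size_iota. Qed.
Let sph : size ph = nvert T. Proof. by rewrite (perm_size pph) size_iota. Qed.
Let ups : uniq ps. Proof. by rewrite (perm_uniq pps) iota_uniq. Qed.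
Let uph : uniq ph. Proof. by rewrite (perm_uniq pph) iota_uniq. Qed.
Let ps_lt h : h < nhalf T -> nth 0 ps h < nhalf T.
Proof.
move=> hh; have : nth 0 ps h \in ps by rewrite mem_nth ?sps.
by rewrite (perm_mem pps) mem_iota.
Qed.
Let ph_lt v : v < nvert T -> nth 0 ph v < nvert T.
Proof.
move=> hh; have : nth 0 ph v \in ph by rewrite mem_nth ?sph.
by rewrite (perm_mem pph) mem_iota nv.
Qed.
Let mem_ps h : h < nhalf T -> h \in ps. Proof. by rewrite (perm_mem pps) mem_iota. Qed.
Let mem_ph v : v < nvert T -> v \in ph. Proof. by rewrite (perm_mem pph) mem_iota nv. Qed.
Let nips h : h < nhalf T -> nth 0 ips h = index h ps.
Proof. by move=> hh; rewrite (nth_map 0) ?size_iota // nth_iota. Qed.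
Let niph v : v < nvert T -> nth 0 iph v = index v ph.
Proof. by move=> hh; rewrite (nth_map 0) ?size_iota // nth_iota. Qed.

Let perm_index (l : seq nat) n : perm_eq l (iota 0 n) ->
  perm_eq [seq index h l | h <- iota 0 n] (iota 0 n).
Proof.
move=> p; have u : uniq l by rewrite (perm_uniq p) iota_uniq.
rewrite -{2}(size_iota 0 n) -(perm_size p) -map_index_uniq //; apply: perm_map.
by rewrite perm_sym.
Qed.

Lemma bij_mor (U V : rtr) (qs qh : seq nat) :
  perm_eq qs (iota 0 (nhalf U)) -> nhalf V = nhalf U ->
  perm_eq qh (iota 0 (nvert V)) -> nvert V = nvert U ->
  (forall h, h < nhalf V -> nth 0 qs (mate V h) = mate U (nth 0 qs h)) ->
  [seq nth 0 qs h | h <- legs V] = legs U ->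
  (forall h, h < nhalf V -> nth 0 qh (vertex U (nth 0 qs h)) = vertex V h) ->
  is_mor U V (PreMor qs qh).
Proof.
move=> p1 n1 p2 n2 hm hl hv.
have s1 : size qs = nhalf V by rewrite (perm_size p1) size_iota n1.
have s2 : size qh = nvert U by rewrite (perm_size p2) size_iota.
have u2 : uniq qh by rewrite (perm_uniq p2) iota_uniq.
split=> //=.
- by apply/allP => h; rewrite (perm_mem p1) mem_iota.
- by rewrite (perm_uniq p1) iota_uniq.
- by apply/allP => h; rewrite (perm_mem p2) mem_iota.
- by move=> v hv'; rewrite (perm_mem p2) mem_iota.
- by move=> h hh; rewrite (perm_mem p1) mem_iota hh.
- move=> v hv'; have fv : fiber_verts U (PreMor qs qh) v = [:: index v qh].
    rewrite /fiber_verts (@eq_in_filter _ _ (pred1 (index v qh))); last first.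
      move=> x; rewrite mem_iota => /andP[_ hx] /=; rewrite /onvert /=.
      apply/eqP/eqP => [<-|->]; first by rewrite index_uniq // s2.
      by rewrite nth_index // (perm_mem p2) mem_iota.
    rewrite filter_pred1_uniq ?iota_uniq // mem_iota add0n /= -s2 index_mem.
    by rewrite (perm_mem p2) mem_iota.
  by split; rewrite /= fv //= => -[|x] [|y] // _ _; exists [::].
Qed.

Let ips_mor : is_mor S T (PreMor ips iph).
Proof.
apply: bij_mor => //.
- by rewrite nh; exact: perm_index.
- by apply: perm_index; rewrite -nv.
- move=> h hh; rewrite !nips ?mate_lt //.
  have hi : index h ps < nhalf S by rewrite nh -sps index_mem mem_ps.
  have := hmate hi; rewrite nth_index ?mem_ps // => <-.
  by rewrite index_uniq // sps -nh mate_lt.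
- rewrite -hlegs -map_comp; apply: map_id_in => h /legs_lt hh /=.
  have hT : h < nhalf T by rewrite -nh.
  by rewrite nips ?index_uniq ?sps // ps_lt.
- move=> h hh; rewrite nips //.
  have hi : index h ps < nhalf S by rewrite nh -sps index_mem mem_ps.
  rewrite niph -?nv ?vertex_lt // -hvert // nth_index ?mem_ps //.
  by rewrite index_uniq // sph vertex_lt.
Qed.

(** Both lists are permutations of an initial segment, so inverses are computed by [index], and
    every fiber is a single vertex and therefore connected. *)
Lemma iso_build : exists w : iso T S, mor w = PreMor ps ph.
Proof.
have mf : is_mor T S (PreMor ps ph) by exact: bij_mor.
have e1 : comp_mor (PreMor ips iph) (PreMor ps ph) = id_mor T.
  rewrite /comp_mor /id_mor /=; congr PreMor.
    rewrite /ips -map_comp; apply: map_id_in => h; rewrite mem_iota => /andP[_ hh] /=.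
    by rewrite /onhalf /= nth_index ?mem_ps.
  rewrite -[ph](mkseq_nth 0) /mkseq sph -map_comp; apply: map_id_in => v.
  rewrite mem_iota => /andP[_ hv] /=; rewrite /onvert /= niph ?ph_lt //.
  by rewrite index_uniq ?sph.
have e2 : comp_mor (PreMor ps ph) (PreMor ips iph) = id_mor S.
  rewrite /comp_mor /id_mor /= nh nv; congr PreMor.
    rewrite -[ps](mkseq_nth 0) /mkseq sps -map_comp; apply: map_id_in => v.
    rewrite mem_iota => /andP[_ hv] /=; rewrite /onhalf /= nips ?ps_lt //.
    by rewrite index_uniq ?sps.
  rewrite /iph -map_comp; apply: map_id_in => h; rewrite mem_iota => /andP[_ hh] /=.
  by rewrite /onvert /= nth_index ?mem_ph.
by exists (@Iso T S (Hom mf) (Hom ips_mor) e1 e2).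
Qed.

End IsoBuild.

Section RtrBuild.
Variable t : otree.
Hypotheses (gt : is_graph t) (legs0 : legs t <> [::]) (root0 : tree_root t = 0).
Hypotheses (v0 : vertex t 0 = 0) (euler : nvert t = (nedge t).+1).
Hypothesis parent : forall v, 0 < v < nvert t -> exists h, [/\ h < nhalf t,
  vertex t h = v & vertex t (mate t h) < v].
Hypothesis internal : forall h, h < nhalf t -> mate t h <> h ->
  (forall h', h' < nhalf t -> vertex t h' = vertex t h -> h <= h') \/
  vertex t h < vertex t (mate t h) /\ (vertex t h = 0 \/
    forall x, x < nhalf t -> vertex t x = vertex t (mate t h) ->
      vertex t (mate t x) = vertex t h \/ mate t x = x).

Let conn v w := exists2 p, path (adjacent t) v p & last v p = w.

Let conn_trans u v w : conn u v -> conn v w -> conn u w.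
Proof.
by case=> p pp <- [q pq <-]; exists (p ++ q); rewrite ?cat_path ?pp ?last_cat.
Qed.

Let conn_half h : h < nhalf t -> conn (vertex t h) (vertex t (mate t h)).
Proof.
move=> hh; exists [:: vertex t (mate t h)] => //=; rewrite andbT.
by apply/hasP; exists h; rewrite ?mem_iota // !eqxx.
Qed.

Let gmate_lt h : h < nhalf t -> mate t h < nhalf t.
Proof.
by move=> hh; apply: (allP (graph_flip gt)); apply: mem_nth; rewrite (graph_size gt).
Qed.

Let conn0 v : v < nvert t -> conn v 0 /\ conn 0 v.
Proof.
elim/ltn_ind: v => v IH hv; case: (posnP v) => [->|v_gt0].
  by split; exists [::].
have [|h [hh ev lt]] := parent (v := v); first by rewrite v_gt0.
rewrite -ev; have [|c1 c2] := IH _ lt; first exact: ltn_trans lt hv.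
split; first exact: conn_trans (conn_half hh) c1.
apply: conn_trans c2 _; have := conn_half (gmate_lt hh).
by rewrite (graph_invol gt hh).
Qed.

(** Parents of smaller number connect every vertex to the vertex 0. The condition on local orders
    only concerns rootward half-edges, and a half-edge towards a child is not rootward: a path from
    the child that avoids the parent cannot end at 0, either because the parent is 0 or because the
    child is a leaf. *)
Lemma rtr_build : is_rtr t.
Proof.
have nv0 : 0 < nvert t by exact: graph_nvert gt.
split=> //; first by split=> // v w hv hw; apply: (@conn_trans _ 0); apply conn0.
move=> h h' hh hh' [->|[hm [p pp lp]]] e; first by rewrite root0.
have [hmin|[lt [z|leaf]]] := internal hh hm; first exact: hmin.
  rewrite root0 v0 -z in lp; exfalso.
  have : vertex t (mate t h) <> vertex t h by move=> e'; rewrite e' ltnn in lt.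
  elim: p (vertex t (mate t h)) pp lp => [|u p IH] x /=; first by move=> _ -> [].
  by case/andP=> /andP[_ /eqP ne] pp lp _; exact: IH pp lp ne.
rewrite root0 v0 in lp; exfalso.
suff : last (vertex t (mate t h)) p = vertex t (mate t h) by rewrite lp => e'; rewrite -e' in lt.
elim: p pp {lp} => //= u p IH /andP[/andP[/hasP[x]]].
rewrite mem_iota add0n => /andP[_ hx] /andP[/eqP xv /eqP xu] ne pp.
have eu : u = vertex t (mate t h).
  by case: (leaf x hx xv) => ex; [move: ne; rewrite -xu ex eqxx | rewrite -xu ex].
by move: pp; rewrite eu => /IH.
Qed.

End RtrBuild.

Definition swap (x y h : nat) : nat := if h == x then y else if h == y then x else h.

Lemma swapK x y h : swap x y (swap x y h) = h.
Proof.
rewrite /swap; have [->|n1] := eqVneq h x; first by rewrite eqxx; case: eqP.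
have [->|n2] := eqVneq h y; first by rewrite eqxx.
by rewrite (negPf n1) (negPf n2).
Qed.

Lemma swap_lt N x y h : x < N -> y < N -> h < N -> swap x y h < N.
Proof. by rewrite /swap; case: ifP => // _; case: ifP. Qed.

(* Two vertices with m and n inputs, the second at the input i of the first. *)
Definition tree2 (m n i : nat) (lg : seq nat) : otree :=
  OTree 2 (nseq m.+1 0 ++ nseq n.+1 1)
    [seq swap i.+1 m.+1 h | h <- iota 0 (m.+1 + n.+1)] lg.

Definition labels2 (m n i : nat) : seq nat := splice (iota 0 m.+1) i.+1 (iota m.+1 n.+1).

Section Tree2.
Variables (m n i : nat) (lg : seq nat).
Let t := tree2 m n i lg.

Lemma tree2_nhalf : nhalf t = m.+1 + n.+1.
Proof. by rewrite /nhalf size_cat !size_nseq. Qed.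

Lemma tree2_mate h : h < m.+1 + n.+1 -> mate t h = swap i.+1 m.+1 h.
Proof. by move=> hh; rewrite /mate (nth_map 0) ?size_iota // nth_iota. Qed.

Lemma tree2_vertex h : h < m.+1 + n.+1 -> vertex t h = (m < h).
Proof.
move=> hh; rewrite /vertex nth_cat size_nseq ltnS; case: leqP => h1.
  by rewrite nth_nseq if_same.
by rewrite nth_nseq; case: ifP => //; lia.
Qed.

Lemma tree2_halves0 : halves t 0 = iota 0 m.+1.
Proof.
rewrite /halves tree2_nhalf iotaD filter_cat.
rewrite (_ : [seq h <- iota (0 + m.+1) n.+1 | _] = [::]) ?cats0.
  apply/all_filterP/allP => h; rewrite mem_iota => /andP[_ hh].
  by rewrite tree2_vertex; last lia; have -> : (m < h) = false by lia.
apply/eqP; rewrite -[_ == _]negbK -has_filter; apply/hasPn => h; rewrite mem_iota => hh.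
by rewrite tree2_vertex; last lia; have -> : (m < h) = true by lia.
Qed.

Lemma tree2_halves1 : halves t 1 = iota m.+1 n.+1.
Proof.
rewrite /halves tree2_nhalf iotaD filter_cat.
rewrite (_ : [seq h <- iota 0 m.+1 | _] = [::]).
  apply/all_filterP/allP => h; rewrite mem_iota => hh.
  by rewrite tree2_vertex; last lia; have -> : (m < h) = true by lia.
apply/eqP; rewrite -[_ == _]negbK -has_filter; apply/hasPn => h; rewrite mem_iota => hh.
by rewrite tree2_vertex; last lia; have -> : (m < h) = false by lia.
Qed.

Lemma labels2_uniq : uniq (iota 0 m.+1 ++ behead (iota m.+1 n.+1)).
Proof.
rewrite cat_uniq !iota_uniq /= andbT; apply/hasPn => x; rewrite !mem_iota.
by move=> h; rewrite inE mem_iota; lia.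
Qed.

Hypothesis im : i < m.

Lemma index_succ_iota : index i.+1 (iota 0 m.+1) = i.+1.
Proof. by rewrite index_iota0. Qed.

Lemma mem_labels2 x : x \in labels2 m n i = (x < m.+1 + n.+1) && (x != i.+1) && (x != m.+1).
Proof.
have im' : i.+1 \in iota 0 m.+1 by rewrite mem_iota; lia.
have p := splice_perm (iota m.+1 n.+1) im'.
have u := perm_uniq p; rewrite labels2_uniq -/(labels2 m n i) in u p.
have := perm_mem p x; rewrite inE (mem_cat x (iota 0 m.+1)).
have -> : behead (iota m.+1 n.+1) = iota m.+2 n by [].
rewrite !mem_iota; have [->|ne] := eqVneq x i.+1.
  by move=> _; rewrite andbF /=; apply/negbTE; case/andP: u.
by rewrite /= => ->; lia.
Qed.

Lemma tree2_filter : perm_eq (labels2 m n i) [seq h <- iota 0 (nhalf t) | mate t h == h].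
Proof.
apply: uniq_perm; rewrite ?filter_uniq ?iota_uniq //.
  by apply: splice_uniq; rewrite ?labels2_uniq // mem_iota; lia.
move=> x; rewrite mem_labels2 mem_filter mem_iota add0n tree2_nhalf leq0n /=.
case hx: (x < m.+1 + n.+1); rewrite ?andbF //= andbT tree2_mate // /swap.
have im1 : (m.+1 == i.+1) = false by rewrite eqSS gtn_eqF.
case: (x =P i.+1) => [e|ne] /=; first by rewrite e im1.
case: (x =P m.+1) => [e|ne'] /=; first by rewrite e eq_sym im1.
by rewrite eqxx.
Qed.

Lemma head_labels2 : head 0 (labels2 m n i) = 0.
Proof. by rewrite /labels2 /splice index_succ_iota. Qed.

Hypothesis hlg : relabels (labels2 m n i) lg.

Lemma tree2_graph : is_graph t.
Proof.
split=> //.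
- by rewrite all_cat !all_nseq /=.
- rewrite (sorted_pairwise leq_trans) pairwise_cat -!(sorted_pairwise leq_trans).
  apply/and3P; split; first by apply/allrelP => x y /nseqP[-> _].
    by apply/(sortedP 0) => j; rewrite size_nseq => hj; rewrite !nth_nseq !if_same.
  by apply/(sortedP 0) => j; rewrite size_nseq => hj; rewrite !nth_nseq hj (ltnW hj).
- by rewrite tree2_nhalf size_map size_iota.
- apply/allP => _ /mapP[h + ->]; rewrite mem_iota tree2_nhalf => hh.
  by apply: swap_lt; lia.
- move=> h; rewrite tree2_nhalf => hh; rewrite !tree2_mate ?swapK //.
  by apply: swap_lt; lia.
- apply: perm_trans tree2_filter; rewrite perm_sym; by case/and3P: hlg.
Qed.

Lemma tree2_nedge : nedge t = 1.
Proof.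
have nl : size (legs t) = m + n.
  rewrite -(relabels_size hlg) size_splice ?mem_iota ?size_iota //; lia.
rewrite /nedge.
have e : count (fun h => mate t h != h) (iota 0 (nhalf t)) = nhalf t - size (legs t).
  rewrite (perm_size (graph_legs tree2_graph)) size_filter.
  by rewrite -[X in X - _](size_iota 0) -(count_predC (fun h => mate t h == h)) addKn.
by rewrite e nl tree2_nhalf (_ : _ - _ = 2) //; lia.
Qed.

Lemma tree2_root : tree_root t = 0.
Proof. by case/and3P: hlg => _ _ /eqP e; rewrite /tree_root -e head_labels2. Qed.

Lemma tree2_rtr : is_rtr t.
Proof.
apply: rtr_build.
- exact: tree2_graph.
- move=> e; have e' : lg = [::] by exact: e.
  have := relabels_size hlg; rewrite e' size_splice ?mem_iota ?size_iota //=; lia.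
- exact: tree2_root.
- by rewrite tree2_vertex //; lia.
- by rewrite tree2_nedge.
- move=> [|[|v]] //= _; exists m.+1; rewrite tree2_nhalf tree2_mate; last lia.
  have -> : swap i.+1 m.+1 m.+1 = i.+1.
    by rewrite /swap eqSS gtn_eqF // eqxx.
  have e1 : (m < i.+1) = false by lia.
  by split; rewrite ?tree2_vertex ?e1 ?ltnSn //; lia.
- move=> h; rewrite tree2_nhalf => hh; rewrite tree2_mate // /swap.
  case: (h =P i.+1) => [-> _|ne].
    have e1 : (m < i.+1) = false by lia.
    by right; split; [|left]; rewrite !tree2_vertex ?e1 ?ltnSn //; lia.
  case: (h =P m.+1) => [-> _|//]; left => h' hh'; rewrite !tree2_vertex; lia.
Qed.

End Tree2.

Local Open Scope ring_scope.

Section Tree2Facts.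
Variables (m n i : nat) (lg : seq nat).
Hypotheses (im : (i < m)%N) (hlg : relabels (labels2 m n i) lg).
Let t := tree2 m n i lg.

Definition rtree2 : rtr := RTr (tree2_rtr im hlg).

Lemma tree2_rootv : rootv t = 0%N.
Proof. by rewrite /rootv (tree2_root im hlg) tree2_vertex. Qed.

Lemma tree2_bot : bot t = i.+1.
Proof.
rewrite /bot tree2_rootv // tree2_halves0 //.
suff -> : [seq h <- iota 0 m.+1 | mate t h != h] = [seq h <- iota 0 m.+1 | pred1 i.+1 h].
  by rewrite filter_pred1_uniq ?iota_uniq // mem_iota; lia.
apply: eq_in_filter => h; rewrite mem_iota => hh.
rewrite tree2_mate ?/swap /=; last lia.
case: (h =P i.+1) => [->|ne]; first by rewrite eqSS gtn_eqF.
by case: (h =P m.+1) => [e|ne']; [lia | rewrite eqxx].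
Qed.

Lemma tree2_topv : topv t = 1%N.
Proof.
rewrite /topv tree2_bot tree2_mate; last lia.
by rewrite /swap eqxx tree2_vertex ?ltnSn //; lia.
Qed.

Lemma tree2_edge_labels : edge_labels t = labels2 m n i.
Proof.
rewrite /edge_labels tree2_rootv tree2_topv tree2_bot tree2_halves0 //.
by rewrite tree2_halves1.
Qed.

Lemma tree2_bot_index : bot_index t = i.
Proof. by rewrite /bot_index tree2_bot tree2_rootv // tree2_halves0 // index_iota0 // ltnS. Qed.

Lemma tree2_valences : valences t = [:: m; n].
Proof.
rewrite -[LHS]/[:: (size (halves t 0)).-1; (size (halves t 1)).-1].
rewrite tree2_halves0; rewrite ?tree2_halves1 ?size_iota //.
Qed.

Lemma fits_tree2 (k : fieldType) (A : gcoll k) (w : seq (packed A)) :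
  fits t w -> exists x y, [/\ w = [:: x; y], ar x = m & ar y = n].
Proof.
move/eqP; rewrite tree2_valences => e; have := f_equal size e; rewrite size_map.
by case: w e => [|x [|y [|]]] // e _; exists x, y; case: e.
Qed.

Lemma tree2_labels : labels t (labels2 m n i).
Proof. by rewrite -tree2_edge_labels; exact: (@labels_edge rtree2 (tree2_nedge im hlg)). Qed.

End Tree2Facts.

Lemma labels2_relabels m n i : (i < m)%N -> relabels (labels2 m n i) (labels2 m n i).
Proof.
move=> im; apply/relabels_refl/splice_uniq; first by rewrite mem_iota; lia.
exact: labels2_uniq.
Qed.

(** Half-edges are listed at the root vertex first and then at the other vertex, each time in local
    order; the two vertices are exchanged if the root vertex has number 1. *)
Lemma edge_standard (T : rtr) : nedge T = 1%N ->
  exists (m n i : nat) (lg : seq nat) (im : (i < m)%N) (hlg : relabels (labels2 m n i) lg),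
    inhabited (iso T (rtree2 im hlg)).
Proof.
move=> hT; have [b1 b2 b3 b4] := edge_facts hT; have nv := edge_nvert2 hT.
have r2 := rootv_lt hT; have bb := bot_behead hT; have gT := rtr_graph (rtrP T).
set r := rootv T in b1 b3 r2 bb; set u := topv T in b3 b4.
have hr : (r < nvert T)%N by rewrite nv.
have hu : (u < nvert T)%N by exact: topv_lt.
set m := valence T r; set n := valence T u; set i := bot_index T.
have sr : size (halves T r) = m.+1 by exact: size_halves.
have su : size (halves T u) = n.+1 by exact: size_halves.
have ib : index (bot T) (halves T r) = i.+1.
  by rewrite /i /bot_index prednK //; case/andP: (index_behead (halves_uniq T r) bb).
have im : (i < m)%N by rewrite -ltnS -ib -sr index_mem.
set ps := halves T r ++ halves T u.
have ur := halves_uniq T r; have uu := halves_uniq T u.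
have ru : r <> u by rewrite b3; lia.
have ups : uniq ps.
  rewrite cat_uniq ur uu andbT; apply/hasPn => h; rewrite !mem_halves => /andP[_ /eqP e].
  by rewrite negb_and; apply/orP; right; apply/eqP => e'; apply: ru; rewrite -e -e'.
have pps : perm_eq ps (iota 0 (nhalf T)).
  apply: uniq_perm; rewrite ?iota_uniq // => h.
  rewrite mem_cat !mem_halves mem_iota add0n -andb_orr /=; case hh: (h < nhalf T)%N => //=.
  by have := vertex_lt hh; rewrite nv b3; case: eqP => //= ? ?; apply/eqP; lia.
have nh : (m.+1 + n.+1)%N = nhalf T by rewrite -sr -su -size_cat (perm_size pps) size_iota.
have nth1 h : (h < m.+1)%N -> nth 0%N ps h = nth 0%N (halves T r) h.
  by move=> hh; rewrite nth_cat sr hh.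
have nth2 h : nth 0%N ps (m.+1 + h) = nth 0%N (halves T u) h.
  by rewrite nth_cat sr ltnNge leq_addr /= addKn.
have nb : nth 0%N ps i.+1 = bot T by rewrite nth1 // -ib nth_index.
have nt : nth 0%N ps m.+1 = mate T (bot T) by rewrite -[m.+1]addn0 nth2 nth0.
have iT : [seq index h ps | h <- edge_labels T] = labels2 m n i.
  rewrite /edge_labels -/r -/u splice_map; last first.
    move=> x y hx hy; apply: contra_eq => ne.
    have inp z : z \in bot T :: halves T r -> z \in ps.
      by rewrite inE mem_cat => /orP[/eqP -> |->] //; rewrite b1.
    by apply/eqP => e; case/eqP: ne; rewrite -(nth_index 0%N (inp _ hx)) e nth_index // inp.
  have e1 : [seq index h ps | h <- halves T r] = iota 0 m.+1.
    rewrite -sr -(map_index_uniq ur); apply/eq_in_map => h hh.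
    by rewrite index_cat hh.
  have e2 : [seq index h ps | h <- halves T u] = iota m.+1 n.+1.
    rewrite -[m.+1]addn0 iotaDl -su -(map_index_uniq uu) -map_comp; apply/eq_in_map => h hh /=.
    rewrite index_cat sr; case: ifP => // hh'; case: ru; move: hh hh'.
    by rewrite !mem_halves => /andP[_ /eqP <-] /andP[_ /eqP <-].
  by rewrite e1 e2 index_cat b1 ib.
set lg := [seq index h ps | h <- legs T].
have hlg : relabels (labels2 m n i) lg.
  rewrite -iT; apply: relabels_map; last exact: labels_relabels (labels_edge hT) (labels_legs T).
    by rewrite size_edge_labels // -/r -/u -/m; lia.
  have sub h : h \in edge_labels T -> h \in ps.
    by move/(labels_lt (labels_edge hT)); rewrite (perm_mem pps) mem_iota.
  by move=> x y /sub hx /sub hy e; rewrite -(nth_index 0%N hx) e nth_index.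
exists m, n, i, lg, im, hlg; set S := rtree2 im hlg.
have hS : nhalf S = nhalf T by rewrite tree2_nhalf.
have memps h : (h < nhalf T)%N -> nth 0%N ps h \in ps.
  by move=> hh; rewrite mem_nth // (perm_size pps) size_iota.
have ltps h : (h < nhalf T)%N -> (nth 0%N ps h < nhalf T)%N.
  by move/memps; rewrite (perm_mem pps) mem_iota.
have inj x y : (x < nhalf T)%N -> (y < nhalf T)%N -> nth 0%N ps x = nth 0%N ps y -> x = y.
  by move=> hx hy /eqP; rewrite nth_uniq ?(perm_size pps) ?size_iota // => /eqP.
set ph := if r == 0%N then [:: 0; 1]%N else [:: 1; 0]%N.
have hph : perm_eq ph (iota 0 (nvert S)) by rewrite /ph; case: ifP.
have hmate h : (h < nhalf S)%N -> nth 0%N ps (mate S h) = mate T (nth 0%N ps h).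
  rewrite hS => hh; rewrite [mate S _]tree2_mate ?nh // /swap.
  case: eqP => [->|n1]; first by rewrite nb nt.
  case: eqP => [->|n2]; first by rewrite nb nt graph_invol ?bot_lt.
  apply: contrapT => ne; have := edge_internal hT (bot_lt hT) (ltps _ hh) b2.
  case=> [e|e|e]; first by apply: ne.
    by apply: n1; apply: inj => //; [lia | rewrite nb].
  by apply: n2; apply: inj => //; [lia | rewrite nt].
have hlegs : [seq nth 0%N ps h | h <- legs S] = legs T.
  rewrite /= -map_comp; apply: map_id_in => h hh /=; rewrite nth_index //.
  by rewrite (perm_mem pps) mem_iota legs_lt.
have hvert h : (h < nhalf S)%N -> nth 0%N ph (vertex T (nth 0%N ps h)) = vertex S h.
  rewrite hS => hh; rewrite [vertex S _]tree2_vertex ?nh //.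
  case: (ltnP m h) => h1.
    have -> : h = (m.+1 + (h - m.+1))%N by lia.
    rewrite nth2; have : nth 0%N (halves T u) (h - m.+1) \in halves T u.
      by rewrite mem_nth // su; lia.
    rewrite mem_halves => /andP[_ /eqP ->]; rewrite b3.
    by rewrite /ph; move: r2; case: (r) => [|[|]].
  rewrite nth1 //; have : nth 0%N (halves T r) h \in halves T r by rewrite mem_nth // sr.
  rewrite mem_halves => /andP[_ /eqP ->].
  by rewrite /ph; move: r2; case: (r) => [|[|]].
by have [w _] := iso_build pps hS hph (esym nv) hmate hlegs hvert; exists.
Qed.

Local Open Scope ring_scope.

(** * From invariant operations on one-edge trees to a composition *)

Section Family.
Variables (k : fieldType) (A : gcoll k) (s : symm A) (dl : int).
Variable e : forall T : rtr, endT s T dl.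
Hypothesis e_pull : forall (T S : rtr) (w : iso T S), nedge T = 1%N -> epull w (e S) = e T.
Hypothesis e_strict : forall (T u F : rtr) (f : hom T u) i (hu : local_terminal u)
  (ef : elementary f i F), nedge T = 1%N ->
  cast (strict (end_operad s) hu ef) (e F : end_operad s F dl) = e T.

(** Two trees with an edge and the same [unlabel] are a total tree and its fiber over a one-vertex
    tree ([relabel_elementary]), so [e_strict] compares their operations. *)
Lemma family_unlabel (T T' : rtr) : nedge T = 1%N -> unlabel T = unlabel T' ->
  ev (e T) = ev (e T').
Proof.
move=> hT eT; have h0 : (0 < nedge T)%N by rewrite hT.
rewrite -(e_strict (erefl : local_terminal (relabel_u h0 eT)) (relabel_elementary h0 eT) hT).
by rewrite (ev_strict (core_unlabel (esym eT))).
Qed.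

Section Standard.
Variables (m n i : nat) (im : (i < m)%N).

Definition std2 : rtr := rtree2 im (labels2_relabels n im).

Lemma family_std2 lg (hlg : relabels (labels2 m n i) lg) :
  ev (e (rtree2 im hlg)) = ev (e std2).
Proof.
have h1 := tree2_nedge im hlg; have h2 := tree2_nedge im (labels2_relabels n im).
have e1 : take 1 lg = take 1 (labels2 m n i).
  case/and3P: hlg => _ p /eqP; have := perm_size p; have : (0 < size (labels2 m n i))%N.
    by rewrite (labels_size (labels_legs std2)) size_legs.
  by case: (labels2 m n i) (lg) => [|a l] [|b l'] //= _ _ ->; rewrite !take0.
apply: family_unlabel => //; rewrite /unlabel h1 h2 ltnS leqnn.
by congr OTree; exact: e1.
Qed.

End Standard.

(** The numbering [labels2 m n i] puts the inputs of the second element in the place of the input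
    [i], which is the convention for partial compositions. *)
Definition family_gc (m n : nat) (i : 'I_m) (p q d : int) (_ : d = dl + (p + q))
    (x : A m p) (y : A n q) : A (m + n).-1 d :=
  ev (e (std2 n (ltn_ord i))) (labels2 m n i) [:: pack x; pack y] (m + n).-1 d.

Lemma fits2 m n i lg p q (x : A m p) (y : A n q) :
  fits (tree2 m n i lg) [:: pack x; pack y].
Proof. by rewrite /fits tree2_valences. Qed.

Lemma size_labels2 m n i : (i < m)%N -> size (labels2 m n i) = (m + n)%N.
Proof. by move=> im; rewrite size_splice ?mem_iota ?size_iota //; lia. Qed.

Lemma tin_family m n (i : 'I_m) (p q d : int) (h : d = dl + (p + q)) (x : A m p) (y : A n q) :
  tin (pack (family_gc i h x y)) =
  ev (e (std2 n (ltn_ord i))) (labels2 m n i) [:: pack x; pack y].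
Proof.
apply: tin_pk => c d' h'; apply: ev_wrong => -[h1 h2]; apply: h'.
rewrite size_labels2 ?ltn_ord // in h1; split; first by rewrite -h1.
by rewrite h h2 !degs_cons /degs big_nil addr0.
Qed.

Lemma ev_family m n (i : 'I_m) (p q d : int) (h : d = dl + (p + q)) (x : A m p) (y : A n q)
    lg (hlg : relabels (labels2 m n i) lg) l : labels (tree2 m n i lg) l ->
  ev (e (rtree2 (ltn_ord i) hlg)) l [:: pack x; pack y] =
  rel s (labels2 m n i) l (tin (pack (family_gc i h x y))).
Proof.
move=> hl; rewrite tin_family family_std2; apply: (endo_rel (evP _)).
  exact: (tree2_labels (ltn_ord i) (labels2_relabels n (ltn_ord i))).
apply: relabels_labels (tree2_labels (ltn_ord i) (labels2_relabels n (ltn_ord i))) _.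
exact: labels_relabels (tree2_labels (ltn_ord i) hlg) hl.
Qed.

Section Equivariance.
Variables (m n : nat) (i : 'I_m) (tau : 'S_m) (sigma : 'S_n).

(** Half-edge map of an isomorphism between standard trees that permutes the inputs at the two
    vertices. The inverses are there so that [pin] undoes the actions of [tau] and [sigma] on the
    operands. *)
Let ps := perm_list (tau^-1)%g ++ [seq (m.+1 + h)%N | h <- perm_list (sigma^-1)%g].
Let ti := tau i.
Let lgS := labels2 m n ti.
Let lgT := [seq nth 0%N ps h | h <- lgS].

Let pps : perm_eq ps (iota 0 (m.+1 + n.+1)).
Proof.
rewrite iotaD perm_cat ?perm_list_perm //.
by rewrite -[X in iota X]addn0 iotaDl; apply: perm_map; exact: perm_list_perm.
Qed.

Let ps1 (j : 'I_m) : nth 0%N ps j.+1 = ((tau^-1)%g j).+1.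
Proof. by rewrite nth_cat size_perm_list ltnS ltn_ord nth_perm_list. Qed.

Let ps2 h : (h < n.+1)%N -> nth 0%N ps (m.+1 + h) = (m.+1 + nth 0%N (perm_list (sigma^-1)%g) h)%N.
Proof.
move=> hh; rewrite nth_cat size_perm_list.
have -> : (m.+1 + h < m.+1)%N = false by lia.
by rewrite addKn (nth_map 0%N) // size_perm_list.
Qed.

Let psm : nth 0%N ps m.+1 = m.+1.
Proof. by rewrite -[m.+1]addn0 ps2. Qed.

Let psi1 : nth 0%N ps ti.+1 = i.+1.
Proof. by rewrite ps1 permK. Qed.

Let inj x y : (x < m.+1 + n.+1)%N -> (y < m.+1 + n.+1)%N -> nth 0%N ps x = nth 0%N ps y -> x = y.
Proof.
move=> hx hy /eqP; rewrite nth_uniq ?(perm_size pps) ?size_iota //; first by move/eqP.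
by rewrite (perm_uniq pps) iota_uniq.
Qed.

Let ps_lt x : (x < m.+1 + n.+1)%N -> (nth 0%N ps x < m.+1 + n.+1)%N.
Proof.
move=> hx; have : nth 0%N ps x \in ps by rewrite mem_nth ?(perm_size pps) ?size_iota.
by rewrite (perm_mem pps) mem_iota.
Qed.

Let b1 : [seq nth 0%N ps h | h <- iota 0 m.+1] = perm_list (tau^-1)%g.
Proof.
rewrite -[RHS](mkseq_nth 0%N) /mkseq size_perm_list; apply/eq_in_map => h.
by rewrite mem_iota => /andP[_ hh]; rewrite nth_cat size_perm_list hh.
Qed.

Let b2 : [seq nth 0%N ps h | h <- iota m.+1 n.+1] = [seq (m.+1 + h)%N | h <- perm_list (sigma^-1)%g].
Proof.
rewrite -[X in iota X]addn0 iotaDl -map_comp -[perm_list (sigma^-1)%g in RHS](mkseq_nth 0%N).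
rewrite /mkseq size_perm_list -map_comp; apply/eq_in_map => h.
by rewrite mem_iota => /andP[_ hh]; exact: ps2.
Qed.

Let rb1 : relabels (iota 0 m.+1) (perm_list (tau^-1)%g).
Proof. by rewrite /relabels iota_uniq perm_sym perm_list_perm. Qed.

Let rb2 : relabels (iota m.+1 n.+1) [seq (m.+1 + h)%N | h <- perm_list (sigma^-1)%g].
Proof.
rewrite -[X in iota X]addn0 iotaDl; apply: relabels_map => //.
  by move=> x y _ _ /addnI.
by rewrite /relabels iota_uniq perm_sym perm_list_perm.
Qed.

Let lgT_splice : lgT = splice (perm_list (tau^-1)%g) i.+1
  [seq (m.+1 + h)%N | h <- perm_list (sigma^-1)%g].
Proof.
rewrite /lgT /lgS /labels2 splice_map ?b1 ?b2 ?psi1 //.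
have lt x : x \in ti.+1 :: iota 0 m.+1 -> (x < m.+1 + n.+1)%N.
  by rewrite inE mem_iota => /orP[/eqP ->|]; have := ltn_ord ti; lia.
by move=> x y /lt hx /lt hy; exact: inj.
Qed.

Let ib : i.+1 \in behead (iota 0 m.+1).
Proof. by rewrite mem_iota; have := ltn_ord i; lia. Qed.

Let hlgT : relabels (labels2 m n i) lgT.
Proof.
rewrite lgT_splice; apply: splice_relabels => //; exact: labels2_uniq.
Qed.

Let T := rtree2 (ltn_ord i) hlgT.
Let S := rtree2 (ltn_ord ti) (labels2_relabels n (ltn_ord ti)).

Let perm_iso : exists w : iso T S, mor w = PreMor ps [:: 0; 1]%N.
Proof.
apply: iso_build; rewrite ?tree2_nhalf //.
- move=> h hh; rewrite [mate S _]tree2_mate // [mate T _]tree2_mate ?ps_lt // /swap.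
  have hti := ltn_ord ti.
  have -> : (nth 0%N ps h == i.+1) = (h == ti.+1).
    by apply/eqP/eqP => [|-> //]; rewrite -psi1 => /inj; apply=> //; lia.
  have -> : (nth 0%N ps h == m.+1) = (h == m.+1).
    by apply/eqP/eqP => [|-> //]; rewrite -{1}psm => /inj; apply=> //; lia.
  by case: ifP => _; rewrite ?psm //; case: ifP => _; rewrite ?psi1.
- move=> h hh; rewrite [vertex S _]tree2_vertex // [vertex T _]tree2_vertex ?ps_lt //.
  have -> : (m < nth 0%N ps h)%N = (m < h)%N.
    case: (ltnP m h) => h1.
      have -> : h = (m.+1 + (h - m.+1))%N by lia.
      by rewrite ps2; lia.
    have : nth 0%N (perm_list (tau^-1)%g) h \in perm_list (tau^-1)%g by rewrite mem_nth ?size_perm_list.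
    by rewrite (perm_mem (perm_list_perm _)) mem_iota nth_cat size_perm_list ltnS h1; lia.
  by case: (m < h)%N.
Qed.

(** Invariance of the family under the isomorphism above gives the identity up to a renumbering of
    the result; it remains to recognize [rho] as the permutation between the two spliced
    numberings. *)
Lemma family_equiv (p q d : int) (h : d = dl + (p + q)) (x : A m p) (y : A n q) rho :
  is_insertion tau i sigma rho ->
  family_gc i h (sact s x tau) (sact s y sigma) = sact s (family_gc ti h x y) rho.
Proof.
move=> hrho; have [w ew] := perm_iso; have hti := ltn_ord ti; have hi := ltn_ord i.
have hT : nedge T = 1%N by exact: tree2_nedge.
have lT : labels T (labels2 m n i) by exact: (tree2_labels hi hlgT).
have fT : fits T [:: pack (sact s x tau); pack (sact s y sigma)] by exact: fits2.
have ov v : onvert w v = nth 0%N [:: 0; 1]%N v by rewrite ew.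
have oh v : onhalf w v = nth 0%N ps v by rewrite ew.
have ob v : (v < 2)%N -> onvert (bwd w) v = v.
  move=> hv; apply: (@onvert_inj _ _ w); rewrite ?onvert_lt //.
  by rewrite iso_fwdK // ov; case: v hv => [|[|]].
have main : tin (pack (family_gc i h (sact s x tau) (sact s y sigma))) =
    rel s lgT (labels2 m n i) (tin (pack (family_gc ti h x y))).
  have r1 := labels2_relabels n hi.
  rewrite -[LHS](@rel_id k A s (labels2 m n i)); last by case/and3P: r1.
  rewrite -(ev_family h _ _ hlgT lT) -(e_pull w hT) ev_pull //.
  rewrite (pull_sign2 w _ erefl) !ov /= scale1r.
  have -> : pin s w [:: pack (sact s x tau); pack (sact s y sigma)] = [:: pack x; pack y].
    set a := [:: pack (sact s x tau); pack (sact s y sigma)].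
    pose z v := prel s (halves T (onvert (bwd w) v)) [seq onhalf w h | h <- halves S v]
      (nth (p0 A) a (onvert (bwd w) v)).
    have z0 : z 0%N = prel s (iota 0 m.+1) (perm_list (tau^-1)%g) (pack (sact s x tau)).
      by rewrite /z ob // [halves T 0]tree2_halves0 [halves S 0]tree2_halves0 (eq_map oh) b1.
    have z1 : z 1%N = prel s (iota m.+1 n.+1) [seq (m.+1 + h)%N | h <- perm_list (sigma^-1)%g]
        (pack (sact s y sigma)).
      by rewrite /z ob // [halves T 1]tree2_halves1 [halves S 1]tree2_halves1 (eq_map oh) b2.
    rewrite -[LHS]/[:: z 0%N; z 1%N] z0 z1 !prel_pack !sactM.
    have -> : relperm m (iota 0 m.+1) (perm_list (tau^-1)%g) = (tau^-1)%g.
      apply: relperm_uniq; first exact: iota_uniq.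
      split; first by rewrite size_iota.
      by move=> j; rewrite nth_iota ?ltnS // nth_perm_list.
    have -> : relperm n (iota m.+1 n.+1) [seq (m.+1 + h)%N | h <- perm_list (sigma^-1)%g] = (sigma^-1)%g.
      apply: relperm_uniq; first exact: iota_uniq.
      split; first by rewrite size_iota.
      move=> j; rewrite nth_iota ?ltnS //.
      by rewrite (nth_map 0%N) ?size_perm_list ?ltnS // nth_perm_list.
    by rewrite !mulVg !sact1.
  have lS := labels_reind w lT; rewrite (ev_family h _ _ _ lS).
  have -> : labels2 m n ti = reind (psi w) (legs T) by rewrite reind_legs.
  exact: reind_rel (labels_legs T) lT.
move: (f_equal (fun z : tot A => z (m + n).-1 d) main).
rewrite /= !tin_pack => ->; rewrite /rel tin_pack; congr sact.
have [u1 _ _] := and3P (relabels_sym hlgT); apply: relperm_uniq => //.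
have iL1 : i.+1 \in iota 0 m.+1 by rewrite mem_iota; lia.
have e1 : index i.+1 (iota 0 m.+1) = i.+1 by rewrite index_iota0.
have e2 : index i.+1 (perm_list (tau^-1)%g) = ti.+1.
  have -> : i.+1 = nth 0%N (perm_list (tau^-1)%g) ti.+1 by rewrite nth_perm_list permK.
  by rewrite index_uniq ?size_perm_list // (perm_uniq (perm_list_perm _)) iota_uniq.
have iL2 : i.+1 \in perm_list (tau^-1)%g by rewrite -index_mem e2 size_perm_list ltnS.
have [in1 out1] := hrho; rewrite lgT_splice; set L' := [seq (m.+1 + h)%N | h <- _].
have sL' : size L' = n.+1 by rewrite size_map size_perm_list.
split=> [|j]; first by rewrite size_splice ?size_perm_list ?sL' //; lia.
(* An input of the composite is an input of the second element or an input of the first one other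
   than [i], as in [is_insertion]. *)
have hj := ltn_ord j; have [[l ej]|[l [ne ej]]] : (exists l : 'I_n, j = (i + l)%N :> nat) \/
    (exists l : 'I_m, l <> i /\ j = slot i n l :> nat).
  have [h1|h1] := ltnP j i.
    have h2 : (j < m)%N by lia.
    right; exists (Ordinal h2); split; last by rewrite /slot /= h1.
    by move/(f_equal val) => /= h3; lia.
  have [h2|h2] := ltnP j (i + n).
    have h3 : (j - i < n)%N by lia.
    by left; exists (Ordinal h3) => /=; lia.
  have h3 : (j.+1 - n < m)%N by lia.
  right; exists (Ordinal h3); split; first by move/(f_equal val) => /= h4; lia.
  by rewrite /slot /=; case: ifP => h4; lia.
  have := @nth_splice_in (iota 0 m.+1) i.+1 (iota m.+1 n.+1) l iL1.
  have := @nth_splice_in (perm_list (tau^-1)%g) i.+1 L' (sigma l) iL2.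
  rewrite sL' size_iota e1 e2 (in1 _ _ ej) ej !addSn.
  move=> /(_ (ltn_ord _)) -> /(_ (ltn_ord _)) ->.
  rewrite nth_iota ?ltnS // (nth_map 0%N) ?size_perm_list ?ltnS //.
  by rewrite nth_perm_list permK.
have ne1 : l.+1 <> i.+1 by move=> [/ord_inj].
have ne2 : (tau l).+1 <> ti.+1 by move=> [/ord_inj/perm_inj].
have t1 := @slot_succ l i.+1 n isT ne1; have t2 := @slot_succ (tau l) ti.+1 n isT ne2.
rewrite (out1 _ _ ne ej) ej t1 t2.
have := @nth_splice_out (iota 0 m.+1) i.+1 (iota m.+1 n.+1) l.+1 iL1.
have := @nth_splice_out (perm_list (tau^-1)%g) i.+1 L' (tau l).+1 iL2.
rewrite sL' size_iota e1 e2 => h2 h1; rewrite (h1 isT ne1) (h2 isT ne2).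
by rewrite nth_iota ?ltnS // nth_perm_list permK.
Qed.

End Equivariance.

Definition family_gcmp : gcmp s dl.
Proof.
apply: (@Gcmp k A s dl family_gc).
- move=> m n i p q d h y a x x'; rewrite /family_gc.
  rewrite (@endo_slot _ _ _ _ _ _ (evP _) (labels2 m n i) [::] [:: pack y] m p a x x').
  exact: tot_linE.
- move=> m n i p q d h x a y y'; rewrite /family_gc.
  rewrite (@endo_slot _ _ _ _ _ _ (evP _) (labels2 m n i) [:: pack x] [::] n q a y y').
  exact: tot_linE.
- by move=> m n i p q d h f g tau sigma rho; exact: family_equiv.
Defined.

(** Both families are invariant under isomorphisms, so standard trees suffice, and there the
    composition was defined by the value of [e]. *)
Lemma family_edge (T : rtr) : nedge T = 1%N -> e T = edge_end family_gcmp T.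
Proof.
move=> hT; have [m [n [i [lg [im [hlg [w]]]]]]] := edge_standard hT.
rewrite -(e_pull w hT) -(edge_end_pull family_gcmp w hT); congr epull.
apply: (@evT_ext k A s) => l a hl fa; have hS : nedge (rtree2 im hlg) = 1%N by exact: tree2_nedge.
have [[m' [p x]] [[n' [q y]] [ea]]] := fits_tree2 fa.
rewrite /ar /= => e1 e2; subst m' n'; rewrite ea.
rewrite -[existT _ m _]/(pack x) -[existT _ n _]/(pack y) in ea *.
rewrite (ev_edge family_gcmp hS hl) ?fits2 // /edge_raw /edge_sign.
rewrite tree2_rootv // tree2_edge_labels // tree2_bot_index //= scale1r.
rewrite -[i]/(val (Ordinal im)) (pcpE family_gcmp _ erefl).
have := @ev_family m n (Ordinal im) p q _ erefl x y lg hlg l hl.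
by rewrite (bool_irrelevance (ltn_ord (Ordinal im)) im).
Qed.

End Family.

Local Open Scope nat_scope.

(** * Trees with two edges *)

Section ContractBuild.
Variables (T S F : rtr) (ps ph : seq nat) (i : nat).
Hypotheses (sps : size ps = nhalf S) (lps : all (fun h => h < nhalf T) ps) (ups : uniq ps).
Hypothesis hmate : forall h, h < nhalf S -> nth 0 ps (mate S h) = mate T (nth 0 ps h).
Hypothesis hlegs : [seq nth 0 ps h | h <- legs S] = legs T.
Hypotheses (sph : size ph = nvert T) (oph : sorted leq ph).
Hypothesis (mph : forall v, (v < nvert S) = (v \in ph)).
Hypothesis hvert : forall h, h < nhalf S -> nth 0 ph (vertex T (nth 0 ps h)) = vertex S h.
Hypothesis hcon : forall h, h < nhalf T -> h \notin ps ->
  nth 0 ph (vertex T h) = nth 0 ph (vertex T (mate T h)).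
Hypothesis hi : i < nvert S.
Hypothesis hF : fiber T S (PreMor ps ph) i = F.
Hypothesis eF : 1 <= nedge F.
Hypothesis htriv : forall j, j < nvert S -> j <> i -> trivial_tree (fiber T S (PreMor ps ph) j).

Lemma contract_build : exists f : hom T S, mor f = PreMor ps ph /\ elementary f i F.
Proof.
have fP : is_mor T S (PreMor ps ph).
  split=> //.
  - by apply/allP => v; rewrite -mph.
  - by move=> v; rewrite mph.
  - move=> v hv; have [->|ne] := v =P i; first by rewrite hF; exact: rtr_connected (rtrP F).
    have [n1 _] := htriv hv ne; split; rewrite n1 //.
    by move=> [|u] [|w] // _ _; exists [::].
by exists (Hom fP); split.
Qed.

End ContractBuild.

Lemma swap_fix x y h : h <> x -> h <> y -> swap x y h = h.
Proof. by rewrite /swap => /eqP/negPf -> /eqP/negPf ->. Qed.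
Lemma swapl x y : swap x y x = y. Proof. by rewrite /swap eqxx. Qed.
Lemma swapr x y : swap x y y = x.
Proof. by rewrite /swap eqxx; case: eqP. Qed.

Lemma map_iota0 (f : nat -> nat) n l : size l = n ->
  (forall h, h < n -> f h = nth 0 l h) -> [seq f h | h <- iota 0 n] = l.
Proof.
move=> sl h; rewrite -[RHS](mkseq_nth 0) /mkseq sl; apply/eq_in_map => j.
by rewrite mem_iota => /andP[_ hj]; exact: h.
Qed.

Lemma filter_iota (p : pred nat) n u w : u + w <= n ->
  (forall h, h < n -> p h = (u <= h < u + w)) -> [seq h <- iota 0 n | p h] = iota u w.
Proof.
move=> le hp; apply: (@irr_sorted_eq _ ltn ltn_trans ltnn).
- exact: (sorted_filter ltn_trans _ (iota_ltn_sorted 0 _)).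
- exact: iota_ltn_sorted.
move=> h; rewrite mem_filter !mem_iota add0n /=.
by case: (ltnP h n) => hh; [rewrite hp // andbT | rewrite andbF; lia].
Qed.

(* Three vertices; the second is grafted at the input [x] of the first and the
   third at the half-edge [g] of one of the others. *)
Definition tree3 (a b c x g : nat) (lg : seq nat) : otree :=
  OTree 3 (nseq a.+1 0 ++ nseq b.+1 1 ++ nseq c.+1 2)
    [seq swap x.+1 a.+1 (swap g (a.+1 + b.+1) h) | h <- iota 0 (a.+1 + (b.+1 + c.+1))] lg.

Definition labels3 (a b c x g : nat) : seq nat :=
  splice (labels2 a b x) g (iota (a.+1 + b.+1) c.+1).

(** The third vertex may be grafted at any half-edge of the first two vertices except the root 0 and
    the two ends [x.+1] and [a.+1] of the first edge. *)
Definition graft_at (a b x g : nat) : Prop :=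
  [/\ x < a, 0 < g < a.+1 + b.+1, g <> x.+1 & g <> a.+1].

Section Tree3.
Variables (a b c x g : nat) (lg : seq nat).
Let t := tree3 a b c x g lg.
Let N := a.+1 + (b.+1 + c.+1).
Let Q := a.+1 + b.+1.

Lemma tree3_nhalf : nhalf t = N.
Proof. by rewrite /nhalf !size_cat !size_nseq. Qed.

Lemma tree3_mate h : h < N -> mate t h = swap x.+1 a.+1 (swap g Q h).
Proof. by move=> hh; rewrite /mate (nth_map 0) ?size_iota // nth_iota. Qed.

Lemma tree3_vertex h : h < N -> vertex t h = (a < h) + (Q <= h).
Proof.
rewrite /N /Q => hh; rewrite /vertex nth_cat size_nseq ltnS; case: (leqP h a) => h1.
  by rewrite nth_nseq if_same; lia.
rewrite nth_cat size_nseq; case: (ltnP (h - a.+1) b.+1) => h2.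
  by rewrite nth_nseq h2; lia.
by rewrite nth_nseq; case: ifP; lia.
Qed.

Let vert_halves v u w : (forall h, h < N -> (vertex t h == v) = (u <= h < u + w)) ->
  u + w <= N -> halves t v = iota u w.
Proof.
move=> hv le; rewrite /halves tree3_nhalf; apply: filter_iota => // h hh; exact: hv.
Qed.

Lemma tree3_halves0 : halves t 0 = iota 0 a.+1.
Proof. by apply: vert_halves => [h hh|]; [rewrite tree3_vertex //; rewrite /N in hh|]; rewrite /Q ?/N; lia. Qed.
Lemma tree3_halves1 : halves t 1 = iota a.+1 b.+1.
Proof. by apply: vert_halves => [h hh|]; [rewrite tree3_vertex //; rewrite /N in hh|]; rewrite /Q ?/N; lia. Qed.
Lemma tree3_halves2 : halves t 2 = iota Q c.+1.
Proof. by apply: vert_halves => [h hh|]; [rewrite tree3_vertex //; rewrite /N in hh|]; rewrite /Q ?/N; lia. Qed.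

Lemma tree3_valences : valences t = [:: a; b; c].
Proof.
rewrite -[LHS]/[:: (size (halves t 0)).-1; (size (halves t 1)).-1; (size (halves t 2)).-1].
by rewrite tree3_halves0 tree3_halves1 tree3_halves2 !size_iota.
Qed.

Lemma fits_tree3 (k : fieldType) (A : gcoll k) (w : seq (packed A)) :
  fits t w -> exists u v z, [/\ w = [:: u; v; z], ar u = a, ar v = b & ar z = c].
Proof.
move/eqP; rewrite tree3_valences => e; have := f_equal size e; rewrite size_map.
by case: w e => [|u [|v [|z []]]] // e _; exists u, v, z; case: e.
Qed.

Hypothesis ok : graft_at a b x g.

Lemma tree3_edges : [/\ mate t x.+1 = a.+1, mate t a.+1 = x.+1, mate t g = Q & mate t Q = g].
Proof.
have [h1 h2 h3 h4] := ok; rewrite !tree3_mate /N /Q; try lia.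
by split; rewrite ?(swapl, swapr) ?(@swap_fix g) ?(swapl, swapr, swap_fix) //; lia.
Qed.

Lemma tree3_fix h : h < N -> h <> x.+1 -> h <> a.+1 -> h <> g -> h <> Q -> mate t h = h.
Proof. by move=> hh *; rewrite tree3_mate // !swap_fix. Qed.

Lemma graft_labels2 : g \in labels2 a b x.
Proof. by have [h1 h2 h3 h4] := ok; rewrite mem_labels2 //; apply/andP; split; lia. Qed.

Lemma labels3_pre : uniq (labels2 a b x ++ behead (iota Q c.+1)).
Proof.
have [h1 h2 h3 h4] := ok; have := labels2_relabels b h1; case/and3P=> u _ _.
rewrite cat_uniq u /= iota_uniq andbT; apply/hasPn => h; rewrite mem_iota => hh.
by rewrite mem_labels2 // /Q in hh *; lia.
Qed.

Lemma labels3_uniq : uniq (labels3 a b c x g).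
Proof. by apply: splice_uniq; [exact: graft_labels2 | exact: labels3_pre]. Qed.

Lemma mem_labels3 h : h \in labels3 a b c x g =
  [&& h < N, h != x.+1, h != a.+1, h != g & h != Q].
Proof.
have [h1 h2 h3 h4] := ok; have p := splice_perm (iota Q c.+1) graft_labels2.
have u := perm_uniq p; rewrite labels3_pre -/(labels3 a b c x g) in u p.
have := perm_mem p h; rewrite inE (mem_cat h (labels2 a b x)) mem_labels2 //.
rewrite mem_iota; have [->|ne] := eqVneq h g.
  by move=> _; rewrite !andbF; apply/negbTE; case/andP: u.
by rewrite /= => ->; rewrite /Q /N in ne *; lia.
Qed.

Lemma tree3_filter : perm_eq (labels3 a b c x g) [seq h <- iota 0 (nhalf t) | mate t h == h].
Proof.
have [h1 h2 h3 h4] := ok; have [m1 m2 m3 m4] := tree3_edges.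
apply: uniq_perm; rewrite ?filter_uniq ?iota_uniq ?labels3_uniq //.
move=> h; rewrite mem_labels3 mem_filter mem_iota tree3_nhalf add0n.
case hN: (h < N); rewrite ?andbF //= andbT.
have [->|n1] := h =P x.+1; first by rewrite m1; lia.
have [->|n2] := h =P a.+1; first by rewrite m2; lia.
have [->|n3] := h =P g; first by rewrite m3 /Q; lia.
have [->|n4] := h =P Q; first by rewrite m4 /Q; lia.
by rewrite tree3_fix // eqxx.
Qed.

Lemma head_labels3 : head 0 (labels3 a b c x g) = 0.
Proof.
have [h1 h2 h3 h4] := ok; rewrite /labels3 /splice.
have e := head_labels2 b h1; have g2 := graft_labels2.
by case: (labels2 a b x) e g2 => //= y l -> _; have -> : (0 == g) = false by lia.
Qed.

Lemma size_labels3 : size (labels3 a b c x g) = (a + b + c).-1.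
Proof.
have [h1 _ _ _] := ok.
by rewrite size_splice ?graft_labels2 ?size_iota // size_splice ?mem_iota ?size_iota //; lia.
Qed.

Hypothesis hlg : relabels (labels3 a b c x g) lg.

Lemma tree3_graph : is_graph t.
Proof.
have [h1 h2 h3 h4] := ok; split=> //.
- by rewrite !all_cat !all_nseq /=.
- rewrite (sorted_pairwise leq_trans) !pairwise_cat -!(sorted_pairwise leq_trans).
  have so v n : sorted leq (nseq n v).
    by apply/(sortedP 0) => j; rewrite size_nseq => hj; rewrite !nth_nseq hj (ltnW hj).
  rewrite !so !andbT; apply/andP; split; apply/allrelP => u w /nseqP[-> _] //.
  by move/nseqP=> [->].
- by rewrite tree3_nhalf size_map size_iota.
- apply/allP => _ /mapP[h + ->]; rewrite mem_iota tree3_nhalf => hh.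
  by apply: swap_lt; [| |apply: swap_lt]; rewrite /N; lia.
- move=> h; rewrite tree3_nhalf => hh; have [m1 m2 m3 m4] := tree3_edges.
  have [->|n1] := h =P x.+1; first by rewrite m1.
  have [->|n2] := h =P a.+1; first by rewrite m2.
  have [->|n3] := h =P g; first by rewrite m3.
  have [->|n4] := h =P Q; first by rewrite m4.
  by rewrite !tree3_fix.
- by apply: perm_trans tree3_filter; rewrite perm_sym; case/and3P: hlg.
Qed.

Lemma tree3_nedge : nedge t = 2.
Proof.
have [h1 _ _ _] := ok; rewrite /nedge.
have -> : count (fun h => mate t h != h) (iota 0 (nhalf t)) = nhalf t - size (legs t).
  rewrite (perm_size (graph_legs tree3_graph)) size_filter.
  by rewrite -[X in X - _](size_iota 0) -(count_predC (fun h => mate t h == h)) addKn.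
by rewrite -(relabels_size hlg) size_labels3 tree3_nhalf (_ : _ - _ = 4) //; rewrite /N; lia.
Qed.

Lemma tree3_root : tree_root t = 0.
Proof. by case/and3P: hlg => _ _ /eqP e; rewrite /tree_root -e head_labels3. Qed.

Lemma tree3_rtr : is_rtr t.
Proof.
have [h1 h2 h3 h4] := ok; have [m1 m2 m3 m4] := tree3_edges.
have v0 : vertex t x.+1 = 0 by rewrite tree3_vertex /N /Q; lia.
have v1 : vertex t a.+1 = 1 by rewrite tree3_vertex /N /Q; lia.
have v2 : vertex t Q = 2 by rewrite tree3_vertex /N /Q; lia.
have vg : vertex t g < 2 by rewrite tree3_vertex /N /Q; lia.
apply: rtr_build.
- exact: tree3_graph.
- by move=> e; have := relabels_size hlg; rewrite (_ : lg = [::]) // size_labels3 /=; lia.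
- exact: tree3_root.
- by rewrite tree3_vertex /N /Q; lia.
- by rewrite tree3_nedge.
- move=> [|[|[|v]]] //= _; rewrite tree3_nhalf.
    by exists a.+1; rewrite v1 m2 v0 /N; split=> //; lia.
  by exists Q; rewrite v2 m4 /N /Q; split=> //; lia.
- move=> h; rewrite tree3_nhalf => hh hm.
  have [e|n1] := h =P x.+1.
    by right; rewrite e m1 v0 v1; split=> //; left.
  have [e|n2] := h =P a.+1.
    left=> h' hh'; rewrite e v1 tree3_vertex //; case: (ltnP a h') => //.
    by move=> h5; have -> : (Q <= h') = false by rewrite /Q; lia.
  have [e|n3] := h =P g.
    right; rewrite e m3 v2; split=> //; right=> h' hh' e'.
    have [->|n5] := h' =P Q; first by left; rewrite m4.
    by right; move: e'; rewrite tree3_vertex // => e'; apply: tree3_fix => //; rewrite /Q in n5 e' *; lia.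
  have [e|n4] := h =P Q; last by case: hm; exact: tree3_fix.
  left=> h' hh'; rewrite e v2 tree3_vertex //; case: (leqP Q h') => //.
  by case: (a < h').
Qed.

Definition rtree3 : rtr := RTr tree3_rtr.

End Tree3.

Local Open Scope nat_scope.

(** As [g] is an input of the middle element, grafting there commutes with grafting the middle
    element itself. This is the combinatorial content of associativity along a chain. *)
Lemma splice_assoc L h L' g L'' : g \in behead L' -> g \notin L -> head 0 L' <> g ->
  splice (splice L h L') g L'' = splice L h (splice L' g L'').
Proof.
move=> gL' gL ne; rewrite /splice.
have n1 : g \notin take (index h L) L by apply: contra gL; exact: mem_take.
rewrite index_cat (negPf n1) index_cat gL' take_cat ltnNge leq_addr /= addKn.
rewrite take_cat (index_mem g) gL' drop_cat -addnS ltnNge leq_addr /= addKn.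
rewrite drop_cat; case: L' gL' ne => // y M gM /= /eqP/negPf ne.
rewrite ne /= -!catA; congr (_ ++ _ ++ _ ++ _).
case: (ltnP (index g M).+1 (size M)) => // h1.
have e : (index g M).+1 = size M by apply/eqP; rewrite eqn_leq h1 index_mem gM.
by rewrite e subnn drop0 drop_size.
Qed.

Lemma index_map_add n h l : index (n + h) [seq n + j | j <- l] = index h l.
Proof. by elim: l => //= j l ->; rewrite eqn_add2l. Qed.

Lemma iota_shift n m : iota n m = [seq n + h | h <- iota 0 m].
Proof. by rewrite -iotaDl addn0. Qed.

(** * The two contractions of a standard tree with two edges *)

Section Contract1.
Variables (a b c x g : nat) (lg : seq nat).
Hypotheses (ok : graft_at a b x g) (hlg : relabels (labels3 a b c x g) lg).
Let Y := rtree3 ok hlg.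
Let L := labels2 a b x.
Let m := (a + b).-1.
Let i := (index g L).-1.
Let Q := a.+1 + b.+1.
Let ps := L ++ iota Q c.+1.

Let xa : x < a. Proof. by case: ok. Qed.
Let gL : g \in L. Proof. exact: graft_labels2. Qed.
Let sL : size L = m.+1.
Proof. by rewrite size_splice ?mem_iota ?size_iota // /m; have := xa; lia. Qed.
Let ig : index g L = i.+1.
Proof.
rewrite prednK //; have := head_labels2 b xa; rewrite -/L; have [_ g0 _ _] := ok.
by case: L gL => //= y l _ ->; have -> : (0 == g) = false by lia.
Qed.

Lemma contract1_index : (index g (labels2 a b x)).-1 < (a + b).-1.
Proof. by have := gL; rewrite -index_mem -/L sL ig. Qed.
Let im : i < m := contract1_index.

Let memL h : h \in L = [&& h < Q, h != x.+1 & h != a.+1].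
Proof. by rewrite mem_labels2 // andbA. Qed.
Let mem_ps h : h \in ps = [&& h < a.+1 + (b.+1 + c.+1), h != x.+1 & h != a.+1].
Proof. by rewrite mem_cat memL mem_iota /Q; have := xa; lia. Qed.
Let ups : uniq ps.
Proof.
rewrite cat_uniq iota_uniq andbT; have /and3P[-> _ _] := labels2_relabels b xa.
by apply/hasPn => h; rewrite mem_iota => hh; rewrite memL; lia.
Qed.
Let sps : size ps = m.+1 + c.+1.
Proof. by rewrite size_cat sL size_iota. Qed.

Let index_L h : h \in L -> index h ps = index h L.
Proof. by rewrite index_cat => ->. Qed.

Let e1 : [seq index h ps | h <- L] = iota 0 m.+1.
Proof.
have /and3P[u _ _] := labels2_relabels b xa; rewrite -sL -(map_index_uniq u).
by apply/eq_in_map => h hL; exact: index_L.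
Qed.

Let e2 : [seq index h ps | h <- iota Q c.+1] = iota m.+1 c.+1.
Proof.
rewrite [RHS]iota_shift -[c.+1 in RHS](size_iota Q) -(map_index_uniq (iota_uniq Q c.+1)) -map_comp.
apply/eq_in_map => h; rewrite mem_iota => hh; rewrite index_cat.
by rewrite (_ : h \in L = false) ?sL // memL; lia.
Qed.

(** Once the first edge is contracted, the third vertex is grafted at the position of [g] among the
    legs of the first two; the predecessor discounts the root. *)
Lemma contract1_labels : reind (labels2 a b x ++ iota Q c.+1) (labels3 a b c x g) =
  labels2 (a + b).-1 c (index g (labels2 a b x)).-1.
Proof.
rewrite /reind /labels3 splice_map; first by rewrite e1 e2 index_L // ig.
have lt h : h \in g :: L -> h \in ps.
  by rewrite inE => /orP[/eqP ->|hL]; rewrite (mem_cat _ L) ?gL ?hL.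
by move=> h h' /lt hh /lt hh' e; rewrite -(nth_index 0 hh) e nth_index.
Qed.

Let lgY : {subset lg <= ps}.
Proof.
case/and3P: hlg => _ p _ h; rewrite -(perm_mem p) mem_labels3 // mem_ps.
by case/and5P=> -> -> ->.
Qed.

Lemma contract1_relabels : relabels (labels2 (a + b).-1 c (index g (labels2 a b x)).-1)
  (reind ps lg).
Proof.
rewrite -contract1_labels; apply: relabels_map hlg.
  by rewrite size_labels3 //; have [? ? ? ?] := ok; lia.
have lt h : h \in labels3 a b c x g -> h \in ps.
  by rewrite mem_labels3 // mem_ps => /and5P[-> -> ->].
by move=> h h' /lt hh /lt hh' e; rewrite -(nth_index 0 hh) e nth_index.
Qed.

Definition contract1_S : rtr := rtree2 contract1_index contract1_relabels.
Definition contract1_F : rtr := rtree2 xa (labels2_relabels b xa).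
Let S := contract1_S.

Let nS : nhalf S = m.+1 + c.+1. Proof. exact: tree2_nhalf. Qed.
Let nY : nhalf Y = a.+1 + (b.+1 + c.+1). Proof. exact: tree3_nhalf. Qed.
Let ps1 h : h < m.+1 -> nth 0 ps h = nth 0 L h. Proof. by rewrite nth_cat sL => ->. Qed.
Let ps2 h : h < c.+1 -> nth 0 ps (m.+1 + h) = Q + h.
Proof. by move=> hh; rewrite nth_cat sL ltnNge leq_addr addKn nth_iota. Qed.
Let psg : nth 0 ps i.+1 = g. Proof. by rewrite ps1 -?ig ?nth_index // ig; have := im; lia. Qed.
Let psQ : nth 0 ps m.+1 = Q. Proof. by rewrite -[m.+1]addn0 ps2 // addn0. Qed.
Let ps_inj h h' : h < m.+1 + c.+1 -> h' < m.+1 + c.+1 -> nth 0 ps h = nth 0 ps h' -> h = h'.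
Proof. by move=> hh hh' /eqP; rewrite nth_uniq ?sps // => /eqP. Qed.
Let ps_mem h : h < m.+1 + c.+1 -> nth 0 ps h \in ps.
Proof. by move=> hh; rewrite mem_nth ?sps. Qed.
Let ps_lo h : h < m.+1 -> nth 0 ps h < Q.
Proof.
by move=> hh; rewrite ps1 //; have : nth 0 L h \in L by [rewrite mem_nth ?sL]; rewrite memL => /and3P[].
Qed.

Let vertY h : h < a.+1 + (b.+1 + c.+1) -> vertex Y h = (a < h) + (Q <= h).
Proof. exact: tree3_vertex. Qed.

Let cfiber0 : fiber Y S (PreMor ps [:: 0; 0; 1]) 0 = contract1_F.
Proof.
have fh : fiber_halves Y (PreMor ps [:: 0; 0; 1]) 0 = iota 0 Q.
  rewrite /fiber_halves nY; apply: filter_iota => [|h hh]; first by rewrite /Q; lia.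
  rewrite vertY // /onvert /= add0n; case: (leqP Q h) => h1.
    by have -> : a < h by rewrite /Q in h1; lia.
  by case: (a < h).
have nv : fiber_verts Y (PreMor ps [:: 0; 0; 1]) 0 = [:: 0; 1] by [].
have ltN h : h < Q -> h < a.+1 + (b.+1 + c.+1) by rewrite /Q; lia.
rewrite /fiber fh nv; congr OTree.
- apply: map_iota0 => [|h hh]; first by rewrite size_cat !size_nseq.
  rewrite -[RHS]/(vertex (tree2 a b x L) h) tree2_vertex // vertY ?ltN //.
  by rewrite [Q <= h]leqNgt hh addn0; case: (a < h).
- apply: map_iota0 => [|h hh]; first by rewrite size_map size_iota.
  rewrite -[RHS]/(mate (tree2 a b x L) h) tree2_mate //.
  have -> : h \in psi (PreMor ps [:: 0; 0; 1]) = (h != x.+1) && (h != a.+1).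
    by rewrite [LHS]mem_ps ltN.
  have [E1 E2 _ _] := tree3_edges c lg ok.
  case: (h =P x.+1) => [->|n1].
    change (index (mate Y x.+1) (iota 0 Q) = swap x.+1 a.+1 x.+1).
    by rewrite [mate Y _]E1 swapl index_iota0 // /Q; lia.
  case: (h =P a.+1) => [->|n2].
    change (index (mate Y a.+1) (iota 0 Q) = swap x.+1 a.+1 a.+1).
    rewrite [mate Y _]E2 swapr index_iota0 // /Q.
    by have := xa; lia.
  change (index h (iota 0 Q) = swap x.+1 a.+1 h).
  by rewrite index_iota0 // swap_fix.
- rewrite -/(halves S 0) [halves S 0]tree2_halves0; apply: map_iota0 => // h hh.
  change (index (nth 0 ps h) (iota 0 Q) = nth 0 L h).
  by rewrite index_iota0 ?ps_lo // ps1.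
Qed.

Let cfiber1 : trivial_tree (fiber Y S (PreMor ps [:: 0; 0; 1]) 1).
Proof.
have fh : fiber_halves Y (PreMor ps [:: 0; 0; 1]) 1 = iota Q c.+1.
  rewrite /fiber_halves nY; apply: filter_iota => [|h hh]; first by rewrite /Q; lia.
  rewrite vertY // /onvert /=; case: (leqP Q h) => h1.
    have -> : a < h by rewrite /Q in h1; lia.
    by rewrite /Q /=; lia.
  by case: (a < h).
split; first by [].
rewrite /fiber /nhalf fh size_map size_iota -/(halves S 1) [halves S 1]tree2_halves1.
rewrite (iota_shift m.+1) -map_comp; apply: map_iota0; rewrite ?size_iota // => h hh.
change (index (nth 0 ps (m.+1 + h)) (iota Q c.+1) = nth 0 (iota 0 c.+1) h).
by rewrite ps2 // iota_shift index_map_add index_iota0 // nth_iota.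
Qed.

Lemma contract1_exists : exists f : hom Y contract1_S,
  mor f = PreMor ps [:: 0; 0; 1] /\ elementary f 0 contract1_F.
Proof.
have [E1 E2 E3 E4] := tree3_edges c lg ok.
apply: contract_build => //.
- by rewrite nS sps.
- by apply/allP => h; rewrite mem_ps nY => /and3P[].
- move=> h; rewrite nS => hh; rewrite [mate S h]tree2_mate //.
  have [->|n1] := h =P i.+1; first by rewrite swapl psQ psg [mate Y _]E3.
  have [->|n2] := h =P m.+1; first by rewrite swapr psQ psg [mate Y _]E4.
  have := ps_mem hh; rewrite mem_ps => /and3P[l1 /eqP l2 /eqP l3].
  have l4 : nth 0 ps h <> g.
    by rewrite -psg => e; apply: n1; apply: ps_inj e => //; have := im; lia.
  have l5 : nth 0 ps h <> Q by rewrite -psQ => e; apply: n2; apply: ps_inj e => //; lia.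
  by rewrite swap_fix // [mate Y _]tree3_fix.
- by rewrite [legs S]/(reind ps lg) reindK.
- by move=> [|[|v]].
- move=> h; rewrite nS => hh; rewrite [vertex S h]tree2_vertex //.
  have := ps_mem hh; rewrite mem_ps => /and3P[l1 _ _]; rewrite vertY //.
  case: (ltnP m h) => h1.
    have -> : h = m.+1 + (h - m.+1) by lia.
    by rewrite ps2; [have -> : a < Q + (h - m.+1) by rewrite /Q; lia|lia]; rewrite leq_addr.
  by rewrite [Q <= _]leqNgt ps_lo // addn0; case: (a < _).
- have v0 : vertex Y x.+1 = 0.
    rewrite vertY; last by have := xa; lia.
    have -> : (a < x.+1) = false by have := xa; lia.
    by have -> : (Q <= x.+1) = false by rewrite /Q; have := xa; lia.
  have v1 : vertex Y a.+1 = 1.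
    rewrite vertY; last by lia.
    have -> : (a < a.+1) = true by lia.
    by have -> : (Q <= a.+1) = false by rewrite /Q; lia.
  move=> h; rewrite nY => hh; rewrite mem_ps hh /= negb_and !negbK => /orP[] /eqP ->.
    by rewrite [mate Y _]E1 v0 v1.
  by rewrite [mate Y _]E2 v0 v1.
- have -> : nedge contract1_F = 1 by exact: (tree2_nedge xa (labels2_relabels b xa)).
  by [].
- by move=> [|[|j]].
Qed.

End Contract1.

Local Open Scope nat_scope.

(** The half-edges of the second vertex start at [a.+1] with the one towards the root, so
    [a.+1 + y.+1] is its input [y]. *)
Lemma chain_graft a b x y : x < a -> y < b -> graft_at a b x (a.+1 + y.+1).
Proof. by move=> h1 h2; split; lia. Qed.

Section Contract2.
Variables (a b c x y : nat) (lg : seq nat).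
Hypotheses (xa : x < a) (yb : y < b).
Let g := a.+1 + y.+1.
Hypothesis (hlg : relabels (labels3 a b c x g) lg).
Let ok : graft_at a b x g := chain_graft xa yb.
Let Y := rtree3 ok hlg.
Let L := labels2 b c y.
Let m := (b + c).-1.
Let Q := a.+1 + b.+1.
Let ps := iota 0 a.+1 ++ [seq a.+1 + h | h <- L].

Let sL : size L = m.+1.
Proof. by rewrite size_splice ?mem_iota ?size_iota // /m; have := yb; lia. Qed.
Let sps : size ps = a.+1 + m.+1.
Proof. by rewrite size_cat size_map sL size_iota. Qed.
Let uL : uniq L. Proof. by have /and3P[] := labels2_relabels c yb. Qed.
Let mem_ps h : h \in ps = [&& h < a.+1 + (b.+1 + c.+1), h != g & h != Q].
Proof.
rewrite mem_cat mem_iota add0n leq0n; case: (ltnP h a.+1) => h1.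
  by symmetry; apply/and3P; split; rewrite /g /Q; lia.
have [j ->] : exists j, h = a.+1 + j by exists (h - a.+1); lia.
rewrite (mem_map (@addnI a.+1)) mem_labels2 // /g /Q.
by rewrite !eqn_add2l ltn_add2l andbA.
Qed.
Let ups : uniq ps.
Proof.
rewrite cat_uniq iota_uniq (map_inj_uniq (@addnI a.+1)) uL andbT.
by apply/hasPn => h /mapP[j _ ->]; rewrite mem_iota; lia.
Qed.

Lemma chain_labels : labels3 a b c x g = splice (iota 0 a.+1) x.+1 [seq a.+1 + h | h <- labels2 b c y].
Proof.
rewrite /labels3 /labels2 splice_assoc; first last.
- by rewrite /= /g; lia.
- by rewrite mem_iota /g; lia.
- by rewrite mem_iota /g; have := yb; lia.
rewrite splice_map; last by move=> h h' _ _ /addnI.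
by congr splice; rewrite (iota_shift a.+1) (iota_shift (a.+1 + b.+1)) (iota_shift b.+1) -map_comp;
  congr splice; apply: eq_map => h /=; rewrite addnA.
Qed.

Lemma contract2_labels : reind ps (labels3 a b c x g) = labels2 a (b + c).-1 x.
Proof.
have e1 : [seq index h ps | h <- iota 0 a.+1] = iota 0 a.+1.
  apply: map_id_in => h; rewrite mem_iota => /andP[_ hh].
  by rewrite index_cat mem_iota hh index_iota0.
have e2 : [seq index h ps | h <- [seq a.+1 + h | h <- L]] = iota a.+1 m.+1.
  rewrite [RHS]iota_shift -sL -(map_index_uniq uL) -!map_comp; apply: eq_map => h.
  change (index (a.+1 + h) ps = a.+1 + index h L); rewrite index_cat mem_iota (_ : (_ < 0 + a.+1) = false) ?andbF; last lia.
  by rewrite size_iota index_map_add.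
have i1 : index x.+1 ps = x.+1.
  by rewrite index_cat mem_iota (_ : 0 <= x.+1 < 0 + a.+1) ?index_iota0 //; have := xa; lia.
rewrite /reind chain_labels splice_map ?e1 ?e2 ?i1 //.
have lt h : h \in x.+1 :: iota 0 a.+1 -> h \in ps.
  by rewrite inE mem_cat => /orP[/eqP ->|-> //]; rewrite mem_iota; have := xa; lia.
by move=> h h' /lt hh /lt hh' e; rewrite -(nth_index 0 hh) e nth_index.
Qed.

Let lgY : {subset lg <= ps}.
Proof.
case/and3P: hlg => _ p _ h; rewrite -(perm_mem p) mem_labels3 // mem_ps.
by case/and5P=> -> _ _ -> ->.
Qed.

Lemma contract2_relabels : relabels (labels2 a (b + c).-1 x) (reind ps lg).
Proof.
rewrite -contract2_labels; apply: relabels_map hlg.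
  by rewrite size_labels3 //; have := xa; have := yb; lia.
have lt h : h \in labels3 a b c x g -> h \in ps.
  by rewrite mem_labels3 // mem_ps => /and5P[-> _ _ -> ->].
by move=> h h' /lt hh /lt hh' e; rewrite -(nth_index 0 hh) e nth_index.
Qed.

Definition contract2_S : rtr := rtree2 xa contract2_relabels.
Definition contract2_F : rtr := rtree2 yb (labels2_relabels c yb).
Let S := contract2_S.

Let nS : nhalf S = a.+1 + m.+1. Proof. exact: tree2_nhalf. Qed.
Let nY : nhalf Y = a.+1 + (b.+1 + c.+1). Proof. exact: tree3_nhalf. Qed.
Let ps1 h : h < a.+1 -> nth 0 ps h = h.
Proof. by move=> hh; rewrite nth_cat size_iota hh nth_iota. Qed.
Let ps2 h : h < m.+1 -> nth 0 ps (a.+1 + h) = a.+1 + nth 0 L h.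
Proof.
by move=> hh; rewrite nth_cat size_iota ltnNge leq_addr addKn (nth_map 0) ?sL.
Qed.
Let psa : nth 0 ps a.+1 = a.+1.
Proof.
rewrite -[X in nth _ _ X]addn0 ps2 //; have := head_labels2 c yb; rewrite -/L.
by rewrite -nth0 => ->; rewrite addn0.
Qed.
Let ps_inj h h' : h < a.+1 + m.+1 -> h' < a.+1 + m.+1 -> nth 0 ps h = nth 0 ps h' -> h = h'.
Proof. by move=> hh hh' /eqP; rewrite nth_uniq ?sps // => /eqP. Qed.
Let ps_mem h : h < a.+1 + m.+1 -> nth 0 ps h \in ps.
Proof. by move=> hh; rewrite mem_nth ?sps. Qed.
Let vertY h : h < a.+1 + (b.+1 + c.+1) -> vertex Y h = (a < h) + (Q <= h).
Proof. exact: tree3_vertex. Qed.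
Let L_lt h : h < m.+1 -> nth 0 L h < b.+1 + c.+1.
Proof.
by move=> hh; have : nth 0 L h \in L by [rewrite mem_nth ?sL]; rewrite mem_labels2 // => /andP[/andP[]].
Qed.

Let cfiber1 : fiber Y S (PreMor ps [:: 0; 1; 1]) 1 = contract2_F.
Proof.
have fh : fiber_halves Y (PreMor ps [:: 0; 1; 1]) 1 = iota a.+1 (b.+1 + c.+1).
  rewrite /fiber_halves nY; apply: filter_iota => // h hh.
  rewrite vertY // /onvert /=; case: (ltnP a h) => h1; first by rewrite hh; case: (Q <= h).
  by have -> : (Q <= h) = false by rewrite /Q; lia.
have nv : fiber_verts Y (PreMor ps [:: 0; 1; 1]) 1 = [:: 1; 2] by [].
rewrite /fiber fh nv; congr OTree.
- rewrite iota_shift -map_comp; apply: map_iota0 => [|h hh]; first by rewrite size_cat !size_nseq.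
  rewrite -[RHS]/(vertex (tree2 b c y L) h) tree2_vertex //.
  change (index (vertex Y (a.+1 + h)) [:: 1; 2] = (b < h)); rewrite vertY ?ltn_add2l //.
  by rewrite (_ : (a < a.+1 + h) = true) ?/Q ?leq_add2l; [case: (b < h) | lia].
- rewrite [X in map _ X = _]iota_shift -map_comp; apply: map_iota0 => [|h hh].
    by rewrite size_map size_iota.
  rewrite -[RHS]/(mate (tree2 b c y L) h) tree2_mate //.
  change (index (if a.+1 + h \in ps then a.+1 + h else mate Y (a.+1 + h)) (iota a.+1 (b.+1 + c.+1))
    = swap y.+1 b.+1 h).
  have -> : a.+1 + h \in ps = (h != y.+1) && (h != b.+1).
    by rewrite mem_ps ltn_add2l hh /g /Q !eqn_add2l.
  have [_ _ E1 E2] := tree3_edges c lg ok; rewrite (iota_shift a.+1).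
  case: (h =P y.+1) => [->|n1].
    change (index (mate Y g) [seq a.+1 + h | h <- iota 0 (b.+1 + c.+1)] = swap y.+1 b.+1 y.+1).
    by rewrite [mate Y _]E1 swapl index_map_add index_iota0 //; lia.
  case: (h =P b.+1) => [->|n2].
    change (index (mate Y Q) [seq a.+1 + h | h <- iota 0 (b.+1 + c.+1)] = swap y.+1 b.+1 b.+1).
    by rewrite [mate Y _]E2 swapr index_map_add index_iota0 //; have := yb; lia.
  change (index (a.+1 + h) [seq a.+1 + h | h <- iota 0 (b.+1 + c.+1)] = swap y.+1 b.+1 h).
  by rewrite index_map_add index_iota0 // swap_fix.
- rewrite -/(halves S 1) [halves S 1]tree2_halves1 (iota_shift a.+1 m.+1) -map_comp.
  apply: map_iota0 => // h hh.
  change (index (nth 0 ps (a.+1 + h)) (iota a.+1 (b.+1 + c.+1)) = nth 0 L h).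
  by rewrite ps2 // iota_shift index_map_add index_iota0 // L_lt.
Qed.

Let cfiber0 : trivial_tree (fiber Y S (PreMor ps [:: 0; 1; 1]) 0).
Proof.
have fh : fiber_halves Y (PreMor ps [:: 0; 1; 1]) 0 = iota 0 a.+1.
  rewrite /fiber_halves nY; apply: filter_iota => [|h hh]; first by lia.
  rewrite vertY // /onvert /= add0n ltnS; case: (ltnP a h) => h1; first by case: (Q <= h).
  by have -> : (Q <= h) = false by rewrite /Q; lia.
split; first by [].
rewrite /fiber /nhalf fh size_map size_iota -/(halves S 0) [halves S 0]tree2_halves0.
apply: map_iota0; rewrite ?size_iota // => h hh.
change (index (nth 0 ps h) (iota 0 a.+1) = nth 0 (iota 0 a.+1) h).
by rewrite ps1 // index_iota0 // nth_iota.
Qed.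

Lemma contract2_exists : exists f : hom Y contract2_S,
  mor f = PreMor ps [:: 0; 1; 1] /\ elementary f 1 contract2_F.
Proof.
have [E1 E2 E3 E4] := tree3_edges c lg ok.
apply: contract_build => //.
- by rewrite nS sps.
- by apply/allP => h; rewrite mem_ps nY => /and3P[].
- move=> h; rewrite nS => hh; rewrite [mate S h]tree2_mate //.
  have px : nth 0 ps x.+1 = x.+1 by rewrite ps1 // ltnS.
  have [->|n1] := h =P x.+1; first by rewrite swapl psa px [mate Y _]E1.
  have [->|n2] := h =P a.+1; first by rewrite swapr psa px [mate Y _]E2.
  have := ps_mem hh; rewrite mem_ps => /and3P[l1 /eqP l2 /eqP l3].
  have l4 : nth 0 ps h <> x.+1.
    by rewrite -px => e; apply: n1; apply: ps_inj e => //; have := xa; lia.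
  have l5 : nth 0 ps h <> a.+1 by rewrite -psa => e; apply: n2; apply: ps_inj e => //; lia.
  by rewrite swap_fix // [mate Y _]tree3_fix.
- by rewrite [legs S]/(reind ps lg) reindK.
- by move=> [|[|v]].
- move=> h; rewrite nS => hh; rewrite [vertex S h]tree2_vertex //.
  have := ps_mem hh; rewrite mem_ps => /and3P[l1 _ _]; rewrite vertY //.
  case: (ltnP a h) => h1.
    have eh : h = a.+1 + (h - a.+1) by lia.
    rewrite eh ps2; last by lia.
    by rewrite leq_addr; case: (Q <= _).
  rewrite ps1 // [a < h]ltnNge h1 /=.
  by have -> : (Q <= h) = false by rewrite /Q; lia.
- have vg : vertex Y g = 1.
    rewrite vertY; last by rewrite /g; have := yb; lia.
    have -> : (a < g) = true by rewrite /g; lia.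
    by have -> : (Q <= g) = false by rewrite /Q /g; have := yb; lia.
  have vQ : vertex Y Q = 2.
    rewrite vertY; last by rewrite /Q; lia.
    by rewrite leqnn (_ : (a < Q) = true) // /Q; lia.
  move=> h; rewrite nY => hh; rewrite mem_ps hh /= negb_and !negbK => /orP[] /eqP ->.
    by rewrite [mate Y _]E3 vg vQ.
  by rewrite [mate Y _]E4 vg vQ.
- have -> : nedge contract2_F = 1 by exact: (tree2_nedge yb (labels2_relabels c yb)).
  by [].
- by move=> [|[|j]].
Qed.

End Contract2.

Local Open Scope ring_scope.

(** * Values of the two contractions as nested composites *)

Section Evaluations.
Variables (k : fieldType) (A : gcoll k) (s : symm A) (dl : int) (P : gcmp s dl).
Implicit Types u v z : packed A.

Lemma ev_edge2 m n i lg (im : (i < m)%N) (hlg : relabels (labels2 m n i) lg) l u v :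
  labels (tree2 m n i lg) l -> ar u = m -> ar v = n ->
  ev (edge_end P (rtree2 im hlg)) l [:: u; v] = rel s (labels2 m n i) l (tin (pcp P i u v)).
Proof.
move=> hl hu hv.
have hS : nedge (rtree2 im hlg) = 1%N by exact: (tree2_nedge im hlg).
have fS : fits (rtree2 im hlg) [:: u; v] by rewrite /fits [valences _]tree2_valences /= hu hv.
rewrite (ev_edge P hS hl fS) /edge_raw /edge_sign (tree2_rootv im hlg) //.
by rewrite (tree2_edge_labels im hlg) // (tree2_bot_index im hlg) // scale1r.
Qed.

Lemma inner_edge2 m n i (im : (i < m)%N) u v : ar u = m -> ar v = n ->
  inner (edge_end P (rtree2 im (labels2_relabels n im))) [:: u; v] = pcp P i u v.
Proof.
move=> hu hv; set F := rtree2 _ _.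
have hl : labels F (legs F) by exact: labels_legs.
rewrite /inner (ev_edge2 im (labels2_relabels n im) hl hu hv) rel_id; last exact: labels_uniq hl.
rewrite -[RHS]pk_tin pcp_ar pcp_dg; congr (pk _ _ _); last first.
  by rewrite !degs_cons /degs big_nil addr0.
rewrite /pi0 -[legs F]/(labels2 m n i) size_labels2 //; congr _.-1.
by rewrite hu hv.
Qed.

Section Three.
Variables (a b c x g : nat) (lg : seq nat).
Hypotheses (ok : graft_at a b x g) (hlg : relabels (labels3 a b c x g) lg).

Lemma tree3_labels : labels (rtree3 ok hlg) (labels3 a b c x g).
Proof. exact: relabels_labels (labels_legs (rtree3 ok hlg)) (relabels_sym hlg). Qed.

Lemma ev_contract1 (f : hom (rtree3 ok hlg) (contract1_S ok hlg))
  (ef : elementary f 0 (contract1_F ok)) ph :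
  mor f = PreMor (labels2 a b x ++ iota (a.+1 + b.+1) c.+1) ph ->
  forall l u v z, labels (rtree3 ok hlg) l -> ar u = a -> ar v = b -> ar z = c ->
  ev (ecirc ef erefl (edge_end P (contract1_S ok hlg)) (edge_end P (contract1_F ok)))
    l [:: u; v; z] =
  rel s (labels3 a b c x g) l
    (tin (pcp P (index g (labels2 a b x)).-1 (pcp P x u v) z)).
Proof.
move=> mf l u v z hl hu hv hz.
have fY : fits (rtree3 ok hlg) ([::] ++ [:: u; v] ++ [:: z]).
  by rewrite /fits [valences _]tree3_valences /= hu hv hz.
rewrite -[[:: u; v; z]]/([::] ++ [:: u; v] ++ [:: z]) ev_circ //.
rewrite /degs big_nil mulr0 koszul0 scale1r cat0s inner_edge2 //.
have hl1 := labels_reind f hl.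
rewrite (ev_edge2 _ _ hl1) //; last by rewrite pcp_ar hu hv.
rewrite -(contract1_labels c lg ok) -(reind_rel s f _ tree3_labels hl).
by rewrite mf.
Qed.

End Three.

Section Chain.
Variables (a b c x y : nat) (lg : seq nat).
Hypotheses (xa : (x < a)%N) (yb : (y < b)%N).
Hypothesis (hlg : relabels (labels3 a b c x (a.+1 + y.+1)) lg).

(** Here the fiber consists of the last two vertices, so its operation of degree [dl] passes the
    input [u]; in [ev_contract1] nothing precedes the fiber. This is the origin of the sign in the
    associativity of compositions of nonzero degree. *)
Lemma ev_contract2 (f : hom (rtree3 (chain_graft xa yb) hlg) (contract2_S xa yb hlg))
  (ef : elementary f 1 (contract2_F c yb)) ph :
  mor f = PreMor (iota 0 a.+1 ++ [seq (a.+1 + h)%N | h <- labels2 b c y]) ph ->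
  forall l u v z, labels (rtree3 (chain_graft xa yb) hlg) l ->
  ar u = a -> ar v = b -> ar z = c ->
  ev (ecirc ef erefl (edge_end P (contract2_S xa yb hlg)) (edge_end P (contract2_F c yb)))
    l [:: u; v; z] =
  koszul k (dl * dg u) *:
  rel s (labels3 a b c x (a.+1 + y.+1)) l (tin (pcp P x u (pcp P y v z))).
Proof.
move=> mf l u v z hl hu hv hz; set ok := chain_graft xa yb in f ef mf hl *.
have fY : fits (rtree3 ok hlg) ([:: u] ++ [:: v; z] ++ [::]).
  by rewrite /fits [valences _]tree3_valences /= hu hv hz.
rewrite -[[:: u; v; z]]/([:: u] ++ [:: v; z] ++ [::]) ev_circ //.
rewrite degs_cons /degs big_nil addr0 inner_edge2 //; congr (_ *: _).
have hl1 := labels_reind f hl.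
rewrite -[[:: u] ++ _]/[:: u; pcp P y v z] (ev_edge2 _ _ hl1) //; last by rewrite pcp_ar hv hz.
rewrite -(contract2_labels c lg xa yb) -(reind_rel s f _ (tree3_labels ok hlg) hl).
by rewrite mf.
Qed.

Lemma chain_index : (index (a.+1 + y.+1) (labels2 a b x)).-1 = (x + y)%N.
Proof.
have xin : x.+1 \in iota 0 a.+1 by rewrite mem_iota; have := xa; lia.
have := @nth_splice_in (iota 0 a.+1) x.+1 (iota a.+1 b.+1) y xin.
rewrite size_iota => /(_ yb); rewrite index_iota0 // nth_iota // => e.
have e2 : nth 0%N (labels2 a b x) (x.+1 + y) = (a.+1 + y.+1)%N by exact: e.
have /and3P[u _ _] := labels2_relabels b xa.
have lt : (x.+1 + y < size (labels2 a b x))%N.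
  by rewrite size_labels2 //; have := xa; have := yb; lia.
by have := index_uniq 0%N lt u; rewrite e2 => ->.
Qed.

End Chain.

(** If [y] comes after [x], the [b] inputs that have replaced the input [x] shift it by [b - 1]. *)
Lemma fork_index a b x y : (x < a)%N -> (y < a)%N -> y <> x ->
  (index y.+1 (labels2 a b x)).-1 = (if (y < x)%N then y else y + b - 1)%N.
Proof.
move=> xa ya ne; have xin : x.+1 \in iota 0 a.+1 by rewrite mem_iota; lia.
have ne' : y.+1 <> index x.+1 (iota 0 a.+1) by rewrite index_iota0 // => -[].
have := @nth_splice_out (iota 0 a.+1) x.+1 (iota a.+1 b.+1) y.+1 xin.
rewrite size_iota index_iota0 // nth_iota // add0n in ne' * => /(_ isT ne') e.
have /and3P[u _ _] := labels2_relabels b xa.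
have lt : ((if y.+1 < x.+1 then y.+1 else y.+1 + b.+1 - 2) < size (labels2 a b x))%N.
  by rewrite size_labels2 //; case: ifP; lia.
have := index_uniq 0%N lt u; rewrite [nth _ _ _]e => ->; rewrite ltnS.
by case: ifP; lia.
Qed.

End Evaluations.

Local Open Scope nat_scope.

Lemma iso_comp T S V (v : iso T S) (w : iso S V) :
  exists u : iso T V, mor u = comp_mor w v.
Proof.
have nT := iso_nhalf v; have nS := iso_nhalf w; have vT := iso_nvert v; have vS := iso_nvert w.
have pv := morP v; have pw := morP w.
have sps : size (psi w) = nhalf V by exact: mor_psi_size pw.
have lt h : h \in psi w -> h < nhalf S by move/(allP (mor_psi_lt pw)).
have ltp h : h \in phi v -> h < nvert S by move/(allP (mor_phi_lt pv)).
have up : uniq (phi v) by rewrite (perm_uniq (iso_phi_perm v)) iota_uniq.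
have ov h : h < nhalf V -> nth 0 [seq onhalf v h | h <- psi w] h = onhalf v (onhalf w h).
  by move=> hh; rewrite (nth_map 0) ?sps.
have op u : u < nvert T -> nth 0 [seq onvert w u | u <- phi v] u = onvert w (onvert v u).
  by move=> hh; rewrite (nth_map 0) ?(mor_phi_size pv).
apply: iso_build; rewrite ?nT ?nS ?vT ?vS //.
- apply: uniq_perm; rewrite ?iota_uniq //.
    rewrite map_inj_in_uniq ?(mor_psi_uniq pw) // => h h' /lt hh /lt hh'.
    exact: onhalf_inj.
  have u : uniq [seq onhalf v h | h <- psi w].
    rewrite map_inj_in_uniq ?(mor_psi_uniq pw) // => h h' /lt hh /lt hh'.
    exact: onhalf_inj.
  have sub : {subset [seq onhalf v h | h <- psi w] <= iota 0 (nhalf V)}.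
    by move=> _ /mapP[h /lt hh ->]; rewrite mem_iota add0n -nS -nT onhalf_lt.
  have [|_] := uniq_min_size u sub; first by rewrite size_iota size_map sps.
  by move=> e h; rewrite e.
- have u : uniq [seq onvert w u | u <- phi v].
    by rewrite map_inj_in_uniq // => h h' /ltp hh /ltp hh'; exact: onvert_inj.
  apply: uniq_perm; rewrite ?iota_uniq //.
  have sub : {subset [seq onvert w u | u <- phi v] <= iota 0 (nvert V)}.
    by move=> _ /mapP[h /ltp hh ->]; rewrite mem_iota add0n onvert_lt.
  have [|_] := uniq_min_size u sub; first by rewrite size_iota size_map (mor_phi_size pv) vT vS.
  by move=> e h; rewrite e.
- move=> h hh; rewrite !ov ?mate_lt // iso_mate ?onhalf_lt //; congr onhalf.
  by rewrite iso_mate.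
- rewrite -(mor_legs pv) -(mor_legs pw) -map_comp; apply/eq_in_map => h /legs_lt hh.
  exact: ov.
- move=> h hh; rewrite ov // op ?vertex_lt ?onhalf_lt //.
  by rewrite (mor_vertex pv) ?onhalf_lt // (mor_vertex pw).
Qed.

Lemma nth_fiber_mate T S (f : premor) j h : h < size (fiber_halves T f j) ->
  mate (fiber T S f j) h =
  index (if nth 0 (fiber_halves T f j) h \in psi f then nth 0 (fiber_halves T f j) h
         else mate T (nth 0 (fiber_halves T f j) h)) (fiber_halves T f j).
Proof. by move=> hh; rewrite /mate /= (nth_map 0). Qed.

Lemma nth_fiber_vertex T S (f : premor) j h : h < size (fiber_halves T f j) ->
  vertex (fiber T S f j) h =
  index (vertex T (nth 0 (fiber_halves T f j) h)) (fiber_verts T f j).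
Proof. by move=> hh; rewrite /vertex /= (nth_map 0). Qed.

Lemma nhalf_fiberE T S (f : premor) j : nhalf (fiber T S f j) = size (fiber_halves T f j).
Proof. by rewrite /nhalf /= size_map. Qed.

(** * Contractions are determined by the half-edges that survive *)

Section ContractionUnique.
Variables (T S T' S' : rtr) (p : hom T S) (p' : hom T' S') (s1 : iso T T').
Hypothesis (nv : nvert S = nvert S').
Hypothesis im : psi p =i psi (comp_mor p' s1).

Let pP := morP p.
Let pP' := morP p'.
Let q h := onhalf s1 (onhalf p' h).
Let r v := onvert p' (onvert s1 v).

Let psiq : psi (comp_mor p' s1) = [seq q h | h <- iota 0 (nhalf S')].
Proof.
rewrite /= -{1}[psi p'](mkseq_nth 0) /mkseq hom_psi_size -map_comp.
by apply: eq_map.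
Qed.
Let phir : phi (comp_mor p' s1) = [seq r v | v <- iota 0 (nvert T)].
Proof.
rewrite /= -{1}[phi s1](mkseq_nth 0) /mkseq hom_phi_size -map_comp.
by apply: eq_map.
Qed.
Let q_lt h : h < nhalf S' -> q h < nhalf T.
Proof. by move=> hh; rewrite onhalf_lt // onhalf_lt. Qed.
Let r_lt v : v < nvert T -> r v < nvert S'.
Proof. by move=> hh; rewrite onvert_lt // onvert_lt. Qed.
Let q_inj h h' : h < nhalf S' -> h' < nhalf S' -> q h = q h' -> h = h'.
Proof. by move=> hh hh' e; apply: (@onhalf_inj _ _ p') => //; apply: (@onhalf_inj _ _ s1) => //; exact: onhalf_lt. Qed.
Let q_in h : h < nhalf S' -> q h \in psi p.
Proof. by move=> hh; rewrite im psiq map_f // mem_iota. Qed.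

Let contr h : h < nhalf T -> h \notin psi p -> r (vertex T h) = r (vertex T (mate T h)).
Proof.
move=> hh hn; have [h' hh' e] : exists2 h', h' < nhalf T' & h = onhalf s1 h'.
  by exists (onhalf (bwd s1) h); rewrite ?onhalf_lt // iso_onhalfK.
have hn' : h' \notin psi p'.
  apply: contra hn => hp; rewrite im psiq e; case/(nthP 0): hp => j.
  rewrite hom_psi_size => hj <-; apply: (map_f q); by rewrite mem_iota.
rewrite /r e iso_mate // !(mor_vertex (morP s1)) ?mate_lt //.
exact: (mor_contract pP').
Qed.

(** Two vertices in one fiber of [p] are joined by a path inside the fiber, which runs through
    half-edges outside [psi p]. These are contracted by the other morphism as well, so that it
    factors through [p]. *)
Let kernel u v : u < nvert T -> v < nvert T -> onvert p u = onvert p v -> r u = r v.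
Proof.
move=> hu hv e; set j := onvert p v in e; have hj : j < nvert S by exact: onvert_lt.
set V := fiber_verts T p j.
have memV w : (w \in V) = (w < nvert T) && (onvert p w == j).
  by rewrite mem_filter mem_iota add0n andbC.
have uV : u \in V by rewrite memV hu e eqxx.
have vV : v \in V by rewrite memV hv eqxx.
have [_ cn] := mor_fiber pP hj.
have [|| path1 pp lp] := cn (index u V) (index v V); rewrite ?index_mem //.
have key : forall l x, path (adjacent (fiber T S p j)) x l -> x < size V ->
    r (nth 0 V x) = r (nth 0 V (last x l)).
  elim=> [//|y l IH] x /= /andP[/hasP[h]]; rewrite mem_iota add0n nhalf_fiberE => /andP[_ hh].
  case/andP=> /eqP hx /eqP hy pl hxV.
  set h1 := nth 0 (fiber_halves T p j) h.
  have h1in : h1 \in fiber_halves T p j by rewrite mem_nth.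
  have : h1 < nhalf T /\ onvert p (vertex T h1) = j.
    by move: h1in; rewrite mem_filter mem_iota add0n => /andP[/eqP ? ?].
  case=> h1lt h1v.
  have v1 : vertex T h1 \in V by rewrite memV vertex_lt // h1v eqxx.
  have ex : nth 0 V x = vertex T h1 by rewrite -hx nth_fiber_vertex // nth_index.
  rewrite nth_fiber_mate // -/h1 in hy.
  set h2 := if h1 \in psi p then h1 else mate T h1 in hy.
  have h2f : [/\ h2 < nhalf T, onvert p (vertex T h2) = j & r (vertex T h1) = r (vertex T h2)].
    rewrite /h2; case: ifP => // hn; split; first exact: mate_lt.
      by rewrite -(mor_contract pP) ?hn.
    by apply: contr; rewrite ?hn.
  case: h2f => h2lt h2v er.
  have h2in : h2 \in fiber_halves T p j by rewrite mem_filter mem_iota add0n h2lt h2v eqxx.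
  have v2 : vertex T h2 \in V by rewrite memV vertex_lt // h2v eqxx.
  have ey : nth 0 V y = vertex T h2.
    by rewrite -hy nth_fiber_vertex ?index_mem // nth_index // nth_index.
  have yV : y < size V by rewrite -hy nth_fiber_vertex ?index_mem // nth_index // index_mem.
  by rewrite -(IH y pl yV) ex ey er.
by have := key _ _ pp; rewrite index_mem lp !nth_index // => ->.
Qed.

Let ps := [seq index (q h) (psi p) | h <- iota 0 (nhalf S')].
Let ph := [seq r (index v (phi p)) | v <- iota 0 (nvert S)].

Let nps h : h < nhalf S' -> nth 0 ps h = index (q h) (psi p).
Proof. by move=> hh; rewrite (nth_map 0) ?size_iota // nth_iota. Qed.
Let ops h : h < nhalf S' -> onhalf p (nth 0 ps h) = q h.
Proof. by move=> hh; rewrite nps // /onhalf nth_index // q_in. Qed.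
Let ps_lt h : h < nhalf S' -> nth 0 ps h < nhalf S.
Proof. by move=> hh; rewrite nps // -(hom_psi_size p) index_mem q_in. Qed.
Let nph v : v < nvert T -> nth 0 ph (onvert p v) = r v.
Proof.
move=> hv; have hp := onvert_lt p hv; rewrite (nth_map 0) ?size_iota // nth_iota //.
have vin : onvert p v \in phi p by rewrite mem_nth // hom_phi_size.
apply: kernel => //; first by rewrite -(hom_phi_size p) index_mem.
by rewrite {1}/onvert nth_index.
Qed.

Let nhS : nhalf S' = nhalf S.
Proof.
have : perm_eq (psi p) (psi (comp_mor p' s1)).
  apply: uniq_perm => //; first exact: mor_psi_uniq pP.
  rewrite psiq map_inj_in_uniq ?iota_uniq // => h h'; rewrite !mem_iota !add0n => hh hh'.
  exact: q_inj.
by move/perm_size; rewrite hom_psi_size psiq size_map size_iota.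
Qed.

(** The induced map on vertices exists by [kernel] and is onto; the equality [nv] of the numbers of
    vertices makes it bijective. *)
Lemma contraction_unique : exists s2 : iso S S', comp_mor s2 p = comp_mor p' s1.
Proof.
have [s2 e2] : exists s2 : iso S S', mor s2 = PreMor ps ph.
  apply: iso_build => //.
  - apply: (perm_trans (y := [seq index h (psi p) | h <- psi p])); last first.
      by rewrite map_index_uniq ?(mor_psi_uniq pP) // hom_psi_size.
    rewrite /ps (map_comp (fun h => index h (psi p)) q); apply: perm_map.
    rewrite -psiq; apply: uniq_perm; last by move=> h; rewrite im.
      rewrite psiq map_inj_in_uniq ?iota_uniq // => h h'; rewrite !mem_iota !add0n => hh hh'.
      exact: q_inj.
    exact: mor_psi_uniq pP.
  - have sub : {subset iota 0 (nvert S') <= ph}.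
      move=> v'; rewrite mem_iota add0n => /andP[_ hv'].
      have /(nthP 0)[u] := mor_phi_surj pP' hv'; rewrite hom_phi_size => hu e.
      have hu' := onvert_lt (bwd s1) hu.
      have <- : r (onvert (bwd s1) u) = v' by rewrite /r iso_fwdK.
      rewrite -nph //; apply: mem_nth; rewrite size_map size_iota; exact: onvert_lt.
    have [|e1 e2] := uniq_min_size (iota_uniq 0 (nvert S')) sub.
      by rewrite size_map !size_iota nv.
    rewrite perm_sym; apply: uniq_perm; rewrite ?iota_uniq //.
    by rewrite (uniq_size_uniq (iota_uniq 0 (nvert S')) e2) size_map !size_iota nv.
  - move=> h hh; apply: (@onhalf_inj _ _ p); rewrite ?mate_lt ?ps_lt // ?ps_lt ?mate_lt //.
    rewrite ops ?mate_lt // (mor_mate pP) ?ps_lt // ops // /q (mor_mate pP') //.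
    by rewrite iso_mate // onhalf_lt.
  - rewrite -(reind_legs p) -(mor_legs (morP s1)) -(mor_legs pP') /reind -!map_comp.
    by apply/eq_in_map => h /legs_lt hh; exact: nps.
  - move=> h hh; rewrite -(mor_vertex pP) ?ps_lt // nph ?vertex_lt ?onhalf_lt ?ps_lt //.
    rewrite ops // /r /q (mor_vertex (morP s1)) ?onhalf_lt //; exact: (mor_vertex pP').
exists s2; rewrite e2; case E : (comp_mor p' s1) => [A1 A2]; congr PreMor.
  rewrite -[A1]/(psi (PreMor A1 A2)) -E psiq /ps -map_comp; apply/eq_in_map => h.
  by rewrite mem_iota add0n => /andP[_ hh]; rewrite -ops // nps.
rewrite -[A2]/(phi (PreMor A1 A2)) -E phir -{1}[phi p](mkseq_nth 0) /mkseq hom_phi_size -map_comp.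
by apply/eq_in_map => v; rewrite mem_iota add0n => /andP[_ hv]; exact: nph.
Qed.

End ContractionUnique.

Local Open Scope nat_scope.

Lemma relabelled_rtr (T : rtr) lg : relabels (legs T) lg ->
  is_rtr (OTree (nvert T) (src T) (flip T) lg).
Proof.
case/and3P=> u pl /eqP hd; have [g cn eu lgn rt] := rtrP T; split=> //.
- case: g => g1 g2 g3 g4 g5 g6 g7; split=> //.
  by apply: perm_trans g7; rewrite perm_sym.
- by move=> e; move: lgn; have := perm_size pl; rewrite (e : lg = [::]); case: (legs T).
- move=> h h' hh hh' [e|e]; last by apply: rt => //; right; rewrite /tree_root hd.
  by apply: rt => //; left; rewrite /tree_root hd.
Qed.

Section IsoFiber.
Variables (T' S' F' T'' S'' F'' : rtr) (f' : hom T' S') (f'' : hom T'' S'') (i j : nat).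
Variables (ef' : elementary f' i F') (ef'' : elementary f'' j F'').
Variables (w : iso T' T'') (s : iso S' S'').
Hypothesis sq : comp_mor f'' w = comp_mor s f'.

Let gf := comp_mor f'' w.

Let sqv v : v < nvert T' -> onvert f'' (onvert w v) = onvert s (onvert f' v).
Proof.
move=> hv; have := f_equal (fun m => onvert m v) sq.
by rewrite !onvert_comp ?hom_phi_size.
Qed.

Let sqh h : h < nhalf S'' -> onhalf w (onhalf f'' h) = onhalf f' (onhalf s h).
Proof.
move=> hv; have := f_equal (fun m => onhalf m h) sq.
by rewrite !onhalf_comp ?hom_psi_size.
Qed.

(** The vertices [i] and [i.+1] of the block of [f'] have distinct images under [w] that [f''] sends
    to one vertex, and a vertex with two preimages can only be [j]. *)
Lemma iso_index : onvert s i = j.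
Proof.
have n2 := edge_nvert (elt_edge ef'); have nT := elt_nvert ef'; have hi := elt_lt ef'.
have l0 : i < nvert T' by lia.
have l1 : i.+1 < nvert T' by lia.
have f0 : onvert f' i = i by rewrite (elt_onvert ef') // ltnn (_ : i < i + nvert F') //; lia.
have f1 : onvert f' i.+1 = i.
  by rewrite (elt_onvert ef') // ltnNge leqnSn /= -addn1 ltn_add2l n2.
apply: contrapT => ne; have hw0 := onvert_lt w l0; have hw1 := onvert_lt w l1.
have e0 := over_uniq ef'' ne hw0 (etrans (sqv l0) (f_equal (onvert s) f0)).
have e1 := over_uniq ef'' ne hw1 (etrans (sqv l1) (f_equal (onvert s) f1)).
by have /eqP := onvert_inj l0 l1 (etrans e0 (esym e1)); rewrite ltn_eqF.
Qed.

Let hi := elt_lt ef'.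

Let gfv v : v < nvert T' -> (onvert gf v == j) = (onvert f' v == i).
Proof.
move=> hv; rewrite onvert_comp ?hom_phi_size // sqv // -iso_index.
by apply/eqP/eqP => [|-> //]; apply: onvert_inj => //; exact: onvert_lt.
Qed.

Let V := fiber_verts T' f' i.
Let H := fiber_halves T' f' i.

Let eV : fiber_verts T' gf j = V.
Proof. by apply/eq_in_filter => v; rewrite mem_iota add0n => /andP[_ hv]; exact: gfv. Qed.
Let eH : fiber_halves T' gf j = H.
Proof.
by apply/eq_in_filter => h; rewrite mem_iota add0n => /andP[_ hh]; apply: gfv; exact: vertex_lt.
Qed.

Let psi_gf : psi gf =i psi f'.
Proof.
move=> h; rewrite /gf sq; apply/mapP/(nthP 0) => [[x]|[x]].
  case/(nthP 0)=> y; rewrite hom_psi_size => hy <- ->.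
  exists (onhalf s y) => //; rewrite hom_psi_size; exact: onhalf_lt.
rewrite hom_psi_size => hx <-; exists x => //; rewrite -(iso_onhalfK s hx) mem_nth //.
by rewrite hom_psi_size onhalf_lt.
Qed.

Let lg := [seq index (onhalf gf h) H | h <- halves S'' j].

Let lg_relabels : relabels (legs F') lg.
Proof.
rewrite (legs_fiber ef') -/H; have := iso_halves s hi; rewrite iso_index => r.
have -> : lg = [seq index (onhalf f' h) H | h <- [seq onhalf s h | h <- halves S'' j]].
  rewrite -map_comp; apply/eq_in_map => h; rewrite mem_halves => /andP[hh _].
  by rewrite onhalf_comp ?hom_psi_size // sqh.
apply: relabels_map r; first by rewrite size_halves.
move=> h h'; rewrite !mem_halves => /andP[hh /eqP vh] /andP[hh' /eqP vh'] e.
have inH x : x < nhalf S' -> vertex S' x = i -> onhalf f' x \in H.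
  by move=> hx vx; rewrite mem_fiber_halves onhalf_lt // (mor_vertex (morP f')) // vx eqxx.
apply: (@onhalf_inj _ _ f') => //.
by rewrite -(nth_index 0 (inH _ hh vh)) e nth_index // inH.
Qed.

Let Ft := fiber T' S'' gf j.
Let eF : Ft = OTree (nvert F') (src F') (flip F') lg.
Proof.
rewrite /Ft /fiber eV eH (elt_fiber ef') /=; congr OTree.
by apply: eq_map => h; rewrite psi_gf.
Qed.

Let F : rtr := RTr (relabelled_rtr lg_relabels).
Let FE : tree F = Ft. Proof. by rewrite eF. Qed.

Let H2 := fiber_halves T'' f'' j.
Let V2 := fiber_verts T'' f'' j.
Let ps := [seq index (onhalf w h) H | h <- H2].
Let ph := [seq index (onvert w v) V2 | v <- V].

Let memH h : (h \in H) = (h < nhalf T') && (onvert f' (vertex T' h) == i).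
Proof. exact: mem_fiber_halves. Qed.
Let memH2 h : (h \in H2) = (h < nhalf T'') && (onvert f'' (vertex T'' h) == j).
Proof. exact: mem_fiber_halves. Qed.
Let uH : uniq H. Proof. exact: fiber_halves_uniq. Qed.
Let uH2 : uniq H2. Proof. exact: fiber_halves_uniq. Qed.
Let memV v : (v \in V) = (v < nvert T') && (onvert f' v == i).
Proof. by rewrite mem_filter mem_iota add0n andbC. Qed.
Let memV2 v : (v \in V2) = (v < nvert T'') && (onvert f'' v == j).
Proof. by rewrite mem_filter mem_iota add0n andbC. Qed.

Let wH h : h < nhalf T'' -> (onhalf w h \in H) = (h \in H2).
Proof.
move=> hh; rewrite memH memH2 hh onhalf_lt //= -gfv ?vertex_lt ?onhalf_lt //.
rewrite onvert_comp ?hom_phi_size ?vertex_lt ?onhalf_lt //.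
by rewrite (mor_vertex (morP w)).
Qed.
Let H2_lt h : h \in H2 -> h < nhalf T''. Proof. by rewrite memH2 => /andP[]. Qed.
Let wV v : v < nvert T' -> (onvert w v \in V2) = (v \in V).
Proof.
by move=> hv; rewrite memV memV2 hv onvert_lt //= -gfv // onvert_comp ?hom_phi_size.
Qed.

Let permH : perm_eq [seq onhalf w h | h <- H2] H.
Proof.
apply: uniq_perm => //.
  by rewrite map_inj_in_uniq // => h h' /H2_lt hh /H2_lt hh'; exact: onhalf_inj.
move=> h; apply/mapP/idP => [[x hx ->]|hH]; first by rewrite wH ?H2_lt.
have hh : h < nhalf T' by move: hH; rewrite memH => /andP[].
exists (onhalf (bwd w) h); last by rewrite iso_onhalfK.
by rewrite -wH ?onhalf_lt // iso_onhalfK.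
Qed.

Let permV : perm_eq [seq onvert w v | v <- V] V2.
Proof.
have V_lt v : v \in V -> v < nvert T' by rewrite memV => /andP[].
apply: uniq_perm => //; rewrite ?filter_uniq ?iota_uniq //.
  rewrite map_inj_in_uniq ?filter_uniq ?iota_uniq // => h h' /V_lt hh /V_lt hh'; exact: onvert_inj.
move=> v; apply/mapP/idP => [[x hx ->]|hV]; first by rewrite wV ?V_lt.
have hv : v < nvert T'' by move: hV; rewrite memV2 => /andP[].
exists (onvert (bwd w) v); last by rewrite iso_fwdK.
by rewrite -wV ?onvert_lt // iso_fwdK.
Qed.

Let nF : nhalf F = size H. Proof. by rewrite -[nhalf F]/(nhalf F') (nhalf_fiber ef'). Qed.
Let nF2 : nhalf F'' = size H2. Proof. exact: nhalf_fiber ef''. Qed.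
Let sH : size H2 = size H. Proof. by have := perm_size permH; rewrite size_map. Qed.
Let sV : size V = size V2. Proof. by have := perm_size permV; rewrite size_map. Qed.
Let vF : nvert F = size V. Proof. by rewrite -[nvert F]/(nvert F') (nvert_fiber ef'). Qed.
Let vF2 : nvert F'' = size V2. Proof. exact: nvert_fiber ef''. Qed.

Let mateF h : h < size H -> mate F h =
  index (if nth 0 H h \in psi f' then nth 0 H h else mate T' (nth 0 H h)) H.
Proof. by move=> hh; rewrite -[mate F h]/(mate F' h) (elt_fiber ef') nth_fiber_mate. Qed.
Let vertF h : h < size H -> vertex F h = index (vertex T' (nth 0 H h)) V.
Proof. by move=> hh; rewrite -[vertex F h]/(vertex F' h) (elt_fiber ef') nth_fiber_vertex. Qed.
Let nps h : h < size H2 -> nth 0 ps h = index (onhalf w (nth 0 H2 h)) H.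
Proof. by move=> hh; rewrite (nth_map 0). Qed.

(** Provides the data that [circ_iso] takes for granted. The fiber of the composite is [F'] with its
    legs in the order coming from [S''], hence has the same [unlabel] as [F']. *)
Lemma iso_fiber_exists : exists (F u : rtr) (g : hom F u) (l : nat)
  (hu : local_terminal u) (eg : elementary g l F') (wj : iso F F''),
  tree F = fiber T' S'' (comp_mor f'' w) j /\ mor wj = induced T' T'' w f'' j.
Proof.
have h0 : 0 < nedge F by exact: (elt_edge ef').
have eu : unlabel F = unlabel F'.
  have e1 : 0 < nedge F' by exact: (elt_edge ef').
  rewrite /unlabel h0 ?e1; congr OTree; have /and3P[_ pl /eqP] := lg_relabels.
  have := perm_size pl; have := rtr_leg (rtrP F'); rewrite -[legs F]/lg.
  by case: (legs F') (lg) => [|y l] [|y' l'] //= _ _ ->; rewrite !take0.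
have [wj ewj] : exists wj : iso F F'', mor wj = PreMor ps ph.
  apply: iso_build.
  - rewrite nF -(map_index_uniq uH) /ps (map_comp (fun h => index h H) (onhalf w)).
    exact: perm_map.
  - by rewrite nF nF2.
  - rewrite vF2 -(map_index_uniq (l := V2)) ?filter_uniq ?iota_uniq // /ph.
    by rewrite (map_comp (fun v => index v V2) (onvert w)); exact: perm_map.
  - by rewrite vF vF2.
  - rewrite nF2 => h hh; have xin := mem_nth 0 hh; set x := nth 0 H2 h in xin.
    have hx := H2_lt xin; have wx : onhalf w x \in H by rewrite wH.
    rewrite [nth 0 ps h]nps // -/x mateF ?index_mem // nth_index //.
    have -> : mate F'' h = index (if x \in psi f'' then x else mate T'' x) H2.
      by rewrite (elt_fiber ef'') nth_fiber_mate.
    have -> : (onhalf w x \in psi f') = (x \in psi f'').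
      rewrite -psi_gf; apply/mapP/idP => [[y hy e]|]; last by exists x.
      by rewrite (_ : x = y) //; apply: (@onhalf_inj _ _ w) => //; exact: (allP (mor_psi_lt (morP f''))).
    set x' := if x \in psi f'' then x else mate T'' x.
    have x'in : x' \in H2.
      rewrite /x'; case: ifP => // hn; rewrite memH2 mate_lt //=.
      by rewrite -(mor_contract (morP f'')) ?hn //; move: xin; rewrite memH2 => /andP[].
    rewrite nps ?index_mem // nth_index // /x'; congr index.
    by case: ifP => // _; rewrite iso_mate.
  - rewrite -[legs F]/lg (legs_fiber ef'') -/H2 -map_comp; apply/eq_in_map => h.
    rewrite mem_halves => /andP[hh /eqP vh] /=.
    have xin : onhalf f'' h \in H2.
      by rewrite memH2 onhalf_lt // (mor_vertex (morP f'')) // vh eqxx.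
    by rewrite nps ?index_mem // nth_index // onhalf_comp ?hom_psi_size.
  - rewrite nF2 => h hh; have xin := mem_nth 0 hh; set x := nth 0 H2 h in xin.
    have hx := H2_lt xin; have wx : onhalf w x \in H by rewrite wH.
    rewrite nps // -/x vertF ?index_mem // nth_index //.
    have vin : vertex T' (onhalf w x) \in V.
      by move: wx; rewrite memH memV => /andP[h1 h2]; rewrite vertex_lt.
    rewrite (nth_map 0) ?index_mem // nth_index // (mor_vertex (morP w)) //.
    by rewrite (elt_fiber ef'') nth_fiber_vertex.
exists F, (relabel_u h0 eu), (relabel_hom h0 eu), 0, erefl, (relabel_elementary h0 eu), wj.
split; first exact: FE.
by rewrite ewj /induced -/gf eV eH.
Qed.

End IsoFiber.

Local Open Scope ring_scope.

(** * Decompositions of a tree with two edges and their values *)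

Lemma comp_morA (T S : rtr) (h g f : premor) :
  is_mor T S f -> {subset psi h <= iota 0 (size (psi g))} ->
  size (phi g) = nvert S ->
  comp_mor h (comp_mor g f) = comp_mor (comp_mor h g) f.
Proof.
move=> fP lh sg; rewrite /comp_mor /=; congr PreMor.
  rewrite -map_comp; apply/eq_in_map => x /lh; rewrite mem_iota => /andP[_ hx].
  by rewrite /onhalf /= (nth_map 0%N).
rewrite -map_comp; apply/eq_in_map => x /(allP (mor_phi_lt fP)) hx.
by rewrite /onvert /= (nth_map 0%N) ?sg.
Qed.

Lemma hom_compA T S U V (f : hom T S) (g : hom S U) (h : hom U V) :
  comp_mor h (comp_mor g f) = comp_mor (comp_mor h g) f.
Proof.
apply: (comp_morA (morP f)); last exact: hom_phi_size.
by move=> x /(allP (mor_psi_lt (morP h))) hx; rewrite hom_psi_size mem_iota.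
Qed.

Lemma hom_comp1 T S (f : hom T S) : comp_mor f (id_mor T) = f.
Proof.
case: f => [[ps ph] fP]; rewrite /comp_mor /=; congr PreMor.
  apply: map_id_in => h hh; rewrite /onhalf nth_iota //.
  exact: (allP (mor_psi_lt fP) _ hh).
by rewrite -(mor_phi_size fP) -/(mkseq _ _) mkseq_nth.
Qed.

Lemma dec_nedge X (c : decomp X) : nedge X = (nedge (dec_S c) + nedge (dec_F c))%N.
Proof.
have := elt_nvert (dec_elt c); rewrite !(rtr_euler (rtrP _)) (iso_nedge (dec_iso c)).
lia.
Qed.

Lemma dec_nedge1 X (c : decomp X) : nedge X = 2%N ->
  nedge (dec_S c) = 1%N /\ nedge (dec_F c) = 1%N.
Proof.
by rewrite (dec_nedge c); have := dec_edge c; have := elt_edge (dec_elt c); lia.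
Qed.

Definition dec_mor X (c : decomp X) : premor := comp_mor (dec_hom c) (dec_iso c).

(** By [contraction_unique]: both quotient trees have one edge and so the same number of vertices.
    Classes of decompositions are thereby reduced to sets of half-edges. *)
Lemma dec_equivI X (c c' : decomp X) : nedge X = 2%N ->
  psi (dec_mor c) =i psi (dec_mor c') -> decomp_equiv c c'.
Proof.
move=> hX im; have [hS _] := dec_nedge1 c hX; have [hS' _] := dec_nedge1 c' hX.
have [s1 e1] := iso_comp (inv_iso (dec_iso c)) (dec_iso c').
have e2 : comp_mor s1 (dec_iso c) = dec_iso c'.
  by rewrite e1 -(hom_compA (dec_iso c) (bwd (dec_iso c)) (dec_iso c')) iso_bf hom_comp1.
have [|h|s2 e3] := @contraction_unique _ _ _ _ (dec_hom c) (dec_hom c') s1.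
- by rewrite !(rtr_euler (rtrP _)) hS hS'.
- have lt h' : h' \in psi (dec_hom c) -> (h' < nhalf (dec_T c))%N.
    exact: (allP (mor_psi_lt (morP (dec_hom c)))).
  have e4 : psi (comp_mor (dec_hom c') s1) = [seq onhalf (bwd (dec_iso c)) h | h <- psi (dec_mor c')].
    rewrite /dec_mor /= -map_comp; apply/eq_in_map => y /(allP (mor_psi_lt (morP (dec_hom c')))) hy.
    by rewrite /= e1 onhalf_comp ?hom_psi_size.
  rewrite e4; apply/idP/mapP => [hp|[y]].
    exists (onhalf (dec_iso c) h); last by rewrite iso_bwd_onhalfK ?lt.
    by rewrite -im; exact: (map_f (onhalf (dec_iso c))).
  by rewrite -im => /mapP[z hz ->] ->; rewrite iso_bwd_onhalfK ?lt.
by exists s1, s2.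
Qed.

Section Value.
Variables (k : fieldType) (A : gcoll k) (s : symm A) (dl : int) (P : gcmp s dl).

Definition two_edges (T S F : rtr) (f : hom T S) i (ef : elementary f i F) :
  endT s T (dl + dl) := ecirc ef erefl (edge_end P S) (edge_end P F).

Definition value X (c : decomp X) : endT s X (dl + dl) :=
  epull (dec_iso c) (two_edges (dec_elt c)).

(** This is [circ_iso], the operations on the one-edge trees being invariant under the isomorphisms
    of quotients and of fibers. *)
Lemma two_edges_sq (T' S' F' T'' S'' F'' : rtr) (f' : hom T' S') (f'' : hom T'' S'') i j
  (ef' : elementary f' i F') (ef'' : elementary f'' j F'') (w : iso T' T'') (t : iso S' S'') :
  nedge S' = 1%N -> nedge F'' = 1%N -> comp_mor f'' w = comp_mor t f' ->
  epull w (two_edges ef'') = two_edges ef'.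
Proof.
move=> hS hF sq.
have [F [u [g [l [hu [eg [wj [e1 e2]]]]]]]] := iso_fiber_exists ef' ef'' sq.
have hF1 : nedge F = 1%N by rewrite (iso_nedge wj).
rewrite /two_edges -[LHS]/(@pull k (end_operad s) _ _ w _ (@circ k (end_operad s) _ _ _ _ _ ef''
  _ _ _ erefl (edge_end P S'') (edge_end P F''))).
rewrite (@circ_iso k (end_operad s) _ _ _ _ _ _ _ _ _ _ _ _ _ _ ef' ef'' w t wj hu eg sq e1 e2).
rewrite -[pull t _]/(epull t (edge_end P S'')) (edge_end_pull P t hS).
rewrite -[pull wj _]/(epull wj (edge_end P F'')) (edge_end_pull P wj hF1).
by rewrite -(edge_end_strict P hu eg hF1) castK.
Qed.

Lemma value_equiv X (c c' : decomp X) : nedge X = 2%N -> decomp_equiv c c' ->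
  value c = value c'.
Proof.
move=> hX [s1 [s2 [e1 e2]]]; have [hS _] := dec_nedge1 c hX; have [_ hF] := dec_nedge1 c' hX.
rewrite /value (epull_comp (esym e1)); congr epull.
by symmetry; exact: (two_edges_sq (dec_elt c) (dec_elt c') hS hF (esym e2)).
Qed.

End Value.

(** * Reduction of trees with two edges to standard ones *)

Local Open Scope nat_scope.

(** Otherwise there would be six distinct internal half-edges, that is, three edges. *)
Lemma two_edge_internal (T : rtr) h1 h2 h : nedge T = 2 -> h1 < nhalf T -> h2 < nhalf T ->
  h < nhalf T -> mate T h1 <> h1 -> mate T h2 <> h2 -> h2 <> h1 -> h2 <> mate T h1 ->
  mate T h <> h -> [\/ h = h1, h = mate T h1, h = h2 | h = mate T h2].
Proof.
move=> hT l1 l2 l m1 m2 n1 n2 m; have gT := rtr_graph (rtrP T).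
apply: contrapT => ne.
have K y : y < nhalf T -> mate T (mate T y) = y by exact: graph_invol gT y.
have [a1 [a2 [a3 a4]]] : h <> h1 /\ h <> mate T h1 /\ h <> h2 /\ h <> mate T h2.
  by split; [|split; [|split]] => e; apply: ne; [constructor 1|constructor 2|constructor 3|constructor 4].
have inj y z : y < nhalf T -> z < nhalf T -> mate T y = mate T z -> y = z.
  by move=> hy hz e; rewrite -(K y hy) e K.
have u : uniq [:: h1; mate T h1; h2; mate T h2; h; mate T h].
  rewrite /= !inE !negb_or !andbT; do !(apply/andP; split); apply/eqP => // e.
  - by apply: m1.
  - by apply: n1.
  - by apply: n2; rewrite e K.
  - by apply: a1.
  - by apply: a2; rewrite e K.
  - by apply: n2.
  - by apply: n1; apply: inj.
  - by apply: a2.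
  - by apply: a1; apply: inj.
  - by apply: m2.
  - by apply: a3.
  - by apply: a4; rewrite e K.
  - by apply: a4.
  - by apply: a3; apply: inj.
  - by apply: m.
have := hT; rewrite /nedge -size_filter.
set r := filter _ _; suff : 5 < size r by case: (size r) => [|[|[|[|[|[|]]]]]].
apply: (uniq_leq_size u) => y; rewrite !inE mem_filter mem_iota add0n /=.
have lm z : z < nhalf T -> mate T z <> z -> (mate T (mate T z) != mate T z) && (mate T z < nhalf T).
  by move=> hz mz; rewrite mate_lt // andbT K //; apply/eqP => e; apply: mz.
by move=> /orP[/eqP->|/orP[/eqP->|/orP[/eqP->|/orP[/eqP->|/orP[/eqP->|/eqP->]]]]];
  rewrite ?lm //; apply/andP; split=> //; apply/eqP.
Qed.

Section Standard3.
Variables (T : rtr) (v0 v1 v2 hx hg : nat).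
Hypotheses (hT : nedge T = 2) (pv : perm_eq [:: v0; v1; v2] (iota 0 3)).
Hypotheses (r0 : vertex T (tree_root T) = v0) (lx : hx < nhalf T) (lg0 : hg < nhalf T).
Hypotheses (vx : vertex T hx = v0) (mx : mate T hx = head 0 (halves T v1)).
Hypotheses (vg : vertex T hg = v0 \/ vertex T hg = v1) (mg : mate T hg = head 0 (halves T v2)).
Hypothesis ne : hg <> hx.

Let nT : nvert T = 3. Proof. by rewrite (rtr_euler (rtrP T)) hT. Qed.
Let lt v : v \in [:: v0; v1; v2] -> v < nvert T.
Proof. by rewrite (perm_mem pv) mem_iota nT. Qed.
Let l0 : v0 < nvert T. Proof. by apply: lt; rewrite mem_head. Qed.
Let l1 : v1 < nvert T. Proof. by apply: lt; rewrite !inE eqxx orbT. Qed.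
Let l2 : v2 < nvert T. Proof. by apply: lt; rewrite !inE eqxx !orbT. Qed.
Let uv : uniq [:: v0; v1; v2]. Proof. by rewrite (perm_uniq pv) iota_uniq. Qed.
Let n01 : v0 <> v1. Proof. by move=> e; have := uv; rewrite /= e mem_head. Qed.
Let n02 : v0 <> v2. Proof. by move=> e; have := uv; rewrite /= e !inE eqxx orbT. Qed.
Let n12 : v1 <> v2. Proof. by move=> e; have := uv; rewrite /= e !inE eqxx !andbF. Qed.

Let H0 := halves T v0.
Let H1 := halves T v1.
Let H2 := halves T v2.
Let ps := H0 ++ H1 ++ H2.
Let a := valence T v0.
Let b := valence T v1.
Let c := valence T v2.
Let s0 : size H0 = a.+1. Proof. exact: size_halves. Qed.
Let s1 : size H1 = b.+1. Proof. exact: size_halves. Qed.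
Let s2 : size H2 = c.+1. Proof. exact: size_halves. Qed.
Let Q := a.+1 + b.+1.
Let N := a.+1 + (b.+1 + c.+1).

Let cover v : v < nvert T -> v \in [:: v0; v1; v2].
Proof. by rewrite (perm_mem pv) mem_iota nT. Qed.

Let pps : perm_eq ps (iota 0 (nhalf T)).
Proof.
have mem h : (h \in ps) = (h < nhalf T).
  rewrite !mem_cat !mem_halves; case hh: (h < nhalf T) => //=.
  by have := cover (vertex_lt hh); rewrite !inE.
apply: uniq_perm; rewrite ?iota_uniq //; last by move=> h; rewrite mem mem_iota.
have dis (u v : nat) : u <> v -> ~~ has (fun h : nat => h \in halves T u) (halves T v).
  move=> ne'; apply/hasPn => h; rewrite /= !mem_halves => /andP[_ /eqP e].
  by rewrite negb_and; apply/orP; right; apply/eqP => e'; apply: ne'; rewrite -e -e'.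
rewrite !cat_uniq !halves_uniq has_cat negb_or !andbT /= !dis //.
Qed.

Let sps : size ps = N. Proof. by rewrite !size_cat s0 s1 s2. Qed.
Let nhN : nhalf T = N. Proof. by rewrite -sps (perm_size pps) size_iota. Qed.
Let ups : uniq ps. Proof. by rewrite (perm_uniq pps) iota_uniq. Qed.
Let mem_ps h : (h \in ps) = (h < N). Proof. by rewrite (perm_mem pps) mem_iota nhN. Qed.
Let lt_ps h : h < N -> nth 0 ps h < nhalf T.
Proof. by move=> hh; rewrite nhN -mem_ps mem_nth ?sps. Qed.

Let x := (index hx H0).-1.
Let g := index hg ps.

Let root_head : head 0 H0 = tree_root T.
Proof. by rewrite /H0 -r0 head_halves ?legs_lt ?root_leg //; left. Qed.
Let root_fix : mate T (tree_root T) = tree_root T.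
Proof. by have := root_leg T; rewrite mem_legs => /andP[_ /eqP]. Qed.
Let headP v : v < nvert T -> vertex T (head 0 (halves T v)) = v.
Proof. by case/head_halvesP. Qed.
Let vmx : vertex T (mate T hx) = v1. Proof. by rewrite mx headP. Qed.
Let vmg : vertex T (mate T hg) = v2. Proof. by rewrite mg headP. Qed.
Let ix : mate T hx <> hx. Proof. by move=> e; apply: n01; rewrite -vmx e vx. Qed.
Let ig : mate T hg <> hg.
Proof. by move=> e; case: vg => e'; [apply: n02|apply: n12]; rewrite -vmg e e'. Qed.
Let hxin : hx \in H0. Proof. by rewrite mem_halves lx vx eqxx. Qed.
Let ixE : index hx H0 = x.+1.
Proof.
rewrite /x prednK //; case E : H0 hxin root_head => [//|y l] _ /= ->.
by case: eqP => // e; case: ix; rewrite -e root_fix.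
Qed.
Let xa : x < a. Proof. by rewrite -ltnS -ixE -s0 index_mem. Qed.
Let nx : nth 0 ps x.+1 = hx.
Proof. by rewrite nth_cat s0 ltnS xa -ixE nth_index. Qed.
Let na : nth 0 ps a.+1 = mate T hx.
Proof. by rewrite mx nth_cat s0 ltnn subnn nth_cat s1 /= nth0. Qed.
Let ng : nth 0 ps g = hg. Proof. by rewrite nth_index // mem_ps -nhN. Qed.
Let nQ : nth 0 ps Q = mate T hg.
Proof.
rewrite mg nth_cat s0 /Q ltnNge leq_addr addKn nth_cat s1 ltnn subnn.
by rewrite nth0.
Qed.
Let gN : g < N. Proof. by rewrite -sps index_mem mem_ps -nhN. Qed.

Let vps h : h < N -> vertex T (nth 0 ps h) = if h < a.+1 then v0 else if h < Q then v1 else v2.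
Proof.
have nthv v h' : h' < size (halves T v) -> vertex T (nth 0 (halves T v) h') = v.
  by move=> hh'; have := mem_nth 0 hh'; rewrite mem_halves => /andP[_ /eqP].
move=> hh; rewrite nth_cat s0; case: (ltnP h a.+1) => h1; first by rewrite nthv ?s0.
rewrite nth_cat s1 (_ : (h - a.+1 < b.+1) = (h < Q)); last by rewrite ltn_subLR.
case: (ltnP h Q) => h2; rewrite nthv //.
  by rewrite [size _]s1 ltn_subLR.
by rewrite [size _]s2 !ltn_subLR // leq_subRL.
Qed.

Let inj h h' : h < N -> h' < N -> nth 0 ps h = nth 0 ps h' -> h = h'.
Proof. by move=> hh hh' /eqP; rewrite nth_uniq ?sps // => /eqP. Qed.

Let gQ : g < Q.
Proof.
have := vps gN; rewrite ng; case: ifP => [h _|_]; first by apply: leq_trans h _; rewrite leq_addr.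
by case: ifP => // _ e; case: vg; rewrite e => e'; [case: n02|case: n12].
Qed.

Let ok : graft_at a b x g.
Proof.
split=> //.
- rewrite gQ andbT lt0n; apply/eqP => e; have := ng; rewrite e nth_cat s0 /= nth0 root_head => e'.
  by apply: ig; rewrite -e' root_fix.
- by move=> e; apply: ne; rewrite -ng e nx.
- by move=> e; have := vmg; rewrite -ng e na graph_invol ?vx //; exact: rtr_graph (rtrP T).
Qed.

Let lgl := [seq index h ps | h <- legs T].

Let hlg : relabels (labels3 a b c x g) lgl.
Proof.
have u1 := labels3_uniq c ok; rewrite /relabels u1 andTb; apply/andP; split.
  have in_ps h : h \in legs T -> h \in ps by move/legs_lt; rewrite mem_ps nhN.
  apply: uniq_perm => //.
    rewrite map_inj_in_uniq ?(labels_uniq (labels_legs T)) // => h h' /in_ps hh /in_ps hh' e.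
    by rewrite -(nth_index 0 hh) e nth_index.
  move=> j; rewrite (mem_labels3 c ok); apply/idP/mapP => [/and5P[hj /eqP j1 /eqP j2 /eqP j3 /eqP j4]|].
    exists (nth 0 ps j); last by rewrite index_uniq // sps.
    rewrite mem_legs lt_ps //=; apply/eqP; apply: contrapT => m.
    have hQ : Q < N by rewrite /Q /N addnA -[X in X < _]addn0 ltn_add2l.
    have ha : a.+1 < N by rewrite /N -[X in X < _]addn0 ltn_add2l.
    have hxx : x.+1 < N by apply: leq_trans ha; rewrite ltnS ltnW.
    have := two_edge_internal hT lx lg0 (lt_ps hj) ix ig ne _ m.
    case=> [e|e|e|e|e].
    - by have := vmg; rewrite e (graph_invol (rtr_graph (rtrP T)) lx) vx => e2; case: n02.
    - by apply: j1; apply: inj; rewrite ?nx.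
    - by apply: j2; apply: inj; rewrite ?na.
    - by apply: j3; apply: inj; rewrite ?ng.
    - by apply: j4; apply: inj; rewrite ?nQ.
  case=> h hl ->; have hp := in_ps _ hl; have := hl; rewrite mem_legs => /andP[hh /eqP hf].
  have K := graph_invol (rtr_graph (rtrP T)).
  apply/and5P; split; first by rewrite -[X in _ < X]/N -sps index_mem.
  - by apply/eqP => e; apply: ix; rewrite -nx -e nth_index.
  - by apply/eqP => e; have e' : h = mate T hx by [rewrite -na -e nth_index]; apply: ix; rewrite -{2}(K hx lx) -e' hf.
  - by apply/eqP => e; apply: ig; rewrite -ng -e nth_index.
  - by apply/eqP => e; have e2 : index h ps = Q := e; have e' : h = mate T hg by [rewrite -nQ -e2 nth_index]; apply: ig; rewrite -{2}(K hg lg0) -e' hf.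
rewrite head_labels3 // /lgl legs_cons /= -root_head.
have -> : head 0 H0 = nth 0 ps 0 by rewrite nth_cat s0 nth0.
by rewrite index_uniq // sps.
Qed.

(** The vertices are renumbered with the root vertex [v0] first, each of the others being attached
    to an earlier one, at [hx] and at [hg]. The last clause tells a fork from a chain. *)
Lemma standard3 : exists (a b c x g : nat) (lg : seq nat) (ok : graft_at a b x g)
  (hlg : relabels (labels3 a b c x g) lg) (w : iso T (rtree3 ok hlg)),
  [/\ onhalf w x.+1 = hx, onhalf w g = hg & (g < a.+1) = (vertex T hg == v0)].
Proof.
exists a, b, c, x, g, lgl, ok, hlg; set Y := rtree3 _ _.
have nY : nhalf Y = N by exact: tree3_nhalf.
have K := graph_invol (rtr_graph (rtrP T)).
have [E1 E2 E3 E4] := tree3_edges c lgl ok.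
have [w ew] : exists w : iso T Y, mor w = PreMor ps [seq index v [:: v0; v1; v2] | v <- iota 0 3].
  apply: iso_build => //.
  - by rewrite nY nhN.
  - rewrite -[X in perm_eq _ X](map_index_uniq uv); apply: perm_map.
    by rewrite perm_sym.
  - move=> h; rewrite nY => hh.
    have [->|m1] := h =P x.+1; first by rewrite [mate Y _]E1 na nx.
    have [->|m2] := h =P a.+1; first by rewrite [mate Y _]E2 na nx K.
    have [->|m3] := h =P g; first by rewrite [mate Y _]E3 nQ ng.
    have [->|m4] := h =P Q; first by rewrite [mate Y _]E4 nQ ng K.
    rewrite [mate Y h](tree3_fix lgl hh) //; apply/esym.
    have : h \in labels3 a b c x g.
      by rewrite (mem_labels3 c ok); apply/and5P; split=> //; apply/eqP.
    case/and3P: hlg => _ pl _; rewrite (perm_mem pl) => /mapP[h' h'l ->].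
    have h'p : h' \in ps by rewrite mem_ps -nhN legs_lt.
    by rewrite nth_index //; move: h'l; rewrite mem_legs => /andP[_ /eqP].
  - rewrite -[legs Y]/lgl -map_comp; apply: map_id_in => h /legs_lt hh /=.
    by rewrite nth_index // mem_ps -nhN.
  - move=> h; rewrite nY => hh; rewrite [vertex Y h]tree3_vertex // vps //.
    have i0 : nth 0 [seq index v [:: v0; v1; v2] | v <- iota 0 3] v0 = 0.
      by rewrite (nth_map 0) ?nth_iota ?size_iota -?nT //= eqxx.
    have i1 : nth 0 [seq index v [:: v0; v1; v2] | v <- iota 0 3] v1 = 1.
      by rewrite (nth_map 0) ?nth_iota ?size_iota -?nT //= eqxx; case: eqP.
    have i2 : nth 0 [seq index v [:: v0; v1; v2] | v <- iota 0 3] v2 = 2.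
      by rewrite (nth_map 0) ?nth_iota ?size_iota -?nT //= eqxx; do 2!case: eqP => //.
    rewrite [a < h]ltnNge -[h <= a]ltnS; case: (ltnP h a.+1) => h1.
      by rewrite i0 /= leqNgt (leq_trans h1) // leq_addr.
    by rewrite [Q <= h]leqNgt; case: (h < Q); rewrite ?i1 ?i2.
exists w; split; rewrite ?ew //.
have := vps gN; rewrite ng => ->; case: ifP => _; first by rewrite eqxx.
by case: ifP => _; symmetry; apply/eqP => e; [case: n01 | case: n02].
Qed.

End Standard3.

Local Open Scope nat_scope.

Section Missing.
Variables (T S F : rtr) (f : hom T S) (i : nat) (ef : elementary f i F).
Hypothesis (hF : nedge F = 1).
Let H := fiber_halves T f i.
(** The lower end of the contracted edge, as a half-edge of [T]. *)
Definition contracted := nth 0 (fiber_halves T f i) (bot F).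
Let hb := contracted.

Let sH : size H = nhalf F. Proof. by rewrite (nhalf_fiber ef). Qed.
Let bF : bot F < size H. Proof. by rewrite sH bot_lt. Qed.
Let memH h : (h \in H) = (h < nhalf T) && (onvert f (vertex T h) == i).
Proof. exact: mem_fiber_halves. Qed.
Let hbH : hb \in H. Proof. exact: mem_nth. Qed.
Let uH : uniq H. Proof. exact: fiber_halves_uniq. Qed.
Let mateF h : h < size H -> mate F h =
  index (if nth 0 H h \in psi f then nth 0 H h else mate T (nth 0 H h)) H.
Proof. by move=> hh; rewrite (elt_fiber ef) nth_fiber_mate. Qed.
Let K y : y < nhalf T -> mate T (mate T y) = y.
Proof. exact: graph_invol (rtr_graph (rtrP T)) y. Qed.

Lemma contracted_lt : contracted < nhalf T.
Proof. by have := hbH; rewrite memH => /andP[]. Qed.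

Lemma contracted_psi : contracted \notin psi f.
Proof.
have [_ h2 _ _] := edge_facts hF; apply/negP => hp; apply: h2.
by rewrite mateF // -/hb hp index_uniq.
Qed.

Let mateH h : h \in H -> h \notin psi f -> mate T h \in H.
Proof.
rewrite !memH => /andP[hh /eqP e] hn; rewrite mate_lt //=.
by rewrite -(mor_contract (morP f)) // e.
Qed.

Lemma contracted_mate : mate T contracted = nth 0 H (mate F (bot F)).
Proof.
by rewrite mateF // -/hb (negPf contracted_psi) nth_index // mateH ?contracted_psi.
Qed.

Lemma contracted_vertex : vertex T contracted = i + rootv F.
Proof.
rewrite -(vertex_fiber ef) ?bot_lt //; congr (_ + _).
by have [+ _ _ _] := edge_facts hF; rewrite mem_halves => /andP[_ /eqP].
Qed.

(** At vertices outside the block all half-edges survive, by triviality of the fibers. Inside, a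
    half-edge that does not survive is internal in [F], which has a single edge. *)
Lemma psi_contracted h : h < nhalf T ->
  (h \in psi f) = (h != contracted) && (h != mate T contracted).
Proof.
move=> hh; have hb_lt := contracted_lt; apply/idP/andP => [hp|[/eqP n1 /eqP n2]].
  split; apply/eqP => e; first by have := contracted_psi; rewrite -e hp.
  have /negP := contracted_psi; apply; rewrite -(K hb_lt) -e.
  case/(nthP 0): hp => y; rewrite hom_psi_size => hy <-.
  by rewrite -(mor_mate (morP f)) // mem_nth // hom_psi_size mate_lt.
apply: contrapT => /negP hn; have hv := onvert_lt f (vertex_lt hh).
have [e|ne] := onvert f (vertex T h) =P i; last first.
  move/negP: hn; apply; have : h \in fiber_halves T f (onvert f (vertex T h)).
    by rewrite mem_fiber_halves hh eqxx.
  rewrite (over_halves ef) // -(over_onhalf ef) // => /mapP[y]; rewrite mem_halves => /andP[hy _] ->.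
  by rewrite mem_nth // hom_psi_size.
have hH : h \in H by rewrite memH hh e eqxx.
have lh : index h H < size H by rewrite index_mem.
have mh : mate T h <> h.
  move=> e'; move/negP: hn; apply; apply: (labels_sub f (labels_legs T)).
  by rewrite mem_legs hh e' eqxx.
have [_ b2 _ _] := edge_facts hF.
have my : mate F (index h H) <> index h H.
  rewrite mateF // nth_index // (negPf hn) => e'.
  by apply: mh; rewrite -(nth_index 0 (mateH hH hn)) e' nth_index.
have lb := bot_lt hF; rewrite sH in lh.
case: (edge_internal hF lb lh b2 my) => e'.
  by apply: n1; rewrite -(nth_index 0 hH) e'.
by apply: n2; rewrite contracted_mate -e' nth_index.
Qed.

End Missing.

Section StandardDecomp.
Variables (T S F : rtr) (f : hom T S) (i : nat) (ef : elementary f i F).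
Hypotheses (hS : nedge S = 1) (hF : nedge F = 1) (hT : nedge T = 2).
Let H := fiber_halves T f i.
Let nT : nvert T = 3. Proof. by rewrite (rtr_euler (rtrP T)) hT. Qed.
Let nF : nvert F = 2. Proof. exact: edge_nvert2. Qed.
Let nS : nvert S = 2. Proof. exact: edge_nvert2. Qed.
Let hb := contracted F f i.
Let hs := onhalf f (bot S).
Let fP := morP f.

Let headF l : l < nvert F -> nth 0 H (head 0 (halves F l)) = head 0 (halves T (i + l)).
Proof.
by move=> hl; rewrite -(fiber_halvesE ef hl) (halves_cons hl).
Qed.

Let headS j : j < nvert S -> j <> i ->
  onhalf f (head 0 (halves S j)) = head 0 (halves T (over F i j)).
Proof. by move=> hj ne; rewrite -(over_onhalf ef hj ne) (halves_cons hj). Qed.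

Let rootT : onhalf f (tree_root S) = tree_root T.
Proof.
have := f_equal (head 0) (mor_legs fP).
by rewrite /tree_root [in RHS]legs_cons (legs_cons S) /=.
Qed.

Let rootF : nth 0 H (tree_root F) = onhalf f (head 0 (halves S i)).
Proof.
have hi := elt_lt ef; have [h1 h2 h3 _] := head_halvesP hi.
rewrite /tree_root (legs_fiber ef) (halves_cons hi) /= nth_index //.
by rewrite mem_fiber_halves onhalf_lt // (mor_vertex fP) // h3 eqxx.
Qed.

Let lF : rootv F < 2. Proof. exact: rootv_lt. Qed.
Let lS : rootv S < 2. Proof. exact: rootv_lt. Qed.
Let hsm : mate T hs = onhalf f (mate S (bot S)).
Proof. by rewrite /hs (mor_mate fP) ?bot_lt. Qed.
Let hs_lt : hs < nhalf T. Proof. by rewrite onhalf_lt ?bot_lt. Qed.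
Let hs_psi : hs \in psi f. Proof. by rewrite mem_nth // hom_psi_size bot_lt. Qed.
Let hb_psi := contracted_psi ef hF.
Let hb_lt := contracted_lt ef hF.
Let hbm : mate T hb = head 0 (halves T (i + topv F)).
Proof.
rewrite /hb (contracted_mate ef hF) -headF ?topv_lt //.
by have [_ _ _ ->] := edge_facts hF.
Qed.

Let perm3 (u v z : nat) : u < 3 -> v < 3 -> z < 3 -> u <> v -> u <> z -> v <> z ->
  perm_eq [:: u; v; z] (iota 0 3).
Proof. by case: u v z => [|[|[|?]]] [|[|[|?]]] [|[|[|?]]] //. Qed.

Let rF : i + rootv F < 3 /\ i + topv F < 3.
Proof.
have := elt_nvert ef; have := elt_lt ef; have [_ _ -> _] := edge_facts hF.
by rewrite nT nS nF; lia.
Qed.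

(** If the block contains the root vertex, the contracted edge is taken as the first edge of the
    standard tree. Otherwise the two edges form a chain of which the contracted edge is the upper
    one, attached at [g]. *)
Lemma standard_elementary : exists (a b c x g : nat) (lg : seq nat) (ok : graft_at a b x g)
  (hlg : relabels (labels3 a b c x g) lg) (w : iso T (rtree3 ok hlg)),
  (contracted F f i = onhalf w x.+1) \/ (a < g /\ contracted F f i = onhalf w g).
Proof.
have [F1 F2 F3 F4] := edge_facts hF; have [S1 S2 S3 S4] := edge_facts hS.
have hi := elt_lt ef; have [rF1 rF2] := rF; have rS : rootv S < nvert S by rewrite nS.
have tS : topv S < nvert S by exact: topv_lt.
have vF : rootv F < nvert F by rewrite nF.
have oT j : j < nvert S -> over F i j < 3 by move=> hj; rewrite -nT (over_lt ef).
have neo j l : j < nvert S -> j <> i -> l < nvert F -> over F i j <> i + l.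
  move=> hj ne hl e; have := onvert_over ef hj ne; rewrite e (elt_onvert ef).
    by rewrite ltn_add2l hl ltnNge leq_addr /= => /esym.
  by rewrite -e (over_lt ef).
have neF : i + rootv F <> i + topv F by rewrite F3 => /addnI; move: lF; case: (rootv F) => [|[|]].
have vb : vertex T hb = i + rootv F by exact: contracted_vertex.
have vbS : vertex S (bot S) = rootv S by move: S1; rewrite mem_halves => /andP[_ /eqP].
have neh : hs <> hb by move=> e; move: hb_psi; rewrite -[contracted _ _ _]/hb -e hs_psi.
have hrS : tree_root S < nhalf S by exact: legs_lt (root_leg S).
have headSr : head 0 (halves S (rootv S)) = tree_root S by rewrite rootv_halves.
have [e|ne] := rootv S =P i.
  have net : topv S <> i by rewrite S3 -e; move: lS; case: (rootv S) => [|[|]].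
  have rT : vertex T (tree_root T) = i + rootv F.
    rewrite -rootT -headSr e -rootF -(vertex_fiber ef); first by [].
    exact: legs_lt (root_leg F).
  have pv : perm_eq [:: i + rootv F; i + topv F; over F i (topv S)] (iota 0 3).
    by apply: perm3; rewrite ?oT //; apply/nesym; apply: neo => //; exact: topv_lt.
  have vh : vertex T hs = i + rootv F \/ vertex T hs = i + topv F.
    have : onvert f (vertex T hs) = i by rewrite (mor_vertex fP) ?bot_lt // vbS.
    have hv := vertex_lt hs_lt; rewrite (elt_onvert ef) // nF F3.
    have := rF1; have := lF; move: (vertex T hs) hv (rootv F) => u hu r.
    rewrite nT in hu; case: (ltnP u i) => h1; first lia.
    case: (ltnP u (i + 2)) => h2; last lia.
    by case: r => [|[|]] // _ _ _; lia.
  have mh : mate T hs = head 0 (halves T (over F i (topv S))) by rewrite hsm -headS // S4.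
  have [a [b [c [x [g [lg [ok [hlg [w [w1 w2 w3]]]]]]]]]] :=
    standard3 hT pv rT hb_lt hs_lt vb hbm vh mh neh.
  by exists a, b, c, x, g, lg, ok, hlg, w; left.
have ti : topv S = i by rewrite S3; move: lS hi ne; rewrite nS; case: (rootv S) => [|[|]] //; case: (i) => [|[|]].
have vs : vertex T hs = over F i (rootv S).
  have : hs \in halves T (over F i (rootv S)).
    by rewrite -(over_onhalf ef rS ne); apply: map_f.
  by rewrite mem_halves => /andP[_ /eqP].
have rT : vertex T (tree_root T) = over F i (rootv S).
  have : onhalf f (tree_root S) \in halves T (over F i (rootv S)).
    by rewrite -(over_onhalf ef rS ne); apply: map_f; rewrite -headSr (halves_cons rS) mem_head.
  by rewrite rootT mem_halves => /andP[_ /eqP].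
have headFr : head 0 (halves F (rootv F)) = tree_root F by rewrite rootv_halves.
have pv : perm_eq [:: over F i (rootv S); i + rootv F; i + topv F] (iota 0 3).
  by apply: perm3; rewrite ?oT //; apply: neo => //; exact: topv_lt.
have mh : mate T hs = head 0 (halves T (i + rootv F)).
  by rewrite hsm -headF // headFr rootF -ti S4.
have [a [b [c [x [g [lg [ok [hlg [w [w1 w2 w3]]]]]]]]]] :=
    standard3 hT pv rT hs_lt hb_lt vs mh (or_intror vb) hbm (nesym neh).
exists a, b, c, x, g, lg, ok, hlg, w; right; split=> //.
rewrite ltnNge -ltnS w3 vb; apply/eqP => e; exact: (neo _ _ rS ne vF (esym e)).
Qed.

End StandardDecomp.

(** * Decompositions according to the edge contracted *)

Local Open Scope nat_scope.

(** For a tree with two edges, [h1] and [h2] are the ends of the edge that [c] contracts; they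
    determine the class of [c] ([misses_equiv]). *)
Definition misses X (c : decomp X) (h1 h2 : nat) : Prop :=
  forall h, h < nhalf X -> (h \in psi (dec_mor c)) = (h != h1) && (h != h2).

Lemma misses_sym X (c : decomp X) h1 h2 : misses c h1 h2 -> misses c h2 h1.
Proof. by move=> m h hh; rewrite m // andbC. Qed.

Lemma dec_mor_lt X (c : decomp X) h : h \in psi (dec_mor c) -> h < nhalf X.
Proof.
by case/mapP=> y /(allP (mor_psi_lt (morP (dec_hom c)))) hy ->; exact: onhalf_lt.
Qed.

Lemma misses_equiv X (c c' : decomp X) h1 h2 : nedge X = 2 ->
  misses c h1 h2 -> misses c' h1 h2 -> decomp_equiv c c'.
Proof.
move=> hX m m'; apply: dec_equivI => // h; case hh: (h < nhalf X); first by rewrite m ?m'.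
by apply/idP/idP => /dec_mor_lt; rewrite hh.
Qed.

Lemma equiv_psi X (c c' : decomp X) : decomp_equiv c c' -> psi (dec_mor c) =i psi (dec_mor c').
Proof.
case=> s1 [s2 [e1 e2]] h.
have -> : dec_mor c' = comp_mor s2 (dec_mor c).
  rewrite /dec_mor -e1 (hom_compA (dec_iso c) s1 (dec_hom c')) -e2.
  exact: esym (hom_compA (dec_iso c) (dec_hom c) s2).
have sz : size (psi (dec_mor c)) = nhalf (dec_S c) by rewrite size_map hom_psi_size.
apply/idP/mapP => [/(nthP 0)[y]|[y hy ->]]; last first.
  by rewrite mem_nth // sz -(iso_nhalf (inv_iso s2)) -?(iso_nhalf s2) (allP (mor_psi_lt (morP s2))).
rewrite sz => hy <-; exists y => //; rewrite -(iso_onhalfK s2 hy) mem_nth // hom_psi_size.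
exact: onhalf_lt.
Qed.

Lemma misses_not_equiv X (c c' : decomp X) h1 h2 h3 h4 : misses c h1 h2 -> misses c' h3 h4 ->
  h1 < nhalf X -> h1 <> h3 -> h1 <> h4 -> ~ decomp_equiv c c'.
Proof.
move=> m m' hh /eqP n3 /eqP n4 /equiv_psi/(_ h1).
by rewrite m // m' // eqxx n3 n4.
Qed.

Lemma iso_misses X Y S (w : iso X Y) (f : hom Y S) y1 y2 : y1 < nhalf Y -> y2 < nhalf Y ->
  (forall h, h < nhalf Y -> (h \in psi f) = (h != y1) && (h != y2)) ->
  forall h, h < nhalf X ->
  (h \in psi (comp_mor f w)) = (h != onhalf w y1) && (h != onhalf w y2).
Proof.
move=> l1 l2 m h hh; have lb := onhalf_lt (bwd w) hh.
have ne y : y < nhalf Y -> (h == onhalf w y) = (onhalf (bwd w) h == y).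
  move=> hy; apply/eqP/eqP => [->|<-]; first exact: iso_bwd_onhalfK.
  by rewrite iso_onhalfK.
rewrite !ne // -m //; apply/mapP/idP => [[y hy ->]|hp].
  by rewrite iso_bwd_onhalfK //; exact: (allP (mor_psi_lt (morP f))).
by exists (onhalf (bwd w) h); rewrite ?iso_onhalfK.
Qed.

Lemma dec_misses X (c : decomp X) : nedge X = 2 ->
  exists h, [/\ h < nhalf X, mate X h <> h & misses c h (mate X h)].
Proof.
move=> hX; have [hS hF] := dec_nedge1 c hX; have lc := contracted_lt (dec_elt c) hF.
set hc := contracted _ _ _ in lc; have lm := mate_lt lc.
exists (onhalf (dec_iso c) hc); split; first exact: onhalf_lt.
  rewrite iso_mate // => /onhalf_inj e; have {}e := e lm lc.
  have := contracted_psi (dec_elt c) hF; rewrite -/hc.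
  by rewrite (labels_sub (dec_hom c) (labels_legs _)) // mem_legs lc e eqxx.
rewrite iso_mate //; apply: iso_misses => // h hh.
exact: (psi_contracted (dec_elt c) hF hh).
Qed.

Section OnTree3.
Variables (a b c x g : nat) (lg : seq nat).
Hypotheses (ok : graft_at a b x g) (hlg : relabels (labels3 a b c x g) lg).
Let Y := rtree3 ok hlg.
Let Q := a.+1 + b.+1.
Variables (X : rtr) (w : iso X Y).

Let nY : nhalf Y = a.+1 + (b.+1 + c.+1). Proof. exact: tree3_nhalf. Qed.

Lemma tree3_lts : [/\ x.+1 < nhalf Y, a.+1 < nhalf Y, g < nhalf Y & Q < nhalf Y].
Proof. by rewrite nY /Q; have [h1 h2 _ _] := ok; split; lia. Qed.

Lemma iso_tree3_nedge : nedge X = 2.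
Proof. by rewrite (iso_nedge w); exact: (tree3_nedge ok hlg). Qed.

Lemma edge_cases (d : decomp X) : misses d (onhalf w x.+1) (onhalf w a.+1) \/
  misses d (onhalf w g) (onhalf w Q).
Proof.
have [l1 l2 l3 l4] := tree3_lts; have [E1 E2 E3 E4] := tree3_edges c lg ok.
have [h [hh mh m]] := dec_misses d iso_tree3_nedge.
set y := onhalf (bwd w) h; have hy : y < nhalf Y by exact: onhalf_lt.
have ey : onhalf w y = h by rewrite iso_onhalfK.
have em : mate X h = onhalf w (mate Y y) by rewrite -iso_mate // ey.
have my : mate Y y <> y by move=> e; apply: mh; rewrite em e.
rewrite em -ey in m.
have [e|n1] := y =P x.+1; first by left; move: m; rewrite e [mate Y _]E1.
have [e|n2] := y =P a.+1; first by left; apply: misses_sym; move: m; rewrite e [mate Y _]E2.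
have [e|n3] := y =P g; first by right; move: m; rewrite e [mate Y _]E3.
have [e|n4] := y =P Q; first by right; apply: misses_sym; move: m; rewrite e [mate Y _]E4.
by case: my; apply: tree3_fix => //; rewrite -nY.
Qed.

(** The field and the composition are quantified after [d]: the contraction is combinatorial and
    does not depend on where it is evaluated. *)
Lemma con1P : exists d : decomp X, misses d (onhalf w x.+1) (onhalf w a.+1) /\
  forall (k : fieldType) (A : gcoll k) (s : symm A) (dl : int) (P : gcmp s dl),
  exists Z : endT s Y (dl + dl)%R, value P d = epull w Z /\
  forall l u v z, labels Y l -> ar u = a -> ar v = b -> ar z = c ->
  ev Z l [:: u; v; z] = rel s (labels3 a b c x g) l
    (tin (pcp P (index g (labels2 a b x)).-1 (pcp P x u v) z)).
Proof.
have [f [ef elf]] := contract1_exists ok hlg.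
have hS : 1 <= nedge (contract1_S ok hlg).
  by have := rtr_euler (rtrP (contract1_S ok hlg)); rewrite -[nvert _]/2 => -[<-].
have [l1 l2 l3 l4] := tree3_lts; have [h1 _ _ _] := ok.
exists (Decomp w elf hS); split.
  have ep : psi f = labels2 a b x ++ iota (a.+1 + b.+1) c.+1 by rewrite ef.
  apply: iso_misses => // h; rewrite nY ep mem_cat mem_labels2 // mem_iota => hh.
  by have := h1; lia.
move=> k A s dl P; exists (two_edges P elf); split=> //.
exact: (ev_contract1 P elf ef).
Qed.

(** For [g <= a] both edges are attached to the vertex 0. A rootward half-edge there is the root
    leg, which is not internal, so no edge continues another one. *)
Lemma composable_tree3 : composable Y <-> a < g.
Proof.
have [l1 l2 l3 l4] := tree3_lts; have [E1 E2 E3 E4] := tree3_edges c lg ok.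
have vY h : h < nhalf Y -> vertex Y h = (a < h) + (Q <= h).
  by rewrite nY; exact: tree3_vertex.
have [h1 h2 h3 h4] := ok; have nv : nvert Y = 3 by [].
have hd0 : head 0 (halves Y 0) = 0 by rewrite [halves Y 0]tree3_halves0.
have hd1 : head 0 (halves Y 1) = a.+1 by rewrite [halves Y 1]tree3_halves1.
have hd2 : head 0 (halves Y 2) = Q by rewrite [halves Y 2]tree3_halves2.
have vx : vertex Y x.+1 = 0.
  by rewrite vY //; case: (ltnP a x.+1) => ?; case: (leqP Q x.+1); rewrite /Q; lia.
split=> [[y1 [y2 [hy1 hy2 m1 m2 [r1 r2 e]]]]|ag].
  rewrite ltnNge; apply/negP => ga.
  have vg : vertex Y g = 0.
    by rewrite vY //; case: (ltnP a g) => ?; case: (leqP Q g); rewrite /Q; lia.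
  have e1 := head_halves hy1 r1; have e2 := head_halves hy2 r2.
  have root0 : mate Y 0 = 0.
    by have := root_leg Y; rewrite (tree3_root ok hlg) mem_legs => /andP[_ /eqP].
  have vm : vertex Y (mate Y y1) = 0.
    have := vertex_lt hy1; rewrite nv; move: e1; case: (vertex Y y1) => [|[|[|]]] // e1 _.
    - by case: m1; rewrite -e1 hd0.
    - by rewrite -e1 hd1 [mate Y _]E2.
    - by rewrite -e1 hd2 [mate Y _]E4.
  by apply: m2; rewrite -e2 -e vm hd0.
have vg : vertex Y g = 1.
  by rewrite vY //; case: (ltnP a g) => ?; case: (leqP Q g); rewrite /Q; lia.
have n1 : 1 < nvert Y by []. have n2 : 2 < nvert Y by [].
have [_ _ v1 r1] := head_halvesP n1; have [_ _ v2 r2] := head_halvesP n2.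
rewrite hd1 in v1 r1; rewrite hd2 in v2 r2.
exists Q, a.+1; split=> //; first by rewrite [mate Y _]E4 /Q; lia.
  by rewrite [mate Y _]E2; lia.
by split=> //; rewrite [mate Y _]E4 vg v1.
Qed.

End OnTree3.

Lemma composable_iso X Y (w : iso X Y) : composable Y -> composable X.
Proof.
case=> h1 [h2 [l1 l2 m1 m2 [r1 r2 e]]].
exists (onhalf w h1), (onhalf w h2); split; rewrite ?onhalf_lt //.
- by rewrite iso_mate // => /onhalf_inj e'; apply: m1; apply: e' => //; exact: mate_lt.
- by rewrite iso_mate // => /onhalf_inj e'; apply: m2; apply: e' => //; exact: mate_lt.
split; try exact: iso_rootward.
by rewrite iso_mate // !iso_vertex ?mate_lt // e.
Qed.

Section OnChain.
Variables (a b c x y : nat) (lg : seq nat).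
Hypotheses (xa : x < a) (yb : y < b).
Hypothesis (hlg : relabels (labels3 a b c x (a.+1 + y.+1)) lg).
Let Y := rtree3 (chain_graft xa yb) hlg.
Variables (X : rtr) (w : iso X Y).

Lemma con2P : exists d : decomp X,
  misses d (onhalf w (a.+1 + y.+1)) (onhalf w (a.+1 + b.+1)) /\
  forall (k : fieldType) (A : gcoll k) (s : symm A) (dl : int) (P : gcmp s dl),
  exists Z : endT s Y (dl + dl)%R, value P d = epull w Z /\
  forall l u v z, labels Y l -> ar u = a -> ar v = b -> ar z = c ->
  ev Z l [:: u; v; z] = (koszul k (dl * dg u) *: rel s (labels3 a b c x (a.+1 + y.+1)) l
    (tin (pcp P x u (pcp P y v z))))%R.
Proof.
have [f [ef elf]] := contract2_exists xa yb hlg.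
have hS : 1 <= nedge (contract2_S xa yb hlg).
  by have := rtr_euler (rtrP (contract2_S xa yb hlg)); rewrite -[nvert _]/2 => -[<-].
have [l1 l2 l3 l4] := tree3_lts (chain_graft xa yb) hlg.
exists (Decomp w elf hS); split.
  have ep : psi f = iota 0 a.+1 ++ [seq a.+1 + h | h <- labels2 b c y] by rewrite ef.
  apply: iso_misses => // h; rewrite tree3_nhalf ep mem_cat mem_iota => hh.
  case: (ltnP h a.+1) => h1; first by rewrite /=; symmetry; apply/andP; split; apply/eqP; lia.
  have [j ej] : exists j, h = a.+1 + j by exists (h - a.+1); lia.
  rewrite ej (mem_map (@addnI a.+1)) mem_labels2 // !eqn_add2l andbF orFb.
  by have -> : (j < b.+1 + c.+1) = true by move: hh; rewrite ej ltn_add2l.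
move=> k A s dl P; exists (two_edges P elf); split=> //.
exact: (ev_contract2 P elf ef).
Qed.

End OnChain.

Lemma standard_decomp X (d : decomp X) : nedge X = 2 ->
  exists (a b c x g : nat) (lg : seq nat) (ok : graft_at a b x g)
    (hlg : relabels (labels3 a b c x g) lg) (w : iso X (rtree3 ok hlg)),
  misses d (onhalf w x.+1) (onhalf w a.+1) \/
  (a < g /\ misses d (onhalf w g) (onhalf w (a.+1 + b.+1))).
Proof.
move=> hX; have [hS hF] := dec_nedge1 d hX.
have hT : nedge (dec_T d) = 2 by rewrite -(iso_nedge (dec_iso d)).
have [a [b [c [x [g [lg [ok [hlg [v cv]]]]]]]]] := standard_elementary (dec_elt d) hS hF hT.
have [w ew] := iso_comp (dec_iso d) v.
have [l1 l2 l3 l4] := tree3_lts ok hlg; have [E1 E2 E3 E4] := tree3_edges c lg ok.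
have ow h : h < nhalf (rtree3 ok hlg) -> onhalf w h = onhalf (dec_iso d) (onhalf v h).
  by move=> hh; rewrite ew onhalf_comp ?hom_psi_size.
have lc := contracted_lt (dec_elt d) hF.
have m0 := iso_misses (dec_iso d) lc (mate_lt lc) (psi_contracted (dec_elt d) hF).
exists a, b, c, x, g, lg, ok, hlg, w; case: cv => [e|[ag e]]; [left|right; split=> //].
  by move=> h hh; rewrite (m0 h hh) e iso_mate // [mate _ x.+1]E1 !ow.
by move=> h hh; rewrite (m0 h hh) e iso_mate // [mate _ g]E3 !ow.
Qed.

(** * Associativity relations and values of decompositions *)

Local Open Scope ring_scope.

Section Relations.
Variables (k : fieldType) (A : gcoll k) (s : symm A) (dl : int) (P : gcmp s dl) (eps : k).
Implicit Types u v z : packed A.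

(** The input [y] of [v] is the input [x + y] of the first composite. The Koszul sign is the one of
    [ev_contract2], and [eps] is the factor between the two values imposed by the relations: 1 for
    [pp] and -1 for its dual. *)
Definition chain_rel : Prop := forall x y u v z, (x < ar u)%N -> (y < ar v)%N ->
  tin (pcp P (x + y)%N (pcp P x u v) z) =
  (eps * koszul k (dl * dg u)) *: tin (pcp P x u (pcp P y v z)).

(** The conditional gives the place in the first composite of the input [y] of [u], as in
    [fork_index]. *)
Definition fork_rel : Prop := forall x y u v z, (x < ar u)%N -> (y < ar u)%N -> y <> x ->
  tin (pcp P (if (y < x)%N then y else y + ar v - 1)%N (pcp P x u v) z) = 0.

Hypothesis eps2 : eps * eps = 1.

(** There are two classes, one for each edge of the chain. As [eps] squares to 1, the relation is
    symmetric in them and it does not matter which of [c1] and [c2] contracts the lower edge. *)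
Lemma chain_values : chain_rel -> forall X (c1 c2 : decomp X), nedge X = 2%N ->
  composable X -> ~ decomp_equiv c1 c2 -> value P c1 = eps *: value P c2.
Proof.
move=> hr X c1 c2 hX cX ne.
have [a [b [c [x [g [lg [ok [hlg [w _]]]]]]]]] := standard_decomp c1 hX.
have ag : (a < g)%N by apply/(composable_tree3 ok hlg); exact: composable_iso (inv_iso w) cX.
have [xa gQ g1 g2] := ok.
have [y eg] : exists y, g = (a.+1 + y.+1)%N by exists (g - a.+2)%N; lia.
subst g; have yb : (y < b)%N by lia.
have eok := Prop_irrelevance ok (chain_graft xa yb); subst ok.
have [d1 [m1 D1]] := con1P w; have [d2 [m2 D2]] := con2P w.
have [Z1 [V1 E1]] := D1 k A s dl P; have [Z2 [V2 E2]] := D2 k A s dl P.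
have eZ : Z1 = eps *: Z2.
  apply: evT_ext => l v hl /(fits_tree3)[u1 [u2 [u3 [-> a1 a2 a3]]]].
  rewrite evT_scale E1 // E2 // (chain_index xa yb hlg) hr ?a1 ?a2 //.
  by rewrite (linZ _ _ (rel_linear s _ _)) scalerA.
have e12 : value P d1 = eps *: value P d2.
  by rewrite V1 V2 eZ (linZ _ _ (@epull_linear k A s _ _ w (dl + dl))).
have e21 : value P d2 = eps *: value P d1 by rewrite e12 scalerA eps2 scale1r.
have eqv (d d' : decomp X) h1 h2 : misses d h1 h2 -> misses d' h1 h2 -> value P d = value P d'.
  by move=> n n'; apply: (value_equiv P hX); exact: (misses_equiv hX n n').
case: (edge_cases w c1) => n1; case: (edge_cases w c2) => n2.
- by case: ne; exact: (misses_equiv hX n1 n2).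
- by rewrite (eqv _ _ _ _ n1 m1) (eqv _ _ _ _ n2 m2).
- by rewrite (eqv _ _ _ _ n1 m2) (eqv _ _ _ _ n2 m1).
- by case: ne; exact: (misses_equiv hX n1 n2).
Qed.

(** Evaluate on the standard chain with its own numbering of the legs, so that no renumbering is
    left. *)
Lemma chain_rel_of_values : (forall X (c1 c2 : decomp X), nedge X = 2%N ->
  composable X -> ~ decomp_equiv c1 c2 -> value P c1 = eps *: value P c2) -> chain_rel.
Proof.
move=> hv x y u v z xa yb; set a := ar u in xa *; set b := ar v in yb *; set c := ar z.
have ok := chain_graft xa yb; have hlg := relabels_refl (labels3_uniq c ok).
have eok := Prop_irrelevance ok (chain_graft xa yb); subst ok.
set Y := rtree3 (chain_graft xa yb) hlg; have hY : nedge Y = 2%N by exact: (iso_tree3_nedge (id_iso Y)).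
have [d1 [m1 D1]] := con1P (id_iso Y); have [d2 [m2 D2]] := con2P (id_iso Y).
have [Z1 [V1 E1]] := D1 k A s dl P; have [Z2 [V2 E2]] := D2 k A s dl P.
have [l1 l2 l3 l4] := tree3_lts (chain_graft xa yb) hlg.
have oid h : (h < nhalf Y)%N -> onhalf (id_iso Y) h = h by move=> hh; rewrite /onhalf nth_iota.
have ne : ~ decomp_equiv d1 d2.
  by apply: (misses_not_equiv m1 m2); rewrite !oid //; lia.
have cY : composable Y by apply/composable_tree3; lia.
have := hv _ _ _ hY cY ne; rewrite V1 V2 !(@epull_id k A s Y (id_iso Y) erefl) => e.
have hl : labels Y (labels3 a b c x (a.+1 + y.+1)) by exact: tree3_labels.
have e' : ev Z1 (labels3 a b c x (a.+1 + y.+1)) [:: u; v; z] =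
    eps *: ev Z2 (labels3 a b c x (a.+1 + y.+1)) [:: u; v; z] by rewrite e evT_scale.
move: e'; rewrite E1 // E2 // (chain_index xa yb hlg) !rel_id ?(labels_uniq hl) // scalerA.
by [].
Qed.

(** The standard tree is adapted to [d]: in a fork either edge can be made the first one, so the
    evaluation of the first contraction covers both classes. *)
Lemma fork_values : fork_rel -> forall X (d : decomp X), nedge X = 2%N ->
  ~ composable X -> value P d = 0.
Proof.
move=> hr X d hX cX.
have [a [b [c [x [g [lg [ok [hlg [w cs]]]]]]]]] := standard_decomp d hX.
have ga : (g <= a)%N.
  by rewrite leqNgt; apply/negP => ag; apply: cX; apply: (composable_iso w); apply/composable_tree3.
case: cs => [m|[ag _]]; last by lia.
have [xa gQ g1 g2] := ok; have [y eg] : exists y, g = y.+1 by exists g.-1; lia.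
subst g; have [d1 [m1 D1]] := con1P w; have [Z1 [V1 E1]] := D1 k A s dl P.
rewrite (value_equiv P hX (misses_equiv hX m m1)) V1.
suff -> : Z1 = 0 by rewrite (lin0 (@epull_linear k A s _ _ w (dl + dl))).
apply: evT_ext => l v hl /(fits_tree3)[u1 [u2 [u3 [-> a1 a2 a3]]]].
have yx : y <> x by move=> e; apply: g1; rewrite e.
rewrite E1 // fork_index //.
have := hr x y u1 u2 u3; rewrite a1 a2 => hz.
by rewrite hz // (lin0 (rel_linear s _ _)).
Qed.

Lemma fork_rel_of_values : (forall X (d : decomp X), nedge X = 2%N ->
  ~ composable X -> value P d = 0) -> fork_rel.
Proof.
move=> hv x y u v z xa ya yx; set a := ar u in xa ya *; set b := ar v; set c := ar z.
have ok : graft_at a b x y.+1 by split=> //; lia.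
have hlg := relabels_refl (labels3_uniq c ok).
set Y := rtree3 ok hlg; have hY : nedge Y = 2%N by exact: (iso_tree3_nedge (id_iso Y)).
have [d1 [m1 D1]] := con1P (id_iso Y); have [Z1 [V1 E1]] := D1 k A s dl P.
have cY : ~ composable Y by move/composable_tree3; lia.
have := hv _ d1 hY cY; rewrite V1 (@epull_id k A s Y (id_iso Y) erefl) => e.
have hl : labels Y (labels3 a b c x y.+1) by exact: tree3_labels.
have := f_equal (fun Z : endT s Y (dl + dl) => ev Z (labels3 a b c x y.+1) [:: u; v; z]) e.
by rewrite /= E1 // fork_index // rel_id ?(labels_uniq hl).
Qed.

End Relations.

Local Open Scope ring_scope.

(** * Relations of pp *)

Section FreeEdge.
Variables (k : fieldType) (E : collection k) (dl : int) (G : edge_gens E dl).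

Lemma fgen_linear (T : rtr) d : linear (@fgen k E T d).
Proof.
move=> a x y; rewrite /fgen (@fcls_lin k E); apply/clsP; exact: teq_gen_linear.
Qed.

Lemma fgen_pull (T S : rtr) (w : iso T S) d (x : E S d) :
  pull w (fgen x : free_operad E S d) = fgen (cpull w x).
Proof. by rewrite /= (@fpullE k E); apply/clsP; apply: teq_sym; exact: teq_gen_pull. Qed.

Lemma fgen_strict (T u F : rtr) (f : hom T u) i (hu : local_terminal u)
    (ef : elementary f i F) d (x : E F d) :
  cast (strict (free_operad E) hu ef) (fgen x : free_operad E F d) = fgen (cast (cstrict E hu ef) x).
Proof.
rewrite [LHS](@cast_cls k E _ _ (over_unlabel hu ef) d); apply/clsP; apply: teq_sym.
exact: teq_gen_strict.
Qed.

Definition fvalue X (c : decomp X) : free_operad E X (dl + dl) :=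
  pull (dec_iso c) (@circ k (free_operad E) _ _ _ _ _ (dec_elt c) dl dl _ erefl
    (fgen (egen G (dec_S c))) (fgen (egen G (dec_F c)))).

Definition gcoord (T : rtr) p (x : E T p) : k :=
  match p =P dl with
  | ReflectT e => ecoord G (match e in _ = q return E T q with erefl => x end)
  | ReflectF _ => 0
  end.

Lemma gcoordE (T : rtr) (x : E T dl) : gcoord x = ecoord G x.
Proof. by rewrite /gcoord; case: eqP => // e; rewrite (Prop_irrelevance e erefl). Qed.

Lemma gcoord0 (T : rtr) p (x : E T p) : p <> dl -> gcoord x = 0.
Proof. by rewrite /gcoord; case: eqP. Qed.

Variable D : forall X : rtr, decomp X -> Prop.

(** The coordinate of a tensor in its summand, which is at most one-dimensional. *)
Definition tcoef X d (t : tensor D E X d) : k :=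
  gcoord (ten_x (tagged t)) * gcoord (ten_y (tagged t)).

Section Target.
Variables (A : gcoll k) (s : symm A) (Psi : operad_map (free_operad E) (end_operad s)).

Definition fev X d (x : free_operad E X d) : multi A := ev (opmap Psi x : endT s X d).

Lemma fev_lin X d a (x y : free_operad E X d) l w :
  fev (a *: x + y) l w = a *: fev x l w + fev y l w.
Proof. by rewrite /fev omap_linear; exact: evT_lin. Qed.

Lemma fev0 X d l w : fev (0 : free_operad E X d) l w = 0.
Proof. by rewrite /fev opmap0. Qed.

Lemma fevZ X d a (x : free_operad E X d) l w : fev (a *: x) l w = a *: fev x l w.
Proof. by have := fev_lin a x 0 l w; rewrite !addr0 fev0 addr0. Qed.

Lemma fevD X d (x y : free_operad E X d) l w : fev (x + y) l w = fev x l w + fev y l w.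
Proof. by have := fev_lin 1 x y l w; rewrite !scale1r. Qed.

Lemma fev_realize1 X d (t : tensor D E X d) l w : 
  fev (realize1 t) l w = (koszul k (dl * dl) * tcoef t) *: fev (fvalue (sval (tag t))) l w.
Proof.
case: t => -[c Dc] [p q e x y]; rewrite /realize1 /tcoef /=.
have cl (S F T : rtr) (f : hom T S) i (ef : elementary f i F) := @circ_linearl k (free_operad E) T S F f i ef.
have cr (S F T : rtr) (f : hom T S) i (ef : elementary f i F) := @circ_linearr k (free_operad E) T S F f i ef.
have zero : (x = 0 \/ y = 0) -> fev (koszul k (p * q) *: pull (dec_iso c)
    (@circ k (free_operad E) _ _ _ _ _ (dec_elt c) _ _ _ e (fgen y) (fgen x))) l w = 0.
  move=> h; rewrite (_ : circ _ _ _ _ = 0); last first.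
    case: h => ->; rewrite (lin0 (@fgen_linear _ _)); first exact: (lin0 (cr _ _ _ _ _ _ _ _ _ _ _)).
    exact: (lin0 (cl _ _ _ _ _ _ _ _ _ _ _)).
  by rewrite (lin0 (@pull_linear k (free_operad E) _ _ _ _)) scaler0 fev0.
have [ep|np] := p =P dl; last first.
  by rewrite zero ?(gcoord0 x np) ?mul0r ?mulr0 ?scale0r //; left; apply: (ezero G) => -[].
have [eq|nq] := q =P dl; last first.
  by rewrite zero ?(gcoord0 y nq) ?mulr0 ?scale0r //; right; apply: (ezero G) => -[].
subst p q d; rewrite !gcoordE {1}(espan G x) {1}(espan G y).
rewrite !(linZ _ _ (@fgen_linear _ _)).
change (fev (koszul k (dl * dl) *: pull (dec_iso c) (@circ k (free_operad E) _ _ _ _ _ (dec_elt c)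
  dl dl _ erefl (ecoord G y *: (fgen (egen G (dec_S c)) : free_operad E (dec_S c) dl))
  (ecoord G x *: (fgen (egen G (dec_F c)) : free_operad E (dec_F c) dl)))) l w =
  (koszul k (dl * dl) * (ecoord G x * ecoord G y)) *: fev (fvalue c) l w).
rewrite (linZ _ _ (cl _ _ _ _ _ _ _ _ _ _ _)) (linZ _ _ (cr _ _ _ _ _ _ _ _ _ _ _)).
rewrite !(linZ _ _ (@pull_linear k (free_operad E) _ _ _ _)) !scalerA fevZ; congr (_ *: _).
by rewrite [ecoord G y * _]mulrC.
Qed.

Lemma fev_realize X d (u : seq (tensor D E X d)) l w :
  fev (realize u) l w =
  \sum_(t <- u) (koszul k (dl * dl) * tcoef t) *: fev (fvalue (sval (tag t))) l w.
Proof.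
rewrite /realize; elim: u => [|t u IH]; first by rewrite !big_nil fev0.
by rewrite !big_cons fevD fev_realize1 IH.
Qed.

End Target.

Section Lift.
Variables (A : gcoll k) (s : symm A).

Definition edge_lift_cmap (P : gcmp s dl) : collection_map E (end_operad s) :=
  @edge_cmap k E dl G (end_operad s) (fun T => edge_end P T)
    (fun T S w h => edge_end_pull P w h)
    (fun T u F f i hu ef h => edge_end_strict P hu ef h).

Definition edge_lift (P : gcmp s dl) : operad_map (free_operad E) (end_operad s) :=
  free_lift (edge_lift_cmap P).

Lemma edge_lift_gen (P : gcmp s dl) (T : rtr) : nedge T = 1%N ->
  opmap (edge_lift P) (fgen (egen G T)) = edge_end P T.
Proof. by move=> hT; rewrite free_lift_gen; exact: edge_cmap_gen. Qed.

Lemma edge_lift_fvalue (P : gcmp s dl) X (c : decomp X) : nedge X = 2%N ->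
  opmap (edge_lift P) (fvalue c) = value P c.
Proof.
move=> hX; have [hS hF] := dec_nedge1 c hX.
by rewrite /fvalue omap_pull omap_circ !edge_lift_gen.
Qed.

Variable Phi : operad_map (free_operad E) (end_operad s).

Definition image_gen (T : rtr) : endT s T dl := opmap Phi (fgen (egen G T)).

Lemma image_gen_pull (T S : rtr) (w : iso T S) : nedge T = 1%N ->
  epull w (image_gen S) = image_gen T.
Proof.
move=> _; rewrite -[LHS]/(pull w (opmap Phi (fgen (egen G S)))) -omap_pull fgen_pull.
by rewrite egen_pull.
Qed.

Lemma image_gen_strict (T u F : rtr) (f : hom T u) i (hu : local_terminal u)
  (ef : elementary f i F) : nedge T = 1%N ->
  cast (strict (end_operad s) hu ef) (image_gen F : end_operad s F dl) = image_gen T.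
Proof.
move=> _; have eu := over_unlabel hu ef.
rewrite /image_gen -(egen_strict G hu ef) -fgen_strict.
rewrite [RHS](opmap_cast Phi (esym eu) (strict (free_operad E) hu ef)).
exact: cast_irr.
Qed.

Definition gcmp_of : gcmp s dl := family_gcmp image_gen_pull image_gen_strict.

(** By the universal property it suffices to compare on generators, where [family_edge] applies. *)
Lemma edge_liftK (T : rtr) d (x : free_operad E T d) :
  opmap Phi x = opmap (edge_lift gcmp_of) x.
Proof.
apply: free_lift_unique => T' d' x'.
apply: (@edge_cmap_ext k E dl G (end_operad s) (fun T d x => opmap Phi (fgen x))
  (fun T d x => cmap (edge_lift_cmap gcmp_of) x)).
- by move=> T0 d0 a y z; rewrite fgen_linear omap_linear.
- by move=> T0 d0; exact: cmap_linear.
- move=> T0 hT0; rewrite [RHS]edge_cmap_gen // -[LHS]/(image_gen T0).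
  exact: family_edge.
Qed.

End Lift.

End FreeEdge.

Section PPMaps.
Variables (k : fieldType) (D : forall X : rtr, decomp X -> Prop) (hD : representatives D).
Variables (A : gcoll k) (s : symm A).
Let G := single_edge_gens k.

Lemma equiv_refl X (c : decomp X) : decomp_equiv c c.
Proof.
exists (id_iso _), (id_iso _); split; first by rewrite [LHS](comp_mor_id (morP (dec_iso c))).
by rewrite [LHS](comp_mor_id (morP (dec_hom c))) [RHS]hom_comp1.
Qed.

Lemma rep_exists X (c : decomp X) : exists d : {c : decomp X | D c}, decomp_equiv c (sval d).
Proof. by have [d [[Dd e] _]] := hD c; exists (exist _ d Dd). Qed.

Lemma rep_unique X (c d : {c : decomp X | D c}) : decomp_equiv (sval c) (sval d) -> c = d.
Proof.
case: c d => [c Dc] [d Dd] /= e; have [r [_ u]] := hD c; apply: eq_exist => /=.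
by rewrite -(u c (conj Dc (equiv_refl c))) (u d (conj Dd e)).
Qed.

Lemma equiv_trans X (c1 c2 c3 : decomp X) : nedge X = 2%N ->
  decomp_equiv c1 c3 -> decomp_equiv c2 c3 -> decomp_equiv c1 c2.
Proof.
move=> hX /equiv_psi e1 /equiv_psi e2; apply: dec_equivI => // h.
by rewrite e1 e2.
Qed.

Variable Psi : operad_map (free_operad (single_edge k)) (end_operad s).

Lemma basis_coef X (c : {c : decomp X | D c}) : nedge X = 2%N -> tcoef G (basis_tensor k c) = 1.
Proof.
move=> hX; have [hS hF] := dec_nedge1 (sval c) hX.
rewrite /tcoef /= !(gcoordE G) -[unit_elt k (nedge (dec_F _)) 0]/(egen G (dec_F (sval c))).
by rewrite -[unit_elt k (nedge (dec_S _)) 0]/(egen G (dec_S (sval c))) !ecoord1 // mulr1.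
Qed.

Lemma fev_basis X (c : {c : decomp X | D c}) l w : nedge X = 2%N ->
  fev Psi (basis_elt k c) l w = fev Psi (fvalue G (sval c)) l w.
Proof.
by move=> hX; rewrite /basis_elt (fev_realize G) big_seq1 basis_coef // mulr1 mulr0 koszul0 scale1r.
Qed.

End PPMaps.

Section PPRelations.
Variables (k : fieldType) (D : forall X : rtr, decomp X -> Prop) (hD : representatives D).
Variables (A : gcoll k) (s : symm A) (P : gcmp s 0).
Let G := single_edge_gens k.
Let Psi := edge_lift G P.

Lemma fev_value X (c : decomp X) : nedge X = 2%N -> fev Psi (fvalue G c) = ev (value P c).
Proof. by move=> hX; rewrite /fev edge_lift_fvalue. Qed.

Lemma pp_kills : chain_rel P 1 ->
  forall T d (x : free_operad (single_edge k) T d), pp_rel D x -> opmap Psi x = 0.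
Proof.
move=> hr T d x [X d'|X c1 c2 a hX cX ne]; first exact: opmap0.
apply: (@evT_ext k A s) => l w hl fw.
rewrite -[LHS]/(fev Psi _ l w) fevZ fevD -[- basis_elt k c2]scaleN1r fevZ.
rewrite !(fev_basis Psi) // !fev_value //.
have -> : value P (sval c1) = value P (sval c2).
  rewrite -[RHS]scale1r; apply: chain_values => //; first exact: mulr1.
  by move=> e; apply: ne; exact: rep_unique e.
by rewrite scaleN1r subrr scaler0.
Qed.

Lemma pp_chain_rel :
  (forall T d (x : free_operad (single_edge k) T d), pp_rel D x -> opmap Psi x = 0) ->
  chain_rel P 1.
Proof.
move=> hk; apply: chain_rel_of_values => X c1 c2 hX cX ne.
have [d1 e1] := rep_exists hD c1; have [d2 e2] := rep_exists hD c2.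
rewrite (value_equiv P hX e1) (value_equiv P hX e2) scale1r.
have nd : d1 <> d2.
  by move=> e; apply: ne; apply: (equiv_trans hX e1); rewrite e.
have hz := hk _ _ _ (PPDiff (k := k) 1 hX cX nd).
apply: evT_ext => l w hl fw; have := f_equal (fun z : endT s X 0 => ev z l w) hz.
rewrite -[LHS]/(fev Psi _ l w) fevZ fevD -[- basis_elt k d2]scaleN1r fevZ.
rewrite !(fev_basis Psi) // !fev_value // scale1r scaleN1r => e.
by apply/eqP; rewrite -subr_eq0; apply/eqP; exact: e.
Qed.

End PPRelations.

Local Open Scope ring_scope.

(** * Relations of the Koszul dual *)

Section Detection.
Variable k : fieldType.

Definition scal : gcoll k := fun _ _ => k^o.

Definition scal_symm : symm scal.
Proof. by apply: (@Symm k scal (fun n d x _ => x)) => // n d s a x y. Defined.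

Definition shift2 (p q : int) : k := (q == p + 2)%:R.

(* Composition by [shift2] tells the two contractions of a tree with two edges
   apart: both nested composites cannot have the right degrees at once. *)
Definition scal_gcmp : gcmp scal_symm 0.
Proof.
apply: (@Gcmp k scal scal_symm 0 (fun m n i p q d e x y => (shift2 p q * (x * y) : k^o))).
- move=> m n i p q d e y a x x'.
  change (shift2 p q * ((a * (x : k) + (x' : k)) * (y : k)) =
    a * (shift2 p q * ((x : k) * (y : k))) + shift2 p q * ((x' : k) * (y : k))).
  by rewrite mulrDl mulrDr -mulrA mulrCA.
- move=> m n i p q d e x a y y'.
  change (shift2 p q * ((x : k) * (a * (y : k) + (y' : k))) =
    a * (shift2 p q * ((x : k) * (y : k))) + shift2 p q * ((x : k) * (y' : k))).
  rewrite mulrDr mulrDr; congr (_ + _).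
  by rewrite (mulrCA (x : k) a (y : k)) (mulrCA (shift2 p q) a).
- by [].
Defined.

Definition one (n : nat) (p : int) : packed scal := @pack k scal n p (1 : k^o).

Definition inputs_of (X : otree) (dg0 : nat -> int) : seq (packed scal) :=
  [seq one (valence X v) (dg0 v) | v <- iota 0 (nvert X)].

Lemma fits_inputs X dg0 : fits X (inputs_of X dg0).
Proof. by rewrite /fits /inputs_of -map_comp. Qed.

Lemma pin_inputs (X Y : rtr) (w : iso X Y) dg0 :
  pin scal_symm w (inputs_of X dg0) = inputs_of Y (fun j => dg0 (onvert (bwd w) j)).
Proof.
apply/eq_in_map => j; rewrite mem_iota add0n => /andP[_ hj].
have hv := onvert_lt (bwd w) hj.
rewrite (nth_map 0%N) ?size_iota // nth_iota // add0n -(iso_valence w hv) iso_fwdK //.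
Qed.

Lemma pull_sign_neq0 (X Y : rtr) (w : iso X Y) (a : seq (packed scal)) : pull_sign w a != 0.
Proof.
rewrite /pull_sign /sgk; elim/big_ind: _ => [||v _]; first exact: oner_neq0.
  by move=> ? ?; exact: mulf_neq0.
elim/big_ind: _ => [||v' _]; first exact: oner_neq0.
  by move=> ? ?; exact: mulf_neq0.
by rewrite /koszul signr_eq0.
Qed.

Lemma tin_scal0 n e : tin (@pack k scal n e (0 : k^o)) = 0.
Proof. exact: (lin0 (@tin_linear k scal n e)). Qed.

Lemma tin_scal_neq0 n e (c : k^o) : c != 0 -> tin (@pack k scal n e c) <> 0.
Proof.
move=> /eqP h e0; apply: h; have := f_equal (fun z : tot scal => z n e) e0.
by rewrite tin_pack.
Qed.

Lemma pcp_scal i m p n q (x : scal m p) (y : scal n q) : (i < m)%N ->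
  pcp scal_gcmp i (pack x) (pack y) =
  @pack k scal (m + n).-1 (0 + (p + q)) (shift2 p q * ((x : k^o) * (y : k^o))).
Proof. by move=> im; exact: (@pcpE k scal _ 0 scal_gcmp m n (Ordinal im) p q _ erefl x y). Qed.

Section Detect.
Variables (a b c x g : nat) (lg : seq nat).
Hypotheses (ok : graft_at a b x g) (hlg : relabels (labels3 a b c x g) lg).
Variables (X : rtr) (w : iso X (rtree3 ok hlg)).
Variables (dg0 : nat -> int) (l : seq nat).
Hypothesis hl : labels X l.

Let D0 j := dg0 (onvert (bwd w) j).

Lemma tree3_inputs : inputs_of (rtree3 ok hlg) D0 = [:: one a (D0 0); one b (D0 1); one c (D0 2)].
Proof.
have := tree3_valences a b c x g lg; rewrite /inputs_of => e.
by have [e0 e1 e2] : [/\ valence (rtree3 ok hlg) 0 = a, valence (rtree3 ok hlg) 1 = b &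
  valence (rtree3 ok hlg) 2 = c] by [case: e]; rewrite -[LHS]/[:: one (valence (rtree3 ok hlg) 0) (D0 0);
  one (valence (rtree3 ok hlg) 1) (D0 1); one (valence (rtree3 ok hlg) 2) (D0 2)] e0 e1 e2.
Qed.

Lemma detect1 (d : decomp X) : misses d (onhalf w x.+1) (onhalf w a.+1) ->
  exists (kappa : k) (n : nat) (e : int), kappa != 0 /\
  ev (value scal_gcmp d) l (inputs_of X dg0) =
  kappa *: tin (@pack k scal n e (shift2 (D0 0) (D0 1) * shift2 (D0 0 + D0 1) (D0 2))).
Proof.
move=> m; have [xa g1 g2 g3] := ok; have hX := iso_tree3_nedge w.
have [d1 [m1 E1]] := con1P w; have [Z [V1 E]] := E1 k scal scal_symm 0 scal_gcmp.
rewrite (value_equiv scal_gcmp hX (misses_equiv hX m m1)) V1.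
rewrite ev_pull ?fits_inputs // pin_inputs tree3_inputs (E _ _ _ _ (labels_reind w hl)) //.
have ig : ((index g (labels2 a b x)).-1 < (a + b).-1)%N.
  have gl : g \in labels2 a b x by rewrite mem_labels2 //; apply/andP; split; lia.
  by have := gl; rewrite -index_mem size_labels2 //; lia.
rewrite !pcp_scal // !mulr1 !add0r mulrC.
by exists (pull_sign w (inputs_of X dg0)); do 2 eexists; split; first exact: pull_sign_neq0.
Qed.

End Detect.

Section DetectChain.
Variables (a b c x y : nat) (lg : seq nat).
Hypotheses (xa : (x < a)%N) (yb : (y < b)%N).
Hypothesis (hlg : relabels (labels3 a b c x (a.+1 + y.+1)) lg).
Variables (X : rtr) (w : iso X (rtree3 (chain_graft xa yb) hlg)).
Variables (dg0 : nat -> int) (l : seq nat).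
Hypothesis hl : labels X l.

Let D0 j := dg0 (onvert (bwd w) j).

Lemma detect2 (d : decomp X) : misses d (onhalf w (a.+1 + y.+1)) (onhalf w (a.+1 + b.+1)) ->
  exists (kappa : k) (n : nat) (e : int), kappa != 0 /\
  ev (value scal_gcmp d) l (inputs_of X dg0) =
  kappa *: tin (@pack k scal n e (shift2 (D0 1) (D0 2) * shift2 (D0 0) (D0 1 + D0 2))).
Proof.
move=> m; have hX := iso_tree3_nedge w.
have [d1 [m1 E1]] := con2P w; have [Z [V1 E]] := E1 k scal scal_symm 0 scal_gcmp.
rewrite (value_equiv scal_gcmp hX (misses_equiv hX m m1)) V1.
rewrite ev_pull ?fits_inputs // pin_inputs tree3_inputs (E _ _ _ _ (labels_reind w hl)) //.
rewrite !pcp_scal // !mulr1 !mul1r !add0r mul0r koszul0 scale1r mulrC.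
by exists (pull_sign w (inputs_of X dg0)); do 2 eexists; split; first exact: pull_sign_neq0.
Qed.

End DetectChain.

Lemma detection (X : rtr) (d : decomp X) : nedge X = 2%N ->
  exists l w, [/\ labels X l, fits X w, ev (value scal_gcmp d) l w <> 0 &
    forall d', ~ decomp_equiv d d' -> ev (value scal_gcmp d') l w = 0].
Proof.
move=> hX; have hl := labels_legs X.
have [a [b [c [x [g [lg [ok [hlg [w cs]]]]]]]]] := standard_decomp d hX.
set Y := rtree3 ok hlg in w cs.
have fwd j : (j < 3)%N -> onvert w (onvert (bwd w) j) = j by move=> hj; rewrite iso_fwdK.
have nz (kappa : k) n e (z : k^o) : kappa != 0 -> z = 1 -> kappa *: tin (@pack k scal n e z) <> 0.
  move=> hk -> /eqP; rewrite scaler_eq0 (negPf hk) /= => /eqP; apply: tin_scal_neq0.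
  exact: oner_neq0.
have root2 (V : rtr) (v : iso X V) : vertex X (tree_root X) = onvert (bwd v) (vertex V (tree_root V)).
  by rewrite -(iso_root v) iso_vertex // legs_lt // root_leg.
have [xa gQ g1 g2] := ok.
have chain : (a < g)%N -> exists y, (y < b)%N /\ g = (a.+1 + y.+1)%N.
  by move=> ag; exists (g - a.+2)%N; lia.
case: cs => [m|[ag m]].
  (* Degrees of the inputs in the order of the standard tree. Here 2 = 0 + 2 and 4 = (0 + 2) + 2, so
     contracting the first edge first gives a nonzero value. The other order gives 0, because 2 + 4
     is not 0 + 2 in a chain and 4 is not 0 + 2 in a fork. *)
  pose dg0 v : int := nth 0 [:: 0; 2; 4] (onvert w v).
  have dE j : (j < 3)%N -> dg0 (onvert (bwd w) j) = nth 0 [:: 0; 2; 4] j.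
    by move=> hj; rewrite /dg0 fwd.
  exists (legs X), (inputs_of X dg0); split; rewrite ?fits_inputs //.
    have [kp [n [e [hk ->]]]] := detect1 dg0 hl m.
    by apply: nz hk _; rewrite (dE 0%N isT) (dE 1%N isT) (dE 2%N isT) /shift2; exact: mulr1.
  move=> d' ne; case: (edge_cases w d') => m'; first by case: ne; exact: (misses_equiv hX m m').
  have [ag|ga] := ltnP a g.
    have [y [yb eg]] := chain ag; subst g.
    have eok := Prop_irrelevance ok (chain_graft xa yb); subst ok.
    have [kp [n [e [hk ->]]]] := detect2 dg0 hl m'.
    by rewrite (dE 0%N isT) (dE 1%N isT) (dE 2%N isT) /shift2 /= mulr0 tin_scal0 scaler0.
  have nc : ~ composable X.
    by move/(composable_iso (inv_iso w))/composable_tree3; rewrite ltnNge ga.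
  (* The other contraction of a fork is the first contraction of a second standard tree. Both have
     the same root vertex ([b0]), and the vertex 1 of the second is the vertex 2 of the first
     ([b1]). *)
  have [a' [b' [c' [x' [g' [lg' [ok' [hlg' [w' cs']]]]]]]]] := standard_decomp d' hX.
  case: cs' => [n'|[ag' _]]; last first.
    by case: nc; apply: (composable_iso w'); apply/composable_tree3.
  have [kp [n [e [hk ->]]]] := detect1 dg0 hl n'.
  have [l1 l2 l3 l4] := tree3_lts ok hlg; have [k1 k2 k3 k4] := tree3_lts ok' hlg'.
  have vroot (aa bb cc xx gg : nat) ll (o : graft_at aa bb xx gg) (h : relabels (labels3 aa bb cc xx gg) ll) :
      vertex (rtree3 o h) (tree_root (rtree3 o h)) = 0%N.
    by rewrite [tree_root _](tree3_root o h) [vertex _ _]tree3_vertex // /=; lia.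
  have b0 : onvert (bwd w') 0 = onvert (bwd w) 0.
    by have := root2 _ w'; rewrite (root2 _ w) !vroot.
  have v1 : vertex (rtree3 ok' hlg') a'.+1 = 1%N.
    rewrite [vertex _ _]tree3_vertex; last by move: k2; rewrite tree3_nhalf.
    by rewrite ltnSn (_ : (_ <= _)%N = false) //; lia.
  have vQ : vertex Y (a.+1 + b.+1) = 2%N.
    rewrite [vertex _ _]tree3_vertex; last by move: l4; rewrite tree3_nhalf.
    by rewrite leqnn (_ : (a < _)%N = true) //; lia.
  have vg : vertex Y g = 0%N.
    rewrite [vertex _ _]tree3_vertex; last by move: l3; rewrite tree3_nhalf.
    by rewrite ltnNge ga /= (_ : (_ <= g)%N = false) //; lia.
  have b1 : onvert (bwd w') 1 = onvert (bwd w) 2.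
    have hh := onhalf_lt w' k2; have := n' _ hh; rewrite m' // eqxx andbF.
    have := iso_vertex w' k2; rewrite v1 => <-.
    move/negbT; rewrite negb_and !negbK => /orP[/eqP e1|/eqP ->]; last by rewrite iso_vertex // vQ.
    have := f_equal (onvert w') (iso_vertex w' k2).
    rewrite v1 iso_fwdK // e1 iso_vertex // vg -b0 iso_fwdK //.
  rewrite b0 b1 (dE 0%N isT) (dE 2%N isT) (_ : shift2 _ (nth 0 _ 2) = 0) ?mul0r ?tin_scal0 ?scaler0 //.
have [y [yb eg]] := chain ag; subst g.
have eok := Prop_irrelevance ok (chain_graft xa yb); subst ok.
(* Here 3 = 1 + 2 and 1 + 3 = 2 + 2, so contracting the upper edge first gives a nonzero value,
   while 1 is not 2 + 2 and the other order gives 0. *)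
pose dg0 v : int := nth 0 [:: 2; 1; 3] (onvert w v).
have dE j : (j < 3)%N -> dg0 (onvert (bwd w) j) = nth 0 [:: 2; 1; 3] j.
  by move=> hj; rewrite /dg0 fwd.
exists (legs X), (inputs_of X dg0); split; rewrite ?fits_inputs //.
  have [kp [n [e [hk ->]]]] := detect2 dg0 hl m.
  by apply: nz hk _; rewrite (dE 0%N isT) (dE 1%N isT) (dE 2%N isT) /shift2; exact: mulr1.
move=> d' ne; case: (edge_cases w d') => m'; last by case: ne; exact: (misses_equiv hX m m').
have [kp [n [e [hk ->]]]] := detect1 dg0 hl m'.
by rewrite (dE 0%N isT) (dE 1%N isT) (dE 2%N isT) /shift2 /= mul0r tin_scal0 scaler0.
Qed.

End Detection.

Local Open Scope ring_scope.

Section TwoReps.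
Variables (D : forall X : rtr, decomp X -> Prop) (hD : representatives D).

Lemma two_reps X (c0 : decomp X) : nedge X = 2%N -> composable X ->
  exists r1 r2 : {c : decomp X | D c}, r1 <> r2 /\ forall c, c = r1 \/ c = r2.
Proof.
move=> hX cX.
have [a [b [c [x [g [lg [ok [hlg [w _]]]]]]]]] := standard_decomp c0 hX.
have ag : (a < g)%N by apply/(composable_tree3 ok hlg); exact: composable_iso (inv_iso w) cX.
have [xa gQ g1 g2] := ok.
have [y [yb eg]] : exists y, (y < b)%N /\ g = (a.+1 + y.+1)%N.
  by exists (g - a.+2)%N; split; clear -ag gQ g2; lia.
subst g; have eok := Prop_irrelevance ok (chain_graft xa yb); subst ok.
have [l1 l2 l3 l4] := tree3_lts (chain_graft xa yb) hlg.
have [d1 [m1 _]] := con1P w; have [d2 [m2 _]] := con2P w.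
have [r1 e1] := rep_exists hD d1; have [r2 e2] := rep_exists hD d2.
have neh z : (z < nhalf (rtree3 (chain_graft xa yb) hlg))%N -> x.+1 <> z ->
    onhalf w x.+1 <> onhalf w z.
  by move=> hz n /onhalf_inj e; apply: n; apply: e.
exists r1, r2; split=> [e|d].
  apply: (misses_not_equiv m1 m2 (onhalf_lt w l1)).
  - by apply: neh => //; clear -xa; lia.
  - by apply: neh => //; clear -xa; lia.
  by apply: dec_equivI => // h; rewrite (equiv_psi e1 h) e (equiv_psi e2 h).
case: (edge_cases w (sval d)) => m; [left | right]; apply: (rep_unique hD);
  apply: dec_equivI => // h.
  by rewrite (equiv_psi (misses_equiv hX m m1) h) (equiv_psi e1 h).
by rewrite (equiv_psi (misses_equiv hX m m2) h) (equiv_psi e2 h).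
Qed.

End TwoReps.

Section Pairing.
Variables (D : forall X : rtr, decomp X -> Prop) (k : fieldType).
Local Notation E := (single_edge k).
Local Notation Gs := (single_edge_gens k).
Local Notation Gd := (dual_edge_gens k).

Lemma gcoord_zero (F : collection k) dl (G : edge_gens F dl) (T : rtr) p : gcoord G (0 : F T p) = 0.
Proof.
have [ep|np] := p =P dl; last exact: gcoord0.
by subst p; rewrite gcoordE; exact: (lin0 (@ecoord_linear _ _ _ G T)).
Qed.

Lemma sdual_evalE (T : rtr) p p' (f : sdual E T p) (x : E T p') :
  sdual_eval f x = gcoord Gd f * gcoord Gs x.
Proof.
have [ep|np] := p =P 1; last first.
  rewrite (gcoord0 Gd f np) mul0r (ezero Gd f) => [|[_ e]]; last exact: np.
  by rewrite /sdual_eval; case: eqP.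
subst p; rewrite /sdual_eval; case: eqP => [e|ne].
  subst p'; rewrite gcoordE -[gcoord Gs x]/(@gcoord k E 0 Gs T 0 x) gcoordE /=.
  have := fapp_lin f (unit_coord (x : unit_graded k (nedge T) 0)) (unit_elt k (nedge T) 0) 0.
  by rewrite addr0 -(unit_span (x : unit_graded k (nedge T) 0)) fapp0 addr0 mulrC.
by rewrite (gcoord0 Gs x) ?mulr0.
Qed.

Definition ind (T : Type) (x y : T) : k := if pselect (x = y) is left _ then 1 else 0.

Lemma ind1 (T : Type) (x : T) : ind x x = 1.
Proof. by rewrite /ind; case: pselect. Qed.

Lemma ind0 (T : Type) (x y : T) : x <> y -> ind x y = 0.
Proof. by rewrite /ind; case: pselect. Qed.

(** The Koszul sign of [pair_at] disappears because the generators of [single_edge] have degree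
    0. *)
Lemma pairingE X d d' (u : tensor D (sdual E) X d) (r : tensor D E X d') :
  pairing u r = ind (tag u) (tag r) * (tcoef Gd u * tcoef Gs r).
Proof.
case: u r => c [p q e x y] [c' [p' q' e' x' y']]; rewrite /pairing /ind /=.
case: pselect => [ec|_]; last by rewrite mul0r.
subst c'; rewrite /= /pair_at /tcoef /= !sdual_evalE mul1r mulrACA.
have [ep|np] := p' =P 0; first by subst p'; rewrite mulr0 koszul0 mul1r.
by rewrite (gcoord0 Gs x' np) mul0r !mulr0.
Qed.

Lemma tcoef_supp (F : collection k) dl (G : edge_gens F dl) X d (t : tensor D F X d) :
  nedge X <> 2%N -> tcoef G t = 0.
Proof.
case: t => c [p q e x y] hX; rewrite /tcoef /=.
have [hF|nF] := nedge (dec_F (sval c)) =P 1%N; last first.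
  by rewrite (ezero G x) ?gcoord_zero ?mul0r // => -[].
have [hS|nS] := nedge (dec_S (sval c)) =P 1%N; last first.
  by rewrite (ezero G y) ?gcoord_zero ?mulr0 // => -[].
by case: hX; rewrite (dec_nedge (sval c)) hF hS.
Qed.

(** The annihilator is tested on lists of tensors, which can only be concatenated; a difference of
    basis elements therefore needs a tensor for the negative term. *)
Definition neg_basis_tensor X (c : {c : decomp X | D c}) : tensor D E X 0 :=
  Tagged (fun c : {c : decomp X | D c} => tensor_at E 0 (sval c))
    (@TensorAt k E X 0 (sval c) 0 0 (esym (addr0 0))
      (-1 *: unit_elt k (nedge (dec_F (sval c))) 0 : E (dec_F (sval c)) 0)
      (unit_elt k (nedge (dec_S (sval c))) 0)).

Lemma realize_diff X (c1 c2 : {c : decomp X | D c}) :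
  realize [:: basis_tensor k c1; neg_basis_tensor c2] = 1 *: (basis_elt k c1 - basis_elt k c2).
Proof.
rewrite scale1r /basis_elt /realize !big_cons !big_nil !addr0; congr (_ + _).
rewrite -scaleN1r /realize1 /=.
rewrite (linZ _ _ (@fgen_linear k E _ _)).
have cr (S F T : rtr) (f : hom T S) i (ef : elementary f i F) := @circ_linearr k (free_operad E) T S F f i ef.
have lin (y : free_operad E (dec_S (sval c2)) 0) (z : free_operad E (dec_F (sval c2)) 0) :
    koszul k (0 * 0) *: pull (dec_iso (sval c2))
      (@circ k (free_operad E) _ _ _ _ _ (dec_elt (sval c2)) 0 0 0 (esym (addr0 0)) y (-1 *: z)) =
    -1 *: (koszul k (0 * 0) *: pull (dec_iso (sval c2))
      (@circ k (free_operad E) _ _ _ _ _ (dec_elt (sval c2)) 0 0 0 (esym (addr0 0)) y z)).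
  rewrite (linZ _ _ (cr _ _ _ _ _ _ _ _ _ _ _)) (linZ _ _ (@pull_linear k (free_operad E) _ _ _ _)).
  by rewrite !scalerA mulrC.
exact: lin.
Qed.

Lemma neg_basis_coef X (c : {c : decomp X | D c}) : nedge X = 2%N ->
  tcoef Gs (neg_basis_tensor c) = -1.
Proof.
move=> hX; have [hS hF] := dec_nedge1 (sval c) hX.
transitivity (ecoord Gs (-1 *: egen Gs (dec_F (sval c))) * ecoord Gs (egen Gs (dec_S (sval c)))).
  by rewrite /tcoef /= !gcoordE.
by rewrite ecoordE // ecoord1 // mulr1.
Qed.

Definition dual_tensor X (c : {c : decomp X | D c}) : tensor D (sdual E) X (1 + 1) :=
  Tagged (fun c : {c : decomp X | D c} => tensor_at (sdual E) (1 + 1) (sval c))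
    (@TensorAt k (sdual E) X (1 + 1) (sval c) 1 1 erefl
      (egen Gd (dec_F (sval c))) (egen Gd (dec_S (sval c)))).

Lemma dual_coef X (c : {c : decomp X | D c}) : nedge X = 2%N -> tcoef Gd (dual_tensor c) = 1.
Proof.
move=> hX; have [hS hF] := dec_nedge1 (sval c) hX.
by rewrite /tcoef /= !gcoordE !ecoord1 // mulr1.
Qed.

(** Phrased through images in endomorphism operads, where no transport along the equality of [d]
    with 0 is needed. *)
Lemma pp_rel_inv T d (x : free_operad E T d) : pp_rel D x ->
  x = 0 \/ (composable T /\ exists (c1 c2 : {c : decomp T | D c}) (a : k), c1 <> c2 /\
    forall (A : gcoll k) (s : symm A) (Psi : operad_map (free_operad E) (end_operad s)) l w,
    fev Psi x l w = a *: (fev Psi (basis_elt k c1) l w - fev Psi (basis_elt k c2) l w)).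
Proof.
case=> [X d'|X c1 c2 a hX cX ne]; [by left | right; split=> //].
exists c1, c2, a; split=> // A s Psi l w.
by rewrite fevZ fevD -[- basis_elt k c2]scaleN1r fevZ scaleN1r.
Qed.

End Pairing.

Section DualRelations.
Variables (D : forall X : rtr, decomp X -> Prop) (hD : representatives D) (k : fieldType).
Local Notation E := (single_edge k).
Local Notation Gs := (single_edge_gens k).
Local Notation Gd := (dual_edge_gens k).
Variables (A : gcoll k) (s : symm A) (P : gcmp s 1).

Lemma fev_dual_value X (c : decomp X) : nedge X = 2%N ->
  fev (edge_lift Gd P) (fvalue Gd c) = ev (value P c).
Proof. by move=> hX; rewrite /fev edge_lift_fvalue. Qed.

(** On a fork all values vanish. On a chain, the pairing with the relation shows that [u] has equal
    total coefficients at the two classes, and the values there are opposite. *)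
Lemma dual_kills : chain_rel P (-1) -> fork_rel P ->
  forall T d (x : free_operad (sdual E) T d), annihilator D (@pp_rel D k) x ->
  opmap (edge_lift Gd P) x = 0.
Proof.
move=> hc hf X d x [u -> hu]; apply: (@evT_ext k A s) => l w hl fw.
rewrite -[LHS]/(fev (edge_lift Gd P) (realize u) l w) (fev_realize Gd) [RHS](@ev0 k A s).
have [hX|nX] := nedge X =P 2%N; last first.
  by apply: big1 => t _; rewrite tcoef_supp // mulr0 scale0r.
have [cX|nc] := pselect (composable X); last first.
  apply: big1 => t _; rewrite fev_dual_value // fork_values //.
  by rewrite (@ev0 k A s) scaler0.
case: u hu => [|t0 u] hu; first exact: big_nil.
have [r1 [r2 [ne cases]]] := two_reps hD (sval (tag t0)) hX cX.
set u' := t0 :: u in hu *.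
have V12 : value P (sval r1) = -1 *: value P (sval r2).
  apply: chain_values => //; first by rewrite mulrNN mulr1.
  by move=> e; apply: ne; exact: rep_unique e.
have hz : \sum_(t <- u') (ind k (tag t) r1 - ind k (tag t) r2) * tcoef Gd t = 0.
  rewrite -[RHS](hu 0 [:: basis_tensor k r1; neg_basis_tensor k r2]); last first.
    by rewrite realize_diff; exact: PPDiff.
  apply: eq_bigr => t _; rewrite !big_cons big_nil addr0 !pairingE basis_coef // neg_basis_coef //=.
  by rewrite mulr1 mulrN1 mulrN -mulrBl.
transitivity (- (koszul k (1 * 1) *
    \sum_(t <- u') (ind k (tag t) r1 - ind k (tag t) r2) * tcoef Gd t) *:
    ev (value P (sval r2)) l w); last by rewrite hz mulr0 oppr0 scale0r.
rewrite mulr_sumr -sumrN scaler_suml; apply: eq_bigr => t _; rewrite fev_dual_value //.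
have ne' : r2 <> r1 by move=> e; apply: ne.
case: (cases (tag t)) => ->.
  rewrite V12 (@evZ k A s) scalerA ind1 (ind0 k ne) subr0 mul1r; congr (_ *: _).
  by rewrite mulrN1 mul1r.
rewrite ind1 (ind0 k ne') sub0r; congr (_ *: _); move: (koszul k _) => K.
by rewrite mulN1r mulrN opprK.
Qed.

(** By [detection] there are arguments at which only the class of [c] has a nonzero value.
    Evaluation there reads the coefficient at [c] off the realization, so that it does not depend on
    the list of tensors chosen. *)
Lemma coef_detect X (c : {c : decomp X | D c}) : nedge X = 2%N ->
  exists l w v, v <> 0 /\ forall d (r : seq (tensor D E X d)),
    fev (edge_lift Gs (scal_gcmp k)) (realize r) l w =
    (\sum_(b <- r) ind k c (tag b) * tcoef Gs b) *: v.
Proof.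
move=> hX; have [l [w [hl fw nz z]]] := detection k (sval c) hX.
exists l, w, (ev (value (scal_gcmp k) (sval c)) l w); split=> // d r.
rewrite (fev_realize Gs) scaler_suml; apply: eq_bigr => b _.
rewrite fev_value // mulr0 koszul0 mul1r.
have [e|ne] := pselect (c = tag b); first by rewrite -e ind1 mul1r.
rewrite ind0 // mul0r scale0r z ?scaler0 // => e; apply: ne; exact: rep_unique e.
Qed.

Definition coef_sum X d (c : {c : decomp X | D c}) (r : seq (tensor D E X d)) : k :=
  \sum_(b <- r) ind k c (tag b) * tcoef Gs b.

Lemma coef_sum0 X d (c : {c : decomp X | D c}) (r : seq (tensor D E X d)) :
  nedge X = 2%N -> realize r = 0 -> coef_sum c r = 0.
Proof.
move=> hX r0; have [l [w [v [nz E]]]] := coef_detect c hX.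
have := E _ r; rewrite r0 fev0 => /esym/eqP; rewrite scaler_eq0 => /orP[/eqP //|/eqP h].
by case: nz.
Qed.

Lemma coef_sum_diff X d (c c1 c2 : {c : decomp X | D c}) a (r : seq (tensor D E X d)) :
  nedge X = 2%N ->
  (forall (A : gcoll k) (s : symm A) (Psi : operad_map (free_operad E) (end_operad s)) l w,
    fev Psi (realize r) l w = a *: (fev Psi (basis_elt k c1) l w - fev Psi (basis_elt k c2) l w)) ->
  coef_sum c r = a * (ind k c c1 - ind k c c2).
Proof.
move=> hX h; have [l [w [v [nz E]]]] := coef_detect c hX.
have eb c' : fev (edge_lift Gs (scal_gcmp k)) (basis_elt k c') l w = ind k c c' *: v.
  by rewrite /basis_elt E big_cons big_nil addr0 basis_coef // mulr1.
have := E _ r; rewrite h !eb -scalerBl scalerA => /esym/eqP.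
rewrite -subr_eq0 -scalerBl scaler_eq0 => /orP[/eqP h'|/eqP h']; last by case: nz.
by apply/eqP; rewrite -subr_eq0; apply/eqP.
Qed.

Lemma pairing_dual X d (c : {c : decomp X | D c}) (r : seq (tensor D E X d)) :
  nedge X = 2%N -> \sum_(b <- r) pairing (dual_tensor k c) b = coef_sum c r.
Proof.
move=> hX; apply: eq_bigr => b _.
by rewrite pairingE dual_coef // mul1r.
Qed.

Hypothesis kills : forall T d (x : free_operad (sdual E) T d),
  annihilator D (@pp_rel D k) x -> opmap (edge_lift Gd P) x = 0.

(** The only relation on a fork is 0, and a list that realizes 0 has zero coefficients. So each dual
    basis tensor lies in the annihilator and its value vanishes. *)
Lemma dual_fork_rel : fork_rel P.
Proof.
apply: fork_rel_of_values => X d hX nc; have [c e] := rep_exists hD d.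
rewrite (value_equiv P hX e).
have hz : opmap (edge_lift Gd P) (realize [:: dual_tensor k c]) = 0.
  apply: kills; exists [:: dual_tensor k c] => // d' r hr.
  rewrite big_cons big_nil addr0 pairing_dual //.
  have [z|[cX _]] := pp_rel_inv hr; [exact: coef_sum0 | by case: nc].
apply: (@evT_ext k A s) => l w hl fw; rewrite [RHS](@ev0 k A s).
have := f_equal (fun z : endT s X (1 + 1) => ev z l w) hz.
rewrite [X in _ = X](@ev0 k A s) -[LHS]/(fev (edge_lift Gd P) _ l w) (fev_realize Gd).
rewrite big_cons big_nil addr0 dual_coef // fev_dual_value // => /eqP.
by rewrite scaler_eq0 mulr1 /koszul signr_eq0 => /eqP.
Qed.

(** Relations on a chain are multiples of the difference of the two basis elements, which is
    annihilated by the sum of the two dual tensors; so the two values add up to 0. *)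
Lemma dual_chain_rel : chain_rel P (-1).
Proof.
apply: chain_rel_of_values => X c1 c2 hX cX ne.
have [d1 e1] := rep_exists hD c1; have [d2 e2] := rep_exists hD c2.
rewrite (value_equiv P hX e1) (value_equiv P hX e2).
have nd : d1 <> d2 by move=> e; apply: ne; apply: (equiv_trans hX e1); rewrite e.
have nd' : d2 <> d1 by move=> e; apply: nd.
have all2 c : c = d1 \/ c = d2.
  have [r1 [r2 [_ cs]]] := two_reps hD c1 hX cX.
  by case: (cs d1) (cs d2) (cs c) nd => -> [] -> [] -> //; auto.
have one c : ind k d1 c + ind k d2 c = 1.
  by case: (all2 c) => ->; rewrite ind1 ind0 // ?addr0 ?add0r.
have hz : opmap (edge_lift Gd P) (realize [:: dual_tensor k d1; dual_tensor k d2]) = 0.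
  apply: kills; exists [:: dual_tensor k d1; dual_tensor k d2] => // d' r hr.
  rewrite !big_cons big_nil addr0 !pairing_dual //.
  have [z|[_ [b1 [b2 [a [_ E]]]]]] := pp_rel_inv hr; first by rewrite !coef_sum0 // addr0.
  by rewrite !(coef_sum_diff _ hX E) -mulrDr addrACA -opprD !one subrr mulr0.
apply: (@evT_ext k A s) => l w hl fw; rewrite [RHS](@evZ k A s).
have := f_equal (fun z : endT s X (1 + 1) => ev z l w) hz.
rewrite [X in _ = X](@ev0 k A s) -[LHS]/(fev (edge_lift Gd P) _ l w) (fev_realize Gd).
rewrite !big_cons big_nil addr0 !dual_coef // !fev_dual_value // -scalerDr => /eqP.
rewrite scaler_eq0 mulr1 /koszul signr_eq0 /= scaleN1r => /eqP h.
by apply/eqP; rewrite -addr_eq0; apply/eqP.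
Qed.

End DualRelations.

Local Open Scope ring_scope.

(** Terms are indexed by unlabelled trees, so one term represents elements at all trees with the
    same [unlabel]. The last hypothesis passes from one of these trees to another. *)
Lemma free_operad_ind (k : fieldType) (E : collection k)
    (Pr : forall (T : rtr) d, free_operad E T d -> Prop) :
  (forall (T : rtr) d (x : E T d), Pr T d (fgen x)) ->
  (forall (U : rtr) (hU : trivial_tree U), Pr U 0 (eta (free_operad E) hU)) ->
  (forall (T S F : rtr) (f : hom T S) i (ef : elementary f i F) (p q d : int) (e : d = p + q)
    (x : free_operad E S p) (y : free_operad E F q), Pr S p x -> Pr F q y -> Pr T d (circ ef e x y)) ->
  (forall (T S : rtr) (w : iso T S) d (x : free_operad E S d), Pr S d x -> Pr T d (pull w x)) ->
  (forall (T : rtr) d, Pr T d 0) ->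
  (forall (T : rtr) d (x y : free_operad E T d), Pr T d x -> Pr T d y -> Pr T d (x + y)) ->
  (forall (T : rtr) d a (x : free_operad E T d), Pr T d x -> Pr T d (a *: x)) ->
  (forall (T T' : rtr) (eM : free_operad E T' = free_operad E T), unlabel T = unlabel T' ->
    forall d (x : free_operad E T' d), Pr T' d x -> Pr T d (cast eM x)) ->
  forall (T : rtr) d (x : free_operad E T d), Pr T d x.
Proof.
move=> hg he hc hp h0 hadd hs ht.
suff main t d (x : term E t d) (T : rtr) (e : unlabel T = t) :
    Pr T d (cls (castt (esym e) x : term_premod E _ _) : fop E T d).
  move=> T d; elim/(@fclsW k E)=> x; exact: (main _ _ x T erefl).
have key (T0 : rtr) n (y : term E (unlabel T0) n) (T1 : rtr)
    (e1 : unlabel T1 = unlabel T0) : Pr T0 n (cls (y : term_premod E _ _) : fop E T0 n) ->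
  Pr T1 n (cls (castt (esym e1) y : term_premod E _ _) : fop E T1 n).
  move=> hy; pose eM : free_operad E T0 = free_operad E T1 := f_equal (fterm E) (esym e1).
  have -> : (cls (castt (esym e1) y : term_premod E _ _) : fop E T1 n) =
      cast eM (cls (y : term_premod E _ _) : fop E T0 n).
    by symmetry; exact: (cast_cls (esym e1) y).
  exact: ht.
elim: x T e => {t d}.
- by move=> T0 d x T e; apply: key; exact: hg.
- by move=> U hU T e; apply: key; exact: he.
- move=> T S F f i ef p q d h x IHx y IHy T' e; apply: key.
  have := hc _ _ _ f i ef p q d h _ _ (IHx S erefl) (IHy F erefl).
  by rewrite /= (@fcircE k E).
- move=> T S w d x IHx T' e; apply: key.
  by have := hp _ _ w _ _ (IHx S erefl); rewrite /= (@fpullE k E).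
- by move=> t d T e; case: t / e; exact: h0.
- move=> t d x IHx y IHy T e; case: t / e x IHx y IHy => x IHx y IHy /=.
  have := hadd _ _ _ _ (IHx T erefl) (IHy T erefl).
  by rewrite [X in Pr _ _ X]qaddE.
- move=> t d a x IHx T e; case: t / e x IHx => x IHx /=.
  have := hs _ _ a _ (IHx T erefl).
  by rewrite [X in Pr _ _ X]qscaleE.
Qed.

(** * Morphisms of algebras *)

Section MapPacked.
Variables (k : fieldType) (A B : gcoll k) (f : gmap A B).

Definition pmapp (p : packed A) : packed B := pack (gapp f (el p)).

Definition tmap (x : tot A) : tot B := fun c d => gapp f (x c d).

Lemma gapp_linear c d : linear (fun x : A c d => gapp f x).
Proof. exact: (proj2_sig f). Qed.

Lemma tmap_linear : linear tmap.
Proof. by move=> a x y; apply: totP => c d; exact: gapp_linear. Qed.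

Lemma tmap_tin p : tmap (tin p) = tin (pmapp p).
Proof.
case: p => c [d x]; apply: totP => c' d'; rewrite -[existT _ c _]/(pack x).
have [[e1 e2]|n] := pselect (c = c' /\ d = d').
  by subst c' d'; rewrite /tmap !tin_pack.
by rewrite /tmap !tin_out //; exact: (lin0 (@gapp_linear _ _)).
Qed.

Lemma pmapp_pk c d x : pmapp (pk c d x) = pk c d (tmap x). Proof. by []. Qed.

Lemma pmapp_p0 : pmapp (p0 A) = p0 B.
Proof. by rewrite /pmapp /p0 /=; congr pack; exact: (lin0 (@gapp_linear _ _)). Qed.

Lemma nth_pmapp w i : nth (p0 B) [seq pmapp p | p <- w] i = pmapp (nth (p0 A) w i).
Proof.
have [h|h] := ltnP i (size w); first exact: nth_map.
by rewrite !nth_default ?size_map // pmapp_p0.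
Qed.

Lemma fits_pmapp t w : fits t w -> fits t [seq pmapp p | p <- w].
Proof. by rewrite /fits -map_comp. Qed.

Lemma degs_pmapp w : degs [seq pmapp p | p <- w] = degs w.
Proof. by rewrite /degs big_map. Qed.

Lemma ins_pmapp (T : rtr) (d : 'I_(nvert T) -> int) (a : inputs A d) :
  ins ((fun v => gapp f (a v)) : inputs B d) = [seq pmapp p | p <- ins a].
Proof.
apply: ins_eq => [|v]; first by rewrite size_map size_ins.
by rewrite nth_pmapp nth_ins.
Qed.

Lemma deg_at_pmapp w v : deg_at [seq pmapp p | p <- w] v = deg_at w v.
Proof. by rewrite /deg_at nth_pmapp. Qed.

Section Equivariant.
Variables (s : symm A) (t : symm B).
Hypothesis f_sact : forall n d (x : A n d) (u : 'S_n), gapp f (sact s x u) = sact t (gapp f x) u.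

Lemma tmap_rel l l' x : tmap (rel s l l' x) = rel t l l' (tmap x).
Proof. by apply: totP => c d; exact: f_sact. Qed.

Lemma pmapp_prel l l' p : pmapp (prel s l l' p) = prel t l l' (pmapp p).
Proof. by rewrite /pmapp /prel /=; congr pack; exact: f_sact. Qed.

Lemma pin_pmapp (T S : rtr) (w : iso T S) a :
  pin t w [seq pmapp p | p <- a] = [seq pmapp p | p <- pin s w a].
Proof.
rewrite /pin -map_comp; apply: eq_map => j; rewrite /comp pmapp_prel.
by rewrite nth_pmapp.
Qed.

Variables (E : collection k) (dl : int) (G : edge_gens E dl).
Variables (Phi : operad_map (free_operad E) (end_operad s)).
Variables (Psi : operad_map (free_operad E) (end_operad t)).

Definition natural_at (T : rtr) d (x : free_operad E T d) : Prop := forall l w,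
  labels T l -> fits T w -> fev Psi x l [seq pmapp p | p <- w] = tmap (fev Phi x l w).

Hypothesis on_gens : forall T : rtr, nedge T = 1%N -> natural_at (fgen (egen G T)).

(** Commutation with [f] is inherited by every operation of the free operad; units and pull-backs
    use that [f] is equivariant. *)
Lemma natural_all (T : rtr) d (x : free_operad E T d) : natural_at x.
Proof.
have tz : tmap 0 = 0 by exact: (lin0 tmap_linear).
move: T d x; apply: free_operad_ind.
- move=> T d x; have [[hT ed]|n] := pselect (nedge T = 1%N /\ d = dl).
    subst d => l w hl fw; rewrite (espan G x) (linZ _ _ (@fgen_linear _ _ _ _)).
    rewrite -[_ *: fgen _]/(_ *: (fgen (egen G T) : free_operad E T dl)).
    by rewrite !fevZ on_gens // (linZ _ _ tmap_linear).
  move=> l w _ _; rewrite (ezero G x n) (lin0 (@fgen_linear _ _ _ _)).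
  by rewrite -[0 : fop E T d]/(0 : free_operad E T d) !fev0 tz.
- move=> U hU l w hl fw; have [p ew hp] := fits_terminal hU.1 fw; rewrite ew in fw *.
  transitivity (ev (eeta t hU) l [:: pmapp p]); first by rewrite /fev omap_eta.
  rewrite (ev_eta t hU (p := pmapp p) hl hp) -tmap_tin -tmap_rel; congr tmap.
  by rewrite /fev omap_eta; symmetry; exact: ev_eta.
- move=> T S F g i ef p q d e x y hx hy l w hl fw.
  have [w1 [w2 [w3 [ew s1 f2 f3]]]] := fits_split ef fw.
  rewrite /fev !omap_circ.
  rewrite -[X in ev X l w]/(ecirc ef e (opmap Phi x : endT s S p) (opmap Phi y : endT s F q)).
  rewrite -[X in ev X l [seq pmapp p | p <- w]]/(ecirc ef e (opmap Psi x : endT t S p) (opmap Psi y : endT t F q)).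
  have fw' := fits_pmapp fw; rewrite ew !map_cat in fw fw' *.
  rewrite (ev_circ ef e _ _ s1 (fits_size f2) hl fw).
  rewrite (ev_circ ef e _ _ _ _ hl fw') ?size_map ?(fits_size f2) //.
  rewrite degs_pmapp (linZ _ _ tmap_linear); congr (_ *: _).
  have ei : inner (opmap Psi y : endT t F q) [seq pmapp p | p <- w2] =
      pmapp (inner (opmap Phi y : endT s F q) w2).
    rewrite /inner pmapp_pk degs_pmapp; congr pk.
    exact: hy (labels_legs F) f2.
  rewrite ei -[_ :: [seq pmapp p | p <- w3]]/[seq pmapp p | p <- _ :: w3] -map_cat.
  by apply: hx; [exact: labels_reind | exact: f3].
- move=> T S w d x hx l a hl fa; rewrite /fev !omap_pull.
  rewrite -[X in ev X l a]/(epull w (opmap Phi x : endT s S d)).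
  rewrite -[X in ev X l [seq pmapp p | p <- a]]/(epull w (opmap Psi x : endT t S d)).
  rewrite !ev_pull ?fits_pmapp // pin_pmapp (linZ _ _ tmap_linear); congr (_ *: _).
    by apply: eq_sgk_rel => //; move=> v *; exact: deg_at_pmapp.
  by apply: hx; [exact: labels_reind | exact: fits_pin].
- by move=> T d l w _ _; rewrite !fev0 tz.
- by move=> T d x y hx hy l w hl fw; rewrite !fevD hx // hy // (linD _ _ tmap_linear).
- by move=> T d a x hx l w hl fw; rewrite !fevZ hx // (linZ _ _ tmap_linear).
- move=> T T' eM e d x hx l w hl fw; rewrite /fev !(opmap_cast _ e).
  have ec : core T' = core T by rewrite (core_unlabel e).
  rewrite !(ev_strict ec); apply: hx.
    by rewrite -[labels T' l]/(labels (core T') l) ec.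
  by rewrite -[fits T' w]/(fits (core T') w) ec.
Qed.

End Equivariant.

End MapPacked.

(** * Algebras over a quotient of a free operad on one generator *)

Section QuotientAlgebra.
Variables (k : fieldType) (E : collection k) (dl : int) (G : edge_gens E dl).
Variable R : op_pred (free_operad E).
Local Notation M := (quotient_by R).

Definition gcmp_data (A : gcoll k) := {s : symm A & gcmp s dl}.

Definition respects (A : gcoll k) (x : gcmp_data A) : Prop :=
  forall T d (r : free_operad E T d), R r -> opmap (edge_lift G (tagged x)) r = 0.

(** The two actions are kept apart because in [data_of_alg] they are only propositionally equal. On
    a standard tree with its own numbering no renumbering takes place, so they do not enter. *)
Lemma gc_of_edge_end (A : gcoll k) (s t : symm A) (P : gcmp s dl) (Q : gcmp t dl) :
  (forall (T : rtr) w, nedge T = 1%N -> fits T w ->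
    ev (edge_end P T) (legs T) w = ev (edge_end Q T) (legs T) w) ->
  forall m n (i : 'I_m) (p q d : int) (e : d = dl + (p + q)) (x : A m p) (y : A n q),
  gc P i e x y = gc Q i e x y.
Proof.
move=> h m n i p q d e x y; apply: (@pack_inj k A).
have im := ltn_ord i; have hlg := labels2_relabels n im.
have hl : labels (tree2 m n i (labels2 m n i)) (labels2 m n i) by exact: (tree2_labels im hlg).
have hT : nedge (rtree2 im hlg) = 1%N by exact: tree2_nedge.
have E0 (r : symm A) (Z : gcmp r dl) :
    ev (edge_end Z (rtree2 im hlg)) (labels2 m n i) [:: pack x; pack y] = tin (pack (gc Z i e x y)).
  rewrite (@ev_edge2 k A r dl Z m n i _ im hlg _ (pack x) (pack y) hl erefl erefl).
  rewrite rel_id; last exact: labels_uniq hl.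
  by rewrite (pcpE Z i e x y).
apply: packed_eq => //; rewrite -!E0; apply: h => //.
by apply/eqP; exact: esym (tree2_valences m n i _).
Qed.

Lemma gcmp_data_eq (A : gcoll k) (x y : gcmp_data A) :
  (forall n d (z : A n d) u, sact (tag x) z u = sact (tag y) z u) ->
  (forall m n (i : 'I_m) (p q d : int) (e : d = dl + (p + q)) (z : A m p) (z' : A n q),
    gc (tagged x) i e z z' = gc (tagged y) i e z z') -> x = y.
Proof.
case: x y => s P [t Q] /= hs hg; have es := symm_eq hs; subst t; congr (existT _ s _).
have : @gc _ _ _ _ P = @gc _ _ _ _ Q.
  by do 9!(apply: functional_extensionality_dep => ?); exact: hg.
case: P Q {hg} => a1 b1 c1 d1 [a2 b2 c2 d2] /= e.
case: a2 / e b2 c2 d2 => b2 c2 d2.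
by congr Gcmp; exact: Prop_irrelevance.
Qed.

Section OfAlgebra.
Variables (A : gcoll k) (al : algebra M A).

Definition free_map : operad_map (free_operad E) (end_operad (symm_of al)) :=
  opmap_comp (map_of al) (quo_proj R).

Definition data_of : gcmp_data A := existT _ (symm_of al) (gcmp_of G free_map).

Lemma free_mapE (T : rtr) d (x : free_operad E T d) :
  opmap free_map x = opmap (map_of al) (opmap (quo_proj R) x).
Proof. by []. Qed.

Lemma respects_data : respects data_of.
Proof.
move=> T d r hr; rewrite -[LHS]/(opmap (edge_lift G (gcmp_of G free_map)) r).
rewrite -(edge_liftK G free_map) free_mapE.
by rewrite (quo_proj_rel hr) opmap0.
Qed.

Lemma ev_free_map (T : rtr) d (x : free_operad E T d) w : fits T w ->
  fev free_map x (legs T) w = aT al (opmap (quo_proj R) x) w.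
Proof.
move=> fw; rewrite /fev free_mapE.
rewrite -[X in ev X]/(map_at al (opmap (quo_proj R) x) : endo (symm_of al) (core T) d).
by rewrite ev_map_at ?labels_legs // rel_id // (labels_uniq (labels_legs T)).
Qed.

Lemma edge_end_free_map (T : rtr) : nedge T = 1%N ->
  edge_end (tagged data_of) T = opmap free_map (fgen (egen G T)).
Proof. by move=> hT; rewrite (edge_liftK G free_map) edge_lift_gen. Qed.

End OfAlgebra.

Definition alg_of (A : gcoll k) (x : gcmp_data A) (h : respects x) : algebra M A :=
  algebra_of (quo_lift h).

Lemma algebra_of_ext (A : gcoll k) (s : symm A) (Phi Psi : operad_map M (end_operad s)) :
  (forall T d (m : M T d), opmap Phi m = opmap Psi m) -> algebra_of Phi = algebra_of Psi.
Proof.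
by move=> h; apply: algebra_eq => T p n d e m a; rewrite /= /act_of /end_of h.
Qed.

Lemma alg_of_data (A : gcoll k) (al : algebra M A) (h : respects (data_of al)) : alg_of h = al.
Proof.
rewrite -[RHS]algebra_of_map_of; apply: algebra_of_ext => T d m.
have [x ->] := quo_proj_surj m.
by rewrite -[LHS]/(quo_lift_at _ _) (quo_lift_cls h) -(edge_liftK G (free_map al)).
Qed.

Lemma data_of_alg (A : gcoll k) (x : gcmp_data A) (h : respects x) : data_of (alg_of h) = x.
Proof.
have es : symm_of (alg_of h) = tag x by exact: symm_of_algebra_of.
apply: gcmp_data_eq => [n d z u|]; first by rewrite [tag _]es.
apply: gc_of_edge_end => T w hT fw.
rewrite edge_end_free_map // -[LHS]/(fev _ _ _ _) ev_free_map //.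
rewrite aT_algebra_of // /end_of -[X in ev X]/(quo_lift_at (edge_lift G (tagged x))
  (opmap (quo_proj R) (fgen (egen G T)))).
by rewrite (quo_lift_cls h) edge_lift_gen.
Qed.

Lemma data_of_inj (A : gcoll k) (al be : algebra M A) : data_of al = data_of be -> al = be.
Proof.
have gen (x y : gcmp_data A) (hx : respects x) (hy : respects y) : x = y -> alg_of hx = alg_of hy.
  by move=> e; subst y; congr alg_of; exact: Prop_irrelevance.
by move=> e; rewrite -(alg_of_data (respects_data al)) -(alg_of_data (respects_data be)); exact: gen.
Qed.

Definition data_map (A B : gcoll k) (x : gcmp_data A) (y : gcmp_data B) (f : gmap A B) : Prop :=
  (forall n d (z : A n d) u, gapp f (sact (tag x) z u) = sact (tag y) (gapp f z) u) /\
  (forall m n (i : 'I_m) (p q d : int) (e : d = dl + (p + q)) (z : A m p) (z' : A n q),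
    gapp f (gc (tagged x) i e z z') = gc (tagged y) i e (gapp f z) (gapp f z')).

Section Maps.
Variables (A B : gcoll k) (al : algebra M A) (be : algebra M B) (f : gmap A B).

Lemma aUp_pmapp (T : rtr) p (m : M T p) w : algebra_map al be f -> fits T w ->
  aUp be m [seq pmapp f p | p <- w] = pmapp f (aUp al m w).
Proof.
move=> hf /ins_surj[d [a <-]]; rewrite -ins_pmapp !(aUpE _ erefl).
by rewrite -hf.
Qed.

Lemma pack_gc_data (C : gcoll k) (ga : algebra M C) m n (i : 'I_m) (p q d : int)
    (e : d = dl + (p + q)) (x : C m p) (y : C n q)
    (hlg : relabels (labels2 m n i) (labels2 m n i)) :
  fits (rtree2 (ltn_ord i) hlg) [:: pack x; pack y] /\
  pack (gc (tagged (data_of ga)) i e x y) =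
  aUp ga (opmap (quo_proj R) (fgen (egen G (rtree2 (ltn_ord i) hlg)))) [:: pack x; pack y].
Proof.
set T := rtree2 _ _; have hT : nedge T = 1%N by exact: tree2_nedge.
have hl : labels (tree2 m n i (labels2 m n i)) (labels2 m n i) by exact: (tree2_labels (ltn_ord i) hlg).
have fT : fits T [:: pack x; pack y] by apply/eqP; exact: esym (tree2_valences m n i _).
split=> //; have eT : tin (pack (gc (tagged (data_of ga)) i e x y)) =
    aT ga (opmap (quo_proj R) (fgen (egen G T))) [:: pack x; pack y].
  rewrite -ev_free_map // -[RHS]/(ev _ _ _) -edge_end_free_map //.
  rewrite (@ev_edge2 k C _ dl (tagged (data_of ga)) m n i _ (ltn_ord i) hlg _ (pack x) (pack y) hl erefl erefl).
  rewrite rel_id; last exact: labels_uniq hl.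
  by rewrite (pcpE (tagged (data_of ga)) i e x y).
apply: packed_eq => //.
  rewrite aUp_ar // /pi0 -[legs T]/(labels2 m n i) size_labels2 ?ltn_ord //.
by rewrite aUp_dg // !degs_cons /degs big_nil addr0.
Qed.

(** The actions and the composition are themselves values of the algebra, at units and at the
    generator. Conversely every operation is the class of an element of the free operad, to which
    [natural_all] applies. *)
Lemma algebra_mapP : algebra_map al be f <-> data_map (data_of al) (data_of be) f.
Proof.
split=> [hf|[hs hg]].
  split=> [n d z u|m n i p q d e z z'].
    apply: (@pack_inj k B); rewrite -[LHS]/(pmapp f (pack (symact al z u))) !pack_symact.
    rewrite -[RHS]/(aUp be _ [seq pmapp f p | p <- [:: pack z]]).
    by rewrite aUp_pmapp // fits_cor.
  apply: (@pack_inj k B); have hlg := labels2_relabels n (ltn_ord i).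
  have [fz ez] := pack_gc_data al e z z' hlg.
  have [_ ->] := pack_gc_data be e (gapp f z) (gapp f z') hlg.
  rewrite -[LHS]/(pmapp f (pack (gc (tagged (data_of al)) i e z z'))) ez.
  by rewrite -aUp_pmapp.
have pcpf i x y : pmapp f (pcp (tagged (data_of al)) i x y) =
    pcp (tagged (data_of be)) i (pmapp f x) (pmapp f y).
  case: x y => m [p x] [n [q y]]; rewrite -[existT _ m _]/(pack x) -[existT _ n _]/(pack y).
  rewrite -[pmapp f (pack x)]/(pack (gapp f x)) -[pmapp f (pack y)]/(pack (gapp f y)).
  have [hi|hi] := ltnP i m.
    rewrite -[i]/(val (Ordinal hi)) !(pcpE _ _ erefl).
    by rewrite -[LHS]/(pack (gapp f _)) hg.
  rewrite /pcp !insubN -?leqNgt //; congr pack; exact: (lin0 (@gapp_linear _ _ _ f _ _)).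
have nat_gen (T : rtr) : nedge T = 1%N ->
    natural_at f (free_map al) (free_map be) (fgen (egen G T)).
  move=> hT l w hl fw; rewrite /fev -!edge_end_free_map //.
  rewrite !ev_edge ?fits_pmapp // /edge_raw (linZ _ _ (tmap_linear f)) (tmap_rel hs) tmap_tin pcpf.
  by rewrite !nth_pmapp /edge_sign !deg_at_pmapp.
move=> T p n d e m a; have [x ->] := quo_proj_surj m.
have fa := fits_ins a.
have := natural_all hs nat_gen x (labels_legs T) fa.
rewrite -ins_pmapp !ev_free_map ?fits_ins // /aT !(aUpE _ e) tmap_tin.
by move/(f_equal (fun z : tot B => z (pi0 T) n)); rewrite !tin_pack => ->.
Qed.

End Maps.

End QuotientAlgebra.

Local Open Scope ring_scope.

Lemma existT_inj (U : Type) (F : U -> Type) (x : U) (a b : F x) :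
  existT F x a = existT F x b -> a = b.
Proof.
by move=> e; have := projT2_eq e; rewrite (Prop_irrelevance (projT1_eq e) erefl).
Qed.

Lemma inj_surj_bij (U V : Type) (f : U -> V) :
  injective f -> (forall y, exists x, f x = y) -> bijective f.
Proof.
move=> fi fs; exists (fun y => sval (cid (fs y))) => [x|y]; last by case: cid.
by apply: fi; case: cid.
Qed.

Lemma partial_comp_eq (k : fieldType) (A : gcoll k) (P Q : partial_comp A) :
  (forall n d (x : A n d) u, ract P x u = ract Q x u) ->
  (forall m n (i : 'I_m) (p q d : int) (e : d = p + q) (x : A m p) (y : A n q),
    pcomp P i e x y = pcomp Q i e x y) -> P = Q.
Proof.
move=> h1 h2; have e1 : @ract _ _ P = @ract _ _ Q.
  by do 4!(apply: functional_extensionality_dep => ?); exact: h1.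
have e2 : @pcomp _ _ P = @pcomp _ _ Q.
  by do 9!(apply: functional_extensionality_dep => ?); exact: h2.
case: P Q e1 e2 {h1 h2} => r1 c1 a1 a2 a3 a4 a5 a6 [r2 c2 b1 b2 b3 b4 b5 b6] /= e1 e2.
case: r2 / e1 b1 b2 b3 b6; case: c2 / e2 b4 b5 => *.
by congr PartialComp; exact: Prop_irrelevance.
Qed.

(** * Isomorphisms of categories *)

Section StrFunctor.
Variables (k : fieldType) (str1 str2 : gcoll k -> Type).
Variable pre1 : forall A B : gcoll k, str1 A -> str1 B -> gmap A B -> Prop.
Variable pre2 : forall A B : gcoll k, str2 A -> str2 B -> gmap A B -> Prop.
Hypothesis id1 : forall A (a : str1 A), pre1 a a (gid A).
Hypothesis comp1 : forall A B C (a : str1 A) (b : str1 B) (c : str1 C) (g : gmap B C) (f : gmap A B),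
  pre1 b c g -> pre1 a b f -> pre1 a c (gcomp g f).
Hypothesis id2 : forall A (a : str2 A), pre2 a a (gid A).
Hypothesis comp2 : forall A B C (a : str2 A) (b : str2 B) (c : str2 C) (g : gmap B C) (f : gmap A B),
  pre2 b c g -> pre2 a b f -> pre2 a c (gcomp g f).
Variable sh : gcoll k -> gcoll k.
Variable shm : forall A B, gmap A B -> gmap (sh A) (sh B).
Hypothesis shm_id : forall A, shm (gid A) = gid (sh A).
Hypothesis shm_comp : forall A B C (g : gmap B C) (f : gmap A B),
  shm (gcomp g f) = gcomp (shm g) (shm f).
Variable to : forall A, str1 A -> str2 (sh A).
Hypothesis toP : forall A B (a : str1 A) (b : str1 B) (f : gmap A B),
  pre1 a b f <-> pre2 (to a) (to b) (shm f).

(** The underlying collections are changed along [sh], which leaves room for the shift of degrees in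
    the case of the Koszul dual. *)
Definition str_functor : functor (str_category id1 comp1) (str_category id2 comp2).
Proof.
apply: (@Functor (str_category id1 comp1) (str_category id2 comp2)
  (fun x => existT str2 (sh (tag x)) (to (tagged x)))
  (fun x y f => exist _ (shm (sval f)) ((toP _ _ _).1 (proj2_sig f)))).
- by move=> x; apply: eq_exist; exact: shm_id.
- by move=> x y z g f; apply: eq_exist; exact: shm_comp.
Defined.

Lemma str_functor_iso : bijective sh ->
  (forall A B, injective (@shm A B)) -> (forall A B (g : gmap (sh A) (sh B)), exists f, shm f = g) ->
  (forall A, injective (@to A)) -> (forall A (b : str2 (sh A)), exists a, to a = b) ->
  is_isomorphism str_functor.
Proof.
move=> [sh' shK shVK] mi ms ti ts; split.
  apply: inj_surj_bij => [[A a] [A' a']|[B b]].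
    move=> /= e; have eA : A = A' by apply: (can_inj shK); exact: (f_equal (@projT1 _ _) e).
    by subst A'; congr existT; apply: ti; exact: (existT_inj e).
  have [A eA] : exists A, sh A = B by exists (sh' B).
  by subst B; have [a <-] := ts _ b; exists (existT _ A a).
move=> [A a] [B b]; apply: inj_surj_bij => [[f hf] [g hg] e|[g hg]].
  by apply: eq_exist; apply: mi; exact: (f_equal (fun h => sval h) e).
have [f ef] := ms _ _ g.
have hf : pre1 a b f by apply/toP; rewrite ef; exact: hg.
by exists (exist _ f hf); apply: eq_exist; exact: ef.
Qed.

End StrFunctor.

(* Algebras over a quadratic operad generated in degree [dl] live in degrees
   shifted by [tau], with composition twisted by the signs [sgn]. *)
Section Regrade.
Variables (k : fieldType) (tau taui : int -> int).
Hypotheses (tauK : cancel tau taui) (tauVK : cancel taui tau).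
Variables (dl : int) (eps : k) (sgn : int -> k).
Hypothesis tau_add : forall p q, tau (p + q) = dl + (tau p + tau q).
Hypothesis sgn2 : forall p, sgn p * sgn p = 1.
Hypothesis sgn_chain : forall p q, sgn (p + q) * (eps * koszul k (dl * tau p)) = sgn q.

Lemma regrade_ind (Q : int -> Prop) : (forall d, Q (tau d)) -> forall d, Q d.
Proof. by move=> h d; rewrite -(tauVK d). Qed.

(** Since [tau] is bijective, a family given on its values extends to all degrees. The transports
    remain hidden behind the stated equation. *)
Lemma regrade_fun (F : int -> Type) (h : forall d, F (tau d)) :
  exists h' : forall d, F d, forall d, h' (tau d) = h d.
Proof.
have aux d d' (e : d' = d) (e2 : tau d' = tau d) : eq_rect (tau d') F (h d') (tau d) e2 = h d.
  by subst d'; rewrite (Prop_irrelevance e2 erefl).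
exists (fun d => eq_rect (tau (taui d)) F (h (taui d)) d (tauVK d)) => d.
by apply: aux; exact: tauK.
Qed.

Lemma regrade_fun3 (F : int -> int -> int -> Type) (h : forall p q d, F (tau p) (tau q) (tau d)) :
  exists h' : forall p q d, F p q d, forall p q d, h' (tau p) (tau q) (tau d) = h p q d.
Proof.
have [g1 H1] := @regrade_fun (fun p => forall q d, F p (tau q) (tau d)) h.
have [g2 H2] := @regrade_fun (fun q => forall p d, F p q (tau d)) (fun q p d => g1 p q d).
have [g3 H3] := @regrade_fun (fun d => forall p q, F p q d) (fun d p q => g2 q p d).
by exists (fun p q d => g3 d p q) => p q d; rewrite H3 H2 H1.
Qed.

Definition regrade (A : gcoll k) : gcoll k := fun c d => A c (tau d).

Lemma regrade_bij : bijective regrade.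
Proof.
exists (fun A c d => A c (taui d)) => A;
  by do 2!(apply: functional_extensionality_dep => ?); rewrite /regrade ?tauK ?tauVK.
Qed.

Definition regrade_map (A B : gcoll k) (f : gmap A B) : gmap (regrade A) (regrade B) :=
  exist (fun f : forall c d, regrade A c d -> regrade B c d => forall c d, linear (f c d))
    (fun c d (x : A c (tau d)) => gapp f x) (fun c d => proj2_sig f c (tau d)).

Lemma regrade_map_inj (A B : gcoll k) : injective (@regrade_map A B).
Proof.
move=> f g e; apply: gmap_ext => c d x; move: d x.
apply: (@regrade_ind (fun d => forall x : A c d, gapp f x = gapp g x)) => d x.
exact: (f_equal (fun h => @gapp k _ _ h c d x) e).
Qed.

Lemma regrade_map_surj (A B : gcoll k) (g : gmap (regrade A) (regrade B)) :
  exists f, regrade_map f = g.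
Proof.
have [h' H] := @regrade_fun (fun d => forall c, A c d -> B c d) (fun d c x => @gapp k _ _ g c d x).
have hl : forall d c, linear (h' d c).
  apply: (@regrade_ind (fun d => forall c, linear (h' d c))) => d c.
  by rewrite H; exact: (proj2_sig g c d).
exists (exist (fun f : forall c d, A c d -> B c d => forall c d, linear (f c d))
  (fun c d => h' d c) (fun c d => hl d c)).
apply: gmap_ext => c d x; change (h' (tau d) c x = gapp g x).
by rewrite H.
Qed.

Lemma tau_deg p q d : d = p + q -> tau d = dl + (tau p + tau q).
Proof. by move=> ->. Qed.

Lemma tau_degV p q d : tau d = dl + (tau p + tau q) -> d = p + q.
Proof. by move=> e; apply: (can_inj tauK); rewrite tau_add. Qed.

Definition regrade_comp (A : gcoll k) (x : gcmp_data dl A) : partial_comp (regrade A).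
Proof.
apply: (@PartialComp k (regrade A)
  (fun n d (z : A n (tau d)) u => sact (tag x) z u)
  (fun m n i p q d e (z : A m (tau p)) (z' : A n (tau q)) =>
    (sgn p *: gc (tagged x) i (tau_deg e) z z' : A (m + n).-1 (tau d)))).
- by move=> n d u; exact: (@sact_linear _ _ (tag x) n (tau d) u).
- by move=> n d z; exact: (@sact1 _ _ (tag x) n (tau d)).
- by move=> n d z u v; exact: (@sactM _ _ (tag x) n (tau d)).
- move=> m n i p q d e y a z z'.
  rewrite -[LHS]/(sgn p *: gc (tagged x) i (tau_deg e) (a *: (z : A m (tau p)) + z') y).
  by rewrite (@gc_linearl _ _ _ _ (tagged x) m n i _ _ _ (tau_deg e) y a z z') scalerDr scalerA [sgn p * a]mulrC -scalerA.
- move=> m n i p q d e y a z z'.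
  rewrite -[LHS]/(sgn p *: gc (tagged x) i (tau_deg e) y (a *: (z : A n (tau q)) + z')).
  by rewrite (@gc_linearr _ _ _ _ (tagged x) m n i _ _ _ (tau_deg e) y a z z') scalerDr scalerA [sgn p * a]mulrC -scalerA.
- move=> m n i p q d e f g t u rho h.
  rewrite -[LHS]/(sgn p *: gc (tagged x) i (tau_deg e) (sact (tag x) (f : A m (tau p)) t) (sact (tag x) (g : A n (tau q)) u)).
  rewrite (gc_equiv (tagged x) (tau_deg e) _ _ h).
  exact: esym (linZ _ _ (@sact_linear k A (tag x) _ _ rho)).
Defined.

Lemma regrade_comp_inj (A : gcoll k) : injective (@regrade_comp A).
Proof.
move=> x y e; apply: gcmp_data_eq.
  move=> n d z u; move: d z.
  apply: (@regrade_ind (fun d => forall z : A n d, sact (tag x) z u = sact (tag y) z u)) => d z.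
  exact: (f_equal (fun P : partial_comp (regrade A) => @ract k _ P n d z u) e).
move=> m n i; apply: (@regrade_ind (fun p => forall q d (h : d = dl + (p + q)) (z : A m p) (z' : A n q),
  gc (tagged x) i h z z' = gc (tagged y) i h z z')) => p.
apply: (@regrade_ind (fun q => forall d (h : d = dl + (tau p + q)) (z : A m (tau p)) (z' : A n q),
  gc (tagged x) i h z z' = gc (tagged y) i h z z')) => q.
apply: (@regrade_ind (fun d => forall (h : d = dl + (tau p + tau q)) (z : A m (tau p)) (z' : A n (tau q)),
  gc (tagged x) i h z z' = gc (tagged y) i h z z')) => d h z z'.
have E : sgn p *: gc (tagged x) i h z z' = sgn p *: gc (tagged y) i h z z'.
  rewrite (Prop_irrelevance h (tau_deg (tau_degV h))).
  exact: (f_equal (fun P : partial_comp (regrade A) => @pcomp k _ P m n i p q d (tau_degV h) z z') e).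
by rewrite -[LHS]scale1r -(sgn2 p) -scalerA E scalerA sgn2 scale1r.
Qed.

Lemma regrade_comp_surj (A : gcoll k) (Q : partial_comp (regrade A)) : exists x, regrade_comp x = Q.
Proof.
have [sa Hs] := @regrade_fun (fun d => forall n, A n d -> 'S_n -> A n d)
  (fun d n z u => @ract k _ Q n d z u).
have l1 : forall d n (u : 'S_n), linear (fun z : A n d => sa d n z u).
  apply: (@regrade_ind (fun d => forall n (u : 'S_n), linear (fun z : A n d => sa d n z u))) => d n u.
  by rewrite Hs; exact: (@ract_linear k _ Q n d u).
have l2 : forall d n (z : A n d), sa d n z 1%g = z.
  apply: (@regrade_ind (fun d => forall n (z : A n d), sa d n z 1%g = z)) => d n z.
  by rewrite Hs; exact: (@ract_id k _ Q n d).
have l3 : forall d n (z : A n d) (u v : 'S_n), sa d n (sa d n z u) v = sa d n z (v * u)%g.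
  apply: (@regrade_ind (fun d => forall n (z : A n d) (u v : 'S_n),
    sa d n (sa d n z u) v = sa d n z (v * u)%g)) => d n z u v.
  by rewrite Hs; exact: (@ract_comp k _ Q n d).
pose s := @Symm k A (fun n d => sa d n) (fun n d => @l1 d n) (fun n d => @l2 d n) (fun n d => @l3 d n).
have [g Hg] := @regrade_fun3 (fun p q d => forall m n (i : 'I_m), d = dl + (p + q) ->
    A m p -> A n q -> A (m + n).-1 d)
  (fun p q d m n i e z z' => sgn p *: @pcomp k _ Q m n i p q d (tau_degV e) z z').
have ind3 (W : int -> int -> int -> Prop) : (forall p q d, W (tau p) (tau q) (tau d)) -> forall p q d, W p q d.
  move=> h p q d; move: p; apply: regrade_ind => p; move: q; apply: regrade_ind => q.
  by move: d; apply: regrade_ind => d; exact: h.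
have g1 : forall p q d m n (i : 'I_m) (e : d = dl + (p + q)) y, linear (fun x => g p q d m n i e x y).
  apply: (ind3 (fun p q d => forall m n (i : 'I_m) (e : d = dl + (p + q)) y,
    linear (fun x => g p q d m n i e x y))) => p q d m n i e y.
  rewrite Hg => a z z'; rewrite (@pcomp_linearl k _ Q m n i p q d (tau_degV e) y a z z').
  by rewrite scalerDr !scalerA [sgn p * a]mulrC.
have g2 : forall p q d m n (i : 'I_m) (e : d = dl + (p + q)) x, linear (fun y => g p q d m n i e x y).
  apply: (ind3 (fun p q d => forall m n (i : 'I_m) (e : d = dl + (p + q)) x,
    linear (fun y => g p q d m n i e x y))) => p q d m n i e y.
  rewrite Hg => a z z'; rewrite (@pcomp_linearr k _ Q m n i p q d (tau_degV e) y a z z').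
  by rewrite scalerDr !scalerA [sgn p * a]mulrC.
have g3 : forall p q d m n (i : 'I_m) (e : d = dl + (p + q)) (x : A m p) (y : A n q)
    (t : 'S_m) (u : 'S_n) rho, is_insertion t i u rho ->
    g p q d m n i e (sa p m x t) (sa q n y u) = sa d _ (g p q d m n (t i) e x y) rho.
  apply: (ind3 (fun p q d => forall m n (i : 'I_m) (e : d = dl + (p + q)) (x : A m p) (y : A n q)
    (t : 'S_m) (u : 'S_n) rho, is_insertion t i u rho ->
    g p q d m n i e (sa p m x t) (sa q n y u) = sa d _ (g p q d m n (t i) e x y) rho)) => p q d m n i e x y t u rho h.
  rewrite !Hg !Hs (@pcomp_equivariant k _ Q m n i p q d (tau_degV e) x y t u rho h).
  exact: esym (linZ _ _ (@ract_linear k _ Q _ d rho)).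
pose P := @Gcmp k A s dl (fun m n i p q d e z z' => g p q d m n i e z z')
  (fun m n i p q d e => @g1 p q d m n i e) (fun m n i p q d e => @g2 p q d m n i e)
  (fun m n i p q d e => @g3 p q d m n i e).
exists (existT _ s P); apply: partial_comp_eq => [n d z u|m n i p q d e z z'].
  by change (sa (tau d) n z u = ract Q z u); rewrite Hs.
change (sgn p *: g (tau p) (tau q) (tau d) m n i (tau_deg e) z z' = pcomp Q i e z z').
rewrite Hg (Prop_irrelevance (tau_degV (tau_deg e)) e).
by rewrite -[LHS]/(sgn p *: (sgn p *: (pcomp Q i e z z' : A _ (tau d)))) scalerA sgn2 scale1r.
Qed.

Section Relations.
Variables (A : gcoll k) (x : gcmp_data dl A).
Local Notation P := (tagged x).
Local Notation pkA := (@pack k A _ _).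

Lemma pack_regradeP c c' d (X : A c (tau d)) (Y : A c' (tau d)) : c = c' ->
  (@pack k (regrade A) c d X = @pack k (regrade A) c' d Y) <-> tin (pkA X) = tin (pkA Y).
Proof.
move=> e; subst c'; split=> [/(@pack_inj k (regrade A)) -> //|h].
by congr pack; have := f_equal (fun z : tot A => z c (tau d)) h; rewrite !tin_pack.
Qed.

Lemma tin_regrade m n (i : 'I_m) (p q d : int) (e : d = p + q) (z : A m (tau p)) (z' : A n (tau q)) :
  tin (pkA (@pcomp k _ (regrade_comp x) m n i p q d e z z')) = sgn p *: tin (pcp P i (pkA z) (pkA z')).
Proof. by rewrite (pcpE P i (tau_deg e)) -(linZ _ _ (@tin_linear k A _ _)). Qed.

Lemma tin_regrade_l a b c (j : 'I_a) (i : 'I_(a + b).-1) (p q r pq d : int) (e1 : pq = p + q)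
    (e2 : d = pq + r) (f : A a (tau p)) (g : A b (tau q)) (h : A c (tau r)) :
  tin (pkA (@pcomp k _ (regrade_comp x) _ _ i _ _ _ e2 (@pcomp k _ (regrade_comp x) _ _ j _ _ _ e1 f g) h)) =
  (sgn pq * sgn p) *: tin (pcp P i (pcp P j (pkA f) (pkA g)) (pkA h)).
Proof.
rewrite tin_regrade -scalerA; congr (_ *: _).
rewrite -[X in pcp P i (pack X)]/(sgn p *: gc P j (tau_deg e1) f g).
by rewrite (linZ _ _ (@pcp_linearl k A _ dl P i _ _ (pkA h))) (pcpE P j (tau_deg e1)).
Qed.

Lemma tin_regrade_r a b c (j : 'I_a) (i : 'I_b) (p q r qr d : int) (e3 : qr = q + r)
    (e4 : d = p + qr) (f : A a (tau p)) (g : A b (tau q)) (h : A c (tau r)) :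
  tin (pkA (@pcomp k _ (regrade_comp x) _ _ j _ _ _ e4 f (@pcomp k _ (regrade_comp x) _ _ i _ _ _ e3 g h))) =
  (sgn p * sgn q) *: tin (pcp P j (pkA f) (pcp P i (pkA g) (pkA h))).
Proof.
rewrite tin_regrade -scalerA; congr (_ *: _).
rewrite -[X in pcp P j _ (pack X)]/(sgn q *: gc P i (tau_deg e3) g h).
by rewrite (linZ _ _ (@pcp_linearr k A _ dl P j _ _ (pkA f))) (pcpE P i (tau_deg e3)).
Qed.

Lemma packed_regrade (W : packed A -> Prop) :
  (forall c d (z : A c (tau d)), W (pkA z)) -> forall u, W u.
Proof.
move=> h [c [d z]]; move: d z.
by apply: (@regrade_ind (fun d => forall z : A c d, W (pkA z))) => d z; exact: h.
Qed.

Lemma sgn_unit p q : (sgn p * sgn q) * (sgn q * sgn p) = 1.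
Proof. by rewrite mulrA -(mulrA (sgn p)) sgn2 mulr1 sgn2. Qed.

Lemma sgn_cancel p q (X Y : tot A) : (sgn q * sgn p) *: X = Y -> X = (sgn p * sgn q) *: Y.
Proof. by move=> <-; rewrite scalerA sgn_unit scale1r. Qed.

(** The left composite carries [sgn (p + q) * sgn p] and the right one [sgn p * sgn q]; by
    [sgn_chain] this difference cancels [eps] together with the Koszul sign. *)
Lemma regrade_sequential : sequential (regrade_comp x) <-> chain_rel P eps.
Proof.
split=> [hs y y' u v z|hc a b c j i i' ei p q r pq qr d e1 e2 e3 e4 f g h].
  elim/packed_regrade: u => a p f; elim/packed_regrade: v => b q g; elim/packed_regrade: z => c r h.
  rewrite /= => ya yb; have hi : (y + y' < (a + b).-1)%N by exact: insert_lt.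
  have er : ((a + b).-1 + c).-1 = (a + (b + c).-1).-1 by clear -ya yb; lia.
  have /(pack_regradeP (d := p + q + r)) E := hs a b c (Ordinal ya) (Ordinal hi) (Ordinal yb)
    erefl p q r _ _ _ erefl erefl erefl (esym (addrA p q r)) f g h.
  have {E} := E er; rewrite tin_regrade_l tin_regrade_r /= => E.
  rewrite (sgn_cancel E) scalerA; congr (_ *: _).
  rewrite mulrACA sgn2 mul1r.
  transitivity (sgn (p + q) * (sgn (p + q) * (eps * koszul k (dl * tau p)))); first by rewrite sgn_chain.
  by rewrite [LHS]mulrA sgn2 mul1r.
apply/(pack_regradeP (d := d)); first by case: j i' {ei} => [j ja] [i' ib] /=; clear -ja ib; lia.
rewrite tin_regrade_l tin_regrade_r ei hc ?ltn_ord // scalerA; congr (_ *: _).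
by rewrite e1 mulrAC -[dg _]/(tau p) sgn_chain mulrC.
Qed.

Lemma regrade_parallel : parallel_zero (regrade_comp x) <-> fork_rel P.
Proof.
split=> [hs y y' u v z|hf a b c j i hij p q r pq d e1 e2 f g h].
  elim/packed_regrade: u => a p f; elim/packed_regrade: v => b q g; elim/packed_regrade: z => c r h.
  rewrite /= => ya yb ne; set i := (if _ then _ else _)%N.
  have hi : (i < (a + b).-1)%N by rewrite /i; case: ifP => h0; clear -ya yb ne h0; lia.
  have hc : (i < y)%N || (y + b <= i)%N by rewrite /i; case: ifP => h0; clear -ya yb ne h0; lia.
  have E : (sgn (p + q) * sgn p) *: tin (pcp P i (pcp P y (pkA f) (pkA g)) (pkA h)) = 0.
    rewrite -(tin_regrade_l (Ordinal ya) (Ordinal hi) (erefl (p + q)) (erefl (p + q + r)) f g h).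
    rewrite (hs a b c (Ordinal ya) (Ordinal hi) hc p q r _ _ erefl erefl f g h).
    exact: (lin0 (@tin_linear k A _ _)).
  by rewrite (sgn_cancel E) scaler0.
(* The input of [f] that has become the input [i] of the composite, found by undoing the shift in
   [fork_rel]. *)
pose y := (if (i < j)%N then i : nat else i.+1 - b)%N.
have hi := ltn_ord i; have hj := ltn_ord j.
have ya : (y < a)%N by rewrite /y; case: ifP => h0; clear -hi hj hij h0; lia.
have ne : y <> j by rewrite /y; case: ifP => h0; clear -hi hj hij h0; lia.
have := hf j y (pkA f) (pkA g) (pkA h) hj ya ne.
rewrite (_ : (if _ then _ else _)%N = i :> nat); last first.
  rewrite -[ar _]/b /y; case: (ltnP i j) hij => h0 /= hij; first by rewrite h0.
  by case: ifP => h1; clear -hi hj hij h0 h1; lia.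
move=> E; have := tin_regrade_l j i e1 e2 f g h; rewrite E scaler0.
by move=> H; have := f_equal (fun z : tot A => z ((a + b).-1 + c).-1 (tau d)) H; rewrite (@tin_pack k A).
Qed.

End Relations.

Lemma regrade_compP (A B : gcoll k) (x : gcmp_data dl A) (y : gcmp_data dl B) (f : gmap A B) :
  data_map x y f <-> partial_comp_map (regrade_comp x) (regrade_comp y) (regrade_map f).
Proof.
split=> [[h1 h2]|[h1 h2]]; split.
- by move=> n d z u; exact: h1.
- move=> m n i p q d e z z'.
  transitivity (sgn p *: gapp f (gc (tagged x) i (tau_deg e) (z : A m (tau p)) (z' : A n (tau q)))).
    exact: (linZ _ _ (@gapp_linear _ _ _ f _ _)).
  by rewrite h2.
- move=> n d z u; move: d z.
  by apply: (@regrade_ind (fun d => forall z : A n d,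
    gapp f (sact (tag x) z u) = sact (tag y) (gapp f z) u)) => d z; exact: h1.
move=> m n i; apply: (@regrade_ind (fun p => forall q d (h : d = dl + (p + q)) (z : A m p) (z' : A n q),
  gapp f (gc (tagged x) i h z z') = gc (tagged y) i h (gapp f z) (gapp f z'))) => p.
apply: (@regrade_ind (fun q => forall d (h : d = dl + (tau p + q)) (z : A m (tau p)) (z' : A n q),
  gapp f (gc (tagged x) i h z z') = gc (tagged y) i h (gapp f z) (gapp f z'))) => q.
apply: (@regrade_ind (fun d => forall (h : d = dl + (tau p + tau q)) (z : A m (tau p)) (z' : A n (tau q)),
  gapp f (gc (tagged x) i h z z') = gc (tagged y) i h (gapp f z) (gapp f z'))) => d h z z'.
rewrite (Prop_irrelevance h (tau_deg (tau_degV h))).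
have E : sgn p *: gapp f (gc (tagged x) i (tau_deg (tau_degV h)) z z') =
    sgn p *: gc (tagged y) i (tau_deg (tau_degV h)) (gapp f z) (gapp f z').
  rewrite -[LHS](linZ _ _ (@gapp_linear _ _ _ f _ _)).
  exact: (h2 m n i p q d (tau_degV h) z z').
by rewrite -[LHS]scale1r -(sgn2 p) -scalerA E scalerA sgn2 scale1r.
Qed.

Variables (E : collection k) (G : edge_gens E dl) (R : op_pred (free_operad E)).
Variable axiom : forall A : gcoll k, partial_comp A -> Prop.
Hypothesis axiomP : forall (A : gcoll k) (x : gcmp_data dl A),
  respects G R x <-> axiom (regrade_comp x).

Definition comp_of (A : gcoll k) (al : algebra (quotient_by R) A) :
    {P : partial_comp (regrade A) | axiom P} :=
  exist _ (regrade_comp (data_of G al)) ((axiomP _).1 (respects_data G al)).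

Lemma comp_of_map (A B : gcoll k) (al : algebra (quotient_by R) A) (be : algebra (quotient_by R) B)
    (f : gmap A B) :
  algebra_map al be f <->
  partial_comp_map (sval (comp_of al)) (sval (comp_of be)) (regrade_map f).
Proof. by rewrite (algebra_mapP G) regrade_compP. Qed.

Lemma regrade_map_id (A : gcoll k) : regrade_map (gid A) = gid (regrade A).
Proof. exact: gmap_ext. Qed.

Lemma regrade_map_comp (A B C : gcoll k) (g : gmap B C) (f : gmap A B) :
  regrade_map (gcomp g f) = gcomp (regrade_map g) (regrade_map f).
Proof. exact: gmap_ext. Qed.

Definition algebra_functor :=
  str_functor (@algebra_map_id k (quotient_by R)) (@algebra_map_comp k (quotient_by R))
    (fun A (P : {P : partial_comp A | axiom P}) => partial_comp_map_id (sval P))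
    (fun A B C (P : {P : partial_comp A | axiom P}) (Q : {P : partial_comp B | axiom P})
       (S : {P : partial_comp C | axiom P}) =>
       @partial_comp_map_comp k A B C (sval P) (sval Q) (sval S))
    regrade_map_id regrade_map_comp comp_of_map.

Lemma algebra_functor_iso : is_isomorphism algebra_functor.
Proof.
apply: str_functor_iso.
- exact: regrade_bij.
- exact: regrade_map_inj.
- exact: regrade_map_surj.
- move=> A al be e; apply: (data_of_inj (G := G)); apply: regrade_comp_inj.
  exact: (f_equal (fun z => sval z) e).
- move=> A [Q hQ]; have [x ex] := regrade_comp_surj Q.
  have h : respects G R x by apply/axiomP; rewrite ex.
  by exists (alg_of h); apply: eq_exist; rewrite /= data_of_alg.
Qed.

End Regrade.

Local Open Scope ring_scope.

Lemma functor_eq (C D : category) (f : C -> D)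
    (m m' : forall x y : C, arrow x y -> arrow (f x) (f y)) i i' c c' :
  (forall x y (g : arrow x y), m x y g = m' x y g) ->
  @Functor C D f m i c = @Functor C D f m' i' c'.
Proof.
move=> h; have e : m = m' by do 3!(apply: functional_extensionality_dep => ?); exact: h.
by subst m'; congr Functor; exact: Prop_irrelevance.
Qed.

(** * The degree 0 case of [pp] and the degree 1 case of its dual *)

Section Instances.
Variables (k : fieldType) (D : forall X : rtr, decomp X -> Prop) (hD : representatives D).

Fact id_add (p q : int) : p + q = 0 + (p + q). Proof. by rewrite add0r. Qed.

Fact id_sgn2 (p : int) : (1 : k) * 1 = 1. Proof. exact: mulr1. Qed.

Fact id_chain (p q : int) : (1 : k) * (1 * koszul k (0 * p)) = 1.
Proof. by rewrite mul0r koszul0 !mulr1. Qed.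

Fact shift_add (p q : int) : p + q - 1 = 1 + ((p - 1) + (q - 1)).
Proof. by lia. Qed.

Fact shift_chain (p q : int) : koszul k (p + q) * (-1 * koszul k (1 * (p - 1))) = koszul k q.
Proof.
rewrite mul1r !koszulD (_ : koszul k (-1) = -1) //.
by rewrite mulrN1 mulN1r opprK mulrAC koszul_sq mul1r.
Qed.

Lemma pp_axiomP (A : gcoll k) (x : gcmp_data 0 A) :
  respects (single_edge_gens k) (@pp_rel D k) x <->
  sequential (@regrade_comp k id 0 (fun=> 1) id_add A x).
Proof.
rewrite (@regrade_sequential k id id (fun=> erefl) 0 1 (fun=> 1) id_add id_sgn2 id_chain).
split=> [h|h]; first exact: (pp_chain_rel hD h).
exact: (pp_kills hD h).
Qed.

Lemma pp_dual_axiomP (A : gcoll k) (x : gcmp_data 1 A) :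
  respects (dual_edge_gens k) (annihilator D (@pp_rel D k)) x <->
  sequential (@regrade_comp k (fun p => p - 1) 1 (koszul k) shift_add A x) /\
  parallel_zero (@regrade_comp k (fun p => p - 1) 1 (koszul k) shift_add A x).
Proof.
rewrite (@regrade_sequential k _ _ (addrK 1) 1 (-1) (koszul k) shift_add (@koszul_sq k) shift_chain).
first [rewrite (@regrade_parallel k _ _ (addrK 1) 1 (koszul k) shift_add (@koszul_sq k)) | rewrite (@regrade_parallel k _ _ (addrK 1) 1 (-1) (koszul k) shift_add (@koszul_sq k) shift_chain)].
split=> [h|[h1 h2]]; first by split; [exact: (dual_chain_rel hD h) | exact: (dual_fork_rel hD h)].
exact: (dual_kills hD h1 h2).
Qed.

End Instances.

Theorem theorem6p4 (k : fieldType) (char0 : [pchar k]%R =i pred0)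
    (D : forall X : rtr, decomp X -> Prop) (hD : representatives D) :
  (exists F : functor (algebra_category (pp D k)) (pre_permutad_category k),
     is_isomorphism F /\
     functor_comp (pre_permutad_forget k) F = algebra_forget (pp D k)) /\
  (exists F : functor (algebra_category (pp_dual D k)) (null_markl_category k),
     is_isomorphism F).

Proof.
split.
  exists (algebra_functor (fun=> erefl) (fun=> erefl) (id_sgn2 k) (@pp_axiomP k D hD)).
  split; first exact: algebra_functor_iso.
  (* With [tau] the identity, [regrade A] is convertible to [A], so the two functors have the same
     map on objects. *)
  by apply: functor_eq => x y g; exact: gmap_ext.
(* Degree [p - 1] of an algebra becomes degree [p], which turns the generator of degree 1 into a
   composition of degree 0. This isomorphism thus lies over a shift of collections and not over the
   identity. *)
exists (algebra_functor (subrK (1%R : int)) (addrK (1%R : int)) (@koszul_sq k) (@pp_dual_axiomP k D hD)).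
exact: algebra_functor_iso.
Qed.
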